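(* Let $n\ge 1$ and $k>0$, and put $\mu_0=k(n-1)$. For $\mu\in\mathbb C$ let $R_\mu\in\mathcal S'(\mathbb R^n)$ be the type $A_{n-1}$ Riesz distribution (defined in the context). Then: (1) If $R_\mu$ is a complex (Radon) measure, then either $\mathrm{Re}\,\mu>\mu_0=k(n-1)$, or $\mu$ belongs to the finite set $[0,\infty[\,\cap\,\bigl(\{0,k,\ldots,k(n-1)\}-\mathbb N_0\bigr)$. (2) $R_\mu$ is a positive measure if and only if $\mu$ belongs to the generalized Wallach set $W_k=\{0,k,\ldots,k(n-1)\}\cup\,]k(n-1),\infty[$.
   Context: For $x,y\in\mathbb C^n$ write $\langle x,y\rangle=\sum_i x_iy_i$. The Dunkl operators of type $A_{n-1}$ with multiplicity $k$ are $T_i(k)=\frac{\partial}{\partial x_i}+k\sum_{j\ne i}\frac{1}{x_i-x_j}(1-\sigma_{ij})$, $i=1,\dots,n$, where $\sigma_{ij}$ acts on functions by exchanging the coordinates $x_i,x_j$; they commute, and $D(T(k)):=\prod_{i=1}^nT_i(k)$. They act on tempered distributions by $\langle T_i(k)u,\varphi\rangle=-\langle u,T_i(k)\varphi\rangle$. Let $\omega_k(x)=\prod_{1\le i<j\le n}|x_i-x_j|^{2k}$, $D(x)=\prod_{i=1}^n x_i$, $\mathbb R_+=]0,\infty[$, $d_n(k)=\prod_{j=1}^n\frac{\Gamma(1+jk)}{\Gamma(1+k)}$, and $\Gamma_n(\mu;k)=\prod_{j=1}^n\Gamma(\mu-k(j-1))$. For $\mathrm{Re}\,\mu>\mu_0$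 the Riesz measure is $\langle R_\mu,\varphi\rangle=\frac{1}{d_n(k)\Gamma_n(\mu;k)}\int_{\mathbb R_+^n}\varphi(x)D(x)^{\mu-\mu_0-1}\omega_k(x)\,dx$. The map $\mu\mapsto R_\mu$ from $\{\mathrm{Re}\,\mu>\mu_0\}$ to $\mathcal S'(\mathbb R^n)$ extends uniquely to a holomorphic $\mathcal S'(\mathbb R^n)$-valued map on $\mathbb C$ (satisfying $D(T(k))R_\mu=R_{\mu-1}$); $R_\mu$ for general $\mu\in\mathbb C$ denotes this extension. *)

(* Defs.v *)
From HB Require Import structures.
From mathcomp Require Import all_boot all_order all_algebra.
From mathcomp Require Import all_classical all_reals all_analysis.
From mathcomp Require Import complex.
Set Implicit Arguments.
Unset Strict Implicit.
Unset Printing Implicit Defensive.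
Import Order.TTheory GRing.Theory Num.Theory.
Import numFieldNormedType.Exports.
Local Open Scope ring_scope.
Local Open Scope classical_set_scope.

Definition cRe (R : Type) (z : R[i]) : R := let: Complex a _ := z in a.
Definition cIm (R : Type) (z : R[i]) : R := let: Complex _ b := z in b.
Definition cr (R : realType) (r : R) : R[i] := Complex r 0.

Definition cexp (R : realType) (z : R[i]) : R[i] :=
  Complex (expR (cRe z) * cos (cIm z)) (expR (cRe z) * sin (cIm z)).

Definition cpow (R : realType) (x : R) (s : R[i]) : R[i] :=
  cexp (s * cr (ln x)).

Definition holomorphic (R : realType) (F : R[i] -> R[i]) : Prop :=
  forall z : R[i], exists l : R[i], forall e : R, 0 < e ->
    exists d : R, 0 < d /\ forall h : R[i], h != 0 -> `|h| < cr d ->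
      `|(F (z + h) - F z) / h - l| < cr e.

(* Euler Gamma function, Gamma(z) = int_0^oo t^(z-1) e^(-t) dt (cRe z > 0) *)
Definition cGamma (R : realType) (z : R[i]) : R[i] :=
  Complex
    (Rintegral lebesgue_measure `]0%R, +oo[%classic
       (fun t : R => cRe (cpow t (z - 1)) * expR (- t)))
    (Rintegral lebesgue_measure `]0%R, +oo[%classic
       (fun t : R => cIm (cpow t (z - 1)) * expR (- t))).

Definition RnB (R : realType) (n : nat) := g_sigma_algebraType (@open 'rV[R]_n).

(* lam is Lebesgue measure on the Borel sets of R^n: it gives every closed box
   its volume (this determines it uniquely) *)
Definition is_lebesgue_Rn (R : realType) (n : nat)
    (lam : {measure set (RnB R n) -> \bar R}) : Prop :=
  forall a b : 'rV[R]_n, (forall i, a ord0 i <= b ord0 i) ->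
    lam [set x : RnB R n | forall i, a ord0 i <= x ord0 i <= b ord0 i] =
    (\prod_(i < n) (b ord0 i - a ord0 i))%:E.

Definition pds (R : realType) (n : nat) (s : seq 'I_n) (f : 'rV[R]_n -> R) :
    'rV[R]_n -> R :=
  foldr (fun i g => 'D_(delta_mx ord0 i) g) f s.

Definition smooth (R : realType) (n : nat) (f : 'rV[R]_n -> R) : Prop :=
  forall (s : seq 'I_n) (x : 'rV[R]_n), differentiable (pds s f) x.

Definition schwartz (R : realType) (n : nat) (f : 'rV[R]_n -> R) : Prop :=
  smooth f /\ forall (s : seq 'I_n) (m : nat), exists c : R,
    forall x, `|x| ^+ m * `|pds s f x| <= c.

Definition testfun (R : realType) (n : nat) (f : 'rV[R]_n -> R) : Prop :=
  smooth f /\ exists r : R, forall x, r < `|x| -> f x = 0.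

(* tempered distribution (a complex tempered distribution is determined by
   its values on real-valued Schwartz functions) *)
Definition tempered (R : realType) (n : nat) (T : ('rV[R]_n -> R) -> R[i]) :
    Prop :=
  (forall (a b : R) f g, schwartz f -> schwartz g ->
     T (fun x => a * f x + b * g x) = cr a * T f + cr b * T g) /\
  exists (N : nat) (c : R), forall f, schwartz f -> forall B : R,
    (forall (s : seq 'I_n) (m : nat) x, (size s <= N)%N -> (m <= N)%N ->
        `|x| ^+ m * `|pds s f x| <= B) ->
    `|T f| <= cr (c * B).

(* locally finite (= Radon) positive Borel measures on R^n *)
Definition locally_finite (R : realType) (n : nat)
    (nu : {measure set (RnB R n) -> \bar R}) : Prop :=
  forall K : set 'rV[R]_n, compact K -> (nu K < +oo)%E.

Definition is_positive_measure (R : realType) (n : nat)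
    (T : ('rV[R]_n -> R) -> R[i]) : Prop :=
  exists nu : {measure set (RnB R n) -> \bar R}, locally_finite nu /\
    forall f, testfun f -> T f = cr (Rintegral nu setT f).

Definition is_complex_measure (R : realType) (n : nat)
    (T : ('rV[R]_n -> R) -> R[i]) : Prop :=
  exists nu1 nu2 nu3 nu4 : {measure set (RnB R n) -> \bar R},
    [/\ locally_finite nu1, locally_finite nu2, locally_finite nu3
      & locally_finite nu4] /\
    forall f, testfun f -> T f =
      Complex (Rintegral nu1 setT f - Rintegral nu2 setT f)
              (Rintegral nu3 setT f - Rintegral nu4 setT f).

Definition mu0 (R : realType) (n : nat) (k : R) : R := k * (n%:R - 1).

Definition omega_k (R : realType) (n : nat) (k : R) (x : 'rV[R]_n) : R :=
  \prod_(i < n) \prod_(j < n | (i < j)%N) (`|x ord0 i - x ord0 j| `^ (2 * k)).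

Definition Dx (R : realType) (n : nat) (x : 'rV[R]_n) : R :=
  \prod_(i < n) x ord0 i.

Definition d_n (R : realType) (n : nat) (k : R) : R[i] :=
  \prod_(j < n) (cGamma (cr (1 + j.+1%:R * k)) / cGamma (cr (1 + k))).

Definition Gamma_n (R : realType) (n : nat) (k : R) (mu : R[i]) : R[i] :=
  \prod_(j < n) cGamma (mu - cr (k * j%:R)).

Definition Rplus_n (R : realType) (n : nat) : set (RnB R n) :=
  [set x | forall i, 0 < x ord0 i].

Definition riesz_integral (R : realType) (n : nat) (k : R)
    (lam : {measure set (RnB R n) -> \bar R}) (mu : R[i]) (phi : 'rV[R]_n -> R)
    : R[i] :=
  let g := fun x : 'rV[R]_n =>
      cpow (Dx x) (mu - cr (mu0 n k) - 1) * cr (phi x * omega_k k x) in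
  Complex (Rintegral lam (@Rplus_n R n) (fun x => cRe (g x)))
          (Rintegral lam (@Rplus_n R n) (fun x => cIm (g x)))
  / (d_n n k * Gamma_n n k mu).

(* Rz is the (unique) holomorphic S'(R^n)-valued extension of
   mu |-> R_mu from {Re mu > mu0} to C *)
Definition riesz_family (R : realType) (n : nat) (k : R)
    (lam : {measure set (RnB R n) -> \bar R})
    (Rz : R[i] -> ('rV[R]_n -> R) -> R[i]) : Prop :=
  [/\ forall mu, tempered (Rz mu),
      forall phi, schwartz phi -> holomorphic (fun mu => Rz mu phi)
    & forall mu phi, mu0 n k < cRe mu -> schwartz phi ->
        Rz mu phi = riesz_integral k lam mu phi].

(* Main.v *)
(** The functions [exp (- M (x_1 + ... + x_n)) q(x)], [q] a polynomial, are tested against [R_mu]; on the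
orthant they agree with Schwartz functions. For real [mu > mu0], integration by parts gives Aomoto's identity,
a recursion for power sums and [R_mu (D phi) = prod_j (mu - k j) R_(mu+1) phi], while the comparison of the
Laguerre-Selberg integral with [Gamma_n] (both are log-convex and satisfy the same functional equation) shows
that [R_mu (exp (- (x_1 + ... + x_n)))] is a positive constant. All these identities extend to every complex
[mu] by the identity theorem for entire functions.

(1) If [R_mu] is a complex measure with [Re mu <= mu0] and [mu] is not of the form [k j - m], then the iterated
relation with [D], applied to bumps around [(2^-l, 2, ..., n)], shows that the total variation of [R_mu] on
infinitely many disjoint boxes in one ball stays bounded below. If [mu < 0] is real, then by homogeneity
[R_mu (phi (t x)) = t^(- n mu) R_mu phi] is unbounded as [t] grows, although the test functions [phi (t x)]
are bounded with supports in a fixed ball.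

(2) Positivity forces [prod_(i < s) (mu - k i) >= 0] for all [s <= n], by Aomoto's identity applied to the
monomials [x_1 ... x_s]; together with (1) this puts [mu] in the Wallach set. Conversely, for [mu = k r] with
[r < n] the candidate measure is the symmetrization of
[prod_(i < r) x_i^(k (n - r + 1) - 1) prod_(i < j < r) |x_i - x_j|^(2 k)] on the face [x_(r+1) = ... = x_n = 0].
Its moments against [exp (- M (x_1 + ... + x_n))] satisfy the same power-sum recursion as those of [R_(k r)],
hence agree with them. A test function is approximated, with all its derivatives, by its Szasz operators,
which are finite combinations of such exponentials times monomials, so the two distributions coincide. *)

Require Import Defs.
From HB Require Import structures.
From mathcomp Require Import all_boot all_order all_algebra.
From mathcomp Require Import all_classical all_reals all_analysis.
From mathcomp Require Import complex.
From mathcomp Require Import fingroup perm measurable_realfun.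
From mathcomp Require Import zify ring lra.
Set Implicit Arguments.
Unset Strict Implicit.
Unset Printing Implicit Defensive.
Import Order.TTheory GRing.Theory Num.Theory.
Import numFieldNormedType.Exports.
Local Open Scope ring_scope.
Local Open Scope classical_set_scope.

(** * Cauchy theory and the identity principle for entire functions *)

(** [R_mu] is known at or below [mu0] only as an entire continuation, without a formula. Only
    equalities survive continuation: each fact becomes an identity between entire functions of [mu],
    proved for large real [mu], and bounds and signs are read off afterwards from explicit factors
    such as [mu - k j]. Two obstacles shape the real-variable part. The weight [|x_i - x_j|^(2k)]
    need not be differentiable on the diagonals, so squares are regularized by a constant [e > 0],
    integration by parts takes the form of a differentiation under the integral along the dilation
    of one coordinate, and [e] tends to 0 at the end. Moreover, monomials are neither test functions
    nor nonnegative beyond the orthant, so they are multiplied by exponentials that are cut off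
    outside it, and the position of the cut-off is adapted to each use. For [mu = k r] the moments
    are matched at every exponential rate, because the Szasz operator with parameter [Q] consists of
    exponentials of rate [Q], which grows as the mesh shrinks. *)

Section IntervalIntegral.
Context {R : realType}.
Implicit Types (a b c M : R) (f g : R -> R).
Notation leb := (@lebesgue_measure R).

Definition itvint a b f := Rintegral leb `[a, b]%classic f.

(** Two-sided continuity at every point of the segment, end points included; it restricts to
    subsegments at once. *)
Definition cont_on a b f := forall x, a <= x <= b -> {for x, continuous f}.

Lemma cont_on_sub a b c d f :
  a <= c -> d <= b -> cont_on a b f -> cont_on c d f.
Proof.
move=> ac db h x /andP[cx xd]; apply: h.
by rewrite (le_trans ac cx) (le_trans xd db).
Qed.

Lemma cont_on_integrable a b f :
  cont_on a b f -> leb.-integrable `[a, b]%classic (EFin \o f).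
Proof.
move=> h; apply: continuous_compact_integrable; first exact: segment_compact.
apply: continuous_in_subspaceT => x /set_mem; rewrite /= in_itv /= => xab.
exact: h.
Qed.

Lemma itvint_split a b c f : a <= c -> c <= b -> cont_on a b f ->
  itvint a b f = itvint a c f + itvint c b f.
Proof.
move=> ac cb h; rewrite /itvint.
have hi := cont_on_integrable h.
have := @Rintegral_itvB R f (BLeft a) (BRight b) c hi.
rewrite !bnd_simp => /(_ ac cb) e.
rewrite -[RHS]addrC -(@Rintegral_itv_obnd_cbnd _ c (BRight b) f); last first.
  by apply: integrableS hi => //; apply: subset_itvr; rewrite bnd_simp.
by rewrite -e subrK.
Qed.

Lemma itvint_bound a b M f : a <= b -> cont_on a b f ->
  (forall x, a <= x <= b -> `|f x| <= M) -> `|itvint a b f| <= M * (b - a).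
Proof.
move=> ab h hM; have hi := cont_on_integrable h.
rewrite /itvint; apply: le_trans (le_normr_Rintegral _ hi) _ => //.
have -> : M * (b - a) = Rintegral leb `[a, b]%classic (fun=> M).
  rewrite Rintegral_cst //= lebesgue_measure_itv /= lte_fin.
  case: ltP => //= ba; have -> : a = b by apply/le_anti; rewrite ab ba.
  by rewrite subrr.
apply: le_Rintegral => //.
- by have := integrable_abse hi.
- apply: continuous_compact_integrable; first exact: segment_compact.
  by apply: continuous_subspaceT => x; exact: cst_continuous.
Qed.

Lemma itvintD a b f g : cont_on a b f -> cont_on a b g ->
  itvint a b (fun x => f x + g x) = itvint a b f + itvint a b g.
Proof.
by move=> hf hg; rewrite /itvint RintegralD //; exact: cont_on_integrable.
Qed.

Lemma itvintZ a b r f : cont_on a b f ->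
  itvint a b (fun x => r * f x) = r * itvint a b f.
Proof.
by move=> hf; rewrite /itvint RintegralZl //; exact: cont_on_integrable.
Qed.

Lemma itvint_lin a b (u v : R) f g : cont_on a b f -> cont_on a b g ->
  itvint a b (fun x => u * f x + v * g x) = u * itvint a b f + v * itvint a b g.
Proof.
have hZ (h : R -> R) r : cont_on a b h -> cont_on a b (fun x => r * h x).
  by move=> ch x hx; apply: cvgM; [exact: cvg_cst|exact: ch].
move=> hf hg; rewrite itvintD; [|exact: hZ|exact: hZ].
by rewrite !itvintZ.
Qed.

Lemma itvint_eq a b f g : (forall x, a <= x <= b -> f x = g x) ->
  itvint a b f = itvint a b g.
Proof.
move=> h; apply: eq_Rintegral => x /set_mem; rewrite /= in_itv /=; exact: h.
Qed.

Lemma itvint_affine a b p q : a <= b ->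
  itvint a b (fun x => p + q * x) = p * (b - a) + q * (b ^+ 2 - a ^+ 2) / 2.
Proof.
rewrite le_eqVlt => /predU1P[->|ab].
  by rewrite /itvint set_itv1 Rintegral_set1 !subrr !mulr0 mul0r addr0.
have dF (x : R) : is_derive x 1 (fun x => p * x + (q / 2) * x ^+ 2) (p + q * x).
  apply: is_derive_eq. rewrite /GRing.scale /=.
  by field.
have cF : continuous (fun x : R => p * x + (q / 2) * x ^+ 2).
  move=> x; apply/differentiable_continuous/derivable1_diffP.
  by case: (dF x).
have cf : continuous (fun x : R => p + q * x).
  move=> x; apply: cvgD; first exact: cvg_cst.
  by apply: cvgM; [exact: cvg_cst|exact: cvg_id].
rewrite /itvint /Rintegral.
rewrite (@continuous_FTC2 _ _ (fun x => p * x + (q / 2) * x ^+ 2) a b ab).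
- by rewrite /=; field.
- exact: continuous_subspaceT.
- split.
  + by move=> x _; case: (dF x).
  + by apply: cvg_at_right_filter; exact: cF.
  + by apply: cvg_at_left_filter; exact: cF.
- by move=> x _; rewrite derive1E; exact: derive_val.
Qed.

End IntervalIntegral.

(** * Goursat's theorem for closed real differential forms on rectangles *)

Section Goursat.
Context {R : realType}.
Implicit Types (P Q : R -> R -> R) (a b c d x y : R).

(** The counterclockwise integral of [P dx + Q dy] along the boundary of [[a, b] x [c, d]]. A
    complex contour integral is a pair of these. *)
Definition circ P Q a b c d :=
  itvint a b (P ^~ c) + itvint c d (Q b) - itvint a b (P ^~ d) -
  itvint c d (Q a).

Definition form_cont P Q a b c d := forall x y : R, a <= x <= b -> c <= y <= d ->
  {for x, continuous (P ^~ y)} /\ {for y, continuous (Q x)}.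

(* [P dx + Q dy] is differentiable and closed at [(x, y)]. *)
Definition closed_at P Q x y := exists p q r : R, forall e : R, 0 < e ->
  exists2 D : R, 0 < D & forall h k : R, `|h| < D -> `|k| < D ->
    `|P (x + h) (y + k) - P x y - (p * h + q * k)| <= e * (`|h| + `|k|) /\
    `|Q (x + h) (y + k) - Q x y - (q * h + r * k)| <= e * (`|h| + `|k|).

Lemma lin_approx_continuous (f : R -> R) (x p : R) :
  (forall e : R, 0 < e -> exists2 D : R, 0 < D & forall h : R, `|h| < D ->
     `|f (x + h) - f x - p * h| <= e * `|h|) -> {for x, continuous f}.
Proof.
move=> H; apply/cvgrPdist_lt => e e0.
have [D D0 HD] := H 1 ltr01.
have c0 : 0 < Num.min D (e / (`|p| + 2)).
  by rewrite lt_min D0 divr_gt0 // ltr_wpDl.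
near=> t.
have tx : `|t - x| < Num.min D (e / (`|p| + 2)).
  by rewrite distrC; near: t; apply: cvgr_dist_lt => //; exact: cvg_id.
move: tx; rewrite lt_min => /andP[t1 t2].
have := HD _ t1; rewrite subrKC mul1r => h.
rewrite distrC (_ : f t - f x = (f t - f x - p * (t - x)) + p * (t - x)); last by ring.
apply: le_lt_trans (ler_normD _ _) _.
rewrite normrM; apply: le_lt_trans (lerD h (lexx _)) _.
rewrite -{1}[`|t - x|]mul1r -mulrDl.
rewrite ltr_pdivlMr in t2; last by rewrite ltr_wpDl.
apply: le_lt_trans _ t2; rewrite mulrC ler_wpM2l //; lra.
Unshelve. all: by end_near.
Qed.

Lemma closed_at_continuous P Q x y : closed_at P Q x y ->
  {for x, continuous (P ^~ y)} /\ {for y, continuous (Q x)}.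
Proof.
move=> [p [q [r H]]]; split.
- apply: (@lin_approx_continuous _ x p) => e /H[D D0 hD]; exists D => // h hh.
  have := hD h 0 hh; rewrite normr0 addr0 => /(_ D0) [+ _].
  by rewrite mulr0 !addr0.
- apply: (@lin_approx_continuous _ y r) => e /H[D D0 hD]; exists D => // h hh.
  have := hD 0 h; rewrite normr0 => /(_ D0 hh) [_].
  by rewrite mulr0 addr0 !add0r.
Qed.

Lemma form_cont_sub P Q a b c d a' b' c' d' :
  a <= a' -> b' <= b -> c <= c' -> d' <= d ->
  form_cont P Q a b c d -> form_cont P Q a' b' c' d'.
Proof.
move=> h1 h2 h3 h4 H x y /andP[x1 x2] /andP[y1 y2]; apply: H; apply/andP; split;
  by [exact: le_trans h1 _|exact: le_trans _ h2|exact: le_trans h3 _|exact: le_trans _ h4].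
Qed.

Lemma form_contP P Q a b c d y : form_cont P Q a b c d -> c <= y <= d ->
  cont_on a b (P ^~ y).
Proof. by move=> H hy x hx; have [] := H x y hx hy. Qed.

Lemma form_contQ P Q a b c d x : form_cont P Q a b c d -> a <= x <= b ->
  cont_on c d (Q x).
Proof. by move=> H hx y hy; have [] := H x y hx hy. Qed.

Lemma circ_splitx_edge P Q (a e b c d : R) : a <= e -> e <= b ->
  cont_on a b (P ^~ c) -> cont_on a b (P ^~ d) ->
  circ P Q a b c d = circ P Q a e c d + circ P Q e b c d.
Proof.
by move=> ae eb h1 h2; rewrite /circ !(itvint_split ae eb) //; ring.
Qed.

Lemma circ_splity_edge P Q (a b c e d : R) : c <= e -> e <= d ->
  cont_on c d (Q a) -> cont_on c d (Q b) ->
  circ P Q a b c d = circ P Q a b c e + circ P Q a b e d.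
Proof.
by move=> ce ed h1 h2; rewrite /circ !(itvint_split ce ed) //; ring.
Qed.

Lemma circ_splitx P Q (a e b c d : R) : a <= e -> e <= b -> c <= d ->
  form_cont P Q a b c d -> circ P Q a b c d = circ P Q a e c d + circ P Q e b c d.
Proof.
move=> ae eb cd H.
by rewrite (circ_splitx_edge _ ae eb (form_contP H _) (form_contP H _)) ?lexx ?cd.
Qed.

Lemma circ_splity P Q (a b c e d : R) : a <= b -> c <= e -> e <= d ->
  form_cont P Q a b c d -> circ P Q a b c d = circ P Q a b c e + circ P Q a b e d.
Proof.
move=> ab ce ed H.
by rewrite (circ_splity_edge _ ce ed (form_contQ H _) (form_contQ H _)) ?lexx ?ab.
Qed.

(** Continuity on the four edges only: squares around an exceptional point contain a possible
    discontinuity in their interior. *)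
Definition edge_cont P Q a b c d := [/\ cont_on a b (P ^~ c),
  cont_on a b (P ^~ d), cont_on c d (Q a) & cont_on c d (Q b)].

Lemma form_cont_edge P Q a b c d : a <= b -> c <= d ->
  form_cont P Q a b c d -> edge_cont P Q a b c d.
Proof.
move=> ab cd H; split; by [apply: (form_contP H); rewrite lexx cd|
  apply: (form_contQ H); rewrite lexx ab].
Qed.

Lemma circ_lin (u v : R) P Q P' Q' a b c d :
  edge_cont P Q a b c d -> edge_cont P' Q' a b c d ->
  circ (fun x y => u * P x y + v * P' x y) (fun x y => u * Q x y + v * Q' x y)
    a b c d = u * circ P Q a b c d + v * circ P' Q' a b c d.
Proof.
move=> [p1 p2 p3 p4] [q1 q2 q3 q4]; rewrite /circ.
rewrite (itvint_lin u v p1 q1) (itvint_lin u v p2 q2).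
rewrite (itvint_lin u v p3 q3) (itvint_lin u v p4 q4); ring.
Qed.

Lemma circB P Q P' Q' a b c d : a <= b -> c <= d ->
  form_cont P Q a b c d -> form_cont P' Q' a b c d ->
  circ (fun x y => P x y - P' x y) (fun x y => Q x y - Q' x y) a b c d =
  circ P Q a b c d - circ P' Q' a b c d.
Proof.
move=> ab cd H H'.
have e (f g : R -> R -> R) :
    (fun x y => f x y - g x y) = (fun x y => 1 * f x y + (-1) * g x y).
  by apply/funext => x; apply/funext => y; rewrite mul1r mulN1r.
rewrite (e P P') (e Q Q').
rewrite (circ_lin 1 (-1) (form_cont_edge ab cd H) (form_cont_edge ab cd H')).
by rewrite mul1r mulN1r.
Qed.

Lemma circ_bound P Q a b c d (M : R) : a <= b -> c <= d -> edge_cont P Q a b c d ->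
  (forall x y, a <= x <= b -> c <= y <= d ->
     (y = c \/ y = d -> `|P x y| <= M) /\ (x = a \/ x = b -> `|Q x y| <= M)) ->
  `|circ P Q a b c d| <= 2 * M * ((b - a) + (d - c)).
Proof.
move=> ab cd [h1 h2 h3 h4] HM; rewrite /circ.
have hc : c <= c <= d by rewrite lexx cd.
have hd : c <= d <= d by rewrite lexx cd.
have ha : a <= a <= b by rewrite lexx ab.
have hb : a <= b <= b by rewrite lexx ab.
have := itvint_bound ab h1 (fun x hx => (HM x c hx hc).1 (or_introl erefl)).
have := itvint_bound ab h2 (fun x hx => (HM x d hx hd).1 (or_intror erefl)).
have := itvint_bound cd h3 (fun x hx => (HM a x ha hx).2 (or_introl erefl)).
have := itvint_bound cd h4 (fun x hx => (HM b x hb hx).2 (or_intror erefl)).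
rewrite !ler_norml; clear.
set i1 := itvint a b _; set i2 := itvint a b _.
set i3 := itvint c d _; set i4 := itvint c d _.
move=> /andP[? ?] /andP[? ?] /andP[? ?] /andP[? ?]; apply/andP; split; lra.
Qed.

Lemma affine_form_cont (u v p q r s a b c d : R) :
  form_cont (fun x y => u + p * x + q * y) (fun x y => v + r * x + s * y) a b c d.
Proof.
have h (A B C : R) : continuous (fun t : R => A + B * t + C).
  move=> t; apply: cvgD; last exact: cvg_cst.
  apply: cvgD; first exact: cvg_cst.
  by apply: cvgM; [exact: cvg_cst|exact: cvg_id].
move=> x y _ _; split; first exact: h.
apply: cvgD; first exact: cvg_cst.
by apply: cvgM; [exact: cvg_cst|exact: cvg_id].
Qed.

Lemma circ_affine (u v p q r a b c d : R) : a <= b -> c <= d ->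
  circ (fun x y => u + p * x + q * y) (fun x y => v + q * x + r * y) a b c d = 0.
Proof.
move=> ab cd; rewrite /circ.
have e1 t : itvint a b (fun x => u + p * x + q * t) =
   (u + q * t) * (b - a) + p * (b ^+ 2 - a ^+ 2) / 2.
  rewrite -itvint_affine //; apply: itvint_eq => x _; ring.
by rewrite !e1 !itvint_affine //; field.
Qed.

Lemma nested_point (s : nat -> R) (w : R) :
  (forall l, s l <= s l.+1) ->
  (forall l, s l.+1 + w * 2^-1 ^+ l.+1 <= s l + w * 2^-1 ^+ l) ->
  0 <= w -> exists z, forall l, s l <= z <= s l + w * 2^-1 ^+ l.
Proof.
move=> s1 s2 w0.
have mono m l : (l <= m)%N -> s l <= s m.
  by elim: m => [|m IH]; [case: l|rewrite leq_eqVlt => /predU1P[->//|/IH h]; exact: le_trans h _].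
have mono2 m l : (l <= m)%N -> s m + w * 2^-1 ^+ m <= s l + w * 2^-1 ^+ l.
  elim: m => [|m IH]; first by case: l.
  by rewrite leq_eqVlt => /predU1P[->//|/IH h]; exact: le_trans (s2 m) h.
have p0 l : 0 <= w * 2^-1 ^+ l by rewrite mulr_ge0 // exprn_ge0.
have ub l m : s m <= s l + w * 2^-1 ^+ l.
  case: (leqP l m) => lm.
    by apply: le_trans (mono2 _ _ lm); rewrite lerDl.
  by apply: le_trans (mono _ _ (ltnW lm)) _; rewrite lerDl.
exists (sup (range s)) => l; apply/andP; split.
  apply: ub_le_sup; last by exists l.
  by exists (s 0%N + w * 2^-1 ^+ 0) => _ [m _ <-].
apply: ge_sup; first by exists (s 0%N); exists 0%N.
by move=> _ [m _ <-].
Qed.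

Lemma half_pow_small (w e : R) : 0 < e -> exists l, w * 2^-1 ^+ l < e.
Proof.
move=> e0.
have : (fun l => w * (2^-1 : R) ^+ l) @ \oo --> w * 0.
  by apply: cvgM; [exact: cvg_cst|apply: cvg_expr; rewrite gtr0_norm ?invf_lt1 ?ltr1n].
rewrite mulr0 => /cvgrPdist_lt /(_ _ e0) [N _ /(_ N (leqnn N))] /=.
rewrite sub0r normrN => h; exists N; exact: le_lt_trans (ler_norm _) h.
Qed.

(** The affine part of the form at the point is itself closed, because [P] and [Q] share the
    coefficient [q], so its circulation is 0. The rest is at most [e / 2 * (W + K)] on a boundary of
    length [2 * (W + K)]. *)
Lemma closed_at_circ_small P Q (x0 y0 e : R) : closed_at P Q x0 y0 -> 0 < e ->
  exists2 D : R, 0 < D & forall u v W K : R, 0 <= W -> 0 <= K -> W + K < D ->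
    u <= x0 <= u + W -> v <= y0 <= v + K -> form_cont P Q u (u + W) v (v + K) ->
    `|circ P Q u (u + W) v (v + K)| <= e * (W + K) ^+ 2.
Proof.
move=> [p [q [r Hl]]] e0.
have [D D0 HD] := Hl (e / 2) (divr_gt0 e0 (ltr0n _ 2)).
exists D => // u v W K W0 K0 WK /andP[Hx1 Hx2] /andP[Hy1 Hy2] FC.
pose P' x y := (P x0 y0 - p * x0 - q * y0) + p * x + q * y.
pose Q' x y := (Q x0 y0 - q * x0 - r * y0) + q * x + r * y.
have uW : u <= u + W by rewrite lerDl.
have vK : v <= v + K by rewrite lerDl.
have FC' : form_cont P' Q' u (u + W) v (v + K) by exact: affine_form_cont.
have -> : circ P Q u (u + W) v (v + K) =
   circ (fun x y => P x y - P' x y) (fun x y => Q x y - Q' x y) u (u + W) v (v + K).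
  by rewrite circB // circ_affine ?subr0.
have -> : e * (W + K) ^+ 2 = 2 * (e / 2 * (W + K)) * ((u + W - u) + (v + K - v)).
  by field.
apply: circ_bound => //.
  apply: form_cont_edge => // x y hx hy.
  have [c1 c2] := FC x y hx hy; have [c3 c4] := FC' x y hx hy.
  by split; apply: cvgB.
move=> x y /andP[x1 x2] /andP[y1 y2].
have kx : `|x - x0| <= W.
  by clear -x1 x2 Hx1 Hx2; rewrite ler_norml; apply/andP; split; lra.
have ky : `|y - y0| <= K.
  by clear -y1 y2 Hy1 Hy2; rewrite ler_norml; apply/andP; split; lra.
have [||n1 n2] := HD (x - x0) (y - y0).
- by clear -kx W0 K0 WK; lra.
- by clear -ky W0 K0 WK; lra.
rewrite !subrKC in n1 n2.
have bd : e / 2 * (`|x - x0| + `|y - y0|) <= e / 2 * (W + K).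
  by rewrite ler_pM2l ?divr_gt0 //; exact: lerD.
split=> _.
  rewrite (_ : _ - _ = P x y - P x0 y0 - (p * (x - x0) + q * (y - y0))); last by rewrite /P'; ring.
  exact: le_trans n1 bd.
rewrite (_ : _ - _ = Q x y - Q x0 y0 - (q * (x - x0) + r * (y - y0))); last by rewrite /Q'; ring.
exact: le_trans n2 bd.
Qed.

Lemma bisection_contra (I T x : R) : 0 < I -> 0 < T ->
  I * T ^+ 2 <= I / (2 * (x ^+ 2 + 1)) * (x * T) ^+ 2 -> False.
Proof.
move=> I0 T0; have x0 : 0 <= x ^+ 2 by exact: sqr_ge0.
rewrite exprMn [X in _ <= X]mulrA ler_pM2r ?exprn_gt0 //.
rewrite mulrAC ler_pdivlMr; last lra.
rewrite ler_pM2l //; lra.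
Qed.

(** Bisection: the circulation is additive, so one quarter of each rectangle carries at least a
    quarter of it. The quarters shrink to a point, where closedness bounds the circulation by a
    small multiple of the squared size. *)
Theorem goursat P Q a b c d : a <= b -> c <= d ->
  (forall x y, a <= x <= b -> c <= y <= d -> closed_at P Q x y) ->
  circ P Q a b c d = 0.
Proof.
move=> ab cd H.
have FC : form_cont P Q a b c d by move=> x y hx hy; exact/closed_at_continuous/H.
apply/eqP; rewrite -normr_eq0; apply/contraT => I0.
have {I0}Ip : 0 < `|circ P Q a b c d| by rewrite lt_def I0 normr_ge0.
set I : R := `|circ P Q a b c d| in Ip.
pose w := b - a; pose h := d - c.
have w0 : 0 <= w by rewrite subr_ge0.
have h0 : 0 <= h by rewrite subr_ge0.
pose t (l : nat) : R := 2^-1 ^+ l.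
have tS l : t l = t l.+1 + t l.+1 by rewrite /t exprS; field.
have t0 l : 0 < t l by rewrite exprn_gt0.
pose A (u v : R) l := circ P Q u (u + w * t l) v (v + h * t l).
pose good l (s : R * R) := [/\ a <= s.1, s.1 + w * t l <= b, c <= s.2,
   s.2 + h * t l <= d & I * (t l) ^+ 2 <= `|A s.1 s.2 l|].
have step (u : nat * (R * R)) : exists s' : R * R, good u.1 u.2 ->
   [/\ good u.1.+1 s', u.2.1 <= s'.1, s'.1 + w * t u.1.+1 <= u.2.1 + w * t u.1,
       u.2.2 <= s'.2 & s'.2 + h * t u.1.+1 <= u.2.2 + h * t u.1].
  case: u => l [u v] /=; case: (pselect (good l (u, v))); last by move=> n; exists (0,0).
  move=> [/= g1 g2 g3 g4 g5].
  have wt : 0 <= w * t l.+1 by rewrite mulr_ge0 // ltW.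
  have ht : 0 <= h * t l.+1 by rewrite mulr_ge0 // ltW.
  rewrite (tS l) !mulrDr in g2 g4.
  have e : A u v l = (A u v l.+1 + A u (v + h * t l.+1) l.+1)
     + (A (u + w * t l.+1) v l.+1 + A (u + w * t l.+1) (v + h * t l.+1) l.+1).
    rewrite /A (tS l) !mulrDr !addrA.
    rewrite (@circ_splitx P Q u (u + w * t l.+1)); [|lra|lra|lra|].
      rewrite (@circ_splity P Q u _ v (v + h * t l.+1)); [|lra|lra|lra|].
        rewrite (@circ_splity P Q (u + w * t l.+1) _ v (v + h * t l.+1)); [|lra|lra|lra|].
          by rewrite !addrA.
        by apply: form_cont_sub FC; lra.
      by apply: form_cont_sub FC; lra.
    by apply: form_cont_sub FC; lra.
  have nn : I * t l.+1 ^+ 2 * 4 <= `|A u v l| by move: g5; rewrite (tS l) => g5; apply: le_trans g5; nra.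
  have : [\/ I * t l.+1 ^+ 2 <= `|A u v l.+1|, I * t l.+1 ^+ 2 <= `|A u (v + h * t l.+1) l.+1|,
      I * t l.+1 ^+ 2 <= `|A (u + w * t l.+1) v l.+1| |
      I * t l.+1 ^+ 2 <= `|A (u + w * t l.+1) (v + h * t l.+1) l.+1|].
    case: (leP _ `|A u v l.+1|) => k1; first by constructor.
    case: (leP _ `|A u (v + h * t l.+1) l.+1|) => k2; first by constructor.
    case: (leP _ `|A (u + w * t l.+1) v l.+1|) => k3; first by constructor.
    case: (leP _ `|A (u + w * t l.+1) (v + h * t l.+1) l.+1|) => k4; first by constructor.
    exfalso; move: nn; apply/negP; rewrite -ltNge e.
    apply: le_lt_trans (ler_normD _ _) _.
    have := ler_normD (A u v l.+1) (A u (v + h * t l.+1) l.+1).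
    have := ler_normD (A (u + w * t l.+1) v l.+1) (A (u + w * t l.+1) (v + h * t l.+1) l.+1).
    lra.
  have fin u' v' : u <= u' -> u' + w * t l.+1 <= u + (w * t l.+1 + w * t l.+1) ->
      v <= v' -> v' + h * t l.+1 <= v + (h * t l.+1 + h * t l.+1) ->
      I * t l.+1 ^+ 2 <= `|A u' v' l.+1| ->
    exists s' : R * R, good l (u, v) ->
      [/\ good l.+1 s', u <= s'.1, s'.1 + w * t l.+1 <= u + w * t l,
       v <= s'.2 & s'.2 + h * t l.+1 <= v + h * t l].
    move=> f1 f2 f3 f4 f5; exists (u', v') => _; rewrite (tS l) !mulrDr; split => //.
    split => //=; [exact: le_trans f1|exact: le_trans f2 _|exact: le_trans f3|].
    exact: le_trans f4 _.
  by case=> kk; apply: fin kk; clear -wt ht; lra.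
have [f Hf] := choice step.
pose s := fix s (l : nat) : R * R := if l is l'.+1 then f (l', s l') else (a, c).
have gs l : good l (s l).
  elim: l => [|l IH]; last by have [] := Hf (l, s l) IH.
  split => //=; rewrite /t ?expr0 ?expr1n ?mulr1 /w /h ?lexx //; try lra.
  by rewrite /A /t /= expr0 !mulr1 /w /h !subrKC.
have [x0 Hx] : exists z, forall l, (s l).1 <= z <= (s l).1 + w * 2^-1 ^+ l.
  by apply: (nested_point (s := fun l => (s l).1)) => // l; have [] := Hf (l, s l) (gs l).
have [y0 Hy] : exists z, forall l, (s l).2 <= z <= (s l).2 + h * 2^-1 ^+ l.
  by apply: (nested_point (s := fun l => (s l).2)) => // l; have [] := Hf (l, s l) (gs l).
have hx0 : a <= x0 <= b by have := Hx 0%N; rewrite /= expr0 mulr1 /w subrKC.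
have hy0 : c <= y0 <= d by have := Hy 0%N; rewrite /= expr0 mulr1 /h subrKC.
(* With [e = I / (2 * B)] the local bound at level [l] is at most half of [I * t l ^+ 2], the amount
   kept by the bisection; the [+ 1] covers a degenerate rectangle. *)
pose B := (w + h) ^+ 2 + 1.
have B0 : 0 < B by rewrite ltr_wpDl // sqr_ge0.
have e0 : 0 < I / (2 * B) by rewrite divr_gt0 // mulr_gt0.
have [D D0 HD] := closed_at_circ_small (H _ _ hx0 hy0) e0.
have [l hl] := half_pow_small (w + h) D0.
rewrite -/(t l) in hl.
have [g1 g2 g3 g4 g5] := gs l.
have {}Hx := Hx l; have {}Hy := Hy l; rewrite -/(t l) in Hx Hy.
have wt : 0 <= w * t l by rewrite mulr_ge0 // ltW.
have ht : 0 <= h * t l by rewrite mulr_ge0 // ltW.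
have := HD _ _ _ _ wt ht _ Hx Hy (form_cont_sub g1 g2 g3 g4 FC).
rewrite -mulrDl => /(_ hl) h1.
by case: (bisection_contra Ip (t0 l) (le_trans g5 h1)).
Qed.

(* The value at the exceptional point is irrelevant, only boundedness nearby
   matters: the inner square has vanishing circulation as it shrinks. *)
Lemma goursat_exceptional P Q a b c d (p q M r : R) : a < p < b -> c < q < d ->
  (forall x y, a <= x <= b -> c <= y <= d -> (x, y) <> (p, q) -> closed_at P Q x y) ->
  0 < r ->
  (forall x y, `|x - p| <= r -> `|y - q| <= r -> `|P x y| <= M /\ `|Q x y| <= M) ->
  circ P Q a b c d = 0.
Proof.
move=> /andP[ap pb] /andP[cq qd] H r0 HM.
have M0 : 0 <= M.
  have [||/(le_trans (normr_ge0 _))] // := HM p q; by rewrite subrr normr0 ltW.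
pose m : R := Num.min r (Num.min (Num.min (p - a) (b - p)) (Num.min (q - c) (d - q))).
have m0 : 0 < m by rewrite !lt_min r0 !subr_gt0 ap pb cq qd.
have small (s : R) : 0 < s -> s <= m -> `|circ P Q a b c d| <= 8 * M * s.
  move=> s0; rewrite !le_min => /andP[sr /andP[/andP[s1 s2] /andP[s3 s4]]].
  have cP x y : a <= x <= b -> c <= y <= d -> (x, y) <> (p, q) ->
     {for x, continuous (P ^~ y)} /\ {for y, continuous (Q x)}.
    by move=> hx hy hn; apply/closed_at_continuous/H.
  have eP y : c <= y <= d -> y <> q -> cont_on a b (P ^~ y).
    by move=> hy hq x hx; apply: (cP x y hx hy _).1 => -[_].
  have eQ x : a <= x <= b -> x <> p -> cont_on c d (Q x).
    by move=> hx hp y hy; apply: (cP x y hx hy _).2 => -[].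
  have aps : a <= p - s by clear -s1; lra.
  have spb : p + s <= b by clear -s2; lra.
  have cqs : c <= q - s by clear -s3; lra.
  have sqd : q + s <= d by clear -s4; lra.
  have ss : p - s <= p + s by clear -s0; lra.
  have ss' : q - s <= q + s by clear -s0; lra.
  have cc : c <= c <= d by rewrite lexx ltW // (lt_trans cq).
  have dd : c <= d <= d by rewrite lexx ltW // (lt_trans cq).
  have cn : c <> q by move=> e; rewrite e ltxx in cq.
  have dn : d <> q by move=> e; rewrite e ltxx in qd.
  have p1 : a <= p - s <= b by rewrite aps (le_trans ss).
  have p2 : a <= p + s <= b by rewrite spb (le_trans _ ss).
  have p1n : p - s <> p by clear -s0 => e; lra.
  have p2n : p + s <> p by clear -s0 => e; lra.
  have q1 : c <= q - s <= d by rewrite cqs (le_trans ss').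
  have q2 : c <= q + s <= d by rewrite sqd (le_trans _ ss').
  have q1n : q - s <> q by clear -s0 => e; lra.
  have q2n : q + s <> q by clear -s0 => e; lra.
  rewrite (circ_splitx_edge _ aps (le_trans ss spb) (eP _ cc cn) (eP _ dd dn)).
  rewrite (circ_splitx_edge (a := p - s) _ ss spb
    (cont_on_sub aps (lexx _) (eP _ cc cn)) (cont_on_sub aps (lexx _) (eP _ dd dn))).
  rewrite (circ_splity_edge (c := c) _ cqs (le_trans ss' sqd) (eQ _ p1 p1n) (eQ _ p2 p2n)).
  rewrite (circ_splity_edge (c := q - s) _ ss' sqd
    (cont_on_sub cqs (lexx _) (eQ _ p1 p1n)) (cont_on_sub cqs (lexx _) (eQ _ p2 p2n))).
  have cd' : c <= d by rewrite ltW // (lt_trans cq).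
  rewrite (@goursat P Q a (p - s) c d) //; last first.
    move=> x y /andP[x1 x2] hy; apply: H => //; first by rewrite x1 (le_trans x2) // (le_trans ss).
    by move=> [xp _]; clear -x2 xp s0; lra.
  rewrite (@goursat P Q (p + s) b c d) //; last first.
    move=> x y /andP[x1 x2] hy; apply: H => //; first by rewrite x2 (le_trans _ x1) // (le_trans aps).
    by move=> [xp _]; clear -x1 xp s0; lra.
  rewrite (@goursat P Q (p - s) (p + s) c (q - s)) //; last first.
    move=> x y /andP[x1 x2] /andP[y1 y2]; apply: H.
    - by rewrite (le_trans aps x1) (le_trans x2 spb).
    - by rewrite y1 (le_trans y2) // (le_trans ss').
    - by move=> [_ yq]; clear -y2 yq s0; lra.
  rewrite (@goursat P Q (p - s) (p + s) (q + s) d) //; last first.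
    move=> x y /andP[x1 x2] /andP[y1 y2]; apply: H.
    - by rewrite (le_trans aps x1) (le_trans x2 spb).
    - by rewrite y2 (le_trans _ y1) // (le_trans cqs).
    - by move=> [_ yq]; clear -y1 yq s0; lra.
  rewrite !add0r !addr0.
  have -> : 8 * M * s = 2 * M * ((p + s - (p - s)) + (q + s - (q - s))) by ring.
  apply: circ_bound => //.
    split; by [apply: cont_on_sub (eP _ q1 q1n)|apply: cont_on_sub (eP _ q2 q2n)|
       apply: cont_on_sub (eQ _ p1 p1n)|apply: cont_on_sub (eQ _ p2 p2n)].
  move=> x y /andP[x1 x2] /andP[y1 y2].
  have [||b1 b2] := HM x y.
  - by clear -x1 x2 sr; rewrite ler_norml; apply/andP; split; lra.
  - by clear -y1 y2 sr; rewrite ler_norml; apply/andP; split; lra.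
  by split.
apply/eqP; rewrite -normr_le0; apply/ler_addgt0Pr => e e0; rewrite add0r.
pose s := Num.min m (e / (8 * M + 1)).
have B0 : 0 < 8 * M + 1 by rewrite ltr_wpDl // mulr_ge0.
have s0 : 0 < s by rewrite lt_min m0 divr_gt0.
have sm : s <= m by rewrite ge_min lexx.
apply: le_trans (small s s0 sm) _.
have : s <= e / (8 * M + 1) by rewrite ge_min lexx orbT.
rewrite ler_pdivlMr // => h; apply: le_trans h; rewrite mulrC ler_wpM2l //; first exact: ltW.
by rewrite lerDl.
Qed.

End Goursat.

Import Normc.

(** * Complex differentiability and the Cauchy-Riemann equations *)

Section ComplexDifferentiable.
Context {R : realType}.
Implicit Types (z w : R[i]) (F G : R[i] -> R[i]).

(** Differentiability as a linear approximation, without a quotient: [h = 0] is no exception, and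
    sums, products and the passage to real forms become estimates of one shape. *)
Definition cdiff F z := exists l : R[i], forall e : R, 0 < e ->
  exists2 D : R, 0 < D & forall h : R[i], normc h < D ->
    normc (F (z + h) - F z - l * h) <= e * normc h.

Lemma ltcR_normc z (e : R) : (`|z| < cr e) = (normc z < e).
Proof. by rewrite ltcR. Qed.

Lemma normc_ge0 z : 0 <= normc z.
Proof. by case: z => a b; exact: sqrtr_ge0. Qed.
Hint Resolve normc_ge0 : core.

Lemma normc_gt0 z : z != 0 -> 0 < normc z.
Proof.
by move=> z0; rewrite lt_def normc_ge0 andbT; apply: contra z0 => /eqP/eq0_normc ->.
Qed.

Lemma normcB z w : normc (z - w) = normc (w - z).
Proof. by rewrite -normcN opprB. Qed.

Lemma cRe_le_normc z : `|cRe z| <= normc z.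
Proof.
case: z => a b /=; rewrite -sqrtr_sqr ler_wsqrtr // lerDl; exact: sqr_ge0.
Qed.

Lemma cIm_le_normc z : `|cIm z| <= normc z.
Proof.
case: z => a b /=; rewrite -sqrtr_sqr ler_wsqrtr // lerDr; exact: sqr_ge0.
Qed.

Lemma normc_le z : normc z <= `|cRe z| + `|cIm z|.
Proof.
case: z => a b /=; rewrite -[leRHS]ger0_norm ?addr_ge0 // -sqrtr_sqr ler_wsqrtr //.
rewrite sqrrD !real_normK ?num_real // -addrA lerD2l lerDr.
by rewrite mulrn_wge0 // mulr_ge0.
Qed.

Lemma normc_cr (x : R) : normc (cr x) = `|x|.
Proof. by rewrite /= expr0n addr0 sqrtr_sqr. Qed.

Lemma normc_expr z n : normc (z ^+ n) = normc z ^+ n.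
Proof. by elim: n => [|n IH]; rewrite ?normc1 // !exprS normcM IH. Qed.

Lemma cdiff_cst (l : R[i]) z : cdiff (fun=> l) z.
Proof.
exists 0 => e e0; exists 1 => // h _.
by rewrite mul0r subrr subr0 normc0 mulr_ge0 // ltW.
Qed.

Lemma cdiff_id z : cdiff id z.
Proof.
exists 1 => e e0; exists 1 => // h _.
by rewrite mul1r [z + h]addrC addrK subrr normc0 mulr_ge0 // ltW.
Qed.

Lemma cdiffD F G z : cdiff F z -> cdiff G z -> cdiff (fun z => F z + G z) z.
Proof.
move=> [l Hl] [m Hm]; exists (l + m) => e e0.
have e2 : 0 < e / 2 by rewrite divr_gt0.
have [D1 D10 H1] := Hl _ e2; have [D2 D20 H2] := Hm _ e2.
exists (Num.min D1 D2); first by rewrite lt_min D10.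
move=> h; rewrite lt_min => /andP[/H1 h1 /H2 h2].
rewrite (_ : _ - _ = (F (z + h) - F z - l * h) + (G (z + h) - G z - m * h)); last by ring.
apply: le_trans (le_normcD _ _) _; apply: le_trans (lerD h1 h2) _.
by rewrite -mulrDl -splitr.
Qed.

Lemma cdiff_bounded F z : cdiff F z -> exists2 C : R, 0 <= C &
  exists2 D : R, 0 < D & forall h, normc h < D -> normc (F (z + h) - F z) <= C * normc h.
Proof.
move=> [l Hl]; exists (1 + normc l); first by rewrite addr_ge0 // normc_ge0.
have [D D0 H] := Hl 1 ltr01; exists D => // h /H h1.
rewrite -[F _ - _](subrK (l * h)); apply: le_trans (le_normcD _ _) _.
by rewrite normcM mulrDl lerD2r.
Qed.

Lemma cdiff_cont F z : cdiff F z -> forall e : R, 0 < e ->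
  exists2 D : R, 0 < D & forall h, normc h < D -> normc (F (z + h) - F z) < e.
Proof.
move=> /cdiff_bounded [C C0 [D D0 H]] e e0.
exists (Num.min D (e / (C + 1))).
  by rewrite lt_min D0 divr_gt0 // ltr_wpDl.
move=> h; rewrite lt_min => /andP[/H h1]; rewrite ltr_pdivlMr ?ltr_wpDl // => h2.
apply: le_lt_trans h1 (le_lt_trans _ h2).
by rewrite mulrC ler_wpM2l ?normc_ge0 // lerDl.
Qed.

Lemma cdiffM F G z : cdiff F z -> cdiff G z -> cdiff (fun z => F z * G z) z.
Proof.
move=> dF dG; have [C C0 [D3 D30 H3]] := cdiff_bounded dF.
have := cdiff_cont dG; move: dF dG => [l Hl] [m Hm] cG.
exists (l * G z + F z * m) => e e0.
pose K := normc (G z) + normc (F z) + C + 1.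
have K0 : 0 < K by rewrite ltr_wpDl // !addr_ge0 // normc_ge0.
have e2 : 0 < e / K by rewrite divr_gt0.
have [D1 D10 H1] := Hl _ e2; have [D2 D20 H2] := Hm _ e2; have [D4 D40 H4] := cG _ e2.
exists (Num.min (Num.min D1 D2) (Num.min D3 D4)); first by rewrite !lt_min D10 D20 D30.
move=> h; rewrite !lt_min => /andP[/andP[/H1 h1 /H2 h2] /andP[/H3 h3 /H4 h4]].
rewrite (_ : _ - _ = (F (z + h) - F z - l * h) * G z + F z * (G (z + h) - G z - m * h)
   + (F (z + h) - F z) * (G (z + h) - G z)); last by ring.
apply: le_trans (le_normcD _ _) _; rewrite normcM.
apply: le_trans (lerD (le_normcD _ _) (lexx _)) _; rewrite !normcM.
have nh := normc_ge0 h.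
have -> : e * normc h = e / K * normc h * normc (G z) + normc (F z) * (e / K * normc h)
  + C * normc h * (e / K) + e / K * normc h.
  by rewrite /K; field; rewrite gt_eqF.
rewrite -[leLHS]addr0; apply: lerD; last by rewrite mulr_ge0 // ltW.
apply: lerD; first by apply: lerD; [apply: ler_wpM2r|apply: ler_wpM2l]; rewrite ?normc_ge0.
by apply: ler_pM; rewrite ?normc_ge0 // ltW.
Qed.

Lemma cdiffV F z : cdiff F z -> F z != 0 -> cdiff (fun z => (F z)^-1) z.
Proof.
move=> dF F0; have cF := cdiff_cont dF; move: dF => [l Hl].
exists (- (l / (F z) ^+ 2)) => e e0.
have n0 := normc_gt0 F0; set N : R := normc (F z) in n0.
pose L : R := normc l; have L0 : 0 <= L by exact: normc_ge0.
(* The increment of the inverse splits into a linearization error and a product of two increments.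
   Near [z] the modulus of [F] stays above [N / 2], and these constants make each part at most
   [e / 2 * normc h]; [L + 1] stands for [L], which may be 0. *)
have e2 : 0 < e * N ^+ 2 / 4 by rewrite divr_gt0 // mulr_gt0 // exprn_gt0.
have e3 : 0 < e * N ^+ 3 / (4 * (L + 1)).
  by rewrite divr_gt0 ?mulr_gt0 ?exprn_gt0 // ltr_wpDl.
have [D1 D10 H1] := Hl _ e2.
have [D2 D20 H2] := cF (N / 2) (divr_gt0 n0 (ltr0n _ 2)).
have [D4 D40 H4] := cF _ e3.
exists (Num.min (Num.min D1 D2) D4); first by rewrite !lt_min D10 D20.
move=> h; rewrite !lt_min => /andP[/andP[/H1 h1 /H2 h2] /H4 h4].
have nF : N / 2 <= normc (F (z + h)).
  have := le_normcD (F (z + h)) (F z - F (z + h)); rewrite subrKC -/N normcB.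
  by move: h2; clear; move=> h2 h5; lra.
have Fh0 : F (z + h) != 0.
  by apply: contraTN nF => /eqP ->; rewrite normc0 -ltNge divr_gt0.
rewrite (_ : _ - _ = - ((F (z + h) - F z - l * h) / (F z * F (z + h))) +
   l * h * (F (z + h) - F z) / ((F z) ^+ 2 * F (z + h))); last first.
  by field; rewrite F0 Fh0.
set dd := F (z + h) - F z in h1 h2 h4 *.
have nh := normc_ge0 h.
have P0 : 0 < N * normc (F (z + h)) by rewrite mulr_gt0 // normc_gt0.
have P1 : 0 < N ^+ 2 * normc (F (z + h)) by rewrite mulr_gt0 ?exprn_gt0 ?normc_gt0.
have P2 : N * (N / 2) <= N * normc (F (z + h)) by rewrite ler_pM2l.
have P3 : N ^+ 2 * (N / 2) <= N ^+ 2 * normc (F (z + h)) by rewrite ler_pM2l ?exprn_gt0.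
apply: le_trans (le_normcD _ _) _; rewrite normcN !normcM !normcV (normcM (F z)) (normcM (F z ^+ 2)) normc_expr.
rewrite -/N -/L (splitr e) mulrDl; apply: lerD.
  rewrite ler_pdivrMr //; apply: le_trans h1 _.
  have -> : e * N ^+ 2 / 4 * normc h = e / 2 * normc h * (N * (N / 2)) by field.
  by rewrite ler_wpM2l // mulr_ge0 // divr_ge0 // ltW.
rewrite ler_pdivrMr //.
apply: le_trans (_ : L * normc h * (e * N ^+ 3 / (4 * (L + 1))) <= _).
  by rewrite ler_wpM2l ?mulr_ge0 // ltW.
have -> : L * normc h * (e * N ^+ 3 / (4 * (L + 1))) =
   (L / (L + 1)) * (e / 2 * normc h * (N ^+ 2 * (N / 2))).
  by field; rewrite gt_eqF // ltr_wpDl.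
apply: le_trans (_ : 1 * (e / 2 * normc h * (N ^+ 2 * (N / 2))) <= _).
  apply: ler_wpM2r; last by rewrite ler_pdivrMr ?ltr_wpDl // mul1r lerDl.
  by rewrite !mulr_ge0 ?exprn_ge0 // ?divr_ge0 // ltW.
by rewrite mul1r ler_wpM2l // mulr_ge0 // divr_ge0 // ltW.
Qed.

Lemma cdiffX F z n : cdiff F z -> cdiff (fun z => F z ^+ n) z.
Proof.
move=> dF; elim: n => [|n IH]; first exact: cdiff_cst.
have -> : (fun z => F z ^+ n.+1) = (fun z => F z * F z ^+ n).
  by apply/funext => w; rewrite exprS.
exact: cdiffM.
Qed.

Lemma holomorphic_cdiff F : holomorphic F -> forall z, cdiff F z.
Proof.
move=> H z; have [l Hl] := H z; exists l => e e0.
have [D [D0 HD]] := Hl e e0; exists D => // h hD.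
have [->|h0] := eqVneq h 0; first by rewrite addr0 mulr0 !subrr normc0 mulr0.
have := HD h h0; rewrite !ltcR_normc => /(_ hD) /ltW.
have -> : F (z + h) - F z - l * h = ((F (z + h) - F z) / h - l) * h.
  by field.
by rewrite normcM => hh; rewrite ler_wpM2r // normc_ge0.
Qed.

Lemma cdiff_holomorphic F : (forall z, cdiff F z) -> holomorphic F.
Proof.
move=> H z; have [l Hl] := H z; exists l => e e0.
have [D D0 HD] := Hl (e / 2) (divr_gt0 e0 (ltr0n _ 2)); exists D; split => // h h0.
rewrite !ltcR_normc => /HD hh.
have -> : (F (z + h) - F z) / h - l = (F (z + h) - F z - l * h) / h by field.
rewrite normcM normcV ltr_pdivrMr ?normc_gt0 //; apply: le_lt_trans hh _.
by rewrite ltr_pM2r ?normc_gt0 // ltr_pdivrMr // ltr_pMr // ltr1n.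
Qed.

Definition cxy (x y : R) : R[i] := Complex x y.

(** For [G = u + i v], [G dz] is [(u dx - v dy) + i (v dx + u dy)]. Multiplication by the complex
    derivative has exactly the symmetry of coefficients that closedness demands. *)
Lemma cdiff_closed_at G x y : cdiff G (Complex x y) ->
  closed_at (fun x y => cRe (G (cxy x y))) (fun x y => - cIm (G (cxy x y))) x y /\
  closed_at (fun x y => cIm (G (cxy x y))) (fun x y => cRe (G (cxy x y))) x y.
Proof.
move=> [l Hl].
have H (e : R) : 0 < e -> exists2 D : R, 0 < D & forall h k : R, `|h| < D -> `|k| < D ->
   `|cRe (G (cxy (x + h) (y + k))) - cRe (G (cxy x y)) - (cRe l * h - cIm l * k)|
       <= e * (`|h| + `|k|) /\
   `|cIm (G (cxy (x + h) (y + k))) - cIm (G (cxy x y)) - (cIm l * h + cRe l * k)|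
       <= e * (`|h| + `|k|).
  move=> e0; have [D D0 HD] := Hl e e0; exists (D / 2); first exact: divr_gt0.
  move=> h k hh hk; have nl := normc_le (Complex h k); rewrite /= -/(cxy h k) in nl.
  have sm : normc (Complex h k) < D by apply: le_lt_trans nl _; rewrite [ltRHS]splitr ltrD.
  have nD := le_trans (HD _ sm) (ler_wpM2l (ltW e0) nl).
  have e1 : Complex x y + Complex h k = cxy (x + h) (y + k) by [].
  rewrite e1 in nD; split.
    apply: le_trans nD; apply: le_trans (cRe_le_normc _).
    by case: (G _) => ? ?; case: (G _) => ? ?; case: (l) => ? ? /=.
  apply: le_trans nD; apply: le_trans (cIm_le_normc _).
  case: (G _) => ? ?; case: (G _) => ? ?; case: (l) => l1 l2 /=.
  by rewrite [l1 * k + _]addrC.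
split.
  exists (cRe l), (- cIm l), (- cRe l) => e /H[D D0 HD]; exists D => // h k hh hk.
  have [h1 h2] := HD h k hh hk; split; first by rewrite mulNr.
  rewrite (_ : _ - _ = - (cIm (G (cxy (x + h) (y + k))) - cIm (G (cxy x y)) -
    (cIm l * h + cRe l * k))) ?normrN //; ring.
exists (cIm l), (cRe l), (- cIm l) => e /H[D D0 HD]; exists D => // h k hh hk.
by have [h1 h2] := HD h k hh hk; split => //; rewrite mulNr.
Qed.

End ComplexDifferentiable.

(** * Contour integrals and functions vanishing on a real ray *)

Section Cauchy.
Context {R : realType}.
Implicit Types (z w : R[i]) (F G : R[i] -> R[i]) (a b c d : R).

Definition cint G a b c d : R[i] := Complex
  (circ (fun x y => cRe (G (cxy x y))) (fun x y => - cIm (G (cxy x y))) a b c d)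
  (circ (fun x y => cIm (G (cxy x y))) (fun x y => cRe (G (cxy x y))) a b c d).

Definition on_edge a b c d z := (a <= cRe z <= b /\ (cIm z = c \/ cIm z = d)) \/
  (c <= cIm z <= d /\ (cRe z = a \/ cRe z = b)).

Definition edge_cdiff G a b c d := forall z, on_edge a b c d z -> cdiff G z.

Lemma edge_cdiff_cont G a b c d : edge_cdiff G a b c d ->
  edge_cont (fun x y => cRe (G (cxy x y))) (fun x y => - cIm (G (cxy x y))) a b c d /\
  edge_cont (fun x y => cIm (G (cxy x y))) (fun x y => cRe (G (cxy x y))) a b c d.
Proof.
move=> H; have K x y : on_edge a b c d (cxy x y) -> _ := fun h => cdiff_closed_at (H _ h).
split; split=> t ht.
- by apply: (closed_at_continuous (K t c _).1).1; left; split => //; left.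
- by apply: (closed_at_continuous (K t d _).1).1; left; split => //; right.
- by apply: (closed_at_continuous (K a t _).1).2; right; split => //; left.
- by apply: (closed_at_continuous (K b t _).1).2; right; split => //; right.
- by apply: (closed_at_continuous (K t c _).2).1; left; split => //; left.
- by apply: (closed_at_continuous (K t d _).2).1; left; split => //; right.
- by apply: (closed_at_continuous (K a t _).2).2; right; split => //; left.
- by apply: (closed_at_continuous (K b t _).2).2; right; split => //; right.
Qed.

Lemma circ_eq (P Q P' Q' : R -> R -> R) a b c d :
  (forall x y, P x y = P' x y) -> (forall x y, Q x y = Q' x y) ->
  circ P Q a b c d = circ P' Q' a b c d.
Proof.
move=> h1 h2; suff [-> ->] : P = P' /\ Q = Q' by [].
by split; apply/funext => x; apply/funext => y.
Qed.

Lemma cintD F G a b c d : edge_cdiff F a b c d -> edge_cdiff G a b c d ->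
  cint (fun z => F z + G z) a b c d = cint F a b c d + cint G a b c d.
Proof.
move=> /edge_cdiff_cont[f1 f2] /edge_cdiff_cont[g1 g2]; rewrite /cint.
have := circ_lin 1 1 f1 g1; have := circ_lin 1 1 f2 g2; rewrite !mul1r => e2 e1.
congr Complex.
  rewrite -e1; apply: circ_eq => x y; rewrite ?mul1r; case: (F _); case: (G _) => //= *.
  by rewrite opprD.
by rewrite -e2; apply: circ_eq => x y; rewrite !mul1r; case: (F _); case: (G _).
Qed.

Lemma cintZ (l : R[i]) F a b c d : edge_cdiff F a b c d ->
  cint (fun z => l * F z) a b c d = l * cint F a b c d.
Proof.
move=> /edge_cdiff_cont[f1 f2]; rewrite /cint; case: l => u v.
have e1 := circ_lin u (- v) f1 f2; have e2 := circ_lin u v f2 f1.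
rewrite /GRing.mul /=; congr Complex.
  rewrite -mulNr -e1; apply: circ_eq => x y; case: (F _) => p q /=; ring.
rewrite -e2; apply: circ_eq => x y; case: (F _) => p q /=; ring.
Qed.

Lemma cint_bound F a b c d (M : R) : a <= b -> c <= d -> edge_cdiff F a b c d ->
  (forall z, on_edge a b c d z -> normc (F z) <= M) ->
  normc (cint F a b c d) <= 4 * M * ((b - a) + (d - c)).
Proof.
move=> ab cd /edge_cdiff_cont[f1 f2] HM; apply: le_trans (normc_le _) _.
have -> : 4 * M * ((b - a) + (d - c)) =
  2 * M * ((b - a) + (d - c)) + 2 * M * ((b - a) + (d - c)) by ring.
apply: lerD; apply: circ_bound => // x y hx hy; split => h; rewrite ?normrN;
  (apply: le_trans (HM (cxy x y) _); [exact: cRe_le_normc || exact: cIm_le_normc|]).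
all: by [left|right].
Qed.

(** The difference quotient is differentiable away from [w] and bounded near it, so Goursat's
    theorem with an exceptional point applies. At [w] itself the quotient is [0 / 0 = 0], which
    respects the bound. *)
Lemma cauchy F a b c d w : (forall z, cdiff F z) -> a < cRe w < b -> c < cIm w < d ->
  cint (fun z => (F z - F w) / (z - w)) a b c d = 0.
Proof.
move=> dF hx hy; pose G z := (F z - F w) / (z - w).
have dG x y : (x, y) <> (cRe w, cIm w) -> cdiff G (cxy x y).
  move=> n; apply: cdiffM.
    by apply: cdiffD; [exact: dF|exact: cdiff_cst].
  apply: cdiffV; first by apply: cdiffD; [exact: cdiff_id|exact: cdiff_cst].
  by rewrite subr_eq0; apply/eqP => e; apply: n; rewrite -e.
have [C C0 [D D0 HD]] := cdiff_bounded (dF w).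
have bG x y : `|x - cRe w| <= D / 4 -> `|y - cIm w| <= D / 4 -> normc (G (cxy x y)) <= C.
  move=> hx' hy'; have [e|n] := eqVneq (cxy x y) w.
    by rewrite /G e !subrr mul0r normc0.
  have n0 : cxy x y - w != 0 by rewrite subr_eq0.
  rewrite /G normcM normcV ler_pdivrMr ?normc_gt0 //.
  have := HD (cxy x y - w); rewrite subrKC; apply.
  apply: le_lt_trans (normc_le _) _.
  have -> : cRe (cxy x y - w) = x - cRe w by case: (w).
  have -> : cIm (cxy x y - w) = y - cIm w by case: (w).
  by apply: le_lt_trans (lerD hx' hy') _; clear -D0; lra.
have D4 : 0 < D / 4 by exact: divr_gt0.
rewrite /cint; congr Complex; apply: (@goursat_exceptional _ _ _ _ _ _ _ _ _ C (D / 4) hx hy _ D4).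
- by move=> x y _ _ /dG/cdiff_closed_at[].
- move=> x y h1 h2; have h := bG x y h1 h2; rewrite normrN.
  by split; apply: le_trans h; [exact: cRe_le_normc|exact: cIm_le_normc].
- by move=> x y _ _ /dG/cdiff_closed_at[].
- move=> x y h1 h2; have h := bG x y h1 h2.
  by split; apply: le_trans h; [exact: cIm_le_normc|exact: cRe_le_normc].
Qed.

Lemma itvint_pos (f : R -> R) a b (m : R) : a < b -> 0 < m -> cont_on a b f ->
  (forall x, a <= x <= b -> m <= f x) -> 0 < itvint a b f.
Proof.
move=> ab m0 cf hm.
have := itvint_affine m 0 (ltW ab); rewrite mul0r mul0r addr0 => e.
apply: lt_le_trans (_ : m * (b - a) <= _); first by rewrite mulr_gt0 // subr_gt0.
rewrite -e; apply: le_Rintegral => //.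
- apply: cont_on_integrable => x _; apply: cvgD; first exact: cvg_cst.
  by apply: cvgM; [exact: cvg_cst|exact: cvg_id].
- exact: cont_on_integrable.
- by move=> x /=; rewrite in_itv /= mul0r addr0; exact: hm.
Qed.

(** Each of the four edges contributes a positive amount to the imaginary part, so the integral is
    nonzero without being evaluated. *)
Lemma winding_neq0 a b c d w : a < cRe w < b -> c < cIm w < d ->
  cint (fun z => (z - w)^-1) a b c d != 0.
Proof.
move=> /andP[h1 h2] /andP[h3 h4].
have dG : edge_cdiff (fun z => (z - w)^-1) a b c d.
  move=> z hz; apply: cdiffV; first by apply: cdiffD; [exact: cdiff_id|exact: cdiff_cst].
  rewrite subr_eq0; apply/eqP => e; move: hz; rewrite e /on_edge.
  by case=> -[_ []] e'; move: h1 h2 h3 h4; rewrite e' ltxx.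
have [_ [g1 g2 g3 g4]] := edge_cdiff_cont dG.
case: w h1 h2 h3 h4 dG g1 g2 g3 g4 => u v /= h1 h2 h3 h4 dG g1 g2 g3 g4.
suff : 0 < cIm (cint (fun z => (z - Complex u v)^-1) a b c d).
  by apply: contraTneq => ->; rewrite ltxx.
have ab : a < b by exact: lt_trans h2.
have cd : c < d by exact: lt_trans h4.
pose B : R := (b - a) ^+ 2 + (d - c) ^+ 2.
have bd (x y : R) : a <= x <= b -> c <= y <= d -> 0 < (x - u) ^+ 2 + (y - v) ^+ 2 ->
   B^-1 <= ((x - u) ^+ 2 + (y - v) ^+ 2)^-1.
  move=> /andP[x1 x2] /andP[y1 y2] p0; rewrite lef_pV2 ?posrE //; last first.
    by rewrite /B ltr_pwDl ?exprn_gt0 ?subr_gt0 // sqr_ge0.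
  apply: lerD; rewrite -ler_sqrt ?sqrtr_sqr ?sqr_ge0 //.
    rewrite [leRHS]ger0_norm ?subr_ge0 ?(ltW ab) // ler_norml; apply/andP.
    by clear -x1 x2 h1 h2; split; lra.
  rewrite [leRHS]ger0_norm ?subr_ge0 ?(ltW cd) // ler_norml; apply/andP.
  by clear -y1 y2 h3 h4; split; lra.
have Bp : 0 < B^-1 by rewrite invr_gt0 /B ltr_pwDl ?exprn_gt0 ?subr_gt0 // sqr_ge0.
rewrite /= /circ.
have i1 : 0 < itvint a b (fun x => cIm ((cxy x c - Complex u v)^-1)).
  apply: (@itvint_pos _ _ _ ((v - c) * B^-1)) => //; first by rewrite mulr_gt0 ?subr_gt0.
  move=> x hx /=; rewrite -mulNr opprB ler_pM2l ?subr_gt0 //; apply: bd => //.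
    by rewrite lexx ltW.
  by rewrite ltr_wpDl ?sqr_ge0 // exprn_even_gt0 //= subr_eq0 lt_eqF.
have i2 : 0 < itvint c d (fun y => cRe ((cxy b y - Complex u v)^-1)).
  apply: (@itvint_pos _ _ _ ((b - u) * B^-1)) => //; first by rewrite mulr_gt0 ?subr_gt0.
  move=> x hx /=; rewrite ler_pM2l ?subr_gt0 //; apply: bd => //.
    by rewrite lexx ltW.
  by rewrite ltr_pwDl ?sqr_ge0 // exprn_even_gt0 //= subr_eq0 gt_eqF.
have i3 : 0 < itvint a b (fun x => - cIm ((cxy x d - Complex u v)^-1)).
  apply: (@itvint_pos _ _ _ ((d - v) * B^-1)) => //; first by rewrite mulr_gt0 ?subr_gt0.
    by move=> x hx; apply: cvgN; exact: g2.
  move=> x hx /=; rewrite opprK ler_pM2l ?subr_gt0 //; apply: bd => //.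
    by rewrite lexx ltW.
  by rewrite ltr_wpDl ?sqr_ge0 // exprn_even_gt0 //= subr_eq0 gt_eqF.
have i4 : 0 < itvint c d (fun y => - cRe ((cxy a y - Complex u v)^-1)).
  apply: (@itvint_pos _ _ _ ((u - a) * B^-1)) => //; first by rewrite mulr_gt0 ?subr_gt0.
    by move=> x hx; apply: cvgN; exact: g3.
  move=> x hx /=; rewrite -mulNr opprB ler_pM2l ?subr_gt0 //; apply: bd => //.
    by rewrite lexx ltW.
  by rewrite ltr_pwDl ?sqr_ge0 // exprn_even_gt0 //= subr_eq0 lt_eqF.
have nI (A B' : R) f : cont_on A B' f -> itvint A B' (fun x => - f x) = - itvint A B' f.
  move=> cf; rewrite -mulN1r -itvintZ //; apply: itvint_eq => x _; by rewrite mulN1r.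
rewrite nI // in i3; rewrite nI // in i4.
by rewrite -addrA !addr_gt0 // addrC.
Qed.

Lemma edge_bounded F a b c d : (forall z, cdiff F z) ->
  exists2 M : R, 0 <= M & forall z, on_edge a b c d z -> normc (F z) <= M.
Proof.
move=> dF.
have bd (f : R -> R) A B : cont_on A B f ->
    exists2 M : R, 0 <= M & forall x, A <= x <= B -> `|f x| <= M.
  move=> cf.
  have cpt : compact (f @` `[A, B]%classic).
    apply: continuous_compact; last exact: segment_compact.
    apply: continuous_in_subspaceT => x /set_mem; rewrite /= in_itv /=; exact: cf.
  have [M [_ HM]] := compact_bounded cpt.
  exists `|M + 1| => // x hx; apply: le_trans (ler_norm _).
  by apply: HM; [rewrite ltrDl|exists x => //=; rewrite in_itv].
have dE : edge_cdiff F a b c d by move=> z _.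
have [[f1 f2 f3 f4] [g1 g2 g3 g4]] := edge_cdiff_cont dE.
have [M1 _ H1] := bd _ _ _ f1; have [M2 _ H2] := bd _ _ _ f2.
have [M3 _ H3] := bd _ _ _ f3; have [M4 _ H4] := bd _ _ _ f4.
have [M5 _ H5] := bd _ _ _ g1; have [M6 _ H6] := bd _ _ _ g2.
have [M7 _ H7] := bd _ _ _ g3; have [M8 _ H8] := bd _ _ _ g4.
exists (`|M1| + `|M2| + `|M3| + `|M4| + `|M5| + `|M6| + `|M7| + `|M8|).
  by rewrite !addr_ge0.
have n1 := ler_norm M1; have n2 := ler_norm M2; have n3 := ler_norm M3.
have n4 := ler_norm M4; have n5 := ler_norm M5; have n6 := ler_norm M6.
have n7 := ler_norm M7; have n8 := ler_norm M8.
have m1 := normr_ge0 M1; have m2 := normr_ge0 M2; have m3 := normr_ge0 M3.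
have m4 := normr_ge0 M4; have m5 := normr_ge0 M5; have m6 := normr_ge0 M6.
have m7 := normr_ge0 M7; have m8 := normr_ge0 M8.
case=> x y; rewrite /on_edge /= => hz; apply: le_trans (normc_le _) _.
case: hz => -[h [] e]; subst.
- by have := H1 x h; have := H5 x h; rewrite -/(cxy _ _); lra.
- by have := H2 x h; have := H6 x h; rewrite -/(cxy _ _); lra.
- by have := H3 y h; have := H7 y h; rewrite -/(cxy _ _) normrN; lra.
- by have := H4 y h; have := H8 y h; rewrite -/(cxy _ _) normrN; lra.
Qed.

Section VanishNear.
Variables (F : R[i] -> R[i]) (c r : R).
Hypothesis dF : forall z, cdiff F z.
Hypothesis r0 : 0 < r.
Hypothesis F0 : forall t : R, 0 < t -> t < r / 2 -> F (cr (c + t)) = 0.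

Let edge z := on_edge (c - r) (c + r) (- r) r z.
Let I G := cint G (c - r) (c + r) (- r) r.
(** Taylor's formula at [c] in integral form: up to the winding factor, [coef N] is the coefficient
    of order [N] and [(w - c) ^+ N * rem N w] the remainder after [N] terms. *)
Let rem N w := I (fun z => F z * ((z - cr c) ^+ N)^-1 * (z - w)^-1).
Let coef N := I (fun z => F z * ((z - cr c) ^+ N.+1)^-1).

Lemma edge_far z : edge z -> r <= normc (z - cr c).
Proof.
case: z => x y; rewrite /edge /on_edge /= => h.
have [k|k] : r <= `|x - c| \/ r <= `|y| .
- case: h => -[h [] e]; subst; [right|right|left|left].
  + by rewrite normrN gtr0_norm.
  + by rewrite gtr0_norm.
  + by rewrite [c - r]addrC addrK normrN gtr0_norm.
  + by rewrite [c + r]addrC addrK gtr0_norm.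
- exact: le_trans k (cRe_le_normc (Complex (x - c) (y - 0))).
- by have := cIm_le_normc (Complex (x - c) (y - 0)); rewrite /= subr0; exact: le_trans.
Qed.

Lemma edge_far2 z w : edge z -> normc (w - cr c) < r / 2 -> r / 2 <= normc (z - w).
Proof.
move=> /edge_far h1 h2; have := le_normcD (z - w) (w - cr c).
by rewrite subrKA; move: h1 h2; lra.
Qed.

Lemma edge_neq z w : edge z -> normc (w - cr c) < r / 2 -> z - w != 0.
Proof.
by move=> h1 h2; have := edge_far2 h1 h2; apply: contraTneq => ->; rewrite normc0 -ltNge divr_gt0.
Qed.

Let cc : normc (cr c - cr c) < r / 2.
Proof. by rewrite subrr normc0 divr_gt0. Qed.

Lemma cdiff_sub w z : cdiff (fun z => z - w) z.
Proof. by apply: cdiffD; [exact: cdiff_id|exact: cdiff_cst]. Qed.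

Lemma cdiff_coef N z : edge z -> cdiff (fun z => F z * ((z - cr c) ^+ N)^-1) z.
Proof.
move=> h; apply: cdiffM => //; apply: cdiffV; first exact/cdiffX/cdiff_sub.
by rewrite expf_neq0 // (edge_neq h cc).
Qed.

Lemma cdiff_rem N w z : edge z -> normc (w - cr c) < r / 2 ->
  cdiff (fun z => F z * ((z - cr c) ^+ N)^-1 * (z - w)^-1) z.
Proof.
move=> h hw; apply: cdiffM; first exact: cdiff_coef.
by apply: cdiffV; [exact: cdiff_sub|exact: edge_neq h hw].
Qed.

Lemma cint_eq G G' : (forall z, edge z -> G z = G' z) -> I G = I G'.
Proof.
move=> h.
have h1 x : c - r <= x <= c + r -> G (cxy x (- r)) = G' (cxy x (- r)).
  by move=> hx; apply: h; left; split => //; left.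
have h2 x : c - r <= x <= c + r -> G (cxy x r) = G' (cxy x r).
  by move=> hx; apply: h; left; split => //; right.
have h3 y : - r <= y <= r -> G (cxy (c - r) y) = G' (cxy (c - r) y).
  by move=> hx; apply: h; right; split => //; left.
have h4 y : - r <= y <= r -> G (cxy (c + r) y) = G' (cxy (c + r) y).
  by move=> hx; apply: h; right; split => //; right.
rewrite /I /cint /circ; congr Complex.
  by congr (_ + _ - _ - _); apply: itvint_eq => t /[dup] ht; rewrite ?h1 ?h2 ?h3 ?h4.
by congr (_ + _ - _ - _); apply: itvint_eq => t /[dup] ht; rewrite ?h1 ?h2 ?h3 ?h4.
Qed.

Lemma rem_step N w : normc (w - cr c) < r / 2 ->
  rem N w = coef N + (w - cr c) * rem N.+1 w.
Proof.
move=> hw; rewrite /rem /coef /I -cintZ; last by move=> z hz; exact: cdiff_rem.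
rewrite -cintD; first 1 last.
- by move=> z hz; exact: cdiff_coef.
- by move=> z hz; apply: cdiffM; [exact: cdiff_cst|exact: cdiff_rem].
apply: cint_eq => z hz; have n1 := edge_neq hz cc; have n2 := edge_neq hz hw.
have n3 : (z - cr c) ^+ N != 0 by rewrite expf_neq0.
by rewrite exprS; field; rewrite n1 n2 n3.
Qed.

Lemma rem_bound : exists2 C : R, 0 <= C & forall N w, normc (w - cr c) < r / 2 ->
  normc (rem N w) <= C * (r^-1) ^+ N.
Proof.
have [M M0 HM] := edge_bounded (c - r) (c + r) (- r) r dF.
pose L : R := (c + r - (c - r)) + (r - - r).
have L0 : 0 <= L by rewrite /L; move: r0; lra.
exists (4 * (M * (r / 2)^-1) * L).
  by rewrite !mulr_ge0 // invr_ge0 divr_ge0 // ltW.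
move=> N w hw.
have -> : 4 * (M * (r / 2)^-1) * L * r^-1 ^+ N = 4 * (M * r^-1 ^+ N * (r / 2)^-1) * L by ring.
apply: cint_bound; [by move: r0; lra|by move: r0; lra| |].
  by move=> z hz; exact: cdiff_rem.
move=> z hz; rewrite !normcM !normcV normc_expr.
have h1 := edge_far hz; have h2 := edge_far2 hz hw.
apply: ler_pM; rewrite ?mulr_ge0 ?invr_ge0 ?exprn_ge0 ?normc_ge0 //.
  apply: ler_pM => //; rewrite ?invr_ge0 ?exprn_ge0 ?normc_ge0 //; first exact: HM.
  rewrite exprVn lef_pV2 ?posrE ?exprn_gt0 //; last exact: lt_le_trans h1.
  by apply: lerXn2r => //; rewrite ?nnegrE ?normc_ge0 // ltW.
by rewrite lef_pV2 ?posrE ?divr_gt0 //; apply: lt_le_trans h2; rewrite divr_gt0.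
Qed.

Lemma inner_box w : normc (w - cr c) < r / 2 ->
  c - r < cRe w < c + r /\ - r < cIm w < r.
Proof.
move=> hw.
have := le_lt_trans (cRe_le_normc (w - cr c)) hw.
have := le_lt_trans (cIm_le_normc (w - cr c)) hw; move: r0.
case: w {hw} => x y /=; rewrite subr0 !ltr_norml => ? /andP[? ?] /andP[? ?].
by split; apply/andP; split; lra.
Qed.

Lemma rem0 w : normc (w - cr c) < r / 2 ->
  rem 0 w = F w * cint (fun z => (z - w)^-1) (c - r) (c + r) (- r) r.
Proof.
move=> hw.
have [b1 b2] := inner_box hw.
have dW z : edge z -> cdiff (fun z => (z - w)^-1) z.
  by move=> hz; apply: cdiffV; [exact: cdiff_sub|exact: edge_neq hz hw].
apply/eqP; rewrite -subr_eq0 -mulNr -cintZ // -cintD; first 1 last.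
- by move=> z hz; exact: cdiff_rem.
- by move=> z hz; apply: cdiffM; [exact: cdiff_cst|exact: dW].
rewrite -(cauchy dF b1 b2); apply/eqP/cint_eq => z hz.
by rewrite expr0 invr1 mulr1 mulrBl mulNr.
Qed.

Lemma real_ray_in (t : R) : 0 < t -> t < r / 2 -> normc (cr (c + t) - cr c) < r / 2.
Proof.
move=> t0 tr; have -> : cr (c + t) - cr c = cr t.
  by rewrite /cr; apply/eqP; rewrite eq_complex /= addrAC subrr add0r subr0 !eqxx.
by rewrite normc_cr gtr0_norm.
Qed.

(** Induction on the order. If [rem N] vanishes on the ray, then [coef N = - t * rem N.+1 (c + t)]
    is arbitrarily small as [t] tends to 0, hence zero; dividing by [t] then kills [rem N.+1]. *)
Lemma rem_ray N (t : R) : 0 < t -> t < r / 2 -> rem N (cr (c + t)) = 0.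
Proof.
elim: N t => [t t0 tr|N IH t t0 tr].
  by rewrite rem0 ?real_ray_in // F0 // mul0r.
have sub (s : R) : cr (c + s) - cr c = cr s.
  by rewrite /cr; apply/eqP; rewrite eq_complex /= addrAC subrr add0r subr0 !eqxx.
have co : coef N = 0.
  have [C C0 HC] := rem_bound.
  apply: eq0_normc; apply/eqP; rewrite eq_le normc_ge0 andbT.
  apply/ler_addgt0Pr => e e0; rewrite add0r.
  pose B : R := C * r^-1 ^+ N.+1 + 1.
  have B0 : 0 < B by rewrite ltr_wpDl // mulr_ge0 // exprn_ge0 // invr_ge0 ltW.
  pose s := Num.min (r / 4) (e / B).
  have s0 : 0 < s by rewrite lt_min !divr_gt0.
  have sr : s < r / 2.
    have : s <= r / 4 by rewrite ge_min lexx.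
    by move: r0; lra.
  have := rem_step N (real_ray_in s0 sr); rewrite IH // sub => /eqP.
  rewrite eq_sym addr_eq0 => /eqP ->; rewrite normcN normcM normc_cr gtr0_norm //.
  apply: le_trans (_ : s * B <= _).
    apply: ler_wpM2l; first exact: ltW.
    by apply: le_trans (HC N.+1 _ (real_ray_in s0 sr)) _; rewrite lerDl.
  by rewrite -ler_pdivlMr // ge_min lexx orbT.
have := rem_step N (real_ray_in t0 tr); rewrite IH // co add0r sub => /esym/eqP.
rewrite mulf_eq0 => /predU1P[|/eqP//] /(congr1 (@cRe R)) /= t1.
by move: t0; rewrite t1 ltxx.
Qed.

(** All coefficients vanish, so [F w] times the winding integral equals [(w - c) ^+ N * rem N w] for
    every [N], which is at most [C / 2 ^ N]. *)
Lemma vanish_near w : normc (w - cr c) < r / 2 -> F w = 0.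
Proof.
move=> hw; have [C C0 HC] := rem_bound.
have co N : coef N = 0.
  have r4 : 0 < r / 4 by rewrite divr_gt0.
  have r42 : r / 4 < r / 2 by move: r0; lra.
  have := rem_step N (real_ray_in r4 r42); rewrite !rem_ray //.
  by rewrite mulr0 addr0.
have e N : rem 0 w = (w - cr c) ^+ N * rem N w.
  elim: N => [|N ->]; first by rewrite mul1r.
  by rewrite (rem_step N hw) co add0r mulrA exprSr.
have z0 : rem 0 w = 0.
  apply: eq0_normc; apply/eqP; rewrite eq_le normc_ge0 andbT.
  apply/ler_addgt0Pr => d d0; rewrite add0r.
  have [N HN] := half_pow_small C d0.
  rewrite (e N) normcM normc_expr; apply: le_trans (ltW HN).
  apply: le_trans (_ : (r / 2) ^+ N * (C * r^-1 ^+ N) <= _).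
    apply: ler_pM; rewrite ?exprn_ge0 ?normc_ge0 //; last exact: HC.
    by apply: lerXn2r; rewrite ?nnegrE ?normc_ge0 // ltW // divr_gt0.
  by rewrite mulrCA -exprMn (_ : r / 2 * r^-1 = 2^-1) //; field; rewrite gt_eqF.
move: z0; rewrite rem0 // => /eqP; rewrite mulf_eq0 => /orP[/eqP//|].
have [b1 b2] := inner_box hw.
by rewrite (negbTE (winding_neq0 b1 b2)).
Qed.

End VanishNear.

(** As [F] is entire, the square around a point of the ray may be taken so large that [z] lies well
    inside: a single expansion suffices, with no continuation along a chain of discs. *)
Theorem entire_vanish F (x0 : R) : holomorphic F ->
  (forall x : R, x0 < x -> F (cr x) = 0) -> forall z, F z = 0.
Proof.
move=> /holomorphic_cdiff dF F0 z.
pose c := x0 + 1; pose r := 2 * normc (z - cr c) + 1.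
have r0 : 0 < r by rewrite ltr_wpDl // mulr_ge0 // normc_ge0.
apply: (vanish_near (c := c) dF r0).
  by move=> t t0 _; apply: F0; rewrite /c -addrA ltrDl addr_gt0.
rewrite /r mulrDl mulrAC divff // mul1r ltrDl divr_gt0 //.
Qed.

End Cauchy.

(** * Closure properties of entire functions and the exponential *)

Section HolomorphicClosure.
Context {R : realType}.
Implicit Types (F G : R[i] -> R[i]).

Lemma holomorphic_cst (l : R[i]) : holomorphic (fun=> l).
Proof. by apply: cdiff_holomorphic => z; exact: cdiff_cst. Qed.

Lemma holomorphic_id : holomorphic (@id R[i]).
Proof. by apply: cdiff_holomorphic => z; exact: cdiff_id. Qed.

Lemma holomorphicD F G : holomorphic F -> holomorphic G ->
  holomorphic (fun z => F z + G z).
Proof.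
by move=> /holomorphic_cdiff f /holomorphic_cdiff g; apply: cdiff_holomorphic => z; exact: cdiffD.
Qed.

Lemma holomorphicM F G : holomorphic F -> holomorphic G ->
  holomorphic (fun z => F z * G z).
Proof.
by move=> /holomorphic_cdiff f /holomorphic_cdiff g; apply: cdiff_holomorphic => z; exact: cdiffM.
Qed.

Lemma holomorphicB F G : holomorphic F -> holomorphic G ->
  holomorphic (fun z => F z - G z).
Proof.
move=> hF hG; have -> : (fun z => F z - G z) = (fun z => F z + (-1) * G z).
  by apply/funext => z; rewrite mulN1r.
by apply: holomorphicD => //; apply: holomorphicM => //; exact: holomorphic_cst.
Qed.

Lemma holomorphic_prod (I : Type) (s : seq I) (P : pred I) (F : I -> R[i] -> R[i]) :
  (forall i, holomorphic (F i)) -> holomorphic (fun z => \prod_(i <- s | P i) F i z).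
Proof.
move=> hF; elim: s => [|i s IH].
  under eq_fun do rewrite big_nil; exact: holomorphic_cst.
under eq_fun do rewrite big_cons; case: (P i) => //; exact: holomorphicM.
Qed.

Lemma holomorphic_shift F (a : R[i]) : holomorphic F -> holomorphic (fun z => F (z + a)).
Proof.
move=> /holomorphic_cdiff f; apply: cdiff_holomorphic => z.
have [l Hl] := f (z + a); exists l => e /Hl[D D0 HD]; exists D => // h /HD.
by rewrite (addrAC z).
Qed.

Lemma entire_eq F G (x0 : R) : holomorphic F -> holomorphic G ->
  (forall x : R, x0 < x -> F (cr x) = G (cr x)) -> forall z, F z = G z.
Proof.
move=> hF hG e z; apply/eqP; rewrite -subr_eq0; apply/eqP.
apply: (entire_vanish (holomorphicB hF hG) (x0 := x0)) => x hx.
by rewrite e // subrr.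
Qed.

Lemma derive_approx (f : R -> R) (x p : R) : is_derive x 1 f p ->
  forall e : R, 0 < e -> exists2 D : R, 0 < D &
    forall h, `|h| < D -> `|f (x + h) - f x - p * h| <= e * `|h|.
Proof.
move=> [df dp] e e0.
have hc : (fun h : R => h^-1 * (f (h + x) - f x)) @ 0^' --> 'D_1 f x.
  have e1 : (fun h : R => h^-1 * (f (h + x) - f x)) =
      (fun h : R => h^-1 *: ((f \o shift x) (h *: 1) - f x)).
    by apply/funext => h; rewrite /= /GRing.scale /= mulr1.
  by rewrite e1; exact: df.
move: hc; rewrite dp.
move=> /cvgrPdist_le /(_ _ e0) [D /= D0 HD]; exists D => // h hD.
have [->|h0] := eqVneq h 0; first by rewrite addr0 mulr0 !subrr normr0 mulr0.
have := HD h; rewrite /= sub0r normrN => /(_ hD h0).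
have -> : f (x + h) - f x - p * h = - (p - h^-1 * (f (h + x) - f x)) * h.
  by rewrite [h + x]addrC; field.
by rewrite normrM normrN => hh; rewrite ler_wpM2r.
Qed.

Lemma complexM (p q r s : R) :
  Complex p q * Complex r s = Complex (p * r - q * s) (p * s + q * r).
Proof. by []. Qed.

Lemma cexpD (z w : R[i]) : cexp (z + w) = cexp z * cexp w.
Proof.
case: z w => a b [c d]; rewrite /cexp /= expRD cosD sinD.
rewrite complexM; congr Complex; ring.
Qed.

Lemma cexp_cr (x : R) : cexp (cr x) = cr (expR x).
Proof. by rewrite /cexp /= cos0 sin0 mulr1 mulr0. Qed.

Lemma cexp_cdiff z : cdiff (@cexp R) z.
Proof.
exists (cexp z) => e e0.
pose N : R := normc (cexp z); have N0 : 0 <= N by exact: normc_ge0.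
(* The real and imaginary parts of [cexp h - 1 - h] will be at most 3 and 5 times [e' * normc h],
   whence the 8; [normc h < e' <= 1] absorbs the quadratic terms. *)
pose e' : R := Num.min 1 (e / (8 * (N + 1))).
have e'0 : 0 < e' by rewrite lt_min ltr01 divr_gt0 // mulr_gt0 // ltr_wpDl.
have e'1 : e' <= 1 by rewrite ge_min lexx.
have e'N : 8 * (N + 1) * e' <= e.
  by rewrite mulrC -ler_pdivlMr ?ge_min ?lexx ?orbT // mulr_gt0 // ltr_wpDl.
have [D1 D10 H1] := derive_approx (is_derive_expR 0) e'0.
have [D2 D20 H2] := derive_approx (is_derive_cos 0) e'0.
have [D3 D30 H3] := derive_approx (is_derive_sin 0) e'0.
exists (Num.min (Num.min D1 D2) (Num.min D3 e')); first by rewrite 3!lt_min D10 D20 D30 e'0.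
move=> h; rewrite 3!lt_min => /andP[/andP[h1 h2] /andP[h3 h4]].
have -> : cexp (z + h) - cexp z - cexp z * h = cexp z * (cexp h - 1 - h).
  by rewrite cexpD; ring.
rewrite normcM -/N.
case: h h1 h2 h3 h4 => a b; set n : R := normc _ => h1 h2 h3 h4.
have na : `|a| <= n by exact: (cRe_le_normc (Complex a b)).
have nb : `|b| <= n by exact: (cIm_le_normc (Complex a b)).
have := H1 a (le_lt_trans na h1); have := H2 b (le_lt_trans nb h2).
have := H3 b (le_lt_trans nb h3).
rewrite !add0r expR0 cos0 sin0 !mul1r subr0 oppr0 mul0r subr0.
move=> k3 k2 k1.
have n0 : 0 <= n by exact: normc_ge0.
have en : 0 <= e' * n by rewrite mulr_ge0 // ltW.
have k1' : `|expR a - 1 - a| <= e' * n by apply: le_trans k1 _; rewrite ler_pM2l.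
have k2' : `|cos b - 1| <= e' * n by apply: le_trans k2 _; rewrite ler_pM2l.
have k3' : `|sin b - b| <= e' * n by apply: le_trans k3 _; rewrite ler_pM2l.
have a1 : `|1 + a| <= 2.
  by apply: le_trans (ler_normD _ _) _; rewrite normr1; move: na h4 e'1; clear; lra.
have a2 : `|expR a - 1| <= e' * n + n.
  by rewrite -[expR a - 1](subrK a); apply: le_trans (ler_normD _ _) _; exact: lerD.
have cb : `|cos b| <= 1 by rewrite ler_norml cos_geN1 cos_le1.
have sb : `|sin b| <= `|b| + e' * n.
  by rewrite -[sin b](subrK b); apply: le_trans (ler_normD _ _) _; rewrite addrC lerD.
have r1 : `|expR a * cos b - 1 - a| <= 3 * (e' * n).
  have -> : expR a * cos b - 1 - a = (expR a - 1 - a) * cos b + (1 + a) * (cos b - 1).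
    ring.
  apply: le_trans (ler_normD _ _) _; rewrite !normrM.
  have : `|expR a - 1 - a| * `|cos b| <= e' * n * 1 by apply: ler_pM.
  have : `|1 + a| * `|cos b - 1| <= 2 * (e' * n) by apply: ler_pM.
  clear; lra.
have r2 : `|expR a * sin b - b| <= 5 * (e' * n).
  have -> : expR a * sin b - b = (expR a - 1) * sin b + (sin b - b) by ring.
  apply: le_trans (ler_normD _ _) _; rewrite normrM.
  have : `|expR a - 1| * `|sin b| <= (2 * n) * (2 * n).
    have u : e' * n <= n by rewrite -[leRHS]mul1r; exact: ler_wpM2r.
    apply: ler_pM => //; first by move: a2 u; clear; lra.
    by move: sb nb u; clear; lra.
  have : n * n <= e' * n by apply: ler_wpM2r => //; exact: ltW.
  by move: k3'; clear; lra.
apply: le_trans (_ : N * (8 * (e' * n)) <= _).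
  apply: ler_wpM2l => //; apply: le_trans (normc_le _) _.
  by rewrite /cexp /= subr0; move: r1 r2; clear; lra.
rewrite (_ : N * _ = 8 * N * e' * n); last by ring.
apply: ler_wpM2r => //; apply: le_trans e'N; apply: ler_wpM2r; first exact: ltW.
by rewrite ler_pM2l // lerDl.
Qed.

Lemma holomorphic_cexp (l : R[i]) : holomorphic (fun z => cexp (l * z)).
Proof.
apply: cdiff_holomorphic => z.
have [L HL] := cexp_cdiff (l * z); exists (L * l) => e e0.
have N0 : 0 <= normc l := normc_ge0 l.
have e1 : 0 < e / (normc l + 1) by rewrite divr_gt0 // ltr_wpDl.
have [D D0 HD] := HL _ e1.
exists (D / (normc l + 1)); first by rewrite divr_gt0 // ltr_wpDl.
move=> h; rewrite ltr_pdivlMr ?ltr_wpDl // => hD.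
have lh : normc (l * h) <= normc h * (normc l + 1).
  by rewrite normcM mulrC ler_wpM2l ?normc_ge0 // lerDl.
have := HD (l * h) (le_lt_trans lh hD); rewrite mulrDr mulrA => hh.
apply: le_trans hh _.
rewrite mulrAC ler_pdivrMr ?ltr_wpDl // -mulrA ler_pM2l //.
Qed.

End HolomorphicClosure.

(** * Smooth functions on R^n *)

Section Smooth.
Context {R : realType} {n : nat}.
Implicit Types (f g : 'rV[R]_n -> R) (x : 'rV[R]_n) (s t : seq 'I_n).

Definition pd (i : 'I_n) f : 'rV[R]_n -> R := 'D_(delta_mx ord0 i) f.

Lemma pds_rcons s i f : pds (rcons s i) f = pds s (pd i f).
Proof. by rewrite /pds foldr_rcons. Qed.

Lemma pds_cat s t f : pds (s ++ t) f = pds s (pds t f).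
Proof. by rewrite /pds foldr_cat. Qed.

(** A coinduction principle: smoothness follows from membership in any class of differentiable
    functions that is stable under partial derivatives. *)
Lemma smooth_class (S : set ('rV[R]_n -> R)) :
  (forall f, S f -> (forall x, differentiable f x) /\ forall i, S (pd i f)) ->
  forall f, S f -> smooth f.
Proof.
move=> H f Sf s x; suff : S (pds s f) by case/H => + _; exact.
by elim: s => [//|i s IH] /=; case: (H _ IH) => _; exact.
Qed.

Lemma smooth_diff f x : smooth f -> differentiable f x.
Proof. by move=> /(_ [::] x). Qed.

Lemma smooth_derivable f x v : smooth f -> derivable f x v.
Proof. by move=> fs; apply: diff_derivable; exact: smooth_diff. Qed.

Lemma smooth_pds s f : smooth f -> smooth (pds s f).
Proof. by move=> fs t x; rewrite -pds_cat; exact: fs. Qed.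

Lemma smooth_pd i f : smooth f -> smooth (pd i f).
Proof. exact: (@smooth_pds [:: i]). Qed.

Definition smooth1 (F : R -> R) := forall m (x : R), derivable (F^`(m)%classic) x 1.

Lemma smooth1_derive F : smooth1 F -> smooth1 (F^`()%classic).
Proof. by move=> Fs m x; rewrite -derive1Sn; exact: Fs. Qed.

Lemma smooth1_class (S : set (R -> R)) :
  (forall F, S F -> (forall x : R, derivable F x 1) /\ S (F^`()%classic)) ->
  forall F, S F -> smooth1 F.
Proof.
move=> H F SF m x; suff : S (F^`(m)%classic) by case/H => + _; exact.
by elim: m => [//|m IH]; rewrite derive1nS; case: (H _ IH).
Qed.

Lemma pd_comp (F : R -> R) f i x : differentiable f x -> derivable F (f x) 1 ->
  pd i (F \o f) x = F^`()%classic (f x) * pd i f x.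
Proof.
move=> df /derivable1_diffP dF; rewrite /pd deriveE; last exact: differentiable_comp.
rewrite (diff_comp df dF) /= (deriveE _ df); move: ('d f x _) => h.
have -> : 'd F (f x) h = h * 'd F (f x) 1.
  by rewrite [in LHS](_ : h = h *: (1 : R)) ?linearZ // /GRing.scale /= mulr1.
by rewrite -derive1E' // mulrC.
Qed.

Lemma pdD i f g x : differentiable f x -> differentiable g x ->
  pd i (fun x => f x + g x) x = pd i f x + pd i g x.
Proof. by move=> df dg; rewrite /pd [LHS]deriveD //; exact: diff_derivable. Qed.

Lemma pdM i f g x : differentiable f x -> differentiable g x ->
  pd i (fun x => f x * g x) x = pd i f x * g x + f x * pd i g x.
Proof.
move=> df dg; rewrite /pd [LHS]deriveM; [|exact: diff_derivable..].
by rewrite addrC /GRing.scale /= mulrC.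
Qed.

Lemma pd_cst i (c : R) : pd i (fun _ => c) = fun _ => 0.
Proof. by apply/funext => x; rewrite /pd derive_cst. Qed.

Lemma pd_coord i j : pd i (fun x => x ord0 j) = fun _ => (j == i)%:R.
Proof.
apply/funext => x; rewrite /pd /derive.
apply: cvg_lim => //; apply: cvg_near_cst; near=> h.
have h0 : h != 0 by near: h; exact: nbhs_dnbhs_neq.
by rewrite /= !mxE eqxx /= addrK /GRing.scale /= mulKf.
Unshelve. all: by end_near.
Qed.

(** The derivative of a product or of a composite is a sum of products, so the closure properties of
    smoothness are proved together: the class generated by all the operations is stable under
    [pd]. *)
Inductive sfun : ('rV[R]_n -> R) -> Prop :=
| sfun_base f : smooth f -> sfun f
| sfun_cst c : sfun (fun _ => c)
| sfun_coord i : sfun (fun x => x ord0 i)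
| sfunD f g : sfun f -> sfun g -> sfun (fun x => f x + g x)
| sfunM f g : sfun f -> sfun g -> sfun (fun x => f x * g x)
| sfun_comp F f : smooth1 F -> sfun f -> sfun (F \o f).

Lemma sfun_diff f x : sfun f -> differentiable f x.
Proof.
move=> h; elim: h x => {f} [f fs|c|i|f g _ df _ dg|f g _ df _ dg|F f Fs _ df] x.
- exact: smooth_diff.
- exact: differentiable_cst.
- exact: differentiable_coord.
- exact: (differentiableD (df x) (dg x)).
- exact: (differentiableM (df x) (dg x)).
- by apply: differentiable_comp => //; apply/derivable1_diffP; exact: (Fs 0%N).
Qed.

Lemma sfun_pd i f : sfun f -> sfun (pd i f).
Proof.
elim=> {f} [f fs|c|j|f g sf df sg dg|f g sf df sg dg|F f Fs sf df].
- by apply: sfun_base; exact: smooth_pd.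
- by rewrite pd_cst; exact: sfun_cst.
- by rewrite pd_coord; exact: sfun_cst.
- rewrite (_ : pd _ _ = fun x => pd i f x + pd i g x); first exact: sfunD.
  by apply/funext => x; rewrite pdD //; exact: sfun_diff.
- rewrite (_ : pd _ _ = fun x => pd i f x * g x + f x * pd i g x).
    by apply: sfunD; exact: sfunM.
  by apply/funext => x; rewrite pdM //; exact: sfun_diff.
- rewrite (_ : pd _ _ = fun x => (F^`()%classic \o f) x * pd i f x).
    by apply: sfunM => //; apply: sfun_comp => //; exact: smooth1_derive.
  apply/funext => x; rewrite pd_comp //; first exact: sfun_diff.
  exact: (Fs 0%N).
Qed.

Lemma sfun_smooth f : sfun f -> smooth f.
Proof.
apply: (smooth_class (S := sfun)) => {}f sf.
by split=> [x|i]; [exact: sfun_diff|exact: sfun_pd].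
Qed.

Lemma smooth_cst c : smooth (fun _ : 'rV[R]_n => c).
Proof. by apply: sfun_smooth; exact: sfun_cst. Qed.

Lemma smooth_coord i : smooth (fun x : 'rV[R]_n => x ord0 i).
Proof. by apply: sfun_smooth; exact: sfun_coord. Qed.

Lemma smoothD f g : smooth f -> smooth g -> smooth (fun x => f x + g x).
Proof. by move=> fs gs; apply: sfun_smooth; apply: sfunD; exact: sfun_base. Qed.

Lemma smoothM f g : smooth f -> smooth g -> smooth (fun x => f x * g x).
Proof. by move=> fs gs; apply: sfun_smooth; apply: sfunM; exact: sfun_base. Qed.

Lemma smooth_comp F f : smooth1 F -> smooth f -> smooth (fun x => F (f x)).
Proof. by move=> Fs fs; apply: sfun_smooth; apply: sfun_comp => //; exact: sfun_base. Qed.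

Lemma smooth_prod (I : Type) (r : seq I) (P : pred I) (f : I -> 'rV[R]_n -> R) :
  (forall i, P i -> smooth (f i)) -> smooth (fun x => \prod_(i <- r | P i) f i x).
Proof.
move=> h; elim: r => [|a r IH].
  by under eq_fun do rewrite big_nil; exact: smooth_cst.
case Pa : (P a); under eq_fun do rewrite big_cons Pa; last exact: IH.
by apply: smoothM => //; exact: h.
Qed.

Lemma smooth_sum (I : Type) (r : seq I) (P : pred I) (f : I -> 'rV[R]_n -> R) :
  (forall i, P i -> smooth (f i)) -> smooth (fun x => \sum_(i <- r | P i) f i x).
Proof.
move=> h; elim: r => [|a r IH].
  by under eq_fun do rewrite big_nil; exact: smooth_cst.
case Pa : (P a); under eq_fun do rewrite big_cons Pa; last exact: IH.
by apply: smoothD => //; exact: h.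
Qed.

Lemma pdsD s f g x : smooth f -> smooth g ->
  pds s (fun x => f x + g x) x = pds s f x + pds s g x.
Proof.
elim/last_ind: s f g => [//|s i IH] f g fs gs; rewrite !pds_rcons.
rewrite (_ : pd i _ = fun x => pd i f x + pd i g x); first by apply: IH; exact: smooth_pd.
by apply/funext => y; rewrite pdD //; exact: smooth_diff.
Qed.

Lemma pdsZ s (c : R) f x : smooth f -> pds s (fun x => c * f x) x = c * pds s f x.
Proof.
elim/last_ind: s f => [//|s i IH] f fs; rewrite !pds_rcons.
rewrite (_ : pd i _ = fun x => c * pd i f x); first by apply: IH; exact: smooth_pd.
apply/funext => y; rewrite pdM ?pd_cst ?mul0r ?add0r //; last exact: smooth_diff.
Qed.

(** The Leibniz rule has [2 ^ size s] terms. The bound is pointwise: [A] and [B] may depend on [x],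
    so growth and decay can be inserted later. *)
Lemma pds_prod_bound s f g x (A B : R) : smooth f -> smooth g -> 0 <= A -> 0 <= B ->
  (forall t, (size t <= size s)%N -> `|pds t f x| <= A) ->
  (forall t, (size t <= size s)%N -> `|pds t g x| <= B) ->
  `|pds s (fun x => f x * g x) x| <= 2 ^+ size s * (A * B).
Proof.
move=> fs gs A0 B0; elim/last_ind: s f g fs gs => [|s i IH] f g fs gs hA hB.
  rewrite /= expr0 mul1r normrM; apply: ler_pM => //; [exact: (hA [::])|exact: (hB [::])].
rewrite pds_rcons (_ : pd i _ = fun x => pd i f x * g x + f x * pd i g x); last first.
  by apply/funext => y; rewrite pdM //; exact: smooth_diff.
rewrite pdsD; [|by apply: smoothM => //; exact: smooth_pd..].
rewrite size_rcons exprS -mulrA mulr_natl mulr2n.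
apply: le_trans (ler_normD _ _) _; rewrite size_rcons in hA hB.
by apply: lerD; apply: IH => // [|t ts|t ts]; rewrite -?pds_rcons; (exact: smooth_pd||apply: hA||apply: hB);
  rewrite ?size_rcons //; exact: leqW.
Qed.

Lemma pds_local (U : set 'rV[R]_n) s f g : open U -> (forall x, U x -> f x = g x) ->
  forall x, U x -> pds s f x = pds s g x.
Proof.
move=> oU fg; elim: s => [//|i s IH] x Ux /=.
by apply: near_eq_derive; near=> y; apply: IH; near: y; exact: open_nbhs_nbhs.
Unshelve. all: by end_near.
Qed.

Lemma pds_zero (U : set 'rV[R]_n) s f : open U -> (forall x, U x -> f x = 0) ->
  forall x, U x -> pds s f x = 0.
Proof.
move=> oU f0 x Ux; rewrite (pds_local s oU (g := fun _ => 0)) // => {Ux}.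
elim/last_ind: s => [//|s i IH]; rewrite pds_rcons pd_cst //.
Qed.

(** A derivative in direction [i] brings out a factor [e]; one in another direction gives 0, hence
    an inequality. *)
Lemma pds_affine s (c e : R) i (F : R -> R) x : smooth1 F ->
  `|pds s (fun x => F (c + e * x ord0 i)) x| <=
  `|e| ^+ size s * `|F^`(size s)%classic (c + e * x ord0 i)|.
Proof.
move=> Fs; have sa : smooth (fun x : 'rV[R]_n => c + e * x ord0 i).
  by apply: smoothD; [exact: smooth_cst|apply: smoothM; [exact: smooth_cst|exact: smooth_coord]].
elim/last_ind: s F Fs => [|s j IH] F Fs; first by rewrite mul1r.
rewrite pds_rcons size_rcons derive1Sn exprS -mulrA.
rewrite (_ : pd j _ = fun x => (e * (i == j)%:R) * F^`()%classic (c + e * x ord0 i)).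
  rewrite pdsZ; last by apply: smooth_comp => //; exact: smooth1_derive.
  rewrite normrM; apply: ler_pM => //; last by apply: IH; exact: smooth1_derive.
  by rewrite normrM ler_piMr //; case: (i == j); rewrite ?normr1 // normr0.
apply/funext => y; rewrite (pd_comp (f := fun x => c + e * x ord0 i)); last exact: (Fs 0%N).
  rewrite pdD; [|exact: smooth_diff (smooth_cst _)|]; last first.
    by apply: smooth_diff; apply: smoothM; [exact: smooth_cst|exact: smooth_coord].
  rewrite pdM; [|exact: smooth_diff (smooth_cst _)|exact: smooth_diff (smooth_coord _)].
  by rewrite !pd_cst pd_coord mul0r !add0r mulrC.
exact: smooth_diff.
Qed.

Lemma pd_scale (c : R) i f y : smooth f -> pd i (fun x => f (c *: x)) y = c * pd i f (c *: y).
Proof.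
move=> fs; have dl : differentiable (fun x : 'rV[R]_n => c *: x) y by exact: differentiableZ.
rewrite /pd deriveE; last exact: (differentiable_comp dl (smooth_diff _ fs)).
rewrite (diff_comp dl (smooth_diff _ fs)) /=.
have -> : 'd (fun x : 'rV[R]_n => c *: x) y (delta_mx ord0 i) = c *: delta_mx ord0 i.
  by rewrite -deriveE // [LHS]deriveZ // derive_id.
by rewrite linearZ /= deriveE //; exact: smooth_diff.
Qed.

Lemma smooth_scale (c : R) f : smooth f -> smooth (fun x => f (c *: x)).
Proof.
move=> fs; pose S : set ('rV[R]_n -> R) := [set h | exists a g, smooth g /\ h = fun x => a * g (c *: x)].
have dl g (y : 'rV[R]_n) : smooth g -> differentiable (fun x => g (c *: x)) y.
  move=> gs; have dl : differentiable (fun x : 'rV[R]_n => c *: x) y by exact: differentiableZ.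
  exact: (differentiable_comp dl (smooth_diff _ gs)).
apply: (smooth_class (S := S)); last first.
  by exists 1, f; split => //; apply/funext => x; rewrite mul1r.
move=> _ [a [g [gs ->]]]; split=> [x|i].
  by apply: (differentiableM (differentiable_cst a x)); exact: dl.
exists (a * c), (pd i g); split; first exact: smooth_pd.
by apply/funext => x; rewrite pdM ?pd_cst ?mul0r ?add0r ?pd_scale ?mulrA //; exact: dl.
Qed.

Lemma pds_scale s (c : R) f x : smooth f ->
  pds s (fun x => f (c *: x)) x = c ^+ size s * pds s f (c *: x).
Proof.
elim/last_ind: s f => [|s i IH] f fs; first by rewrite expr0 mul1r.
rewrite pds_rcons (_ : pd i _ = fun x => c * pd i f (c *: x)); last first.
  by apply/funext => y; rewrite pd_scale.
rewrite pdsZ; last by apply: smooth_scale; exact: smooth_pd.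
by rewrite IH ?size_rcons ?exprS ?mulrA ?pds_rcons //; exact: smooth_pd.
Qed.

End Smooth.

(** * Lebesgue measure on R^n *)

Section BorelRn.
Context {R : realType} {n : nat}.
Implicit Types (a b : 'rV[R]_n).

Definition cbox a b : set (RnB R n) :=
  [set x : RnB R n | forall i, a ord0 i <= x ord0 i <= b ord0 i].

Lemma open_RnB_measurable (U : set 'rV[R]_n) : open U -> measurable (U : set (RnB R n)).
Proof. by move=> oU; exact: sub_sigma_algebra. Qed.

Lemma continuous_RnB_measurable (f : 'rV[R]_n -> R) : continuous f ->
  measurable_fun setT (f : RnB R n -> R).
Proof.
move=> cf; apply: (measurability _ (RGenOInfty.measurableE R)).
move=> _ [_ [a ->] <-]; rewrite setTI; apply: open_RnB_measurable.
by move/continuousP: cf; apply; exact: interval_open.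
Qed.

Lemma coord_measurable (i : 'I_n) : measurable_fun setT (fun x : RnB R n => x ord0 i).
Proof. by apply: continuous_RnB_measurable; exact: coord_continuous. Qed.

Lemma coord_set_measurable (P : 'I_n -> set R) : (forall i, measurable (P i)) ->
  measurable [set x : RnB R n | forall i, P i (x ord0 i)].
Proof.
move=> mP.
have -> : [set x : RnB R n | forall i, P i (x ord0 i)] =
    \bigcap_(i in [set: 'I_n]) ((fun x : RnB R n => x ord0 i) @^-1` (P i)).
  by apply/seteqP; split => x /= h i => [_|]; exact: h.
apply: fin_bigcap_measurable => // i _.
by rewrite -[X in measurable X]setTI; apply: coord_measurable.
Qed.

Lemma cbox_measurable a b : measurable (cbox a b).
Proof.
have -> : cbox a b =
    [set x : RnB R n | forall i, `[a ord0 i, b ord0 i]%classic (x ord0 i)].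
  by apply/seteqP; split => x h i; have := h i; rewrite /= in_itv.
apply: (coord_set_measurable (P := fun i => `[a ord0 i, b ord0 i]%classic)) => i.
exact: measurable_itv.
Qed.

Lemma orthant_measurable : measurable (@Rplus_n R n).
Proof.
have -> : @Rplus_n R n = [set x : RnB R n | forall i, `]0, +oo[%classic (x ord0 i)].
  by apply/seteqP; split => x h i; have := h i; rewrite /= in_itv /= andbT.
apply: (coord_set_measurable (P := fun=> `]0, +oo[%classic)) => i.
exact: measurable_itv.
Qed.

Definition cboxes : set (set (RnB R n)) := [set A | exists a b, A = cbox a b].

(** An open set is the union of the countably many rational boxes that it contains. *)
Lemma open_cboxes (U : set 'rV[R]_n) : open U -> <<s cboxes >> U.
Proof.
move=> oU.
pose B (q : 'rV[rat]_n * 'rV[rat]_n) :=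
  cbox (map_mx (@ratr R) q.1) (map_mx (@ratr R) q.2).
pose good q := `[< B q `<=` U >].
pose A (m : nat) : set (RnB R n) := if unpickle m is Some q then
  (if good q then B q else set0) else set0.
have -> : U = \bigcup_m A m.
  apply/seteqP; split => x; last first.
    move=> [m _]; rewrite /A; case: unpickle => // q; rewrite /good.
    by case: asboolP => // h /h.
  move=> Ux; have := oU _ Ux; rewrite -nbhs_ballE => -[e /= e0 xU].
  have H (i : 'I_n) : exists q : rat * rat, x ord0 i - e < ratr q.1 < x ord0 i /\
     x ord0 i < ratr q.2 < x ord0 i + e.
    have /rat_in_itvoo[q1 h1] : x ord0 i - e < x ord0 i by rewrite ltrBlDr ltrDl.
    have /rat_in_itvoo[q2 h2] : x ord0 i < x ord0 i + e by rewrite ltrDl.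
    by exists (q1, q2); move: h1 h2; rewrite !in_itv.
  have [f Hf] := choice H.
  pose q : 'rV[rat]_n * 'rV[rat]_n := (\row_i (f i).1, \row_i (f i).2).
  have Bx : B q x.
    by move=> i; rewrite !mxE; have [/andP[_ /ltW->] /andP[/ltW-> _]] := Hf i.
  exists (pickle q) => //; rewrite /A pickleK /good; case: asboolP => // -[] y By.
  apply: xU; split => // i j; rewrite ord1.
  have := By j; rewrite !mxE => /andP[y1 y2].
  have [/andP[q1 _] /andP[_ q2]] := Hf j.
  rewrite /ball /= ltr_distl; apply/andP; split.
    by rewrite ltrBlDr (le_lt_trans y2 q2) // .
  by rewrite -ltrBlDr (lt_le_trans q1 y1).
apply: sigma_algebra_bigcup => m; rewrite /A.
case: unpickle => [q|]; last exact: sigma_algebra0.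
case: ifP => _; last exact: sigma_algebra0.
by apply: sub_sigma_algebra; exists (map_mx (@ratr R) q.1), (map_mx (@ratr R) q.2).
Qed.

Lemma RnB_cboxes : @measurable _ (RnB R n) = <<s cboxes >>.
Proof.
apply/seteqP; split.
  apply: smallest_sub; first exact: smallest_sigma_algebra.
  by move=> U oU; exact: open_cboxes.
apply: smallest_sub; first exact: sigma_algebra_measurable.
by move=> _ [a [b ->]]; exact: cbox_measurable.
Qed.

Lemma cboxes_setI : setI_closed cboxes.
Proof.
move=> _ _ [a [b ->]] [a' [b' ->]].
exists (\row_i Num.max (a ord0 i) (a' ord0 i)), (\row_i Num.min (b ord0 i) (b' ord0 i)).
apply/seteqP; split => x.
  by move=> [h1 h2] i; rewrite !mxE ge_max le_min; move: (h1 i) (h2 i) => /andP[-> ->] /andP[-> ->].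
by move=> h; split => i; have := h i; rewrite !mxE ge_max le_min => /andP[/andP[? ?] /andP[? ?]];
  apply/andP.
Qed.

Definition full_cover (m : nat) : set (RnB R n) := cbox (const_mx (- m%:R)) (const_mx m%:R).

Lemma full_coverE : \bigcup_m full_cover m = [set: RnB R n].
Proof.
apply/seteqP; split => // x _.
exists (Num.truncn `|x|).+1 => // i; rewrite !mxE -ler_norml.
apply: le_trans (ltW (truncnS_gt _)); rewrite /Num.Def.normr /=.
rewrite mx_normrE; exact: (le_bigmax _ (fun ij => `|x ij.1 ij.2|) (ord0, i)).
Qed.

End BorelRn.

Section LebesgueRn.
Context {R : realType} {n : nat}.
Variable lam : {measure set (RnB R n) -> \bar R}.
Hypothesis hlam : is_lebesgue_Rn lam.
Implicit Types (a b s : 'rV[R]_n) (sg : 'S_n).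

Lemma cbox_lam a b : (forall i, a ord0 i <= b ord0 i) ->
  lam (cbox a b) = (\prod_(i < n) (b ord0 i - a ord0 i))%:E.
Proof. exact: hlam. Qed.

(** Boxes are stable under intersection and generate the Borel sets, so their measures determine a
    measure. The constant [c] leaves room for a Jacobian. *)
Lemma lam_unique (m : {measure set (RnB R n) -> \bar R}) (c : {nonneg R}) :
  (forall a b, (forall i, a ord0 i <= b ord0 i) ->
    m (cbox a b) = (c%:num%:E * lam (cbox a b))%E) ->
  forall A, measurable A -> m A = (c%:num%:E * lam A)%E.
Proof.
move=> H A mA.
apply: (measure_unique cboxes full_cover RnB_cboxes cboxes_setI _ full_coverE
  m (mscale c lam)) => //.
- by move=> i; exists (const_mx (- i%:R)), (const_mx i%:R).
- move=> _ [a [b ->]]; rewrite /mscale /=.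
  have [h|] := pselect (forall i, a ord0 i <= b ord0 i); first exact: H.
  move=> /existsNP[i /negP]; rewrite -ltNge => ba.
  have -> : cbox a b = set0.
    by apply/seteqP; split => x // /(_ i) /andP[h1 h2]; have := le_lt_trans (le_trans h1 h2) ba; rewrite ltxx.
  by rewrite !measure0.
- move=> k; rewrite H.
    by rewrite /full_cover cbox_lam -?EFinM ?ltry // => i; rewrite !mxE ge0_cp.
  by move=> i; rewrite !mxE (@le_trans _ _ 0) // oppr_le0.
Qed.

(** Dilations and permutations of coordinates send boxes to boxes, so their Jacobian follows from
    the defining property of [lam]. *)
Definition gmap s sg (x : RnB R n) : RnB R n := \row_i (s ord0 i * x ord0 (sg i)).

Lemma gmap_cbox s sg a b : (forall i, 0 < s ord0 i) ->
  gmap s sg @^-1` cbox a b = cbox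
    (\row_j ((s ord0 (sg^-1%g j))^-1 * a ord0 (sg^-1%g j)))
    (\row_j ((s ord0 (sg^-1%g j))^-1 * b ord0 (sg^-1%g j))).
Proof.
move=> s0; apply/seteqP; split => x h i.
  have := h (sg^-1%g i); rewrite !mxE permKV => /andP[h1 h2].
  by rewrite ler_pdivrMl // ler_pdivlMl // h1.
have := h (sg i); rewrite !mxE permK => /andP[h1 h2].
by rewrite ler_pdivrMl // in h1; rewrite ler_pdivlMl // in h2; apply/andP.
Qed.

Lemma gmap_measurable s sg : (forall i, 0 < s ord0 i) -> measurable_fun setT (gmap s sg).
Proof.
move=> s0; apply: (measurability _ RnB_cboxes).
move=> _ [_ [a [b ->]] <-]; rewrite setTI gmap_cbox //; exact: cbox_measurable.
Qed.

Lemma gmap_lam s sg (A : set (RnB R n)) : (forall i, 0 < s ord0 i) -> measurable A ->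
  lam (gmap s sg @^-1` A) = (((\prod_i s ord0 i)^-1)%:E * lam A)%E.
Proof.
move=> s0 mA.
have c0 : 0 <= (\prod_i s ord0 i)^-1 by rewrite invr_ge0 prodr_ge0 // => i _; rewrite ltW.
have mg := gmap_measurable sg s0.
pose m0 := (pushforward lam (gmap s sg) : {measure set (RnB R n) -> \bar R}).
pose m := m0 mg.
have := @lam_unique m (NngNum c0).
apply => //= a b ab; rewrite /m /pushforward /= gmap_cbox // !cbox_lam //; last first.
  by move=> i; rewrite !mxE ler_pM2l ?invr_gt0.
rewrite -EFinM; congr EFin; rewrite -prodfV -big_split /=.
rewrite (reindex_inj (@perm_inj _ sg)) /=; apply: eq_bigr => i _.
by rewrite !mxE permK mulrBr.
Qed.

Lemma gmap_integral_ge0 s sg (D : set (RnB R n)) (f : RnB R n -> \bar R) :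
  (forall i, 0 < s ord0 i) -> measurable D -> measurable_fun D f ->
  (forall x, D x -> (0 <= f x)%E) ->
  (\int[lam]_(x in gmap s sg @^-1` D) f (gmap s sg x))%E =
   (((\prod_i s ord0 i)^-1)%:E * \int[lam]_(x in D) f x)%E.
Proof.
move=> s0 mD mf f0.
have c0 : 0 <= (\prod_i s ord0 i)^-1 by rewrite invr_ge0 prodr_ge0 // => i _; rewrite ltW.
have mg := gmap_measurable sg s0.
rewrite -[LHS](ge0_integral_pushforward mg) //; last by move=> x /set_mem; exact: f0.

rewrite -[X in (X * _)%E]/((NngNum c0)%:num%:E) -(ge0_integral_mscale lam mD (NngNum c0) mf) //.
by apply: eq_measure_integral => A mA _; exact: gmap_lam.
Qed.

Lemma gmap_Rintegral s sg (D : set (RnB R n)) (f : RnB R n -> R) :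
  (forall i, 0 < s ord0 i) -> measurable D -> lam.-integrable D (EFin \o f) ->
  lam.-integrable (gmap s sg @^-1` D) (EFin \o (f \o gmap s sg)) /\
  Rintegral lam (gmap s sg @^-1` D) (fun x => f (gmap s sg x)) =
  (\prod_i s ord0 i)^-1 * Rintegral lam D f.
Proof.
move=> s0 mD fi; have mf := measurable_int lam fi.
have mg := gmap_measurable sg s0.
have mgD : measurable (gmap s sg @^-1` D) by rewrite -[X in measurable X]setTI; exact: mg.
have c0 : 0 <= (\prod_i s ord0 i)^-1 by rewrite invr_ge0 prodr_ge0 // => i _; rewrite ltW.
have key (h : RnB R n -> R) : measurable_fun D h -> (forall x, 0 <= h x) ->
    lam.-integrable D (EFin \o h) ->
    lam.-integrable (gmap s sg @^-1` D) (EFin \o (h \o gmap s sg)) /\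
    Rintegral lam (gmap s sg @^-1` D) (fun x => h (gmap s sg x)) =
    (\prod_i s ord0 i)^-1 * Rintegral lam D h.
  move=> mh h0 hi.
  have e := gmap_integral_ge0 sg (f := EFin \o h) s0 mD.
  have {}e := e (proj2 (measurable_EFinP _ _) mh) (fun x _ => h0 x).
  split.
    apply/integrableP; split.
      apply/measurable_EFinP; apply: (@measurable_comp _ _ _ _ _ _ D) => //.
        by move=> _ [x Dx <-].
      by apply: measurable_funS mg.
    under eq_integral do rewrite gee0_abs ?lee_fin ?h0 //.
    rewrite e; apply: lte_mul_pinfty; rewrite ?lee_fin //.
    by move/integrableP : hi => [_]; under eq_integral do rewrite gee0_abs ?lee_fin ?h0 //.
  rewrite /Rintegral e fineM //; exact: integrable_fin_num.
have mf' : measurable_fun D f by exact/measurable_EFinP.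
pose fp x := Num.max (f x) 0; pose fn x := Num.max (- f x) 0.
have fE x : f x = fp x - fn x.
  rewrite /fp /fn; case: (leP 0 (f x)) => h.
    by rewrite max_r ?oppr_le0 // subr0.
  by rewrite max_l ?oppr_ge0 ?ltW // opprK add0r.
have mfp : measurable_fun D fp by apply: measurable_maxr.
have mfn : measurable_fun D fn by apply: measurable_maxr => //; exact: measurableT_comp.
have ip : lam.-integrable D (EFin \o fp).
  apply: le_integrable fi => //; first exact/measurable_EFinP.
  move=> x _ /=; rewrite lee_fin /fp; case: (leP (f x) 0) => h //; by rewrite normr0.
have in_ : lam.-integrable D (EFin \o fn).
  apply: le_integrable fi => //; first exact/measurable_EFinP.
  move=> x _ /=; rewrite lee_fin /fn; case: (leP (- f x) 0) => h; by rewrite ?normr0 ?normrN.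
have [p1 p2] := key fp mfp (fun x => ltac:(by rewrite le_max lexx orbT)) ip.
have [n1 n2] := key fn mfn (fun x => ltac:(by rewrite le_max lexx orbT)) in_.
have fcE : (fun x => f (gmap s sg x)) = (fun x => fp (gmap s sg x) - fn (gmap s sg x)).
  by apply/funext => x; rewrite fE.
split.
  have -> : EFin \o (f \o gmap s sg) =
     (fun x => (EFin \o (fp \o gmap s sg)) x - (EFin \o (fn \o gmap s sg)) x)%E.
    by apply/funext => x /=; rewrite fE.
  exact: integrableB.
rewrite fcE RintegralB // p2 n2 -mulrBr -RintegralB //.
by congr (_ * _); apply: eq_Rintegral => x _; exact/esym/fE.
Qed.

Lemma geom_sum_bound (q : R) (L : nat) : 0 <= q -> q < 1 ->
  \sum_(l < L) q ^+ l <= (1 - q)^-1.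
Proof.
move=> q0 q1; have p : 0 < 1 - q by rewrite subr_gt0.
rewrite -(ler_pM2l p) divff ?gt_eqF //.
have -> : (1 - q) * \sum_(l < L) q ^+ l = 1 - q ^+ L.
  by rewrite -opprB mulNr -subrX1 opprB.
by rewrite lerBlDr lerDl exprn_ge0.
Qed.

(** * Integrability of product functions over the orthant *)

Section Dyadic.
Variables (C d : R) (h : 'I_n -> R -> R).
Hypothesis (C0 : 0 <= C) (d0 : 0 < d).
Hypothesis mh : forall i, measurable_fun setT (h i).
Hypothesis h0 : forall i (t : R), 0 < t -> 0 <= h i t.
Hypothesis hb : forall i (t : R), 0 < t -> t * h i t <= C * Num.min (t `^ d) (t `^ (- d)).

(** [lam] is given by its values on boxes, so a product function is compared with a step function on
    dyadic boxes; distributivity turns the sum over boxes into the [n]-th power of a one-dimensional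
    sum. The dyadic points are [2 ^ (l - L)] for [l] up to [2 L]. *)
Let u L l : R := 2 ^+ l / 2 ^+ L.
Let q : R := 2 `^ (- d).
(** The exponent is the distance of [l] and [L], written with truncated differences: geometric decay
    on both sides of [t = 1], which is the point of index [L]. *)
Let B L l := C * 2 `^ d * q ^+ ((l - L) + (L - l))%N.

Lemma dyadic_u0 L l : 0 < u L l.
Proof. by rewrite /u divr_gt0 // exprn_gt0. Qed.

Lemma dyadic_q01 : 0 <= q < 1.
Proof.
rewrite powR_ge0 /q powRN invf_lt1 ?powR_gt0 //=.
have e : 1 `^ d = 1 :> R by rewrite powR1.
by rewrite -[ltLHS]e; apply: gt0_ltr_powR => //; rewrite ?nnegrE ?ltr1n.
Qed.

Lemma dyadic_u_pow L l : (u L l) `^ d = q ^- l * q ^+ L.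
Proof.
have p2 m : 0 <= (2 : R) ^+ m by exact: exprn_ge0.
have qi : q^-1 = 2 `^ d by rewrite /q powRN invrK.
have e m : (2 ^+ m : R) `^ d = q ^- m.
  rewrite -[2 ^+ m](@powR_mulrn R 2 m) // -powRrM mulrC powRrM powR_mulrn ?powR_ge0 //.
  by rewrite -qi exprVn.
have V (a : R) : 0 <= a -> (a^-1) `^ d = (a `^ d)^-1.
  move=> a0; rewrite -[a^-1](powR_inv1 a0) -powRrM mulrC powRrM.
  by rewrite (powR_inv1 (powR_ge0 _ _)).
rewrite /u powRM //.
by rewrite V // !e invrK.
Qed.

Lemma dyadic_cell_bound i L l (t : R) : u L l <= t <= 2 * u L l ->
  h i t <= (u L l)^-1 * B L l.
Proof.
move=> /andP[t1 t2]; have u0 := dyadic_u0 L l; have t0 := lt_le_trans u0 t1.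
have [q0 q1] := andP dyadic_q01.
have qp : 0 < q by rewrite powR_gt0.
rewrite ler_pdivlMl //; apply: le_trans (_ : t * h i t <= _).
  by rewrite ler_wpM2r // h0.
apply: le_trans (hb i t0) _; rewrite /B -mulrA ler_wpM2l //.
have [lL|Ll] := leqP l L.
  have -> : (l - L + (L - l) = L - l)%N by lia.
  rewrite ge_min; apply/orP; left.
  apply: le_trans (_ : (2 * u L l) `^ d <= _).
    by apply: ge0_ler_powR; rewrite ?nnegrE ?mulr_ge0 ?(ltW u0) ?(ltW t0) ?(ltW d0).
  rewrite powRM ?(ltW u0) // dyadic_u_pow mulrC.
  by rewrite -{1}(subnK lL) exprD mulrCA mulVf ?mulr1 ?expf_neq0 ?gt_eqF // mulrC.
have -> : (l - L + (L - l) = l - L)%N by lia.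
rewrite ge_min; apply/orP; right.
have p1 : (1 : R) <= 2 `^ d.
  have [_] := andP dyadic_q01; rewrite /q powRN invf_lt1 ?powR_gt0 //; exact: ltW.
apply: le_trans (_ : q ^+ (l - L) <= _); last first.
  by rewrite -[leLHS]mul1r ler_wpM2r ?exprn_ge0.
rewrite powRN.
have -> : q ^+ (l - L) = ((u L l) `^ d)^-1.
  rewrite dyadic_u_pow invfM invrK -{2}(subnK (ltnW Ll)) exprD -mulrA mulfV ?mulr1 //.
  by rewrite expf_neq0 // gt_eqF.
rewrite lef_pV2 ?posrE ?powR_gt0 //.
by apply: ge0_ler_powR; rewrite ?nnegrE ?(ltW u0) ?(ltW t0) ?(ltW d0).
Qed.

Lemma dyadic_sum L : \sum_(l < L + L) B L l <= C * 2 `^ d * (2 * (1 - q)^-1).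
Proof.
have [q0 q1] := andP dyadic_q01.
rewrite -mulr_sumr ler_wpM2l ?mulr_ge0 ?powR_ge0 // big_split_ord /=.
rewrite mulr_natl mulr2n; apply: lerD.
  apply: le_trans (geom_sum_bound L q0 q1).
  rewrite (reindex_inj rev_ord_inj) /=; apply: ler_sum => i _.
  have -> : (L - i.+1 - L + (L - (L - i.+1)) = i.+1)%N by have := ltn_ord i; lia.
  by rewrite exprS -[leRHS]mul1r ler_wpM2r ?exprn_ge0 // ltW.
apply: le_trans (geom_sum_bound L q0 q1); apply: ler_sum => i _.
by have -> : (L + i - L + (L - (L + i)) = i)%N by lia.
Qed.

Lemma dyadic_cover L m (t : R) : u L 0 <= t -> t <= u L m.+1 ->
  exists2 l, (l <= m)%N & u L l <= t <= 2 * u L l.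
Proof.
have uS l : u L l.+1 = 2 * u L l by rewrite /u exprS mulrA.
elim: m => [h1 h2|m IH h1 h2]; first by exists 0%N => //; rewrite h1 -uS.
have [k|k] := leP t (u L m.+1); first by have [l lm hl] := IH h1 k; exists l => //; exact: leqW.
by exists m.+1 => //; rewrite (ltW k) -uS.
Qed.

Let K L : set (RnB R n) := cbox (const_mx (u L 0)) (const_mx (u L (L + L))).
Let cell L (f : {ffun 'I_n -> 'I_(L + L)}) : set (RnB R n) :=
  cbox (\row_i u L (f i)) (\row_i (2 * u L (f i))).

Lemma dyadic_Kpos L x i : K L x -> 0 < x ord0 i.
Proof.
by move=> /(_ i); rewrite !mxE => /andP[+ _]; apply: lt_le_trans; exact: dyadic_u0.
Qed.

Lemma dyadic_measurable D : measurable_fun D (fun x : RnB R n => \prod_i h i (x ord0 i)).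
Proof.
apply: measurable_funTS; apply: measurable_prod => i _.
by apply: measurableT_comp => //; exact: coord_measurable.
Qed.

Lemma dyadic_K_integral L' :
  (\int[lam]_(x in K L'.+1) (\prod_i h i (x ord0 i))%:E <=
   ((C * 2 `^ d * (2 * (1 - q)^-1)) ^+ n)%:E)%E.
Proof.
pose L := L'.+1; rewrite -/L; have [q0 q1] := andP dyadic_q01.
pose c (f : {ffun 'I_n -> 'I_(L + L)}) : R := \prod_i ((u L (f i))^-1 * B L (f i)).
have B0 l : 0 <= B L l by rewrite /B !mulr_ge0 ?powR_ge0 ?exprn_ge0.
have c0 f : 0 <= c f.
  by apply: prodr_ge0 => i _; rewrite mulr_ge0 // invr_ge0 ltW // dyadic_u0.
have mcell f : measurable (cell f) by exact: cbox_measurable.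
have mind f D : measurable_fun D (fun x => (c f * \1_(cell f) x)%:E).
  by apply/measurable_EFinP; apply: measurable_funM => //; exact: measurable_indic.
apply: (@le_trans _ _ (\int[lam]_(x in K L)
   (\sum_(f : {ffun 'I_n -> 'I_(L + L)}) (c f * \1_(cell f) x)%:E))%E).
  apply: ge0_le_integral => //.
  - exact: cbox_measurable.
  - by move=> x Kx; rewrite lee_fin prodr_ge0 // => i _; rewrite h0 // (dyadic_Kpos i Kx).
  - by apply/measurable_EFinP; exact: dyadic_measurable.
  - by apply: emeasurable_sum => f.
  move=> x Kx.
  have H i : exists l : 'I_(L + L), u L l <= x ord0 i <= 2 * u L l.
    have := Kx i; rewrite !mxE => /andP[h1 h2].
    have [l lm hl] := @dyadic_cover L (L' + L)%N _ h1 h2.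
    have lt : (l < L + L)%N by rewrite /L addSn ltnS.
    by exists (Ordinal lt).
  have [f Hf] := choice H.
  rewrite (bigD1 [ffun i => f i]) //= -[leLHS]adde0; apply: leeD; last first.
    by apply: sume_ge0 => g _; rewrite lee_fin mulr_ge0.
  rewrite lee_fin indicE mem_set ?mulr1; last by move=> i; rewrite !mxE ffunE.
  apply: ler_prod => i _; rewrite ffunE h0 ?(dyadic_Kpos i Kx) //=.
  exact: dyadic_cell_bound.
rewrite ge0_integral_sum //; first last.
- by move=> f x _; rewrite lee_fin mulr_ge0.
- exact: cbox_measurable.
apply: (@le_trans _ _ (\sum_(f : {ffun 'I_n -> 'I_(L + L)}) (\prod_i B L (f i))%:E)%E).
  apply: lee_sum => f _.
  under eq_integral do rewrite EFinM.
  rewrite ge0_integralZl //; first 1 last.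
  - exact: cbox_measurable.
  - by apply/measurable_EFinP; exact: measurable_indic.
  - by rewrite lee_fin.
  rewrite integral_indic //; last exact: cbox_measurable.
  apply: (@le_trans _ _ ((c f)%:E * lam (cell f))%E).
    apply: lee_wpmul2l; first by rewrite lee_fin.
    apply: le_measure; first by apply/mem_set/measurableI; [exact: mcell|exact: cbox_measurable].
      by apply/mem_set; exact: mcell.
    by move=> x [].
  rewrite cbox_lam; last first.
    by move=> i; rewrite !mxE ler_peMl ?(ltW (dyadic_u0 _ _)) // ler1n.
  rewrite -EFinM lee_fin /c -big_split /=; apply: ler_prod => i _.
  rewrite !mxE; have u0 := dyadic_u0 L (f i).
  have -> : (u L (f i))^-1 * B L (f i) * (2 * u L (f i) - u L (f i)) = B L (f i).
    by field; rewrite gt_eqF.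
  by rewrite B0 lexx.
rewrite sumEFin lee_fin.
have -> : \sum_(f : {ffun 'I_n -> 'I_(L + L)}) \prod_i B L (f i) = (\sum_(l < L + L) B L l) ^+ n.
  rewrite -[in RHS](card_ord n) -prodr_const.
  by rewrite (bigA_distr_bigA (fun (i : 'I_n) (l : 'I_(L + L)) => B L l)).
apply: lerXn2r; rewrite ?nnegrE ?sumr_ge0 //; last exact: dyadic_sum.
by rewrite !mulr_ge0 ?powR_ge0 // invr_ge0 subr_ge0 ltW.
Qed.

(** The boxes [K L.+1] increase to the orthant and the bound on them does not depend on [L]. *)
Lemma orthant_product_integrable :
  lam.-integrable (@Rplus_n R n) (fun x => (\prod_i h i (x ord0 i))%:E).
Proof.
have [q0 q1] := andP dyadic_q01.
have mK L : measurable (K L) by exact: cbox_measurable.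
have ndK : nondecreasing_seq (fun L => K L.+1).
  apply/nondecreasing_seqP => L; rewrite subsetEset => x Kx i.
  have := Kx i; rewrite !mxE /u => /andP[h1 h2]; apply/andP; split.
    apply: le_trans h1; rewrite ler_pM2l ?exprn_gt0 // lef_pV2 ?posrE ?exprn_gt0 //.
    by rewrite ler_eXn2l ?ltr1n.
  have e M : 2 ^+ (M + M)%N / 2 ^+ M = 2 ^+ M :> R by rewrite exprD mulfK // expf_neq0.
  by apply: le_trans h2 _; rewrite !e ler_eXn2l ?ltr1n.
have cover : \bigcup_L (K L.+1) = @Rplus_n R n.
  apply/seteqP; split => x; first by move=> [L _ Kx] i; exact: dyadic_Kpos Kx.
  move=> xO.
  have arch (t : R) : exists N, t < 2 ^+ N.
    exists (Num.truncn t).+1; apply: lt_trans (truncnS_gt _) _.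
    by rewrite -natrX ltr_nat ltn_expl.
  have arch1 (f : 'I_n -> R) : exists N, forall i, f i < 2 ^+ N.
    have [N HN] := choice (fun i => arch (f i)).
    exists (\max_i N i) => i; apply: lt_le_trans (HN i) _.
    by rewrite ler_eXn2l ?ltr1n // leq_bigmax.
  have [N1 H1] := arch1 (fun i => x ord0 i); have [N2 H2] := arch1 (fun i => (x ord0 i)^-1).
  exists (N1 + N2)%N => // i; rewrite !mxE /u expr0 mul1r; apply/andP; split.
    have xi : 0 < x ord0 i by exact: xO.
    rewrite -[leRHS]invrK lef_pV2 ?posrE ?exprn_gt0 ?invr_gt0 //.
    by apply: le_trans (ltW (H2 i)) _; rewrite ler_eXn2l ?ltr1n // leqW // leq_addl.
  rewrite exprD mulfK ?expf_neq0 //.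
  by apply: le_trans (ltW (H1 i)) _; rewrite ler_eXn2l ?ltr1n // leqW // leq_addr.
have hO x : @Rplus_n R n x -> 0 <= \prod_i h i (x ord0 i).
  by move=> xO; apply: prodr_ge0 => i _; exact: h0.
apply/integrableP; split; first by apply/measurable_EFinP; exact: dyadic_measurable.
apply: (@le_lt_trans _ _ ((C * 2 `^ d * (2 * (1 - q)^-1)) ^+ n)%:E); last exact: ltry.
rewrite -cover.
have := @ge0_nondecreasing_set_cvg_integral _ _ _ (fun L => K L.+1)
  (fun x => `|(\prod_i h i (x ord0 i))%:E|)%E lam ndK (fun L => mK L.+1).
have mabs L : measurable_fun (K L.+1) (fun x => `|(\prod_i h i (x ord0 i))%:E|)%E.
  by apply/measurableT_comp => //; apply/measurable_EFinP; exact: dyadic_measurable.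
move=> /(_ mabs (fun L x _ => abse_ge0 _)) cv.
rewrite -(cvg_lim _ cv) //; apply: lime_le; first by apply/cvg_ex; eexists; exact: cv.
apply: nearW => L /=; apply: le_trans (dyadic_K_integral L).
rewrite le_eqVlt; apply/orP; left; apply/eqP/eq_integral => x /set_mem Kx; rewrite ger0_norm // prodr_ge0 // => i _.
by rewrite h0 // (dyadic_Kpos i Kx).
Qed.

End Dyadic.

End LebesgueRn.

(** * Gamma weights times Vandermonde powers: integrability and moment identities *)

Section Growth.
Context {R : realType}.

(** From [1 + s <= expR s] at [s = c t / m], raised to the power [m]. *)
Lemma pow_expR_bound (N : nat) (c : R) : 0 < c ->
  exists2 C : R, 0 < C & forall t, 0 <= t -> (1 + t) ^+ N * expR (- (c * t)) <= C.
Proof.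
move=> c0; case: N => [|N].
  exists 1 => // t t0; by rewrite mul1r -expR0 ler_expR oppr_le0 mulr_ge0 // ltW.
pose m : R := N.+1%:R; have m0 : 0 < m by rewrite ltr0n.
pose K : R := Num.max 1 (m / c).
have K1 : 1 <= K by rewrite le_max lexx.
have K0 : 0 < K by exact: lt_le_trans K1.
exists (K ^+ N.+1); first by rewrite exprn_gt0.
move=> t t0; have h : 1 + t <= K * expR (c * t / m).
  apply: le_trans (_ : K * (1 + c * t / m) <= _).
    rewrite mulrDr mulr1 lerD //.
    have : m / c * (c * t / m) = t by field; rewrite !gt_eqF.
    move=> {1}<-; rewrite ler_wpM2r ?le_max ?lexx ?orbT //.
    by rewrite divr_ge0 ?mulr_ge0 // ltW.
  by rewrite ler_pM2l // expR_ge1Dx.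
have h2 : (1 + t) ^+ N.+1 <= K ^+ N.+1 * expR (c * t).
  have -> : expR (c * t) = expR (c * t / m) ^+ N.+1.
    by rewrite -expRM_natl -/m; congr expR; field; rewrite gt_eqF.
  rewrite -exprMn; apply: lerXn2r => //; rewrite nnegrE ?addr_ge0 //.
  by rewrite mulr_ge0 ?expR_ge0 // ltW.
by rewrite expRN ler_pdivrMr ?expR_gt0.
Qed.

Lemma powR_expR_bound (p c : R) : 0 <= p -> 0 < c ->
  exists2 C : R, 0 < C & forall t, 0 <= t -> t `^ p * expR (- (c * t)) <= C.
Proof.
move=> p0 c0; pose N := (Num.truncn p).+1.
have pN : p <= N%:R by exact/ltW/truncnS_gt.
have [C C0 HC] := pow_expR_bound N c0; exists C => // t t0.
apply: le_trans (HC t t0); rewrite ler_wpM2r ?expR_ge0 //.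
rewrite -powR_mulrn ?addr_ge0 //.
apply: le_trans (_ : (1 + t) `^ p <= _).
  by apply: ge0_ler_powR; rewrite ?nnegrE ?addr_ge0 // lerDr.
by apply: ler_powR => //; rewrite lerDl.
Qed.

Lemma min_powR_mono (d d' t : R) : 0 < d -> d <= d' -> 0 < t ->
  Num.min (t `^ d') (t `^ (- d')) <= Num.min (t `^ d) (t `^ (- d)).
Proof.
move=> d0 dd t0; have d'0 := lt_le_trans d0 dd.
have [t1|t1] := leP t 1.
  have h : t `^ d' <= t `^ d by apply: ger_powR => //; rewrite t0.
  have h2 : t `^ d <= t `^ (- d).
    by apply: ger_powR; rewrite ?t0 //; apply: le_trans (ltW d0); rewrite oppr_le0 ltW.
  by rewrite ge_min !le_min (le_trans h h2) h.
have t1' := ltW t1.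
have h : t `^ (- d') <= t `^ (- d) by apply: ler_powR => //; rewrite lerN2.
have h2 : t `^ (- d) <= t `^ d.
  by apply: ler_powR => //; apply: le_trans (ltW d0); rewrite oppr_le0 ltW.
by rewrite ge_min !le_min (le_trans h h2) h orbT.
Qed.

(* The two-sided bound required for summability over dyadic cells. *)
Lemma gamma_density_bound (a c : R) : -1 < a -> 0 < c ->
  exists2 C : R, 0 <= C & forall d, 0 < d -> d <= a + 1 ->
  forall t, 0 < t -> t * (t `^ a * expR (- (c * t))) <= C * Num.min (t `^ d) (t `^ (- d)).
Proof.
move=> a1 c0; have d0 : 0 < a + 1 by rewrite -ltrBlDr sub0r.
have [C C0 HC] := powR_expR_bound (ltW (addr_gt0 d0 d0)) c0.
have M1 : 1 <= Num.max 1 C by rewrite le_max lexx.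
exists (Num.max 1 C); first exact: le_trans M1.
move=> d dp da t t0; rewrite mulrA.
apply: le_trans (_ : Num.max 1 C * Num.min (t `^ (a + 1)) (t `^ (- (a + 1))) <= _); last first.
  by rewrite ler_wpM2l ?min_powR_mono // (le_trans _ M1).
have -> : t * t `^ a = t `^ (a + 1).
  by rewrite powRD ?(gt_eqF t0) ?implybT // powRr1 ?ltW // mulrC.
have e1 : expR (- (c * t)) <= 1 by rewrite -expR0 ler_expR oppr_le0 mulr_ge0 // ltW.
rewrite minr_pMr ?le_min; last by rewrite (le_trans _ M1).
apply/andP; split.
  rewrite [leRHS]mulrC ler_wpM2l ?powR_ge0 //.
  exact: le_trans e1 M1.
have p0 : 0 < t `^ (a + 1) by exact: powR_gt0.
rewrite powRN ler_pdivlMr // mulrAC -powRD; last by rewrite (gt_eqF t0) implybT.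
by apply: le_trans (HC t (ltW t0)) _; rewrite le_max lexx orbT.
Qed.

End Growth.

Section MeasurableCond.
Context d (T : measurableType d) (R : realType) (I : eqType) (s : seq I) (P : pred I).
Implicit Types (h : I -> T -> R).

Lemma measurable_prod_cond D h : (forall i, P i -> measurable_fun D (h i)) ->
  measurable_fun D (fun x => \prod_(i <- s | P i) h i x).
Proof.
move=> mh; under eq_fun do rewrite big_mkcond.
have key i : measurable_fun D (fun x => if P i then h i x else 1).
  by case: (boolP (P i)) => [/mh|_]; [exact|exact: measurable_cst].
by apply: (@measurable_prod _ _ _ _ _ s (fun i x => if P i then h i x else 1)).
Qed.

Lemma measurable_sum_cond D h : (forall i, P i -> measurable_fun D (h i)) ->
  measurable_fun D (fun x => \sum_(i <- s | P i) h i x).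
Proof.
move=> mh; under eq_fun do rewrite big_mkcond.
have key i : measurable_fun D (fun x => if P i then h i x else 0).
  by case: (boolP (P i)) => [/mh|_]; [exact|exact: measurable_cst].
by apply: (@measurable_sum _ _ _ _ _ s (fun i x => if P i then h i x else 0)).
Qed.

End MeasurableCond.

Section GammaWeight.
Context {R : realType} {n : nat}.
Variable lam : {measure set (RnB R n) -> \bar R}.
Hypothesis hlam : is_lebesgue_Rn lam.
Variables (E : rel 'I_n) (k : R).
Hypothesis (E_sym : symmetric E) (E_irr : irreflexive E) (k0 : 0 < k).
Implicit Types (dl m : 'I_n -> R) (e : R) (x : RnB R n).

Definition orth := @Rplus_n R n.

Definition p1 x : R := \sum_i x ord0 i.

Definition gam dl m x : R := \prod_i (x ord0 i `^ dl i * expR (- (m i * x ord0 i))).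

(** The product runs over ordered pairs, so each factor occurs twice and [e = 0] gives
    [|x_i - x_j| ^ (2 k)]; [e > 0] makes the weight smooth across the diagonals. The relation [E]
    will be all pairs for the orthant and the pairs inside a face for the face measures. *)
Definition vdm e x : R :=
  \prod_i \prod_(j | E i j) ((x ord0 i - x ord0 j) ^+ 2 + e) `^ (k / 2).

Definition wt dl m e x := gam dl m x * vdm e x.

Lemma gam_ge0 dl m x : 0 <= gam dl m x.
Proof. by apply: prodr_ge0 => i _; rewrite mulr_ge0 ?powR_ge0 ?expR_ge0. Qed.

Lemma vdm_ge0 e x : 0 <= vdm e x.
Proof. by do 2 apply: prodr_ge0 => ? _; exact: powR_ge0. Qed.

Lemma wt_ge0 dl m e x : 0 <= wt dl m e x.
Proof. by rewrite mulr_ge0 ?gam_ge0 ?vdm_ge0. Qed.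

Lemma gam_measurable dl m : measurable_fun setT (gam dl m).
Proof.
apply: measurable_prod => i _; apply: measurable_funM.
  exact: measurableT_comp (measurable_powR _) (coord_measurable i).
do 2 apply: measurableT_comp => //; apply: measurable_funM => //; exact: coord_measurable.
Qed.

Lemma vdm_measurable e : measurable_fun setT (vdm e).
Proof.
apply: measurable_prod => i _; apply: measurable_prod_cond => j _.
apply: measurableT_comp (measurable_powR _) _.
apply: measurable_funD => //; apply: measurable_funX.
by apply: measurable_funB; exact: coord_measurable.
Qed.

Lemma wt_measurable dl m e : measurable_fun setT (wt dl m e).
Proof. by apply: measurable_funM; [exact: gam_measurable|exact: vdm_measurable]. Qed.

Lemma p1_measurable : measurable_fun setT p1.
Proof. by apply: measurable_sum => i; exact: coord_measurable. Qed.

Lemma p1_ge0 x : orth x -> 0 <= p1 x.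
Proof. by move=> h; apply: sumr_ge0 => i _; exact/ltW/h. Qed.

Lemma coord_le_p1 x i : orth x -> x ord0 i <= p1 x.
Proof. by move=> h; rewrite /p1 (bigD1 i) //= lerDl sumr_ge0 // => j _; exact/ltW/h. Qed.

Lemma gam_integrable dl m : (forall i, -1 < dl i) -> (forall i, 0 < m i) ->
  lam.-integrable orth (EFin \o gam dl m).
Proof.
move=> d1 m0.
have H i : exists C : R, 0 <= C /\ forall d, 0 < d -> d <= dl i + 1 -> forall t, 0 < t ->
   t * (t `^ dl i * expR (- (m i * t))) <= C * Num.min (t `^ d) (t `^ (- d)).
  by have [C C0 HC] := gamma_density_bound (d1 i) (m0 i); exists C; split => //; exact: HC.
have [C HC] := choice H.
pose d : R := \big[Num.min/1]_i (dl i + 1).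
have d0 : 0 < d.
  rewrite /d; elim/big_ind: _ => // [a b a0 b0|i _]; first by rewrite lt_min a0.
  by rewrite -ltrBlDr sub0r.
apply: (@orthant_product_integrable _ _ lam hlam (\sum_i C i) d
  (fun i t => t `^ dl i * expR (- (m i * t)))) => //.
- by apply: sumr_ge0 => i _; have [] := HC i.
- move=> i; apply: measurable_funM; first exact: measurable_powR.
  by do 2 apply: measurableT_comp => //; exact: measurable_funM.
- by move=> i t _; rewrite mulr_ge0 ?powR_ge0 ?expR_ge0.
move=> i t t0; have [_ HCi] := HC i.
apply: le_trans (HCi d d0 (bigmin_le_cond _ _ _) t t0) _ => //.
apply: ler_wpM2r; first by rewrite le_min !powR_ge0.
by rewrite (bigD1 i) //= lerDl sumr_ge0 // => j _; have [] := HC j.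
Qed.

Lemma vdm_bound : exists K : nat, forall e x, orth x -> 0 <= e -> e <= 1 ->
  vdm e x <= (1 + p1 x) ^+ K.
Proof.
pose K0 := (Num.truncn k).+1; exists ((K0 * n) * n)%N => e x xO e0 e1.
have P0 := p1_ge0 xO; set P := p1 x in P0 *.
have P1 : 1 <= 1 + P by rewrite lerDl.
have A1 (m : nat) : 1 <= (1 + P) ^+ m by rewrite exprn_ege1.
have b i j : ((x ord0 i - x ord0 j) ^+ 2 + e) `^ (k / 2) <= (1 + P) ^+ K0.
  apply: le_trans (_ : ((1 + P) ^+ 2) `^ (k / 2) <= _).
    apply: ge0_ler_powR; rewrite ?nnegrE ?addr_ge0 ?sqr_ge0 ?exprn_ge0 ?divr_ge0 ?(ltW k0) //.
    apply: le_trans (_ : P ^+ 2 + 1 <= _); last by rewrite sqrrD expr1n; nra.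
    apply: lerD => //; rewrite -real_normK ?num_real //; apply: lerXn2r; rewrite ?nnegrE //.
    have x1 := coord_le_p1 i xO; have x2 := coord_le_p1 j xO.
    have y1 := ltW (xO i); have y2 := ltW (xO j).
    by rewrite ler_norml; move: x1 x2 y1 y2; rewrite -/P; clear; move=> *; apply/andP; split; lra.
  rewrite -powR_mulrn ?addr_ge0 // -powRrM mulrC divfK // -powR_mulrn ?addr_ge0 //.
  by apply: ler_powR => //; exact/ltW/truncnS_gt.
apply: le_trans (_ : \prod_(i < n) ((1 + P) ^+ (K0 * n)) <= _); last first.
  by rewrite prodr_const card_ord -exprM.
apply: ler_prod => i _; rewrite prodr_ge0 /= => [|j _]; last exact: powR_ge0.
apply: le_trans (_ : \prod_(j < n) ((1 + P) ^+ K0) <= _); last first.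
  by rewrite prodr_const card_ord -exprM.
rewrite big_mkcond; apply: ler_prod => j _; case: ifP => _; rewrite ?ler01 ?A1 //=.
by rewrite powR_ge0 b.
Qed.

(** Half of each exponential pays for the polynomial factors, uniformly in [e]. The majorants for
    the differentiation along dilations and for the limit [e -> 0] both come from here. *)
Lemma wt_dom N dl m : (forall i, 0 < m i) ->
  exists C : R, 0 <= C /\ forall e x, orth x -> 0 <= e -> e <= 1 ->
    (1 + p1 x) ^+ N * wt dl m e x <= C * gam dl (fun i => m i / 2) x.
Proof.
move=> m0; have [K HK] := vdm_bound.
pose c : R := \big[Num.min/1]_i (m i / 2).
have c0 : 0 < c.
  rewrite /c; elim/big_ind: _ => // [a b a0 b0|i _]; first by rewrite lt_min a0.
  by rewrite divr_gt0.
have [C C0 HC] := pow_expR_bound (N + K) c0; exists C; split; first exact: ltW.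
move=> e x xO e0 e1; have P0 := p1_ge0 xO.
have -> : (1 + p1 x) ^+ N * wt dl m e x = gam dl m x * ((1 + p1 x) ^+ N * vdm e x).
  by rewrite /wt mulrCA.
have gE : gam dl m x = gam dl (fun i => m i / 2) x * expR (- \sum_i (m i / 2 * x ord0 i)).
  rewrite -sumrN expR_sum /gam -big_split /=; apply: eq_bigr => i _.
  by rewrite -[RHS]mulrA -expRD; congr (_ * expR _); field.
have le1 : expR (- \sum_i (m i / 2 * x ord0 i)) <= expR (- (c * p1 x)).
  rewrite ler_expR lerN2 /p1 mulr_sumr; apply: ler_sum => i _.
  by apply: ler_wpM2r; [exact/ltW/xO|exact: bigmin_le_cond].
rewrite gE -mulrA mulrC; apply: ler_wpM2r; first exact: gam_ge0.
apply: le_trans (HC _ P0); rewrite mulrC exprD.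
apply: ler_pM; rewrite ?expR_ge0 ?mulr_ge0 ?exprn_ge0 ?addr_ge0 ?vdm_ge0 //.
by apply: ler_wpM2l; [rewrite exprn_ge0 ?addr_ge0|exact: HK].
Qed.

Lemma wt_integrable N dl m e (f : RnB R n -> R) (C : R) : (forall i, -1 < dl i) -> (forall i, 0 < m i) ->
  0 <= e -> e <= 1 -> measurable_fun setT f ->
  (forall x, orth x -> `|f x| <= C * (1 + p1 x) ^+ N) ->
  lam.-integrable orth (EFin \o (fun x => f x * wt dl m e x)).
Proof.
move=> d1 m0 e0 e1 mf hf; have [D [D0 HD]] := wt_dom N dl m0.
have m20 i : 0 < m i / 2 by rewrite divr_gt0.
have := @integrableZl _ _ _ lam orth orthant_measurable (`|C| * D) _ (gam_integrable d1 m20).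
apply: le_integrable; first exact: orthant_measurable.
  apply/measurable_EFinP; apply: measurable_funTS; apply: measurable_funM => //.
  exact: wt_measurable.
move=> x xO; rewrite lee_fin /= normrM (ger0_norm (wt_ge0 _ _ _ _)).
rewrite [leRHS]ger0_norm ?mulr_ge0 ?gam_ge0 //.
apply: le_trans (_ : `|C| * (1 + p1 x) ^+ N * wt dl m e x <= _).
  apply: ler_wpM2r; first exact: wt_ge0.
  apply: le_trans (hf x xO) _; rewrite ler_wpM2r ?ler_norm // exprn_ge0 // addr_ge0 //.
  exact: p1_ge0.
by rewrite -!mulrA; apply: ler_wpM2l => //; exact: HD.
Qed.

(** The logarithm of the weight: products become sums, which are differentiated term by term. *)
Definition lwt dl m e x : R :=
  \sum_i (dl i * ln (x ord0 i) - m i * x ord0 i) +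
  k / 2 * \sum_i \sum_j (if E i j then ln ((x ord0 i - x ord0 j) ^+ 2 + e) else 0).

Lemma wt_expR dl m e x : orth x -> 0 < e -> wt dl m e x = expR (lwt dl m e x).
Proof.
move=> xO e0; rewrite /lwt expRD; congr (_ * _).
  rewrite expR_sum; apply: eq_bigr => i _.
  by rewrite /powR gt_eqF ?xO // -expRD.
rewrite mulr_sumr expR_sum; apply: eq_bigr => i _.
rewrite mulr_sumr expR_sum big_mkcond; apply: eq_bigr => j _.
case: ifP => _; last by rewrite mulr0 expR0.
by rewrite /powR gt_eqF // ltr_wpDl ?sqr_ge0.
Qed.

Lemma wt_integrable1 dl m e : (forall i, -1 < dl i) -> (forall i, 0 < m i) ->
  0 <= e -> e <= 1 -> lam.-integrable orth (EFin \o wt dl m e).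
Proof.
move=> d1 m0 e0 e1; have e' : wt dl m e = (fun x => cst 1 x * wt dl m e x).
  by apply/funext => x; rewrite mul1r.
rewrite e'; apply: (@wt_integrable 0 _ _ _ _ 1) => // x _.
by rewrite normr1 expr0 mulr1.
Qed.

Section Scaling.
Variable i0 : 'I_n.

Definition sc (s : R) x : RnB R n := \row_i (if i == i0 then s * x ord0 i else x ord0 i).

Lemma sc_gmap (s : R) : sc s = gmap (\row_i (if i == i0 then s else 1)) 1%g.
Proof.
by apply/funext => x; apply/rowP => i; rewrite !mxE perm1; case: ifP; rewrite ?mul1r.
Qed.

Lemma sc_orth (s : R) x : 0 < s -> (orth (sc s x)) = orth x.
Proof.
move=> s0; apply/propext; split => h i; have := h i; rewrite !mxE; case: ifP => //.
  by rewrite pmulr_rgt0.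
by move=> _ xi; rewrite mulr_gt0.
Qed.

Lemma sc_prod (s : R) : \prod_i (\row_i (if i == i0 then s else 1) : 'rV[R]_n) ord0 i = s.
Proof.
rewrite (bigD1 i0) //= mxE eqxx big1 ?mulr1 // => i /negbTE ii.
by rewrite mxE ii.
Qed.

Let dc x i : R := if i == i0 then x ord0 i else 0.

Definition dlwt dl m e (s : R) x : R :=
  \sum_i (dl i * (dc x i / (sc s x) ord0 i) - m i * dc x i) +
  k / 2 * \sum_i \sum_j (if E i j then
     2 * ((sc s x) ord0 i - (sc s x) ord0 j) * (dc x i - dc x j) /
       (((sc s x) ord0 i - (sc s x) ord0 j) ^+ 2 + e) else 0).

Lemma is_derive_eqf (f g : R -> R) (x a b : R) : is_derive x 1 f a -> (forall y, f y = g y) ->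
  a = b -> is_derive x 1 g b.
Proof. by move=> d fg <-; have <- : f = g by apply/funext. Qed.

Lemma sc_derive (s : R) x i : is_derive s 1 (fun s => (sc s x) ord0 i) (dc x i).
Proof.
have [e|e] := boolP (i == i0).
  apply: (is_derive_eqf (f := fun s => s * x ord0 i)) => [y|].
    by rewrite mxE e.
  by rewrite /dc e /GRing.scale /=; ring.
apply: (is_derive_eqf (f := cst (x ord0 i))) => [y|].
  by rewrite mxE (negbTE e).
by rewrite /dc (negbTE e).
Qed.

Lemma sum_derive (f : 'I_n -> R -> R) (df : 'I_n -> R) (s : R) :
  (forall i, is_derive s 1 (f i) (df i)) ->
  is_derive s 1 (fun s => \sum_i f i s) (\sum_i df i).
Proof.
by move=> h; apply: (is_derive_eqf (f := \sum_i f i)) => // y; rewrite fct_sumE.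
Qed.

Lemma lwt_derive dl m e (s : R) x : orth x -> 0 < e -> 0 < s ->
  is_derive s 1 (fun s => lwt dl m e (sc s x)) (dlwt dl m e s x).
Proof.
move=> xO e0 s0; have scO : orth (sc s x) by rewrite sc_orth.
have lnD (f : R -> R) (a : R) : 0 < f s -> is_derive s 1 f a ->
    is_derive s 1 (fun t => ln (f t)) (a / f s).
  move=> f0 df; have dl1 := is_derive1_ln f0.
  have h := is_derive1_comp dl1 df.
  by apply: (is_derive_eqf h) => //; rewrite mulrC.
have ZD (f : R -> R) (a c : R) : is_derive s 1 f a -> is_derive s 1 (fun t => c * f t) (c * a).
  by move=> df; have h := is_deriveZ c df; apply: (is_derive_eqf h).
have h1 : is_derive s 1 (fun s => \sum_i (dl i * ln ((sc s x) ord0 i) - m i * (sc s x) ord0 i))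
    (\sum_i (dl i * (dc x i / (sc s x) ord0 i) - m i * dc x i)).
  apply: sum_derive => i; apply: is_deriveB; apply: ZD; last exact: sc_derive.
  by apply: (lnD (fun s => (sc s x) ord0 i)); [exact: scO|exact: sc_derive].
have h2 : is_derive s 1 (fun s => k / 2 * \sum_i \sum_j (if E i j then
      ln (((sc s x) ord0 i - (sc s x) ord0 j) ^+ 2 + e) else 0))
    (k / 2 * \sum_i \sum_j (if E i j then
     2 * ((sc s x) ord0 i - (sc s x) ord0 j) * (dc x i - dc x j) /
       (((sc s x) ord0 i - (sc s x) ord0 j) ^+ 2 + e) else 0)).
  apply: ZD; apply: sum_derive => i; apply: sum_derive => j.
  case: ifP => _; last exact: is_derive_cst.
  have dd : is_derive s 1 (fun s => (sc s x) ord0 i - (sc s x) ord0 j) (dc x i - dc x j).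
    by apply: is_deriveB; exact: sc_derive.
  apply: (lnD (fun s => ((sc s x) ord0 i - (sc s x) ord0 j) ^+ 2 + e)).
    by rewrite ltr_wpDl ?sqr_ge0.
  have := is_deriveD (is_deriveX 2 dd) (is_derive_cst e s 1).
  by move=> h; apply: (is_derive_eqf h) => //; rewrite addr0 /GRing.scale /= expr1.
exact: is_deriveD h1 h2.
Qed.

(** The two orientations of a pair containing [i0] contribute equally because [T] is antisymmetric;
    this turns the exponent [k / 2] of each ordered factor into [2 * k]. *)
Lemma dlwt1 dl m e x : orth x -> dlwt dl m e 1 x = dl i0 - m i0 * x ord0 i0 +
  2 * k * \sum_(j | E i0 j) x ord0 i0 * (x ord0 i0 - x ord0 j) / ((x ord0 i0 - x ord0 j) ^+ 2 + e).
Proof.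
move=> xO; rewrite /dlwt; congr (_ + _).
  rewrite (bigD1 i0) //= big1; last first.
    by move=> i /negbTE ii; rewrite /dc ii mul0r !mulr0 subrr.
  by rewrite /dc !mxE eqxx mul1r divff ?gt_eqF ?xO // mulr1 addr0.
have sc1 i : (sc 1 x) ord0 i = x ord0 i by rewrite mxE mul1r if_same.
pose T i j := if E i j then (x ord0 i - x ord0 j) / ((x ord0 i - x ord0 j) ^+ 2 + e) else 0.
have Tanti i j : T j i = - T i j.
  rewrite /T E_sym; case: ifP => _; last by rewrite oppr0.
  by rewrite -opprB sqrrN mulNr.
have e1 : \sum_i \sum_j (if E i j then
     2 * ((sc 1 x) ord0 i - (sc 1 x) ord0 j) * (dc x i - dc x j) /
       (((sc 1 x) ord0 i - (sc 1 x) ord0 j) ^+ 2 + e) else 0) =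
   2 * \sum_i \sum_j dc x i * T i j + 2 * \sum_i \sum_j dc x i * T i j.
  have -> : \sum_i \sum_j dc x i * T i j = \sum_i \sum_j - (dc x j * T i j) :> R.
    rewrite exchange_big /=; apply: eq_bigr => i _; apply: eq_bigr => j _.
    by rewrite Tanti mulrN.
  rewrite {1}(_ : \sum_i \sum_j - (dc x j * T i j) = \sum_i \sum_j dc x i * T i j); last first.
    rewrite exchange_big /=; apply: eq_bigr => i _; apply: eq_bigr => j _.
    by rewrite Tanti mulrN opprK.
  rewrite !mulr_sumr -big_split; apply: eq_bigr => i _.
  rewrite !mulr_sumr -big_split; apply: eq_bigr => j _ /=.
  rewrite !sc1 /T; case: ifP => _; ring.
have e2 : \sum_i \sum_j dc x i * T i j = \sum_j dc x i0 * T i0 j.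
  rewrite (bigD1 i0) //= [X in _ + X = _]big1 ?addr0 // => i /negbTE ii.
  by rewrite big1 // => j _; rewrite /dc ii mul0r.
rewrite e1 e2; have -> : \sum_j dc x i0 * T i0 j =
  \sum_(j | E i0 j) x ord0 i0 * (x ord0 i0 - x ord0 j) / ((x ord0 i0 - x ord0 j) ^+ 2 + e).
  rewrite [RHS]big_mkcond; apply: eq_bigr => j _; rewrite /dc eqxx /T.
  by case: ifP => _; rewrite ?mulr0 // mulrA.
by field.
Qed.

Lemma dlwt_bound dl m e : 0 < e -> exists2 C : R, 0 <= C & forall (s : R) x, orth x ->
  1 / 2 <= s -> s <= 2 -> `|dlwt dl m e s x| <= C * (1 + p1 x) ^+ 2.
Proof.
move=> e0.
pose C1 : R := \sum_i (2 * `|dl i| + `|m i|).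
pose C2 : R := k / 2 * \sum_(i < n) \sum_(j < n) (4 / e).
have C10 : 0 <= C1 by apply: sumr_ge0 => i _; rewrite addr_ge0 // mulr_ge0.
have C20 : 0 <= C2.
  rewrite mulr_ge0 ?divr_ge0 ?(ltW k0) // sumr_ge0 // => i _; rewrite sumr_ge0 // => j _.
  by rewrite divr_ge0 // ltW.
exists (C1 + C2); first exact: addr_ge0.
move=> s x xO s1 s2; have P0 := p1_ge0 xO; set P := p1 x in P0 *.
have s0 : 0 < s by apply: lt_le_trans s1; rewrite divr_gt0.
have xp i : 0 <= x ord0 i <= P by rewrite (ltW (xO i)) coord_le_p1.
have dcp i : 0 <= dc x i <= P by rewrite /dc; case: ifP => // _; rewrite lexx.
have scp i : 0 <= (sc s x) ord0 i <= 2 * P.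
  have /andP[h1 h2] := xp i; rewrite mxE; case: ifP => _.
    by rewrite mulr_ge0 ?(ltW s0) //= ler_pM // ltW.
  by rewrite h1 /= (le_trans h2) // ler_peMl // ler1n.
have sub (a b M : R) : 0 <= a <= M -> 0 <= b <= M -> `|a - b| <= M.
  by move=> /andP[? ?] /andP[? ?]; rewrite ler_norml; apply/andP; split; lra.
have PP : 1 <= (1 + P) ^+ 2 by rewrite exprn_ege1 // lerDl.
have PP1 : P <= (1 + P) ^+ 2 by rewrite sqrrD expr1n; move: P0; nra.
have PP2 : P ^+ 2 <= (1 + P) ^+ 2 by apply: lerXn2r; rewrite ?nnegrE ?addr_ge0 // lerDr.
have PP0 : 0 <= (1 + P) ^+ 2 by exact: le_trans PP.
apply: le_trans (ler_normD _ _) _; rewrite mulrDl; apply: lerD.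
  rewrite mulr_suml; apply: le_trans (ler_norm_sum _ _ _) _; apply: ler_sum => i _.
  apply: le_trans (ler_normB _ _) _; rewrite mulrDl; apply: lerD.
    rewrite normrM mulrAC mulrC ler_wpM2r //.
    have : `|dc x i / (sc s x) ord0 i| <= 2.
      rewrite /dc mxE; case: ifP => ii; last by rewrite mul0r normr0.
      rewrite invfM mulrCA divff ?gt_eqF ?xO // mulr1 gtr0_norm ?invr_gt0 //.
      by rewrite invf_ple ?posrE // -[2^-1]mul1r.
    by move=> h; apply: le_trans h _; rewrite ler_peMr.
  rewrite normrM ler_wpM2l //; have /andP[h1 h2] := dcp i.
  by rewrite ger0_norm // (le_trans h2).
rewrite normrM ger0_norm ?divr_ge0 ?(ltW k0) // /C2 -[leRHS]mulrA.
apply: ler_wpM2l; first by rewrite divr_ge0 // ltW.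
rewrite mulr_suml; apply: le_trans (ler_norm_sum _ _ _) _; apply: ler_sum => i _.
rewrite mulr_suml; apply: le_trans (ler_norm_sum _ _ _) _; apply: ler_sum => j _.
case: ifP => _; last by rewrite normr0 mulr_ge0 // divr_ge0 // ltW.
have d1 := sub _ _ _ (scp i) (scp j); have d2 := sub _ _ _ (dcp i) (dcp j).
set D := (sc s x) ord0 i - (sc s x) ord0 j in d1 *.
have eD : e <= D ^+ 2 + e by rewrite lerDr sqr_ge0.
have De : 0 < D ^+ 2 + e by exact: lt_le_trans eD.
rewrite !normrM normfV (ger0_norm (ltW De)) (ger0_norm (ler0n _ 2)).
rewrite ler_pdivrMr //.
apply: le_trans (_ : 4 * P ^+ 2 <= _).
  have : `|D| * `|dc x i - dc x j| <= 2 * P * P by apply: ler_pM.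
  by rewrite -mulrA expr2; move=> h; lra.
apply: le_trans (_ : 4 * (1 + P) ^+ 2 <= _); first by rewrite ler_pM2l.
have -> : 4 / e * (1 + P) ^+ 2 * (D ^+ 2 + e) = 4 * (1 + P) ^+ 2 * ((D ^+ 2 + e) / e) by ring.
apply: ler_peMr; first by rewrite mulr_ge0.
by rewrite ler_pdivlMr // mul1r.
Qed.

(** The factor [2 ^ |dl i0|] covers both signs of the exponent, as [s] and its inverse are at most
    2. *)
Lemma gam_sc_le dl m (s : R) x : (forall i, 0 < m i) -> orth x -> 1 / 2 <= s -> s <= 2 ->
  gam dl m (sc s x) <= 2 `^ `|dl i0| * gam dl (fun i => m i / 2) x.
Proof.
move=> m0 xO s1 s2; have s0 : 0 < s by apply: lt_le_trans s1; rewrite divr_gt0.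
have -> : 2 `^ `|dl i0| = \prod_i (if i == i0 then 2 `^ `|dl i0| else 1) :> R.
  by rewrite -big_mkcond big_pred1_eq.
rewrite -big_split; apply: ler_prod => i _; rewrite mulr_ge0 ?powR_ge0 ?expR_ge0 //=.
have xi := xO i.
have eh : expR (- (m i * x ord0 i)) <= expR (- (m i / 2 * x ord0 i)).
  by rewrite ler_expR lerN2 ler_pM2r // ler_pdivrMr // ler_pMr // ler1n.
rewrite mxE; case: eqVneq => [->|_]; last first.
  by rewrite mul1r ler_wpM2l // powR_ge0.
rewrite powRM ?(ltW s0) ?(ltW (xO _)) // -mulrA; apply: ler_pM; rewrite ?powR_ge0 ?mulr_ge0 ?powR_ge0 ?expR_ge0 //.
  have [d0|d0] := leP 0 (dl i0).
    by rewrite ger0_norm //; apply: ge0_ler_powR; rewrite ?nnegrE // ltW.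
  rewrite ltr0_norm // -[dl i0 in leLHS]opprK powRN -powRN.
  have -> : s `^ (- (- dl i0)) = (s^-1) `^ (- dl i0).
    by rewrite -[s^-1](powR_inv1 (ltW s0)) -powRrM mulN1r.
  apply: ge0_ler_powR; rewrite ?nnegrE ?invr_ge0 ?oppr_ge0 ?(ltW d0) ?(ltW s0) //.
  by rewrite invf_ple ?posrE // -[2^-1]mul1r.
apply: ler_wpM2l; rewrite ?powR_ge0 // ler_expR lerN2 -mulrA ler_pM2l //.
by rewrite ler_wpM2r ?(ltW (xO _)) // -[2^-1]mul1r.
Qed.

Lemma wt_sc_dom N dl m : (forall i, 0 < m i) -> exists2 C : R, 0 <= C &
  forall e (s : R) x, orth x -> 0 <= e -> e <= 1 -> 1 / 2 <= s -> s <= 2 ->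
  (1 + p1 x) ^+ N * wt dl m e (sc s x) <= C * gam dl (fun i => m i / 2 / 2) x.
Proof.
move=> m0; have [C [C0 HC]] := wt_dom N dl m0.
exists (2 ^+ N * C * 2 `^ `|dl i0|); first by rewrite !mulr_ge0 ?exprn_ge0 ?powR_ge0.
move=> e s x xO e0 e1 s1 s2; have s0 : 0 < s by apply: lt_le_trans s1; rewrite divr_gt0.
have scO : orth (sc s x) by rewrite sc_orth.
have P0 := p1_ge0 xO.
have pp : 1 + p1 x <= 2 * (1 + p1 (sc s x)).
  rewrite mulrDr mulr1; apply: lerD; first by rewrite ler1n.
  rewrite /p1 mulr_sumr; apply: ler_sum => i _; rewrite mxE.
  have xi := ltW (xO i); case: ifP => _; last by rewrite ler_peMl // ler1n.
  by rewrite mulrA ler_peMl // mulrC -ler_pdivrMr.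
apply: le_trans (_ : 2 ^+ N * ((1 + p1 (sc s x)) ^+ N * wt dl m e (sc s x)) <= _).
  rewrite mulrA -exprMn; apply: ler_wpM2r; first exact: wt_ge0.
  by apply: lerXn2r => //; rewrite nnegrE ?mulr_ge0 ?addr_ge0 // p1_ge0.
rewrite -!mulrA; apply: ler_wpM2l; first by rewrite exprn_ge0.
apply: le_trans (HC e _ scO e0 e1) _; apply: ler_wpM2l => //.
by apply: gam_sc_le => // i; rewrite divr_gt0.
Qed.

(** Integration by parts against [x_i0 d/dx_i0] without boundary terms: dilating the coordinate [i0]
    by [s] multiplies the integral by [s^-1], and this relation is differentiated at [s = 1], under
    the integral sign on one side. The interval []1/2, 2[] keeps [s] away from 0 and from
    infinity. *)
Lemma scaling_identity dl m e : (forall i, -1 < dl i) -> (forall i, 0 < m i) ->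
  0 < e -> e <= 1 ->
  Rintegral lam orth (fun x => (1 + dl i0 - m i0 * x ord0 i0 +
    2 * k * \sum_(j | E i0 j) x ord0 i0 * (x ord0 i0 - x ord0 j) / ((x ord0 i0 - x ord0 j) ^+ 2 + e))
    * wt dl m e x) = 0.
Proof.
move=> d1 m0 e0 e1; have m40 i : 0 < m i / 2 / 2 by rewrite !divr_gt0.
have [C1 C10 HC1] := dlwt_bound dl m e0.
have [C2 C20 HC2] := wt_sc_dom 2 dl m0.
have mO := @orthant_measurable R n.
pose f (s : R) x := wt dl m e (sc s x).
pose G x := C1 * C2 * gam dl (fun i => m i / 2 / 2) x.
have iw : lam.-integrable orth (EFin \o wt dl m e).
  by apply: wt_integrable1 => //; exact: ltW.
have gpos (s : R) : 0 < s -> forall i, 0 < (\row_i (if i == i0 then s else 1) : 'rV[R]_n) ord0 i.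
  by move=> s0 i; rewrite mxE; case: ifP.
have pre (s : R) : 0 < s -> gmap (\row_i (if i == i0 then s else 1)) 1%g @^-1` orth = orth.
  by move=> s0; rewrite -sc_gmap; apply/seteqP; split => x /=; rewrite sc_orth.
have FI (s : R) : 0 < s -> lam.-integrable orth (EFin \o f s) /\
    Rintegral lam orth (f s) = s^-1 * Rintegral lam orth (wt dl m e).
  move=> s0; have := gmap_Rintegral hlam 1%g (gpos s s0) mO iw.
  by rewrite pre // sc_prod -sc_gmap.
have Idp (s : R) : `]1 / 2, 2[%classic s -> [/\ 0 < s, 1 / 2 <= s & s <= 2].
  rewrite /= in_itv /= => /andP[h1 h2]; split; [|exact: ltW..].
  by apply: lt_trans h1; rewrite divr_gt0.
have fd (s : R) x : `]1 / 2, 2[%classic s -> orth x ->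
    is_derive s 1 (f ^~ x) (f s x * dlwt dl m e s x).
  move=> /Idp[s0 _ _] xO.
  pose L := fun t => lwt dl m e (sc t x).
  have dL : is_derive s 1 L (dlwt dl m e s x) by exact: lwt_derive.
  have h := is_derive1_comp (is_derive_expR (L s)) dL.
  have h' : is_derive s 1 (fun t => expR (L t)) (f s x * dlwt dl m e s x).
    by apply: (is_derive_eqf h) => //; rewrite /f wt_expR ?sc_orth.
  apply: near_eq_is_derive h'; near=> t; rewrite /f /L wt_expR // sc_orth //.
  by near: t; exact: lt_nbhsr.
have Ia : `]1 / 2, 2[%classic (1 : R) by rewrite /= in_itv /= ltr1n andbT ltr_pdivrMr // mul1r ltr1n.
have intG : lam.-integrable orth (EFin \o G).
  exact: (@integrableZl _ _ _ lam orth mO (C1 * C2) _ (gam_integrable d1 m40)).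
have Gub (s : R) x : `]1 / 2, 2[%classic s -> orth x -> `|f s x * dlwt dl m e s x| <= G x.
  move=> /Idp[s0 s1 s2] xO; rewrite normrM (ger0_norm (wt_ge0 _ _ _ _)).
  apply: le_trans (_ : C1 * ((1 + p1 x) ^+ 2 * wt dl m e (sc s x)) <= _).
    by rewrite mulrA mulrC ler_wpM2r ?wt_ge0 // HC1.
  by rewrite /G -mulrA ler_wpM2l // HC2 // ltW.
have D := @differentiation_under_integral R _ _ lam f orth mO 1 (1 / 2) 2 Ia
  (fun (s : R) hs => (FI s (let: And3 p _ _ := Idp s hs in p)).1)
  (fun (s : R) x hs xO => @ex_derive _ _ _ _ _ _ _ (fd s x hs xO)) G.
have {}D := D (fun x => mulr_ge0 (mulr_ge0 C10 C20) (gam_ge0 _ _ _)) intG.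
have d1E (s : R) x : `]1 / 2, 2[%classic s -> orth x ->
    partial1of2 f s x = f s x * dlwt dl m e s x.
  by move=> hs xO; rewrite partial1of2E (@derive_val _ _ _ _ _ _ _ (fd s x hs xO)).
have {}D : (fun s => Rintegral lam orth (f s))^`()%classic 1 =
    Rintegral lam orth (fun x => partial1of2 f 1 x).
  by apply: D => s x hs xO; rewrite d1E //; exact: Gub.
move: D; rewrite derive1E.
have dF : is_derive (1 : R) 1 (fun s => Rintegral lam orth (f s)) (- Rintegral lam orth (wt dl m e)).
  have h : is_derive (1 : R) 1 (fun s => s^-1 * Rintegral lam orth (wt dl m e))
      (- Rintegral lam orth (wt dl m e)).
    have hv := is_deriveV (f := id) (oner_neq0 R) (is_derive_id (1 : R) 1).
    have hm := is_deriveM hv (is_derive_cst (Rintegral lam orth (wt dl m e)) (1 : R) 1).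
    apply: (is_derive_eqf hm) => //.
    by rewrite /GRing.scale /= expr1n invr1 !mulr1 mulr0 add0r mulrN1.
  apply: near_eq_is_derive h; near=> t; apply/esym; apply: (FI t _).2.
  by near: t; exact: lt_nbhsr.
rewrite (@derive_val _ _ _ _ _ _ _ dF) => D.
pose b x := dl i0 - m i0 * x ord0 i0 + 2 * k * \sum_(j | E i0 j)
  x ord0 i0 * (x ord0 i0 - x ord0 j) / ((x ord0 i0 - x ord0 j) ^+ 2 + e).
have eD : Rintegral lam orth (fun x => b x * wt dl m e x) = - Rintegral lam orth (wt dl m e).
  rewrite D; apply: eq_Rintegral => x /set_mem xO.
  have sx : sc 1 x = x by apply/rowP => i; rewrite mxE mul1r if_same.
  by rewrite d1E // dlwt1 // /f sx mulrC.
have ib : lam.-integrable orth (EFin \o (fun x => b x * wt dl m e x)).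
  have mb : measurable_fun setT b.
    apply: measurable_funD.
      by apply: measurable_funB => //; apply: measurable_funM => //; exact: coord_measurable.
    apply: measurable_funM => //; apply: measurable_sum_cond => j _.
    have cm i := @coord_measurable R n i.
    apply: measurable_funM.
      by apply: measurable_funM => //; exact: measurable_funB.
    have -> : (fun x : RnB R n => ((x ord0 i0 - x ord0 j) ^+ 2 + e)^-1) =
        (fun x => ((x ord0 i0 - x ord0 j) ^+ 2 + e) `^ (-1)).
      by apply/funext => x; rewrite powR_inv1 // addr_ge0 ?sqr_ge0 // ltW.
    apply: measurableT_comp (measurable_powR _) _.
    by apply: measurable_funD => //; apply: measurable_funX; exact: measurable_funB.
  apply: (@wt_integrable 2 _ _ _ _ C1) => //; first exact: ltW.
  move=> x xO; have := HC1 1 x xO; rewrite dlwt1 //; apply.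
    by rewrite ler_pdivrMr // mul1r ler1n.
  by rewrite ler1n.
rewrite -[RHS](addrN (Rintegral lam orth (wt dl m e))) -eD -RintegralD //.
by apply: eq_Rintegral => x _; rewrite /b /= -/(wt dl m e x); move: (\sum_(j | _) _) => S; ring.
Unshelve. all: by end_near.
Qed.

End Scaling.

End GammaWeight.

(** * Removing the regularization of the weight *)

Section GammaLimit.
Context {R : realType} {n : nat}.
Variable lam : {measure set (RnB R n) -> \bar R}.
Hypothesis hlam : is_lebesgue_Rn lam.
Variables (E : rel 'I_n) (k : R).
Hypothesis (E_sym : symmetric E) (E_irr : irreflexive E) (k0 : 0 < k).
Implicit Types (dl m : 'I_n -> R) (e : R) (x : RnB R n).
Local Notation orth := (@Rplus_n R n).
Local Notation vdm := (vdm E k).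
Local Notation wt := (wt E k).

Lemma powR_cvg_harmonic (a p : R) : 0 <= a -> 0 < p ->
  (a + @harmonic R j) `^ p @[j --> \oo] --> a `^ p.
Proof.
move=> a0 p0; have ch : (a + @harmonic R j) @[j --> \oo] --> a.
  by rewrite -[X in _ --> X]addr0; apply: cvgD; [exact: cvg_cst|exact: cvg_harmonic].
move: a0; rewrite le_eqVlt => /orP[/eqP a0|a0].
  have := @powR_cvg0 R p p0; rewrite -a0 powR0 ?gt_eqF // => /cvg_at_rightP; apply.
  by split => [j|]; [rewrite add0r harmonic_gt0|rewrite a0].
have -> : a `^ p = expR (p * ln a) by rewrite /powR gt_eqF.
have -> : (fun j => (a + @harmonic R j) `^ p) = (fun j => expR (p * ln (a + @harmonic R j))).
  by apply/funext => j; rewrite /powR gt_eqF // addr_gt0 // harmonic_gt0.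
apply: continuous_cvg; first exact: continuous_expR.
apply: cvgM; first exact: cvg_cst.
by apply: continuous_cvg ch; exact: continuous_ln.
Qed.

Lemma vdm_cvg x : vdm (@harmonic R j) x @[j --> \oo] --> vdm 0 x.
Proof.
have cm : continuous (fun u : R * R => u.1 * u.2) by exact: mul_continuous.
apply: (cvg_big (U := R) cm) => i _; apply: (cvg_big (U := R) cm) => j _.
rewrite addr0; apply: powR_cvg_harmonic; first exact: sqr_ge0.
by rewrite divr_gt0.
Qed.

Lemma vdm0_eq0 x i j : E i j -> x ord0 i = x ord0 j -> vdm 0 x = 0.
Proof.
move=> ij xij; rewrite /vdm (bigD1 i) //= (bigD1 j) //= xij subrr expr0n addr0.
by rewrite powR0 ?mul0r // gt_eqF // divr_gt0.
Qed.

Lemma harmonic_le1 j : @harmonic R j <= 1.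
Proof. by rewrite /harmonic invf_le1 // ler1n. Qed.

(** Off the diagonal the ratio tends to 1. On the diagonal it is 0, but there the limit weight
    vanishes as well because [k > 0], so convergence holds at every point. *)
Lemma ratio_cvg dl m x i j : E i j ->
  (x ord0 i - x ord0 j) ^+ 2 / ((x ord0 i - x ord0 j) ^+ 2 + @harmonic R l) *
    wt dl m (@harmonic R l) x @[l --> \oo] --> wt dl m 0 x.
Proof.
move=> ij; have cw : wt dl m (@harmonic R l) x @[l --> \oo] --> wt dl m 0 x.
  by apply: cvgM; [exact: cvg_cst|exact: vdm_cvg].
have [xij|xij] := eqVneq (x ord0 i) (x ord0 j).
  rewrite xij subrr expr0n /wt (vdm0_eq0 ij xij) mulr0.
  rewrite (_ : (fun l => _) = cst 0); first exact: cvg_cst.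
  by apply/funext => l; rewrite mul0r mul0r.
set d := (x ord0 i - x ord0 j) ^+ 2; have d0 : d != 0 by rewrite sqrf_eq0 subr_eq0.
rewrite -[X in _ --> X]mul1r; apply: cvgM => //; rewrite -[X in _ --> X](mulfV d0).
apply: cvgM; first exact: cvg_cst.
apply: cvgV => //; rewrite -[X in _ --> X]addr0.
by apply: cvgD; [exact: cvg_cst|exact: cvg_harmonic].
Qed.

Lemma ratio_le1 x i j e : 0 <= e ->
  `|(x ord0 i - x ord0 j) ^+ 2 / ((x ord0 i - x ord0 j) ^+ 2 + e)| <= 1.
Proof.
move=> e0; set d := (_ ^+ 2); have d0 : 0 <= d by exact: sqr_ge0.
rewrite ger0_norm ?divr_ge0 ?addr_ge0 //.
have [->|de] := eqVneq (d + e) 0; first by rewrite invr0 mulr0.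
by rewrite ler_pdivrMr ?mul1r ?lerDl // lt_neqAle eq_sym de addr_ge0.
Qed.

Lemma inv_measurable (f : RnB R n -> R) : (forall x, 0 <= f x) -> measurable_fun setT f ->
  measurable_fun setT (fun x => (f x)^-1).
Proof.
move=> f0 mf; have -> : (fun x => (f x)^-1) = (fun x => (f x) `^ (-1)).
  by apply/funext => x; rewrite powR_inv1.
exact: measurableT_comp (measurable_powR _) mf.
Qed.

(** The singular quotients are assumed to be symmetrized already, so that [e] enters only through
    the weight and through ratios in [[0, 1]]; dominated convergence applies along
    [e = 1 / (l + 1)]. *)
Lemma wt_limit N dl m (A : RnB R n -> R) (B : 'I_n -> 'I_n -> RnB R n -> R) (C : R) :
  (forall i, -1 < dl i) -> (forall i, 0 < m i) ->
  measurable_fun setT A -> (forall i j, measurable_fun setT (B i j)) ->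
  (forall x, orth x -> `|A x| <= C * (1 + p1 x) ^+ N) ->
  (forall i j x, orth x -> `|B i j x| <= C * (1 + p1 x) ^+ N) ->
  (forall e, 0 < e -> e <= 1 -> Rintegral lam orth (fun x => (A x + \sum_i \sum_(j | E i j)
     B i j x * ((x ord0 i - x ord0 j) ^+ 2 / ((x ord0 i - x ord0 j) ^+ 2 + e))) * wt dl m e x) = 0) ->
  Rintegral lam orth (fun x => (A x + \sum_i \sum_(j | E i j) B i j x) * wt dl m 0 x) = 0.
Proof.
move=> d1 m0 mA mB hA hB H.
have mO := @orthant_measurable R n.
pose rt e i j x : R := (x ord0 i - x ord0 j) ^+ 2 / ((x ord0 i - x ord0 j) ^+ 2 + e).
pose f (l : nat) x := (A x + \sum_i \sum_(j | E i j) B i j x * rt (@harmonic R l) i j x) *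
  wt dl m (@harmonic R l) x.
pose f0 x := (A x + \sum_i \sum_(j | E i j) B i j x) * wt dl m 0 x.
have h0 l := ltW (@harmonic_gt0 R l).
have [D [D0 HD]] := wt_dom E k0 N dl m0.
have m20 i : 0 < m i / 2 by rewrite divr_gt0.
have C0 x : orth x -> 0 <= C * (1 + p1 x) ^+ N by move=> xO; exact: le_trans (hA x xO).
pose CC := (1 + n%:R * n%:R) * (`|C| * D).
have ig := @integrableZl _ _ _ lam orth mO CC _ (gam_integrable hlam d1 m20).
have mrt e i j : 0 <= e -> measurable_fun setT (rt e i j).
  move=> e0; have md : measurable_fun setT (fun x : RnB R n => (x ord0 i - x ord0 j) ^+ 2).
    by apply: measurable_funX; apply: measurable_funB; exact: coord_measurable.
  apply: measurable_funM => //; apply: inv_measurable => [x|]; first by rewrite addr_ge0 ?sqr_ge0.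
  exact: measurable_funD.
have mf l : measurable_fun orth (EFin \o f l).
  apply/measurable_EFinP; apply: measurable_funTS; apply: measurable_funM; last exact: wt_measurable.
  apply: measurable_funD => //; do 2 (apply: measurable_sum_cond => ? _).
  by apply: measurable_funM => //; exact: mrt.
have mf0 : measurable_fun orth (EFin \o f0).
  apply/measurable_EFinP; apply: measurable_funTS; apply: measurable_funM; last exact: wt_measurable.
  by apply: measurable_funD => //; do 2 (apply: measurable_sum_cond => ? _).
have cf : {ae lam, forall x, orth x -> (EFin \o f l) x @[l --> \oo] --> (EFin \o f0) x}.
  apply: aeW => x xO; apply/fine_cvgP; split; first exact: nearW.
  rewrite /f /f0 /comp /=.
  have cw : wt dl m (@harmonic R l) x @[l --> \oo] --> wt dl m 0 x.
    by apply: cvgM; [exact: cvg_cst|exact: vdm_cvg].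
  have cad : continuous (fun u : R * R => u.1 + u.2) by exact: add_continuous.
  have -> : (fun l => (A x + \sum_i \sum_(j | E i j) B i j x * rt (@harmonic R l) i j x) *
      wt dl m (@harmonic R l) x) = (fun l => A x * wt dl m (@harmonic R l) x +
      \sum_i \sum_(j | E i j) B i j x * (rt (@harmonic R l) i j x * wt dl m (@harmonic R l) x)).
    apply/funext => l; rewrite mulrDl; congr (_ + _); rewrite mulr_suml; apply: eq_bigr => i _.
    by rewrite mulr_suml; apply: eq_bigr => j _; rewrite mulrA.
  have -> : (A x + \sum_i \sum_(j | E i j) B i j x) * wt dl m 0 x =
      A x * wt dl m 0 x + \sum_i \sum_(j | E i j) B i j x * wt dl m 0 x.
    rewrite mulrDl; congr (_ + _); rewrite mulr_suml; apply: eq_bigr => i _.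
    by rewrite mulr_suml.
  apply: cvgD; first by apply: cvgM => //; exact: cvg_cst.
  apply: (cvg_big (U := R) cad) => i _; apply: (cvg_big (U := R) cad) => j ij.
  by apply: cvgM; [exact: cvg_cst|exact: ratio_cvg].
have bfp : forall x l, orth x -> (`|(EFin \o f l) x| <= CC%:E * (gam dl (fun i => m i / 2) x)%:E)%E.
  move=> x l xO; rewrite -EFinM /= lee_fin /f normrM (ger0_norm (wt_ge0 _ _ _ _ _ _)).
  have P0 := p1_ge0 xO.
  have hs : `|A x + \sum_i \sum_(j | E i j) B i j x * rt (@harmonic R l) i j x| <=
      (1 + n%:R * n%:R) * (`|C| * (1 + p1 x) ^+ N).
    have C' : C * (1 + p1 x) ^+ N <= `|C| * (1 + p1 x) ^+ N.
      by rewrite ler_wpM2r ?ler_norm // exprn_ge0 // addr_ge0.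
    set Q := `|C| * _ in C' *; have Q0 : 0 <= Q by apply: le_trans C'; exact: C0.
    rewrite mulrDl mul1r; apply: le_trans (ler_normD _ _) _; apply: lerD.
      exact: le_trans (hA x xO) C'.
    apply: le_trans (ler_norm_sum _ _ _) _.
    rewrite -mulrA [leRHS](_ : _ = \sum_(i < n) n%:R * Q); last by rewrite sumr_const card_ord mulr_natl.
    apply: ler_sum => i _; apply: le_trans (ler_norm_sum _ _ _) _.
    rewrite [leRHS](_ : _ = \sum_(i < n) Q); last by rewrite sumr_const card_ord mulr_natl.
    rewrite big_mkcond; apply: ler_sum => j _; case: ifP => // _; rewrite normrM.
    rewrite -[leRHS]mulr1; apply: ler_pM => //; first exact: le_trans (hB i j x xO) C'.
    exact: ratio_le1.
  apply: le_trans (ler_wpM2r (wt_ge0 _ _ _ _ _ _) hs) _.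
  rewrite /CC -!mulrA; apply: ler_wpM2l; first by rewrite addr_ge0 ?mulr_ge0.
  by apply: ler_wpM2l => //; apply: HD => //; exact: harmonic_le1.
have [_ _ cv] := dominated_convergence mO mf mf0 cf ig (aeW _ bfp).
have e0 : (fun l => \int[lam]_(x in orth) ((EFin \o f l) x))%E = cst 0%E.
  apply/funext => l /=; have := H _ (harmonic_gt0 l) (harmonic_le1 l).
  have fi : lam.-integrable orth (EFin \o f l).
    apply: le_integrable ig => // x xO; rewrite [leRHS]gee0_abs; first exact: bfp.
    by rewrite -EFinM lee_fin !mulr_ge0 ?gam_ge0 ?addr_ge0 ?mulr_ge0.
  rewrite /Rintegral => /eqP; rewrite fine_eq0 ?integrable_fin_num // => /eqP //.
have := cvg_lim (@ereal_hausdorff R) cv; rewrite e0 lim_cst // => h.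
by rewrite /Rintegral -h.
Unshelve. all: by end_near.
Qed.

Definition mon (b : 'I_n -> nat) (x : RnB R n) : R := \prod_i x ord0 i ^+ b i.

Definition polyb (f : RnB R n -> R) := measurable_fun setT f /\
  exists (C : R) (N : nat), 0 <= C /\ forall x, orth x -> `|f x| <= C * (1 + p1 x) ^+ N.

Lemma p1_ge1 x : orth x -> 1 <= 1 + p1 x.
Proof. by move=> xO; rewrite lerDl p1_ge0. Qed.

Lemma p1_pow_mono x K L : orth x -> (K <= L)%N -> (1 + p1 x) ^+ K <= (1 + p1 x) ^+ L.
Proof. by move=> xO KL; rewrite ler_weXn2l ?p1_ge1. Qed.

Lemma p1_pow_ge0 x K : orth x -> 0 <= (1 + p1 x) ^+ K.
Proof. by move=> xO; rewrite exprn_ge0 // (le_trans ler01) ?p1_ge1. Qed.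

Lemma polyb_cst c : polyb (fun _ => c).
Proof.
by split => //; exists `|c|, 0%N; split => // x _; rewrite expr0 mulr1.
Qed.

Lemma polyb_coord i : polyb (fun x => x ord0 i).
Proof.
split; first exact: coord_measurable.
exists 1, 1%N; split => // x xO; rewrite mul1r expr1 gtr0_norm //.
by apply: le_trans (coord_le_p1 i xO) _; rewrite lerDr.
Qed.

Lemma polybD f g : polyb f -> polyb g -> polyb (fun x => f x + g x).
Proof.
move=> [mf [C [N [C0 hf]]]] [mg [D [M [D0 hg]]]]; split; first exact: measurable_funD.
exists (C + D), (N + M)%N; split=> [|x xO]; first exact: addr_ge0.
apply: le_trans (ler_normD _ _) _; rewrite mulrDl; apply: lerD.
  by apply: le_trans (hf x xO) _; apply: ler_wpM2l => //; rewrite p1_pow_mono ?leq_addr.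
by apply: le_trans (hg x xO) _; apply: ler_wpM2l => //; rewrite p1_pow_mono ?leq_addl.
Qed.

Lemma polybM f g : polyb f -> polyb g -> polyb (fun x => f x * g x).
Proof.
move=> [mf [C [N [C0 hf]]]] [mg [D [M [D0 hg]]]]; split; first exact: measurable_funM.
exists (C * D), (N + M)%N; split=> [|x xO]; first exact: mulr_ge0.
by rewrite normrM exprD mulrACA; apply: ler_pM => //; [exact: hf|exact: hg].
Qed.

Lemma polyb_sum (I : Type) (r : seq I) (P : pred I) (f : I -> RnB R n -> R) :
  (forall i, P i -> polyb (f i)) -> polyb (fun x => \sum_(i <- r | P i) f i x).
Proof.
move=> h; elim: r => [|a r IH].
  by under eq_fun do rewrite big_nil; exact: polyb_cst.
case Pa : (P a); under eq_fun do rewrite big_cons Pa; last exact: IH.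
by apply: polybD => //; exact: h.
Qed.

Lemma polybX f a : polyb f -> polyb (fun x => f x ^+ a).
Proof.
move=> hf; elim: a => [|a IH]; first by under eq_fun do rewrite expr0; exact: polyb_cst.
by under eq_fun do rewrite exprS; exact: polybM.
Qed.

Lemma polybN f : polyb f -> polyb (fun x => - f x).
Proof.
move=> hf; rewrite (_ : (fun x => _) = (fun x => -1 * f x)); last by apply/funext => x; rewrite mulN1r.
by apply: polybM => //; exact: polyb_cst.
Qed.

Lemma polyb_integrable dl m e f : (forall i, -1 < dl i) -> (forall i, 0 < m i) ->
  0 <= e -> e <= 1 -> polyb f -> lam.-integrable orth (EFin \o (fun x => f x * wt dl m e x)).
Proof. by move=> d1 m0 e0 e1 [mf [C [N [_ hf]]]]; apply: (@wt_integrable _ _ _ hlam E k k0 N dl m e f C). Qed.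

Lemma polyb_limit dl m (A : RnB R n -> R) (B : 'I_n -> 'I_n -> RnB R n -> R) :
  (forall i, -1 < dl i) -> (forall i, 0 < m i) -> polyb A -> (forall i j, polyb (B i j)) ->
  (forall e, 0 < e -> e <= 1 -> Rintegral lam orth (fun x => (A x + \sum_i \sum_(j | E i j)
     B i j x * ((x ord0 i - x ord0 j) ^+ 2 / ((x ord0 i - x ord0 j) ^+ 2 + e))) * wt dl m e x) = 0) ->
  Rintegral lam orth (fun x => (A x + \sum_i \sum_(j | E i j) B i j x) * wt dl m 0 x) = 0.
Proof.
move=> d1 m0 [mA [CA [NA [CA0 hA]]]] hB H.
have /choice[CN HCN] : forall ij : 'I_n * 'I_n, exists cn : R * nat, 0 <= cn.1 /\
    forall x, orth x -> `|B ij.1 ij.2 x| <= cn.1 * (1 + p1 x) ^+ cn.2.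
  by move=> [i j]; have [_ [C [N h]]] := hB i j; exists (C, N).
pose N := (NA + \sum_ij (CN ij).2)%N; pose C := CA + \sum_ij (CN ij).1.
have S0 : 0 <= \sum_ij (CN ij).1 by apply: sumr_ge0 => ij _; have [] := HCN ij.
apply: (@wt_limit N _ _ _ _ C) => // [i j|x xO|i j x xO].
- by have [] := hB i j.
- apply: le_trans (hA x xO) _; apply: ler_pM; rewrite ?p1_pow_ge0 ?p1_pow_mono ?leq_addr //.
  by rewrite lerDl.
have [c0 h] := HCN (i, j); apply: le_trans (h x xO) _; apply: ler_pM; rewrite ?p1_pow_ge0 //.
  rewrite /C (bigD1 (i, j)) //= addrCA lerDl addr_ge0 // sumr_ge0 // => ij _.
  by have [] := HCN ij.
apply: p1_pow_mono => //; rewrite /N (bigD1 (i, j)) //= addnCA leq_addr //.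
Qed.

Lemma mon_measurable b : measurable_fun setT (mon b).
Proof.
by apply: measurable_prod => i _; apply: measurable_funX; exact: coord_measurable.
Qed.

Lemma mon_polyb b : polyb (mon b).
Proof.
split; first exact: mon_measurable.
exists 1, (\sum_i b i)%N; split => // x xO; rewrite mul1r normr_prod expr_sum; apply: ler_prod => i _.
rewrite normr_ge0 normrX lerXn2r ?nnegrE ?(le_trans ler01 (p1_ge1 xO)) // gtr0_norm //.
by apply: le_trans (coord_le_p1 i xO) _; rewrite lerDr.
Qed.

Lemma monS b i x : mon (fun j => b j + (j == i))%N x = x ord0 i * mon b x.
Proof.
rewrite /mon (bigD1 i) //= [in RHS](bigD1 i) //= eqxx addn1 exprS -mulrA; congr (_ * (_ * _)).
by apply: eq_bigr => j /negPf ->; rewrite addn0.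
Qed.

Lemma monD b i a x : mon (fun j => b j + a * (j == i))%N x = x ord0 i ^+ a * mon b x.
Proof.
rewrite /mon (bigD1 i) //= [in RHS](bigD1 i) //= eqxx muln1 addnC exprD -mulrA; congr (_ * (_ * _)).
by apply: eq_bigr => j /negPf ->; rewrite muln0 addn0.
Qed.

Lemma wt_shift dl m e b x : orth x -> wt (fun i => dl i + (b i)%:R) m e x = mon b x * wt dl m e x.
Proof.
move=> xO; rewrite /wt mulrA; congr (_ * _); rewrite /gam /mon -big_split; apply: eq_bigr => i _ /=.
rewrite powRD; last by rewrite (gt_eqF (xO i)) implybT.
by rewrite powR_mulrn ?(ltW (xO i)) // mulrA (mulrC (_ ^+ _)).
Qed.

(** A monomial factor is a shift of the exponents of the weight, so the scaling identity with
    shifted exponents is enough. *)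
Lemma scaling_mon dl m e b i0 : (forall i, -1 < dl i) -> (forall i, 0 < m i) -> 0 < e -> e <= 1 ->
  Rintegral lam orth (fun x => (1 + dl i0 + (b i0)%:R - m i0 * x ord0 i0 +
    2 * k * \sum_(j | E i0 j) x ord0 i0 * (x ord0 i0 - x ord0 j) / ((x ord0 i0 - x ord0 j) ^+ 2 + e))
    * mon b x * wt dl m e x) = 0.
Proof.
move=> d1 m0 e0 e1.
have d1' i : -1 < dl i + (b i)%:R by rewrite ltr_wpDr.
rewrite -[RHS](scaling_identity hlam E_sym k0 i0 d1' m0 e0 e1).
apply: eq_Rintegral => x /set_mem xO; rewrite wt_shift // mulrA; do 2 congr (_ * _).
by move: (\sum_(j | _) _) => S; ring.
Qed.

Lemma diff_quot_polyb i j e : 0 < e -> polyb (fun x =>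
  x ord0 i * (x ord0 i - x ord0 j) / ((x ord0 i - x ord0 j) ^+ 2 + e)).
Proof.
move=> e0; have pd : polyb (fun x => x ord0 i - x ord0 j).
  by apply: polybD; [exact: polyb_coord|apply: polybN; exact: polyb_coord].
apply: polybM; first by apply: polybM => //; exact: polyb_coord.
split.
  apply: inv_measurable => [x|]; first by rewrite addr_ge0 ?sqr_ge0 ?ltW.
  by apply: measurable_funD => //; apply: measurable_funX; case: pd.
exists e^-1, 0%N; split=> [|x xO]; first by rewrite invr_ge0 ltW.
rewrite expr0 mulr1; have h : 0 < (x ord0 i - x ord0 j) ^+ 2 + e by rewrite ltr_wpDl ?sqr_ge0.
by rewrite gtr0_norm ?invr_gt0 // lef_pV2 ?posrE // lerDr sqr_ge0.
Qed.

Lemma wt_perm dl m e (sg : 'S_n) x : (forall i j, E (sg i) (sg j) = E i j) ->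
  (forall i, dl (sg i) = dl i) -> (forall i, m (sg i) = m i) ->
  wt dl m e (gmap (const_mx 1) sg x) = wt dl m e x.
Proof.
move=> Es ds ms; rewrite /wt; congr (_ * _).
  rewrite /gam [RHS](reindex_inj (@perm_inj _ sg)); apply: eq_bigr => i _ /=.
  by rewrite !mxE mul1r ds ms.
rewrite /vdm [RHS](reindex_inj (@perm_inj _ sg)); apply: eq_bigr => i _ /=.
rewrite [RHS](reindex_inj (@perm_inj _ sg)) /=; apply: eq_big => [j|j _]; first by rewrite Es.
by rewrite !mxE !mul1r.
Qed.

Lemma perm_Rintegral (sg : 'S_n) (f : RnB R n -> R) : lam.-integrable orth (EFin \o f) ->
  Rintegral lam orth (fun x => f (gmap (const_mx 1) sg x)) = Rintegral lam orth f.
Proof.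
move=> fi; have s0 i : 0 < (const_mx 1 : 'rV[R]_n) ord0 i by rewrite mxE.
have [_] := gmap_Rintegral hlam sg s0 (@orthant_measurable R n) fi.
rewrite big1 => [|i _]; last by rewrite mxE.
rewrite invr1 mul1r => <-; congr Rintegral; apply/seteqP; split=> x xO i /=.
  by rewrite mxE mxE mul1r.
by have := xO ((sg^-1)%g i); rewrite !mxE mul1r permKV.
Qed.

Lemma Rintegral_sum_cond (I : Type) (r : seq I) (P : pred I) (f : I -> RnB R n -> R) :
  (forall i, P i -> lam.-integrable orth (EFin \o f i)) ->
  lam.-integrable orth (EFin \o (fun x => \sum_(i <- r | P i) f i x)) /\
  Rintegral lam orth (fun x => \sum_(i <- r | P i) f i x) =
  \sum_(i <- r | P i) Rintegral lam orth (f i).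
Proof.
have mO := @orthant_measurable R n; move=> fi; elim: r => [|a r [IHi IH]].
  under [X in EFin \o X]eq_fun do rewrite big_nil.
  under [X in Rintegral _ _ X]eq_fun do rewrite big_nil.
  split; first exact: integrable0.
  by rewrite /Rintegral integral0 big_nil.
case Pa : (P a); last first.
  under [X in EFin \o X]eq_fun do rewrite big_cons Pa.
  under [X in Rintegral _ _ X]eq_fun do rewrite big_cons Pa.
  by rewrite big_cons Pa.
under [X in EFin \o X]eq_fun do rewrite big_cons Pa.
under [X in Rintegral _ _ X]eq_fun do rewrite big_cons Pa.
split; first exact: (integrableD mO (fi _ Pa) IHi).
by rewrite (RintegralD mO (fi _ Pa) IHi) big_cons Pa IH.
Qed.

End GammaLimit.

(** * The power-sum recursion *)

Section Vandermonde.
Context {R : realType} {n : nat}.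
Variable lam : {measure set (RnB R n) -> \bar R}.
Hypothesis hlam : is_lebesgue_Rn lam.
Variables (I : pred 'I_n) (k : R).
Hypothesis k0 : 0 < k.
Implicit Types (x : RnB R n).
Local Notation orth := (@Rplus_n R n).

Definition pairs : rel 'I_n := fun i j => [&& I i, I j & i != j].

Lemma pairs_sym : symmetric pairs.
Proof. by move=> i j; rewrite /pairs andbCA eq_sym. Qed.

Local Notation wt := (wt pairs k).

(** Sum over [i] in [I] of the scaling identity for [x_i ^ a] times a monomial. Exchanging the two
    indices of a pair replaces the singular quotients by the polynomial [(x_i ^ (a+1) - x_j ^ (a+1))
    / (x_i - x_j)] times a ratio that tends to 1. The rates [m] are equal on [I] and free outside,
    which later gives the identity on a face. *)
Lemma power_sum_identity (al M : R) (m : 'I_n -> R) a b : -1 < al -> 0 < M -> (forall i, 0 < m i) ->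
  (forall i, I i -> m i = M) ->
  Rintegral lam orth (fun x => (\sum_(i | I i) (1 + al + a%:R + (b i)%:R - M * x ord0 i) *
      (x ord0 i ^+ a * mon b x) +
    \sum_i \sum_(j | pairs i j) k * ((\sum_(c < a.+1) x ord0 i ^+ (a - c) * x ord0 j ^+ c) * mon b x))
    * wt (fun i => if I i then al else 0) m 0 x) = 0.
Proof.
move=> al1 M0 m0 mM.
have d1 i : -1 < (if I i then al else 0) by case: ifP => // _; rewrite oppr_lt0.
pose dl i := if I i then al else 0.
have pm : polyb (mon b : RnB R n -> R) by exact: mon_polyb.
have pc i : polyb (fun x : RnB R n => x ord0 i) by exact: polyb_coord.
have pk (c : R) : polyb (fun x : RnB R n => c) by exact: polyb_cst.
apply: (polyb_limit hlam k0) => //.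
- apply: polyb_sum => i _; apply: polybM; last by apply: polybM => //; exact: polybX.
  by apply: polybD => //; apply: polybN; exact: polybM.
- move=> i j; apply: polybM => //; apply: polybM => //; apply: polyb_sum => c _.
  by apply: polybM; exact: polybX.
move=> e e0 e1.
pose q i j x : R := x ord0 i * (x ord0 i - x ord0 j) / ((x ord0 i - x ord0 j) ^+ 2 + e).
pose b' i l := (b l + a * (l == i))%N.
pose F i x : R := (1 + dl i + (b' i i)%:R - m i * x ord0 i + 2 * k * \sum_(j | pairs i j) q i j x) *
  mon (b' i) x.
have FI i : Rintegral lam orth (fun x => F i x * wt dl m e x) = 0.
  exact: (scaling_mon hlam pairs_sym k0).
have Fi i : lam.-integrable orth (EFin \o (fun x => F i x * wt dl m e x)).
  apply: (@polyb_integrable _ _ _ hlam pairs k k0 dl m e (F i)) => //; first exact: ltW.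
  apply: polybM; last exact: mon_polyb.
  apply: polybD; first by apply: polybD => //; apply: polybN; exact: polybM.
  by apply: polybM => //; apply: polyb_sum => j _; exact: diff_quot_polyb.
have [_ S] := @Rintegral_sum_cond _ _ lam _ (index_enum 'I_n) I _ (fun i _ => Fi i).
rewrite [RHS](_ : 0 = \sum_(i | I i) Rintegral lam orth (fun x => F i x * wt dl m e x)); last first.
  by rewrite big1.
rewrite -S; apply: eq_Rintegral => x /set_mem xO.
rewrite -mulr_suml; congr (_ * _).
have Fe i : I i -> F i x = (1 + al + a%:R + (b i)%:R - M * x ord0 i) * (x ord0 i ^+ a * mon b x) +
    \sum_(j | pairs i j) (2 * k * mon b x) * (x ord0 i ^+ a * q i j x).
  move=> Ii; rewrite /F /b' eqxx muln1 monD /dl Ii mM // natrD -!mulr_sumr.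
  by move: (\sum_(j | _) _) => Q; ring.
rewrite (eq_bigr _ Fe) big_split /=; congr (_ + _).
have -> : \sum_(i | I i) \sum_(j | pairs i j) (2 * k * mon b x) * (x ord0 i ^+ a * q i j x) =
    \sum_i \sum_(j | pairs i j) (2 * k * mon b x) * (x ord0 i ^+ a * q i j x).
  rewrite big_mkcond; apply: eq_bigr => i _; case: ifP => // Ii; rewrite big1 // => j.
  by rewrite /pairs Ii.
pose G i j := k * mon b x * (x ord0 i ^+ a * q i j x).
have sw : \sum_i \sum_(j | pairs i j) G i j = \sum_i \sum_(j | pairs i j) G j i.
  rewrite (exchange_big_dep xpredT) //=; apply: eq_bigr => i _; apply: eq_bigl => j.
  by rewrite pairs_sym.
transitivity (\sum_i \sum_(j | pairs i j) (G i j + G j i)).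
  apply: eq_bigr => i _; apply: eq_bigr => j _; rewrite /G /q.
  have -> : (x ord0 j - x ord0 i) ^+ 2 = (x ord0 i - x ord0 j) ^+ 2 by ring.
  have h := subrXX (x ord0 i) (x ord0 j) a.+1.
  have {}h : (x ord0 i - x ord0 j) * (\sum_(c < a.+1) x ord0 i ^+ (a - c) * x ord0 j ^+ c) =
    x ord0 i ^+ a * x ord0 i - x ord0 j ^+ a * x ord0 j.
    by rewrite -!exprSr h; congr (_ * _); apply: eq_bigr => c _; rewrite subSS.
  move: h; move: (\sum_(c < a.+1) _) (((x ord0 i - x ord0 j) ^+ 2 + e)^-1) => Q D h.
  rewrite [LHS](_ : _ = k * mon b x * D * (x ord0 i - x ord0 j) * ((x ord0 i - x ord0 j) * Q)); last by ring.
  by rewrite h; ring.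
transitivity (\sum_i \sum_(j | pairs i j) (G i j) + \sum_i \sum_(j | pairs i j) (G j i)).
  by rewrite -big_split; apply: eq_bigr => i _; rewrite big_split.
rewrite -sw -big_split; apply: eq_bigr => i _; rewrite -big_split; apply: eq_bigr => j _.
by rewrite /G /=; ring.
Qed.

End Vandermonde.

(** * Aomoto's identity *)

Section Aomoto.
Context {R : realType} {n : nat}.
Variable lam : {measure set (RnB R n) -> \bar R}.
Hypothesis hlam : is_lebesgue_Rn lam.
Variable k : R.
Hypothesis k0 : 0 < k.
Implicit Types (x : RnB R n).
Local Notation orth := (@Rplus_n R n).
Local Notation prs := (@pairs n predT).

(** The scaling identity for [i0], averaged with its images under the transpositions of [i0] and
    [j]. For [j] in [A] the two terms cancel; each of the [n - 1 - #|A|] other indices leaves half a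
    ratio, which becomes a contribution [k] in the limit. *)
Lemma aomoto_identity (al : R) (A : {set 'I_n}) i0 : -1 < al -> i0 \notin A ->
  Rintegral lam orth (fun x => (1 + al + k * (n%:R - 1 - #|A|%:R) - x ord0 i0) *
    mon (fun i => (i \in A) : nat) x * wt prs k (fun _ => al) (fun _ => 1) 0 x) = 0.
Proof.
move=> al1 iA; set b := fun i => (i \in A) : nat.
have mO := @orthant_measurable R n.
have d1 (i : 'I_n) : -1 < (fun _ : 'I_n => al) i by [].
have m0 (i : 'I_n) : 0 < (fun _ : 'I_n => 1 : R) i by [].
pose W e := wt prs k (fun _ : 'I_n => al) (fun _ => 1) e : RnB R n -> R.
have pc i : polyb (fun x : RnB R n => x ord0 i) by exact: polyb_coord.
have pk (c : R) : polyb (fun x : RnB R n => c) by exact: polyb_cst.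
have pm : polyb (mon b : RnB R n -> R) by exact: mon_polyb.
pose A0 x := (1 + al - x ord0 i0) * mon b x.
pose B0 i j x : R := if (i == i0) && (j \notin A) then k * mon b x else 0.
have pA : polyb A0.
  by apply: polybM => //; apply: polybD => //; exact: polybN.
have pB i j : polyb (B0 i j).
  by rewrite /B0; case: ((i == i0) && (j \notin A)) => //; exact: polybM.
have fin x : \sum_i \sum_(j | prs i j) B0 i j x = k * (n%:R - 1 - #|A|%:R) * mon b x.
  rewrite (bigD1 i0) //= [X in _ + X]big1 ?addr0 => [|i /negPf ii]; last first.
    by apply: big1 => j _; rewrite /B0 ii.
  rewrite (eq_bigr (fun j => if j \notin A then k * mon b x else 0)) => [|j _]; last first.
    by rewrite /B0 eqxx.
  rewrite -big_mkcondr /= sumr_const.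
  have -> : #|[pred j | prs i0 j && (j \notin A)]| = (n - #|A| - 1)%N.
    have -> : #|[pred j | prs i0 j && (j \notin A)]| = #|~: A :\ i0|.
      by apply: eq_card => j; rewrite !inE /pairs /= eq_sym.
    have h1 := cardsC A; have h2 := cardsD1 i0 (~: A).
    by move: h1 h2; rewrite finset.in_setC iA card_ord => h1 h2; lia.
  have An : (#|A| < n)%N.
    rewrite -[X in (_ < X)%N]card_ord -cardsT; apply: proper_card; apply/properP; split; first exact: finset.subsetT.
    by exists i0.
  rewrite -[LHS]mulr_natl natrB ?subn_gt0 // natrB ?(ltnW An) //; by ring.
suff H : Rintegral lam orth (fun x => (A0 x + \sum_i \sum_(j | prs i j) B0 i j x) * W 0 x) = 0.
  by rewrite -[RHS]H; apply: eq_Rintegral => x _; rewrite fin /A0 /W; congr (_ * _); ring.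
apply: (polyb_limit hlam k0) => // e e0 e1.
pose q i j x : R := x ord0 i * (x ord0 i - x ord0 j) / ((x ord0 i - x ord0 j) ^+ 2 + e).
pose rt i j x : R := (x ord0 i - x ord0 j) ^+ 2 / ((x ord0 i - x ord0 j) ^+ 2 + e).
have pq i j : polyb (q i j) by exact: diff_quot_polyb.
have H := scaling_mon hlam (@pairs_sym n predT) k0 b i0 d1 m0 e0 e1.
have int f : polyb f -> lam.-integrable orth (EFin \o (fun x => f x * W e x)).
  by move=> pf; apply: (@polyb_integrable _ _ _ hlam prs k k0) => //; exact: ltW.
have swap j : prs i0 j -> 2 * Rintegral lam orth (fun x => q i0 j x * mon b x * W e x) =
    Rintegral lam orth (fun x => (if j \notin A then rt i0 j x * mon b x else 0) * W e x).
  rewrite /pairs /= => ij; pose sg := tperm i0 j.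
  have intq : lam.-integrable orth (EFin \o (fun x => q i0 j x * mon b x * W e x)).
    by apply: int; exact: polybM.
  have intq' : lam.-integrable orth (EFin \o (fun x => q j i0 x * mon (fun i => b (sg i)) x * W e x)).
    by apply: int; apply: polybM => //; exact: mon_polyb.
  have T1 : Rintegral lam orth (fun x => q i0 j x * mon b x * W e x) =
      Rintegral lam orth (fun x => q j i0 x * mon (fun i => b (sg i)) x * W e x).
    rewrite -(perm_Rintegral hlam sg intq); apply: eq_Rintegral => x _.
    rewrite /W wt_perm //; last by move=> i l; rewrite /pairs /= (inj_eq (@perm_inj _ sg)).
    congr (_ * _); rewrite /q !mxE !mul1r tpermL tpermR; congr (_ * _).
    rewrite /mon [RHS](reindex_inj (@perm_inj _ sg)) /=; apply: eq_bigr => i _.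
    by rewrite mxE mxE mul1r tpermK.
  rewrite mulr_natl mulr2n {2}T1 -RintegralD //; apply: eq_Rintegral => x _ /=.
  rewrite -/(W e x) -mulrDl; congr (_ * _).
  have de : (x ord0 j - x ord0 i0) ^+ 2 = (x ord0 i0 - x ord0 j) ^+ 2 by ring.
  rewrite /q /rt de; set D := (_ + e)^-1.
  have rest : mon b x = (x ord0 i0 ^+ b i0 * x ord0 j ^+ b j) * \prod_(i | (i != i0) && (i != j)) x ord0 i ^+ b i.
    by rewrite /mon (bigD1 i0) //= (bigD1 j) 1?eq_sym //= mulrA.
  have rest' : mon (fun i => b (sg i)) x = (x ord0 i0 ^+ b j * x ord0 j ^+ b i0) * \prod_(i | (i != i0) && (i != j)) x ord0 i ^+ b i.
    rewrite /mon (bigD1 i0) //= (bigD1 j) 1?eq_sym //= mulrA /sg tpermL tpermR; congr (_ * _).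
    by apply: eq_bigr => i /andP[h1 h2]; rewrite tpermD // eq_sym.
  rewrite rest rest' /b (negPf iA); move: (\prod_(i | _) _) D => Q D.
  by case: (j \in A) => /=; ring.
have intR j : lam.-integrable orth (EFin \o (fun x => (if j \notin A then rt i0 j x * mon b x else 0) * W e x)).
  apply: int; case: (j \notin A) => //; apply: polybM => //.
  have rE : rt i0 j = (fun x => q i0 j x + q j i0 x).
    apply/funext => x; rewrite /rt /q.
    have -> : (x ord0 j - x ord0 i0) ^+ 2 = (x ord0 i0 - x ord0 j) ^+ 2 by ring.
    by ring.
  by rewrite rE; exact: polybD.
have intA : lam.-integrable orth (EFin \o (fun x => A0 x * W e x)) by exact: int.
have intq j : lam.-integrable orth (EFin \o (fun x => q i0 j x * mon b x * W e x)).
  by apply: int; exact: polybM.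
have [iS S] := Rintegral_sum_cond (index_enum 'I_n) (P := prs i0) (fun j _ => intq j).
have [iS' S'] := Rintegral_sum_cond (index_enum 'I_n) (P := prs i0) (fun j _ => intR j).
have mk f : lam.-integrable orth (EFin \o f) -> forall c, lam.-integrable orth (EFin \o (fun x => c * f x)).
  by move=> fi c; exact: (integrableZl mO c fi).
have E1 : Rintegral lam orth (fun x => A0 x * W e x) +
    2 * k * Rintegral lam orth (fun x => \sum_(j | prs i0 j) q i0 j x * mon b x * W e x) = 0.
  rewrite -[2 * k * _]RintegralZl // -RintegralD //; last exact: mk.
  rewrite -[RHS]H; apply: eq_Rintegral => x _ /=; rewrite /A0 -/(W e x).
  have b0 : (b i0)%:R = 0 :> R by rewrite /b (negPf iA).
  have e2 : \sum_(j | prs i0 j) q i0 j x * mon b x * W e x = (\sum_(j | prs i0 j) q i0 j x) * (mon b x * W e x).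
    by rewrite mulr_suml; apply: eq_bigr => j _; rewrite mulrA.
  by rewrite b0 e2 /q; move: (\sum_(j | _) _) => Q; ring.
rewrite -[RHS]E1 S [X in _ + X](_ : _ = k * Rintegral lam orth (fun x => \sum_(j | prs i0 j)
    (if j \notin A then rt i0 j x * mon b x else 0) * W e x)); last first.
  rewrite S' mulrAC mulrC; congr (_ * _); rewrite mulr_sumr; apply: eq_bigr => j ij.
  exact: swap.
rewrite -[k * _]RintegralZl // -RintegralD //; last exact: mk.
apply: eq_Rintegral => x _ /=; rewrite -/(W e x) -mulr_suml mulrA -mulrDl; congr ((_ + _) * _).
rewrite (bigD1 i0) //= [X in _ + X]big1 ?addr0 => [|i /negPf ii]; last first.
  by apply: big1 => j _; rewrite /B0 ii mul0r.
rewrite mulr_sumr; apply: eq_bigr => j _; rewrite /B0 eqxx /=.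
by case: ifP => _; rewrite ?mul0r ?mulr0 // -mulrA (mulrC (mon b x)).
Qed.

End Aomoto.

(** * Schwartz functions and cut-offs *)

Section Step.
Context {R : realType}.
Implicit Types (F G : R -> R).

Inductive sfun1 : (R -> R) -> Prop :=
| sfun1_base F : smooth1 F -> sfun1 F
| sfun1D F G : sfun1 F -> sfun1 G -> sfun1 (fun t => F t + G t)
| sfun1M F G : sfun1 F -> sfun1 G -> sfun1 (fun t => F t * G t)
| sfun1_comp F G : smooth1 F -> sfun1 G -> sfun1 (F \o G).

Lemma sfun1_smooth F : sfun1 F -> smooth1 F.
Proof.
apply: (smooth1_class (S := sfun1)) => {F} F; elim=> {F} [F Fs|F G _ [dF sF] _ [dG sG]|
    F G sF0 [dF sF] sG0 [dG sG]|F G Fs sG0 [dG sG]].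
- by split; [exact: (Fs 0%N)|apply: sfun1_base; exact: smooth1_derive].
- split=> [x|]; first exact: (derivableD (dF x) (dG x)).
  rewrite (_ : _^`()%classic = fun x => F^`()%classic x + G^`()%classic x); first exact: sfun1D.
  by apply/funext => x; rewrite !derive1E [LHS]deriveD.
- split=> [x|]; first exact: (derivableM (dF x) (dG x)).
  rewrite (_ : _^`()%classic = fun x => F x * G^`()%classic x + G x * F^`()%classic x).
    by apply: sfun1D; exact: sfun1M.
  by apply/funext => x; rewrite !derive1E [LHS]deriveM.
have dc (x : R) : differentiable (F \o G) x.
  by apply: differentiable_comp; apply/derivable1_diffP => //; exact: (Fs 0%N).
split=> [x|]; first exact/derivable1_diffP.
rewrite (_ : _^`()%classic = fun x => (F^`()%classic \o G) x * G^`()%classic x).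
  by apply: sfun1M => //; apply: sfun1_comp => //; exact: smooth1_derive.
apply/funext => x; rewrite derive1_comp //; exact: (Fs 0%N).
Qed.

Lemma smooth1_aff (a b : R) : smooth1 (fun t => a + b * t).
Proof.
have d0 (c : R) : (fun _ : R => c)^`()%classic = fun _ => 0.
  by apply/funext => x; rewrite derive1E derive_cst.
have z m : ((fun _ : R => 0)^`(m)%classic) = (fun _ => 0 : R).
  by elim: m => // m IH; rewrite derive1Sn d0.
have da (x : R) : is_derive x 1 (fun t => a + b * t) b.
  apply: (is_derive_eqf (is_deriveD (is_derive_cst a x 1) (is_deriveM (is_derive_cst b x 1) (is_derive_id x 1)))) => //.
  by rewrite /GRing.scale /= mulr1 mulr0 addr0 add0r.
have d1 : (fun t : R => a + b * t)^`()%classic = fun _ => b.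
  by apply/funext => y; rewrite derive1E (@derive_val _ _ _ _ _ _ _ (da y)).
case=> [|[|m]] x.
- by have [] := da x.
- by rewrite derive1Sn d1.
by rewrite derive1Sn d1 derive1Sn d0 z.
Qed.

Lemma smooth1_expR : smooth1 (@expR R).
Proof.
apply: (smooth1_class (S := [set @expR R])) => // F ->; split=> [x|]; first exact: derivable_expR.
by rewrite /=; apply/funext => x; rewrite derive1E (@derive_val _ _ _ _ _ _ _ (is_derive_expR x)).
Qed.

(** The functions [p(1/t) exp(-1/t)], extended by 0, are stable under differentiation: [p] becomes
    [X^2 (p - p')]. Smoothness for [p = 1] is obtained through the whole family. *)
Definition flat (p : {poly R}) (t : R) := if 0 < t then p.[t^-1] * expR (- t^-1) else 0.

(** Needed at the origin: since [flat p h / h = flat ('X * p) h], a linear bound for ['X * p] gives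
    the derivative 0 there. *)
Lemma flat_bound p : exists2 C, 0 <= C & forall t, `|flat p t| <= C * `|t|.
Proof.
have [C C0 HC] := @pow_expR_bound R (size p).+1 1 ltr01.
pose S := \sum_(i < size p) `|p`_i|; have S0 : 0 <= S by exact: sumr_ge0.
exists (S * C) => [|t]; first by rewrite mulr_ge0 // ltW.
rewrite /flat; case: ifP => t0; last by rewrite normr0 !mulr_ge0 // ltW.
have u0 : 0 <= t^-1 by rewrite invr_ge0 ltW.
have hp : `|p.[t^-1]| <= S * (1 + t^-1) ^+ size p.
  rewrite horner_coef mulr_suml; apply: le_trans (ler_norm_sum _ _ _) _; apply: ler_sum => i _.
  rewrite normrM ler_wpM2l // normrX ger0_norm //; apply: le_trans (_ : (1 + t^-1) ^+ i <= _).
    by rewrite lerXn2r ?nnegrE ?addr_ge0 // lerDr.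
  by rewrite ler_weXn2l ?lerDl // ltnW.
rewrite normrM (ger0_norm (expR_ge0 _)) (gtr0_norm t0).
have := HC _ u0; rewrite mul1r exprSr => h.
apply: le_trans (ler_wpM2r (expR_ge0 _) hp) _; rewrite -!mulrA; apply: ler_wpM2l => //.
have ut : t^-1 * t = 1 by rewrite mulVf ?gt_eqF.
have : 0 <= (1 + t^-1) ^+ size p * expR (- t^-1) by rewrite mulr_ge0 ?exprn_ge0 ?addr_ge0 ?expR_ge0.
set X := _ * expR _ => X0.
have {}h : X * (1 + t^-1) <= C by rewrite /X mulrAC.
rewrite -[X]mulr1 -ut mulrA; apply: ler_wpM2r; first exact: ltW.
by apply: le_trans h; apply: ler_wpM2l => //; rewrite lerDr.
Qed.

Lemma flat_derive p (t : R) : is_derive t 1 (flat p) (flat ('X^2 * (p - p^`())) t).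
Proof.
have [t0|t0|t0] := ltgtP 0 t.
- have d1 := is_derive1_comp (is_derive_poly p t^-1) (is_deriveV (f := id) (lt0r_neq0 t0) (is_derive_id t 1)).
  have dn := is_deriveN (is_deriveV (f := id) (lt0r_neq0 t0) (is_derive_id t 1)).
  have d2 := @is_derive1_comp _ (@expR R) (fun s => - s^-1) t _ _ (is_derive_expR (- t^-1)) dn.
  have h : is_derive t 1 (fun s => p.[s^-1] * expR (- s^-1)) (flat ('X^2 * (p - p^`())) t).
    apply: (is_derive_eqf (is_deriveM d1 d2)) => //.
    rewrite /flat t0 !hornerE /GRing.scale /= mulr1 -exprVn; ring.
  apply: near_eq_is_derive h; near=> s; rewrite /flat; case: ifPn => // /negP; case.
  by near: s; exact: lt_nbhsr.
- rewrite {2}/flat ltNge ltW //=; apply: near_eq_is_derive (is_derive_cst (0 : R) t 1).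
  near=> s; rewrite /flat ltNge ltW //; near: s; exact: lt_nbhsl.
rewrite -t0 {2}/flat ltxx; have [C C0 HC] := flat_bound ('X * p).
have cv : h^-1 *: ((flat p \o shift 0) (h *: (1 : R)) - flat p 0) @[h --> (0 : R)^'] --> (0 : R).
  apply/cvgrPdist_le => e e0; near=> h.
  have h0 : h != 0 by near: h; exact: nbhs_dnbhs_neq.
  rewrite sub0r normrN /= addr0 {2}/flat ltxx subr0 /GRing.scale /= mulr1.
  have -> : h^-1 * flat p h = flat ('X * p) h.
    by rewrite /flat; case: ifP => _; [rewrite hornerM hornerX mulrA|rewrite mulr0].
  apply: le_trans (HC h) _; apply: le_trans (_ : (C + 1) * `|h| <= _).
    by rewrite ler_wpM2r // lerDl.
  rewrite -ler_pdivlMl ?ltr_wpDl //; near: h.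
  apply: dnbhs0_le; rewrite mulr_gt0 // invr_gt0 ltr_wpDl //.
apply: DeriveDef; first by apply/cvg_ex; exists 0.
by rewrite /derive; apply: cvg_lim.
Unshelve. all: by end_near.
Qed.

Lemma smooth1_flat p : smooth1 (flat p).
Proof.
apply: (smooth1_class (S := [set F | exists q, F = flat q])); last by exists p.
move=> _ [q ->]; split=> [x|]; first by have [] := flat_derive q x.
exists ('X^2 * (q - q^`())); apply/funext => x.
by rewrite derive1E (@derive_val _ _ _ _ _ _ _ (flat_derive q x)).
Qed.

(** A transition from 0 to 1 without a quotient: the argument of the outer [flat] is 1 for [t <= 0]
    and at most 0, where [flat] vanishes, for [t >= 1]. The factor [expR 1] normalizes [flat 1 1] to
    1. *)
Definition step (t : R) := 1 - expR 1 * flat 1 (1 - expR 1 * flat 1 t).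

Lemma flat1E t : flat 1 t = if 0 < t then expR (- t^-1) else 0.
Proof. by rewrite /flat -polyC1 hornerC mul1r. Qed.

Lemma flat1_ge0 t : 0 <= flat 1 t.
Proof. by rewrite flat1E; case: ifP => // _; rewrite expR_ge0. Qed.

Lemma flat1_le t : t <= 1 -> expR 1 * flat 1 t <= 1.
Proof.
move=> t1; rewrite flat1E; case: ifP => t0; last by rewrite mulr0.
by rewrite -expRD -[leRHS]expR0 ler_expR subr_le0 invf_ge1.
Qed.

Lemma flat1_ge t : 1 <= t -> 1 <= expR 1 * flat 1 t.
Proof.
move=> t1; have t0 : 0 < t := lt_le_trans ltr01 t1.
by rewrite flat1E t0 -expRD -[leLHS]expR0 ler_expR subr_ge0 invf_le1.
Qed.

Lemma step_ge0 t : 0 <= step t.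
Proof.
by rewrite subr_ge0 flat1_le // gerBl mulr_ge0 ?expR_ge0 ?flat1_ge0.
Qed.

Lemma step_le1 t : step t <= 1.
Proof. by rewrite gerBl mulr_ge0 ?expR_ge0 ?flat1_ge0. Qed.

Lemma step0 t : t <= 0 -> step t = 0.
Proof.
move=> t0; rewrite /step (flat1E t) ltNge t0 /= mulr0 subr0.
by rewrite flat1E ltr01 invr1 -expRD subrr expR0 subrr.
Qed.

Lemma step1 t : 1 <= t -> step t = 1.
Proof.
move=> t1; rewrite /step [flat 1 (1 - _)]flat1E ltNge subr_le0 flat1_ge //=.
by rewrite mulr0 subr0.
Qed.

Lemma smooth1_step : smooth1 step.
Proof.
apply: sfun1_smooth.
have af (a b : R) F : smooth1 F -> sfun1 (fun t => a + b * F t).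
  by move=> Fs; apply: (sfun1_comp (F := fun t => a + b * t)); [exact: smooth1_aff|exact: sfun1_base].
have h : sfun1 (fun t => 1 + - expR 1 * flat 1 (1 + - expR 1 * flat 1 t)).
  apply: (sfun1_comp (F := fun t => 1 + - expR 1 * flat 1 t)).
    by apply: sfun1_smooth; apply: af; exact: smooth1_flat.
  by apply: af; exact: smooth1_flat.
rewrite (_ : step = fun t => 1 + - expR 1 * flat 1 (1 + - expR 1 * flat 1 t)) //.
by apply/funext => t; rewrite /step !mulNr.
Qed.

(** Outside [[0, 1]] the function is locally constant, so its derivatives are bounded by their
    maxima on the segment. *)
Lemma step_bd m : exists2 C, 0 <= C & forall t, `|step^`(m)%classic t| <= C.
Proof.
case: m => [|m].
  by exists 1 => // t /=; rewrite ger0_norm ?step_ge0 // step_le1.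
have cf : {within `[0, 1], continuous (fun t => `|step^`(m.+1)%classic t|)}.
  apply: continuous_subspaceT => x; apply: continuous_comp; last exact: norm_continuous.
  apply: differentiable_continuous; apply/derivable1_diffP; exact: smooth1_step.
have [c _ hc] := EVT_max (ler01 : (0 : R) <= 1) cf.
have loc (U : set R) a t : open U -> (forall s, U s -> step s = a) -> U t -> step^`(m.+1)%classic t = 0.
  move=> oU Ua; elim: m t {cf c hc} => [|m IH] t Ut.
    rewrite derive1nS derive1E (near_eq_derive (g := cst a)) ?derive_cst //.
    by near=> s; apply: Ua; near: s; exact: open_nbhs_nbhs.
  rewrite derive1nS derive1E (near_eq_derive (g := cst 0)) ?derive_cst //.
  by near=> s; apply: IH; near: s; exact: open_nbhs_nbhs.
exists (`|step^`(m.+1)%classic c|) => // t.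
have [t0|t0] := ltP t 0.
  by rewrite (loc _ 0 t (@open_lt _ 0)) ?normr0 // => s /ltW; exact: step0.
have [t1|t1] := ltP 1 t.
  by rewrite (loc _ 1 t (@open_gt _ 1)) ?normr0 // => s /ltW; exact: step1.
by apply: hc; rewrite in_itv /= t0.
Unshelve. all: by end_near.
Qed.

End Step.

Section Schwartz.
Context {R : realType} {n : nat}.
Implicit Types (f g : 'rV[R]_n -> R) (x : 'rV[R]_n) (s t : seq 'I_n).

Lemma coord_le_norm x i : `|x ord0 i| <= `|x|.
Proof.
rewrite {2}/Num.Def.normr /= mx_normrE.
exact: (le_bigmax _ (fun ij => `|x ij.1 ij.2|) (ord0, i)).
Qed.

Lemma norm_le_coord x (B : R) : 0 <= B -> (forall i, `|x ord0 i| <= B) -> `|x| <= B.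
Proof.
move=> B0 h; rewrite /Num.Def.normr /= mx_normrE; apply: bigmax_le => // -[i j] _ /=.
by rewrite (ord1 i).
Qed.

(** The multipliers of the Schwartz space. *)
Definition slow f := smooth f /\ forall s, exists C N, 0 <= C /\
  forall x, `|pds s f x| <= C * (1 + `|x|) ^+ N.

Lemma norm_ge1 x : 1 <= 1 + `|x|. Proof. by rewrite lerDl. Qed.

Lemma slow_max f s : slow f -> exists C N, 0 <= C /\
  forall t, (size t <= size s)%N -> forall x, `|pds t f x| <= C * (1 + `|x|) ^+ N.
Proof.
move=> [_ h]; have /choice[CN HCN] : forall t, exists cn : R * nat, 0 <= cn.1 /\
    forall x, `|pds t f x| <= cn.1 * (1 + `|x|) ^+ cn.2.
  by move=> t; have [C [N ?]] := h t; exists (C, N).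
pose C := \sum_(l < (size s).+1) \sum_(t : l.-tuple 'I_n) (CN t).1.
pose N := (\sum_(l < (size s).+1) \sum_(t : l.-tuple 'I_n) (CN t).2)%N.
exists C, N; split=> [|t ts x].
  by apply: sumr_ge0 => l _; apply: sumr_ge0 => t _; case: (HCN t).
have [c0 ht] := HCN t; apply: le_trans (ht x) _; apply: ler_pM; rewrite ?exprn_ge0 ?addr_ge0 //.
  rewrite /C (bigD1 (Ordinal (ts : (size t < (size s).+1)%N))) //= (bigD1 (in_tuple t)) //=.
  rewrite -addrA lerDl addr_ge0 //; first by apply: sumr_ge0 => u _; case: (HCN u).
  by apply: sumr_ge0 => l _; apply: sumr_ge0 => u _; case: (HCN u).
apply: ler_weXn2l; first exact: norm_ge1.
rewrite /N (bigD1 (Ordinal (ts : (size t < (size s).+1)%N))) //= (bigD1 (in_tuple t)) //=.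
by rewrite -addnA leq_addr.
Qed.

Lemma slowM f g : slow f -> slow g -> slow (fun x => f x * g x).
Proof.
move=> hf hg; have [fs _] := hf; have [gs _] := hg; split; first exact: smoothM.
move=> s; have [C [N [C0 HC]]] := slow_max s hf; have [D [M [D0 HD]]] := slow_max s hg.
exists (2 ^+ size s * (C * D)), (N + M)%N; split=> [|x]; first by rewrite !mulr_ge0 ?exprn_ge0.
have P0 K : 0 <= (1 + `|x|) ^+ K by rewrite exprn_ge0 ?addr_ge0.
have := @pds_prod_bound _ _ s f g x (C * (1 + `|x|) ^+ N) (D * (1 + `|x|) ^+ M) fs gs.
rewrite !mulr_ge0 // => /(_ isT isT) h.
apply: le_trans (h _ _) _ => [t ts|t ts|]; [exact: HC|exact: HD|].
by rewrite exprD -!mulrA; apply: ler_wpM2l; rewrite ?exprn_ge0 // ler_wpM2l // mulrCA.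
Qed.

Lemma slowD f g : slow f -> slow g -> slow (fun x => f x + g x).
Proof.
move=> [fs hf] [gs hg]; split; first exact: smoothD.
move=> s; have [C [N [C0 HC]]] := hf s; have [D [M [D0 HD]]] := hg s.
exists (C + D), (N + M)%N; split=> [|x]; first exact: addr_ge0.
rewrite pdsD //; apply: le_trans (ler_normD _ _) _; rewrite mulrDl; apply: lerD.
  by apply: le_trans (HC x) _; rewrite ler_wpM2l // ler_weXn2l ?norm_ge1 ?leq_addr.
by apply: le_trans (HD x) _; rewrite ler_wpM2l // ler_weXn2l ?norm_ge1 ?leq_addl.
Qed.

Lemma pds_cst0 s (c : R) x : (0 < size s)%N -> pds s (fun _ => c) x = 0.
Proof.
elim/last_ind: s c => [//|s i IH] c _; rewrite pds_rcons pd_cst.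
by case: (posnP (size s)) => [/size0nil -> //|/IH].
Qed.

Lemma slow_cst (c : R) : slow (fun _ => c).
Proof.
split=> [|s]; first exact: smooth_cst.
exists `|c|, 0%N; split=> // x; rewrite expr0 mulr1; case: (posnP (size s)) => [/size0nil -> //|h].
by rewrite pds_cst0 // normr0.
Qed.

Lemma slow_coord i : slow (fun x => x ord0 i).
Proof.
split=> [|s]; first exact: smooth_coord.
exists 1, 1%N; split=> // x; rewrite mul1r expr1; elim/last_ind: s => [|s j _].
  by apply: le_trans (coord_le_norm x i) _; rewrite lerDr.
rewrite pds_rcons pd_coord; case: (posnP (size s)) => [/size0nil -> /=|h].
  by case: (i == j); rewrite ?normr1 ?normr0 ?norm_ge1 // addr_ge0.
by rewrite pds_cst0 // normr0 addr_ge0.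
Qed.

Lemma slow_prod (I : Type) (r : seq I) (P : pred I) (f : I -> 'rV[R]_n -> R) :
  (forall i, P i -> slow (f i)) -> slow (fun x => \prod_(i <- r | P i) f i x).
Proof.
move=> h; elim: r => [|a r IH].
  by under eq_fun do rewrite big_nil; exact: slow_cst.
case Pa : (P a); under eq_fun do rewrite big_cons Pa; last exact: IH.
by apply: slowM => //; exact: h.
Qed.

Lemma slow_sum (I : Type) (r : seq I) (P : pred I) (f : I -> 'rV[R]_n -> R) :
  (forall i, P i -> slow (f i)) -> slow (fun x => \sum_(i <- r | P i) f i x).
Proof.
move=> h; elim: r => [|a r IH].
  by under eq_fun do rewrite big_nil; exact: slow_cst.
case Pa : (P a); under eq_fun do rewrite big_cons Pa; last exact: IH.
by apply: slowD => //; exact: h.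
Qed.

Lemma slowX f a : slow f -> slow (fun x => f x ^+ a).
Proof.
move=> hf; elim: a => [|a IH]; first by under eq_fun do rewrite expr0; exact: slow_cst.
by under eq_fun do rewrite exprS; exact: slowM.
Qed.

Lemma slow_step (c e : R) i : slow (fun x => step (c + e * x ord0 i)).
Proof.
split=> [|s].
  apply: smooth_comp; first exact: smooth1_step.
  by apply: smoothD; [exact: smooth_cst|apply: smoothM; [exact: smooth_cst|exact: smooth_coord]].
have [C C0 HC] := @step_bd R (size s); exists (`|e| ^+ size s * C), 0%N.
split=> [|x]; first by rewrite mulr_ge0 ?exprn_ge0.
rewrite expr0 mulr1; apply: le_trans (pds_affine _ _ _ _ _ (@smooth1_step R)) _.
by rewrite ler_wpM2l ?exprn_ge0.
Qed.

Lemma schwartz_slow f g : schwartz f -> slow g -> schwartz (fun x => f x * g x).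
Proof.
move=> [fs hf] hg; have [gs _] := hg; split; first exact: smoothM.
move=> s m; have [D [M [D0 HD]]] := slow_max s hg.
have hw t : exists C, 0 <= C /\ forall x, (1 + `|x|) ^+ (m + M) * `|pds t f x| <= C.
  have [C1 h1] := hf t 0%N; have [C2 h2] := hf t (m + M)%N.
  have C10 : 0 <= C1 by apply: le_trans (h1 0); rewrite mulr_ge0 ?exprn_ge0.
  have C20 : 0 <= C2 by apply: le_trans (h2 0); rewrite mulr_ge0 ?exprn_ge0.
  exists (2 ^+ (m + M) * (C1 + C2)); split=> [|x]; first by rewrite mulr_ge0 ?exprn_ge0 ?addr_ge0.
  have : (1 + `|x|) ^+ (m + M) <= 2 ^+ (m + M) * (1 + `|x| ^+ (m + M)).
    have [x1|x1] := leP `|x| 1.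
      apply: le_trans (_ : 2 ^+ (m + M) * 1 <= _).
        by rewrite mulr1 lerXn2r ?nnegrE ?addr_ge0 // -[leRHS]/(1 + 1) lerD2l.
      by rewrite ler_wpM2l ?exprn_ge0 // lerDl exprn_ge0.
    apply: le_trans (_ : 2 ^+ (m + M) * `|x| ^+ (m + M) <= _).
      rewrite -exprMn lerXn2r ?nnegrE ?addr_ge0 ?mulr_ge0 //.
      by rewrite mulr_natl mulr2n lerD2r ltW.
    by rewrite ler_wpM2l ?exprn_ge0 // lerDr.
  move=> /(ler_wpM2r (normr_ge0 (pds t f x))) /le_trans; apply.
  rewrite -mulrA ler_wpM2l ?exprn_ge0 // mulrDl mul1r lerD //.
  by have := h1 x; rewrite expr0 mul1r.
have /choice[C HC] := hw.
pose CC := \sum_(l < (size s).+1) \sum_(t : l.-tuple 'I_n) C t.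
exists (2 ^+ size s * (CC * D)) => x.
have P0 K : 0 < (1 + `|x|) ^+ K by rewrite exprn_gt0 // ltr_wpDr.
have fA t : (size t <= size s)%N -> `|pds t f x| <= CC / (1 + `|x|) ^+ (m + M).
  move=> ts; rewrite ler_pdivlMr // mulrC; have [c0 ht] := HC t; apply: le_trans (ht x) _.
  rewrite /CC (bigD1 (Ordinal (ts : (size t < (size s).+1)%N))) //= (bigD1 (in_tuple t)) //=.
  rewrite -addrA lerDl addr_ge0 //; first by apply: sumr_ge0 => u _; case: (HC u).
  by apply: sumr_ge0 => l _; apply: sumr_ge0 => u _; case: (HC u).
have CC0 : 0 <= CC.
  by apply: sumr_ge0 => l _; apply: sumr_ge0 => u _; case: (HC u).
have := @pds_prod_bound _ _ s f g x (CC / (1 + `|x|) ^+ (m + M)) (D * (1 + `|x|) ^+ M) fs gs.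
rewrite divr_ge0 ?(ltW (P0 _)) // mulr_ge0 ?(ltW (P0 _)) // => /(_ isT isT fA (fun t ts => HD t ts x)) h.
apply: le_trans (ler_wpM2l _ h) _; first by rewrite exprn_ge0.
rewrite mulrCA ler_wpM2l ?exprn_ge0 //.
have -> : `|x| ^+ m * (CC / (1 + `|x|) ^+ (m + M) * (D * (1 + `|x|) ^+ M)) =
    CC * D * (`|x| ^+ m / (1 + `|x|) ^+ m).
  by rewrite exprD; field; rewrite !(lt0r_neq0 (P0 _)).
by rewrite ler_piMr ?mulr_ge0 // ler_pdivrMr // mul1r lerXn2r ?nnegrE ?addr_ge0 // lerDr.
Qed.

Lemma schwartzD (a b : R) f g : schwartz f -> schwartz g -> schwartz (fun x => a * f x + b * g x).
Proof.
move=> [fs hf] [gs hg]; have sZ (c : R) h : smooth h -> smooth (fun x => c * h x).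
  by move=> hs; apply: smoothM => //; exact: smooth_cst.
split; first by apply: smoothD; exact: sZ.
move=> s m; have [C HC] := hf s m; have [D HD] := hg s m; exists (`|a| * C + `|b| * D) => x.
rewrite pdsD ?pdsZ //; [|exact: sZ..].
apply: le_trans (ler_wpM2l _ (ler_normD _ _)) _; first by rewrite exprn_ge0.
by rewrite mulrDr !normrM lerD // mulrCA ler_wpM2l.
Qed.

Lemma smooth_continuous f : smooth f -> continuous f.
Proof. by move=> fs x; apply: differentiable_continuous; exact: smooth_diff. Qed.

Lemma testfun_schwartz f : testfun f -> schwartz f.
Proof.
move=> [fs [r fr]]; split=> // s m.
have oU : open [set x : 'rV[R]_n | r < `|x|].
  apply: (@open_comp _ _ (fun x : 'rV[R]_n => `|x|) [set y | r < y]); last exact: open_gt.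
  by move=> x _; exact: norm_continuous.
have z x : r < `|x| -> pds s f x = 0 by move=> rx; exact: (pds_zero s oU fr).
pose F x : R := `|x| ^+ m * `|pds s f x|.
have cF : continuous F.
  have c1 : continuous (fun x : 'rV[R]_n => `|x| ^+ m).
    move=> x; apply: (@continuous_comp _ _ _ (fun x : 'rV[R]_n => `|x|) (fun y => y ^+ m)).
      exact: norm_continuous.
    exact: exprn_continuous.
  have c2 : continuous (fun x : 'rV[R]_n => `|pds s f x|).
    move=> x; apply: (@continuous_comp _ _ _ (pds s f) (fun y => `|y|)); last exact: norm_continuous.
    by apply: smooth_continuous; exact: smooth_pds.
  by move=> x; exact: (continuousM (c1 x) (c2 x)).
have [r0|r0] := ltP r 0.
  exists 0 => x; rewrite z ?normr0 ?mulr0 //; exact: lt_le_trans (normr_ge0 _).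
have cK : compact [set x : 'rV[R]_n | `|x| <= r].
  apply: bounded_closed_compact; first by exists r; split; [exact: num_real|move=> y ry x /= xr; exact: le_trans (ltW ry)].
  rewrite (_ : [set x | _] = (fun x : 'rV[R]_n => `|x|) @^-1` [set y | y <= r]) //.
  apply: closed_comp => [x _|]; [exact: norm_continuous|exact: closed_le].
have K0 : [set x : 'rV[R]_n | `|x| <= r] !=set0 by exists 0; rewrite /= normr0.
have [c _ hc] := @EVT_max_rV R n F _ K0 cK (continuous_subspaceT cF).
exists (F c) => x; have [xr|xr] := leP `|x| r; first by apply: (hc x); exact/mem_set.
by rewrite z // normr0 mulr0 mulr_ge0 ?exprn_ge0.
Qed.

Definition psum x : R := \sum_i x ord0 i.

Lemma pds_expsum s (M : R) x : pds s (fun x => expR (- (M * psum x))) x =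
  (- M) ^+ size s * expR (- (M * psum x)).
Proof.
have sp : smooth (fun x : 'rV[R]_n => - (M * psum x)).
  rewrite (_ : (fun x => _) = fun x => - M * psum x); last by apply/funext => y; rewrite mulNr.
  by apply: smoothM; [exact: smooth_cst|apply: smooth_sum => i _; exact: smooth_coord].
have se : smooth (fun x : 'rV[R]_n => expR (- (M * psum x))).
  by apply: smooth_comp => //; exact: smooth1_expR.
elim/last_ind: s => [|s i IH]; first by rewrite expr0 mul1r.
rewrite pds_rcons (_ : pd i _ = fun x => - M * expR (- (M * psum x))); last first.
  apply/funext => y; rewrite (pd_comp (F := expR) (f := fun x => - (M * psum x))) //; last exact: smooth_diff.
  rewrite derive1E (@derive_val _ _ _ _ _ _ _ (is_derive_expR _)) mulrC; congr (_ * _).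
  rewrite (_ : (fun x => _) = fun x : 'rV[R]_n => - M * psum x); last by apply/funext => z; rewrite mulNr.
  have hs : smooth (fun x : 'rV[R]_n => psum x) by apply: smooth_sum => j _; exact: smooth_coord.
  rewrite pdM; [|exact: smooth_diff (smooth_cst _)|exact: smooth_diff].
  rewrite pd_cst mul0r add0r -[RHS]mulr1; congr (_ * _).
  have -> : pd i (fun x => psum x) y = \sum_j pd i (fun x => x ord0 j) y.
    rewrite /psum; elim: (index_enum _) => [|j r IHr].
      by under eq_fun do rewrite big_nil; rewrite pd_cst big_nil.
    under eq_fun do rewrite big_cons; rewrite pdD ?IHr ?big_cons //.
      exact: smooth_diff (smooth_coord _).
    by apply: smooth_diff; apply: smooth_sum => l _; exact: smooth_coord.
  rewrite (bigD1 i) //= pd_coord eqxx big1 ?addr0 // => j /negPf ji.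
  by rewrite pd_coord ji.
by rewrite pdsZ // IH size_rcons exprS mulrA.
Qed.

(** For [c > 0] this is 1 on the closed orthant and 0 as soon as a coordinate is at most [- 2 / c]:
    it turns exponentials into Schwartz functions without changing them on the orthant. A large [c]
    keeps the support close to the orthant, which matters for positivity and for the range of the
    Szasz operators. *)
Definition Hcut (c : R) x : R := \prod_i step (2 + c * x ord0 i).

Lemma slow_Hcut c : slow (Hcut c).
Proof. by apply: slow_prod => i _; exact: slow_step. Qed.

Lemma Hcut_ge0 c x : 0 <= Hcut c x.
Proof. by apply: prodr_ge0 => i _; exact: step_ge0. Qed.

Lemma Hcut1 c x : 0 <= c -> (forall i, 0 <= x ord0 i) -> Hcut c x = 1.
Proof.
move=> c0 x0; rewrite /Hcut big1 // => i _; apply: step1.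
have : 0 <= c * x ord0 i by rewrite mulr_ge0.
by clear; move=> *; lra.
Qed.

Lemma Hcut0 c x i : 0 < c -> x ord0 i <= - (2 / c) -> Hcut c x = 0.
Proof.
move=> c0 xi; rewrite /Hcut (bigD1 i) //= step0 ?mul0r //.
have e : c * (2 / c) = 2 by rewrite mulrC divfK ?gt_eqF.
by have := ler_wpM2l (ltW c0) xi; rewrite mulrN e; move: (c * x ord0 i) => y; clear; lra.
Qed.

Lemma schwartz_expcut (c M : R) : 0 < c -> 0 < M ->
  schwartz (fun x => Hcut c x * expR (- (M * psum x))).
Proof.
move=> c0 M0; have [Hs _] := slow_Hcut c.
have se : smooth (fun x : 'rV[R]_n => expR (- (M * psum x))).
  apply: smooth_comp; first exact: smooth1_expR.
  rewrite (_ : (fun x => _) = fun x => - M * psum x); last by apply/funext => y; rewrite mulNr.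
  by apply: smoothM; [exact: smooth_cst|apply: smooth_sum => i _; exact: smooth_coord].
split; first exact: smoothM.
move=> s m; have [D [N [D0 HD]]] := slow_max s (slow_Hcut c).
pose A := Num.max 1 M; have A1 : 1 <= A by rewrite le_max lexx.
(* On the support every coordinate is at least [- 2 / c], so [|x| <= psum x + B]: decay in [psum] is
   decay in the norm. *)
pose B := n.+1%:R * (2 / c); have c20 : 0 < 2 / c by rewrite divr_gt0.
have [C C0 HC] := @pow_expR_bound R (m + N) M M0.
exists (2 ^+ size s * (D * A ^+ size s * (expR (M * B) * C))) => x.
have rhs0 : 0 <= 2 ^+ size s * (D * A ^+ size s * (expR (M * B) * C)).
  by rewrite !mulr_ge0 ?exprn_ge0 ?expR_ge0 ?(le_trans ler01 A1) // ltW.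
have oU i : open [set x : 'rV[R]_n | x ord0 i < - (2 / c)].
  apply: (@open_comp _ _ (fun x : 'rV[R]_n => x ord0 i) [set y | y < - (2 / c)]); last exact: open_lt.
  by move=> y _; exact: coord_continuous.
have [[i xi]|/forallNP hx] := pselect (exists i, x ord0 i < - (2 / c)).
  rewrite (pds_zero s (oU i)) ?normr0 ?mulr0 // => y /ltW yi.
  by rewrite (Hcut0 c0 yi) mul0r.
have {}hx i : - (2 / c) <= x ord0 i by rewrite leNgt; apply/negP; exact: hx.
have nx : `|x| <= psum x + B.
  have pj j : x ord0 j + 2 / c <= psum x + n%:R * (2 / c).
    rewrite /psum [n%:R * _](_ : _ = \sum_(i < n) (2 / c)); last by rewrite sumr_const card_ord mulr_natl.
    rewrite -big_split (bigD1 j) //= lerDl sumr_ge0 // => i _.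
    by rewrite -lerBlDr sub0r.
  have B' : B = n%:R * (2 / c) + 2 / c by rewrite /B -natr1 mulrDl mul1r.
  have s0 : 0 <= psum x + n%:R * (2 / c).
    rewrite /psum [n%:R * _](_ : _ = \sum_(i < n) (2 / c)); last by rewrite sumr_const card_ord mulr_natl.
    rewrite -big_split sumr_ge0 // => i _; by rewrite -lerBlDr sub0r.
  apply: norm_le_coord => [|j]; first by rewrite B' addrA addr_ge0 // ltW.
  rewrite ler_norml; move: (pj j) (hx j) s0; rewrite B'; move: (2 / c) c20 => u; move: (n%:R * u) => v.
  by clear; move=> u0 h1 h2 h3; apply/andP; split; lra.
have hD t : (size t <= size s)%N -> `|pds t (fun x => expR (- (M * psum x))) x| <=
    A ^+ size s * expR (- (M * psum x)).
  move=> ts; rewrite pds_expsum normrM (ger0_norm (expR_ge0 _)) ler_wpM2r ?expR_ge0 //.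
  rewrite normrX normrN (gtr0_norm M0); apply: le_trans (_ : A ^+ size t <= _).
    by rewrite lerXn2r ?nnegrE ?(ltW M0) ?(le_trans ler01 A1) // le_max lexx orbT.
  by rewrite ler_weXn2l.
have P0 K : 0 <= (1 + `|x|) ^+ K by rewrite exprn_ge0 ?addr_ge0.
have := @pds_prod_bound _ _ s (Hcut c) (fun x => expR (- (M * psum x))) x (D * (1 + `|x|) ^+ N)
  (A ^+ size s * expR (- (M * psum x))) Hs se.
rewrite mulr_ge0 // mulr_ge0 ?exprn_ge0 ?expR_ge0 ?(le_trans ler01 A1) //.
move=> /(_ isT isT (fun t ts => HD t ts x) hD) h.
apply: le_trans (ler_wpM2l _ h) _; first by rewrite exprn_ge0.
rewrite mulrCA ler_wpM2l ?exprn_ge0 //.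
rewrite [leLHS](_ : _ = D * A ^+ size s * (`|x| ^+ m * (1 + `|x|) ^+ N * expR (- (M * psum x)))); last by ring.
apply: ler_wpM2l; first by rewrite mulr_ge0 ?exprn_ge0 ?(le_trans ler01 A1).
apply: le_trans (_ : (1 + `|x|) ^+ (m + N) * (expR (M * B) * expR (- (M * `|x|))) <= _).
  apply: ler_pM; rewrite ?mulr_ge0 ?exprn_ge0 ?expR_ge0 //.
    by rewrite exprD ler_wpM2r // lerXn2r ?nnegrE ?addr_ge0 // lerDr.
  rewrite -expRD ler_expR -mulrN -mulrN -mulrDr; apply: ler_wpM2l; first exact: ltW.
  by move: nx; clear; move: (psum x) B => p q; move: (`|x|) => N h; lra.
by rewrite mulrCA ler_wpM2l ?expR_ge0 // HC.
Qed.

End Schwartz.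

(** * Laguerre-Selberg integrals and the Gamma function on the real line *)

(** The concave power lies below its tangent at [t]. Integrating this inequality and then choosing
    [t] gives log-convexity, in place of Hoelder's inequality. *)
Lemma amgm_powR (R : realType) (s t D : R) : 0 <= s -> s <= 1 -> 0 < t -> 0 < D ->
  D `^ s <= (1 - s) * t `^ s + s * t `^ (s - 1) * D.
Proof.
move=> s0 s1 t0 D0; pose y := ln D - ln t.
have E1 : D `^ s = t `^ s * expR (s * y).
  by rewrite /powR !gt_eqF // -expRD /y; congr expR; ring.
have E2 : t `^ (s - 1) * D = t `^ s * expR y.
  rewrite /powR !gt_eqF // -{1}(lnK D0) -!expRD /y; congr expR; ring.
rewrite -mulrA E2 E1 mulrCA [X in X + _]mulrC -mulrDr; apply: ler_wpM2l; first exact: powR_ge0.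
have h1 : 1 + - (s * y) <= expR (- (s * y)) := expR_ge1Dx _.
have h2 : 1 + (1 - s) * y <= expR ((1 - s) * y) := expR_ge1Dx _.
have e2 : expR y = expR (s * y) * expR ((1 - s) * y) by rewrite -expRD; congr expR; ring.
have e1 : 1 = expR (s * y) * expR (- (s * y)) by rewrite -expRD subrr expR0.
rewrite e2 -[X in X + _]mulr1 [X in _ * X + _]e1.
have -> : (1 - s) * (expR (s * y) * expR (- (s * y))) + s * (expR (s * y) * expR ((1 - s) * y)) =
  expR (s * y) * ((1 - s) * expR (- (s * y)) + s * expR ((1 - s) * y)) by ring.
rewrite -[leLHS]mulr1; apply: ler_wpM2l; first exact: expR_ge0.
have : (1 - s) * (1 + - (s * y)) + s * (1 + (1 - s) * y) <=
    (1 - s) * expR (- (s * y)) + s * expR ((1 - s) * y).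
  by apply: lerD; apply: ler_wpM2l => //; rewrite subr_ge0.
by apply: le_trans; rewrite le_eqVlt; apply/orP; left; apply/eqP; ring.
Qed.

Section SelbergLaguerre.
Context {R : realType} {n : nat}.
Variable lam : {measure set (RnB R n) -> \bar R}.
Hypothesis hlam : is_lebesgue_Rn lam.
Variable k : R.
Hypothesis k0 : 0 < k.
Implicit Types (x : RnB R n) (al : R).
Local Notation orth := (@Rplus_n R n).
Local Notation prs := (@pairs n predT).

Lemma Rint_gt0 (f : RnB R n -> R) (a b : 'rV[R]_n) : lam.-integrable orth (EFin \o f) ->
  (forall x, orth x -> 0 <= f x) -> (forall i, a ord0 i < b ord0 i) -> cbox a b `<=` orth ->
  (forall x, cbox a b x -> 0 < f x) -> 0 < Rintegral lam orth f.
Proof.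
move=> fi f0 ab sub fb; have mO := @orthant_measurable R n.
have I0 : (0 <= \int[lam]_(x in orth) (EFin \o f) x)%E.
  by apply: integral_ge0 => x xO; rewrite lee_fin f0.
rewrite lt_neqAle /Rintegral fine_ge0 // andbT eq_sym; apply/negP => /eqP I.
have Ie : (\int[lam]_(x in orth) `|(EFin \o f) x| = 0)%E.
  rewrite (eq_integral (EFin \o f)) => [|x /set_mem xO].
    by rewrite -[LHS]fineK ?I //; exact: integrable_fin_num.
  by rewrite /= ger0_norm ?f0.
have mf := measurable_int lam fi.
have [N [mN N0 sN]] := (ae_eq_integral_abs lam mO mf).1 Ie.
have : (lam (cbox a b) <= lam N)%E.
  apply: le_measure; [by apply/mem_set; exact: cbox_measurable|exact/mem_set|].
  move=> x xb; apply: sN => /(_ (sub _ xb)) /= [fx0].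
  by have := fb x xb; rewrite fx0 ltxx.
rewrite N0 (cbox_lam hlam) => [|i]; last exact: ltW.
by apply/negP; rewrite -ltNge lte_fin prodr_gt0 // => i _; rewrite subr_gt0.
Qed.

(** A box near [(1, 2, ..., n)] avoids the diagonals and the walls of the orthant, so the weights
    are positive on it. *)
Definition stair (d : R) : 'rV[R]_n := \row_i (i.+1%:R + d).

Lemma stair_orth : cbox (stair 0) (stair (1 / 2)) `<=` orth.
Proof.
move=> x /= h i; have /andP[+ _] := h i; rewrite mxE addr0 => /lt_le_trans; apply.
by rewrite ltr0n.
Qed.

Lemma stair_lt i : (stair 0) ord0 i < (stair (1 / 2)) ord0 i.
Proof. by rewrite !mxE ltrD2l divr_gt0. Qed.

Lemma stair_neq x i j : cbox (stair 0) (stair (1 / 2)) x -> i != j -> x ord0 i != x ord0 j.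
Proof.
move=> h ij; have := h i; have := h j; rewrite !mxE => /andP[a1 a2] /andP[b1 b2].
apply/eqP => e; have : (i < j)%N || (j < i)%N by rewrite -neq_ltn.
case/orP => lt_ij.
  have : i.+2%:R <= j.+1%:R :> R by rewrite ler_nat.
  by rewrite -natr1; lra.
have : j.+2%:R <= i.+1%:R :> R by rewrite ler_nat.
by rewrite -natr1; lra.
Qed.

Lemma vdm_gt0 (I : pred 'I_n) x : cbox (stair 0) (stair (1 / 2)) x -> 0 < vdm (pairs I) k 0 x.
Proof.
move=> h; apply: prodr_gt0 => i _; apply: prodr_gt0 => j /and3P[_ _ ij].
by rewrite powR_gt0 // addr0 exprn_even_gt0 //= subr_eq0 (stair_neq h).
Qed.

Lemma gam_gt0 dl m x : orth x -> 0 < gam dl m x.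
Proof. by move=> xO; apply: prodr_gt0 => i _; rewrite mulr_gt0 ?powR_gt0 ?expR_gt0. Qed.

Definition Z al : R := Rintegral lam orth (wt prs k (fun _ => al) (fun _ => 1) 0).

Lemma Z_integrable al : -1 < al -> lam.-integrable orth (EFin \o wt prs k (fun _ => al) (fun _ => 1) 0).
Proof. by move=> a1; apply: wt_integrable1. Qed.

Lemma Z_gt0 al : -1 < al -> 0 < Z al.
Proof.
move=> a1; apply: (Rint_gt0 (Z_integrable a1) _ stair_lt stair_orth) => [x _|x xb]; first exact: wt_ge0.
by rewrite mulr_gt0 ?vdm_gt0 ?gam_gt0 //; exact: stair_orth.
Qed.

Lemma Dx_gt0 x : orth x -> 0 < Dx x.
Proof. by move=> xO; exact: prodr_gt0. Qed.

Lemma Dx_powR (s : R) x : orth x -> \prod_i (x ord0 i `^ s) = Dx x `^ s.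
Proof.
move=> xO; rewrite /Dx; elim: (index_enum _) => [|i r IH]; first by rewrite !big_nil powR1.
rewrite !big_cons IH powRM ?(ltW (xO i)) //.
by apply: prodr_ge0 => j _; exact: ltW.
Qed.

Lemma wt_Dx (E : rel 'I_n) al (s : R) m e x : orth x ->
  wt E k (fun _ => al + s) m e x = Dx x `^ s * wt E k (fun _ => al) m e x.
Proof.
move=> xO; rewrite /wt mulrA -Dx_powR //; congr (_ * _); rewrite /gam -big_split; apply: eq_bigr => i _ /=.
by rewrite powRD ?mulrA 1?[X in X * _]mulrC // (gt_eqF (xO i)) implybT.
Qed.

(** [D(x)] is built one coordinate at a time, Aomoto's identity giving one factor each: [c s] is the
    integral of [x_1 ... x_s]. *)
Lemma Z_rec al : -1 < al -> Z (al + 1) = \prod_(s < n) (1 + al + k * (n%:R - 1 - s%:R)) * Z al.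
Proof.
move=> a1; have mO := @orthant_measurable R n; pose A s : {set 'I_n} := finset (fun i : 'I_n => (i < s)%N).
pose c s := Rintegral lam orth (fun x => mon (fun i => (i \in A s) : nat) x *
  wt prs k (fun _ => al) (fun _ => 1) 0 x).
have h s : (s <= n)%N -> c s = \prod_(j < s) (1 + al + k * (n%:R - 1 - j%:R)) * Z al.
  elim: s => [|s IH] sn.
    rewrite big_ord0 mul1r; apply: eq_Rintegral => x _; rewrite /mon big1 ?mul1r // => i _.
    by rewrite inE expr0.
  rewrite big_ord_recr /= mulrAC -(IH (ltnW sn)) mulrC.
  pose i0 := Ordinal sn; have iA : i0 \notin A s by rewrite inE ltnn.
  have cA : #|A s| = s.
    rewrite -sum1_card (eq_bigl (fun i : 'I_n => (i < s)%N)) => [|i]; last by rewrite inE.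
    by rewrite -(big_ord_widen n (fun _ => 1%N) (ltnW sn)) sum1_card card_ord.
  have int b : lam.-integrable orth (EFin \o (fun x => mon b x * wt prs k (fun _ => al) (fun _ => 1) 0 x)).
    by apply: (@polyb_integrable _ _ _ hlam prs k k0 (fun _ => al) (fun _ => 1) 0 (mon b)) => //; exact: mon_polyb.
  have H := aomoto_identity hlam k0 a1 iA; rewrite cA in H.
  have ic (r : R) b := integrableZl mO r (int b).
  rewrite /c -(RintegralZl _ mO (int _)).
  apply/eqP; rewrite eq_sym -subr_eq0; apply/eqP; rewrite -(RintegralB mO (ic _ _) (int _)).
  rewrite -[RHS]H; apply: eq_Rintegral => x _.
  have -> : mon (fun i => (i \in A s.+1) : nat) x = x ord0 i0 * mon (fun i => (i \in A s) : nat) x.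
    rewrite -monS; apply: eq_bigr => i _; congr (_ ^+ _); rewrite !inE ltnS leq_eqVlt -val_eqE /=.
    by case: ltngtP.
  by rewrite -mulrA -mulrBl mulrA.
have := h n (leqnn n); rewrite /c => <-; apply: eq_Rintegral => x /set_mem xO.
rewrite [LHS](wt_Dx prs al 1 (fun _ => 1) 0 xO) powRr1 ?(ltW (Dx_gt0 xO)) //; congr (_ * _); apply: eq_bigr => i _.
by rewrite inE ltn_ord expr1.
Qed.

Lemma Z_logconvex al (s t : R) : -1 < al -> 0 <= s -> s <= 1 -> 0 < t ->
  Z (al + s) <= (1 - s) * t `^ s * Z al + s * t `^ (s - 1) * Z (al + 1).
Proof.
move=> a1 s0 s1 t0; have mO := @orthant_measurable R n.
have b1 : -1 < al + 1 by rewrite ltr_wpDr.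
have as1 : -1 < al + s by rewrite ltr_wpDr.
rewrite /Z -!RintegralZl //; try exact: Z_integrable.
have i1 := integrableZl mO ((1 - s) * t `^ s) (Z_integrable a1).
have i2 := integrableZl mO (s * t `^ (s - 1)) (Z_integrable b1).
rewrite -RintegralD //; apply: le_Rintegral => //; first exact: Z_integrable.
  exact: (integrableD mO i1 i2).
move=> x xO; have := wt_Dx prs al s (fun _ => 1) 0 xO; have := wt_Dx prs al 1 (fun _ => 1) 0 xO.
have := wt_ge0 prs k (fun _ => al) (fun _ => 1) 0 x.
rewrite /wt powRr1 ?(ltW (Dx_gt0 xO)) // => W0 -> ->; rewrite [X in _ <= _ + X]mulrA -mulrDl.
by apply: ler_wpM2r => //; exact: amgm_powR (Dx_gt0 xO).
Qed.

End SelbergLaguerre.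

Lemma RnB_measurable (R : realType) (n : nat) d (T : measurableType d) (f : T -> RnB R n) :
  (forall i, measurable_fun setT (fun t => (f t : 'rV[R]_n) ord0 i)) -> measurable_fun setT f.
Proof.
move=> mf; apply: (measurability _ RnB_cboxes).
move=> _ [_ [a [b ->]] <-]; rewrite setTI.
have -> : f @^-1` cbox a b = \bigcap_(i in [set: 'I_n])
    ((fun t => (f t : 'rV[R]_n) ord0 i) @^-1` `[a ord0 i, b ord0 i]).
  by apply/seteqP; split=> t /= h i => [_|]; [rewrite /= in_itv /=|have := h i I; rewrite /= in_itv].
apply: fin_bigcap_measurable => // i _; rewrite -[X in measurable X]setTI.
by apply: (mf i) => //; exact: measurable_itv.
Qed.

(** * The Gamma function on the positive axis *)

Section GammaReal.
Context {R : realType}.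
Implicit Types (a : R).

Let line (t : measurableTypeR R) : RnB R 1 := const_mx t.

Let line_measurable : measurable_fun setT line.
Proof.
apply: RnB_measurable => i; rewrite (_ : (fun t => _) = id) //.
by apply/funext => t; rewrite mxE.
Qed.

Let lam1 : {measure set (RnB R 1) -> \bar R}.
Proof.
pose m0 := (pushforward (@lebesgue_measure R) line : {measure set (RnB R 1) -> \bar R}).
exact: (m0 line_measurable).
Defined.

Let lam1_lebesgue : is_lebesgue_Rn lam1.
Proof.
move=> a b ab; rewrite /lam1 /= /pushforward big_ord1.
have -> : line @^-1` [set x : RnB R 1 | forall i, a ord0 i <= x ord0 i <= b ord0 i] =
    `[a ord0 ord0, b ord0 ord0]%classic.
  apply/seteqP; split=> t /=; first by move=> /(_ ord0); rewrite mxE in_itv.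
  by move=> h i; rewrite (ord1 i) mxE; move: h; rewrite in_itv.
rewrite /= lebesgue_measure_itv /= lte_fin; case: ltP => // h.
have /eqP -> : b ord0 ord0 == a ord0 ord0 by rewrite eq_le h ab.
by rewrite subrr.
Qed.

Definition Gammar a : R := Rintegral lebesgue_measure `]0, +oo[%classic
  (fun t : R => t `^ (a - 1) * expR (- t)).

Lemma crM (x y : R) : cr x * cr y = cr (x * y).
Proof. by rewrite /cr; apply/eqP; rewrite eq_complex /= !mul0r !mulr0 subr0 addr0 !eqxx. Qed.

Lemma crD (x y : R) : cr x + cr y = cr (x + y).
Proof. by apply/eqP; rewrite eq_complex /= addr0 !eqxx. Qed.

Lemma crN (x : R) : - cr x = cr (- x).
Proof. by apply/eqP; rewrite eq_complex /= oppr0 !eqxx. Qed.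

Lemma cr1 : cr (1 : R) = 1. Proof. by []. Qed.

Lemma crB (x y : R) : cr x - cr y = cr (x - y).
Proof. by rewrite crN crD. Qed.

Lemma cpow_cr (x s : R) : 0 < x -> cpow x (cr s) = cr (x `^ s).
Proof. by move=> x0; rewrite /cpow crM cexp_cr /powR gt_eqF. Qed.

Lemma cGamma_cr a : cGamma (cr a) = cr (Gammar a).
Proof.
have pos (t : R) : t \in `]0, +oo[%classic -> 0 < t by move=> /set_mem; rewrite /= in_itv /= andbT.
rewrite /cGamma /Gammar -cr1 crB; congr Complex.
  by apply: eq_Rintegral => t /pos t0; rewrite cpow_cr.
rewrite (@eq_Rintegral _ _ _ _ _ (fun _ => 0)) ?/Rintegral ?integral0 // => t /pos t0.
by rewrite cpow_cr //= mul0r.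
Qed.

(** Gamma is the Laguerre-Selberg integral in one variable, so its recursion and log-convexity are
    instances of those of [Z]. With one variable there are no pairs, and [k = 1] is an arbitrary
    choice. *)
Let Gammar_Z a : Gammar a = Z lam1 1 (a - 1).
Proof.
rewrite /Gammar /Z /Rintegral; congr fine.
pose w : RnB R 1 -> R := wt (pairs predT) 1 (fun=> a - 1) (fun=> 1) 0.
have mf : measurable_fun (@Rplus_n R 1) (EFin \o w).
  by apply/measurable_EFinP; apply: measurable_funTS; exact: wt_measurable.
have f0 : {in @Rplus_n R 1, forall x, (0 <= (EFin \o w) x)%E}.
  by move=> x _; rewrite lee_fin wt_ge0.
have H := @ge0_integral_pushforward _ _ _ _ _ _ line_measurable lebesgue_measure _ _
  (@orthant_measurable R 1) mf f0.
apply: etrans (esym H).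
have -> : line @^-1` (@Rplus_n R 1) = `]0, +oo[%classic.
  apply/seteqP; split=> t /=; rewrite in_itv /= andbT; first by move=> /(_ ord0); rewrite mxE.
  by move=> h i; rewrite mxE.
apply: eq_integral => t _; rewrite /comp /w /wt /gam /vdm !big_ord1 big_pred0 => [|j].
  by rewrite mulr1 mxE mul1r.
by rewrite /pairs (ord1 j) eqxx.
Qed.

Lemma Gammar_gt0 a : 0 < a -> 0 < Gammar a.
Proof. by move=> a0; rewrite Gammar_Z; apply: (Z_gt0 lam1_lebesgue) => //; rewrite ltrBrDl subrr. Qed.

Lemma Gammar_rec a : 0 < a -> Gammar (a + 1) = a * Gammar a.
Proof.
move=> a0; rewrite !Gammar_Z addrAC (Z_rec lam1_lebesgue) //; last by rewrite ltrBrDl subrr.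
rewrite big_ord1; congr (_ * _); have -> : ((ord0 : 'I_1) : nat)%:R = 0 :> R by [].
by rewrite [X in _ * (X - _ - _)](_ : _ = 1) //; ring.
Qed.

Lemma Gammar_logconvex a (s : R) : 0 < a -> 0 <= s -> s <= 1 ->
  Gammar (a + s) <= a `^ s * Gammar a.
Proof.
move=> a0 s0 s1; have a1 : -1 < a - 1 by rewrite ltrBrDl subrr.
have := Z_logconvex lam1_lebesgue ltr01 a1 s0 s1 a0.
rewrite -Gammar_Z (_ : a - 1 + s = a + s - 1); last by ring.
rewrite -Gammar_Z (_ : a - 1 + 1 = a + 1 - 1); last by ring.
rewrite -Gammar_Z Gammar_rec // (_ : s * _ * _ = s * (a `^ (s - 1) * a) * Gammar a); last by ring.
have -> : a `^ (s - 1) * a = a `^ s.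
  by rewrite -{2}(powRr1 (ltW a0)) -powRD ?subrK // (gt_eqF a0) implybT.
by rewrite -mulrDl -mulrDl subrK mul1r.
Qed.

End GammaReal.

(** * Normalization by the Bohr-Mollerup argument *)

Section BohrMollerup.
Context {R : realType}.
Variables (x0 : R) (q : R -> R).
Hypothesis q0 : forall x, x0 < x -> 0 < q x.
Hypothesis q_mono : forall x y, x0 < x -> x <= y -> q x <= q y.
Hypothesis q_ratio : forall x, x0 < x -> q (x + m%:R + 1) / q (x + m%:R) @[m --> \oo] --> (1 : R).

(** Since [q x = f (x + 1) / f x], the third clause is log-convexity between [x] and [x + 1]. *)
Definition bm (f : R -> R) := [/\ forall x, x0 < x -> 0 < f x,
  forall x, x0 < x -> f (x + 1) = q x * f x
  & forall x s, x0 < x -> 0 <= s -> s <= 1 -> f (x + s) <= q x `^ s * f x].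

(** [f (x + s)] is bounded above from [x], and [g (x + s)] below because [g (x + 1)] is bounded
    above from [x + s]. Monotonicity of [q] merges the two powers into [q (x + 1)]. *)
Lemma bm_step f g x s : bm f -> bm g -> x0 < x -> 0 <= s -> s <= 1 ->
  f (x + s) / g (x + s) <= f x / g x * (q (x + 1) / q x).
Proof.
move=> [f0 fS fl] [g0 gS gl] xx s0 s1.
have xs : x0 < x + s by rewrite ltr_wpDr.
have x1 : x0 < x + 1 by rewrite ltr_wpDr.
have h1 := fl x s xx s0 s1.
have h2 : q x * g x <= q (x + s) `^ (1 - s) * g (x + s).
  rewrite -gS // (_ : x + 1 = x + s + (1 - s)); last by ring.
  by apply: gl => //; rewrite ?subr_ge0 // gerBl.
have h3 : q x `^ s * q (x + s) `^ (1 - s) <= q (x + 1).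
  have e : q (x + 1) = q (x + 1) `^ s * q (x + 1) `^ (1 - s).
    by rewrite -powRD ?subrKC ?powRr1 ?(ltW (q0 _)) // ?(addrC s) ?subrK ?oner_eq0.
  rewrite [leRHS]e; apply: ler_pM; rewrite ?powR_ge0 //; apply: ge0_ler_powR;
    rewrite ?nnegrE ?subr_ge0 ?(ltW (q0 _)) //; apply: q_mono => //; rewrite ?lerD2l ?lerDl ?ler01 //.
rewrite ler_pdivrMr ?g0 //; apply: le_trans h1 _.
have gx := g0 x xx; have gxs := g0 _ xs; have qx := q0 xx; have fx := f0 x xx.
have -> : f x / g x * (q (x + 1) / q x) * g (x + s) = f x * (q (x + 1) * g (x + s)) / (q x * g x).
  by field; rewrite !gt_eqF.
rewrite ler_pdivlMr ?mulr_gt0 // [leLHS](_ : _ = f x * (q x `^ s * (q x * g x))); last by ring.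
apply: ler_wpM2l; first exact: ltW.
apply: le_trans (_ : q x `^ s * (q (x + s) `^ (1 - s) * g (x + s)) <= _).
  by apply: ler_wpM2l => //; exact: powR_ge0.
by rewrite mulrA; apply: ler_wpM2r => //; exact: ltW.
Qed.

Lemma bm_period f g x (m : nat) : bm f -> bm g -> x0 < x -> f (x + m%:R) / g (x + m%:R) = f x / g x.
Proof.
move=> [f0 fS fl] [g0 gS gl] xx; elim: m => [|m IH]; first by rewrite !addr0.
have xm : x0 < x + m%:R by rewrite ltr_wpDr.
rewrite -natr1 addrA fS // gS // -IH -mulf_div divff ?mul1r //; exact/lt0r_neq0/q0.
Qed.

(** [f / g] has period 1, so the estimate may be shifted by [m], and its defect
    [q (x + m + 1) / q (x + m)] tends to 1. Exchanging [f] and [g] will give equality. *)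
Lemma bm_le f g x s : bm f -> bm g -> x0 < x -> 0 <= s -> s <= 1 ->
  f (x + s) / g (x + s) <= f x / g x.
Proof.
move=> bf bg xx s0 s1; have cv := q_ratio xx.
have {cv}cv : f x / g x * (q (x + m%:R + 1) / q (x + m%:R)) @[m --> \oo] --> f x / g x.
  by rewrite -[X in _ --> X]mulr1; apply: cvgM => //; exact: cvg_cst.
have xs : x0 < x + s by rewrite ltr_wpDr.
apply: (closed_cvg (fun y => f (x + s) / g (x + s) <= y)) cv; first exact: closed_ge.
apply: nearW => m; rewrite -(bm_period m bf bg xx) -(bm_period m bf bg xs) addrAC.
by apply: bm_step => //; rewrite ltr_wpDr.
Qed.

Lemma bm_unique f g x y : bm f -> bm g -> x0 < x -> x0 < y -> f x / g x = f y / g y.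
Proof.
move=> bf bg; have ratio h : bm h -> forall z, x0 < z -> 0 < h z by case.
have eqs z s : x0 < z -> 0 <= s -> s <= 1 -> f (z + s) / g (z + s) = f z / g z.
  move=> z0 s0 s1; apply/eqP; rewrite eq_le bm_le //=.
  have zs : x0 < z + s by rewrite ltr_wpDr.
  have := bm_le bg bf z0 s0 s1.
  rewrite -[g _ / f _]invf_div -[g z / f z]invf_div lef_pV2 // posrE divr_gt0 //; exact: ratio.
wlog xy : x y / x <= y => [H x1 y1|x1 y1].
  by case: (leP x y) => xy; [exact: H|apply/esym/H => //; exact: ltW].
have d0 : 0 <= y - x by rewrite subr_ge0.
pose m := Num.truncn (y - x); pose s := y - x - m%:R.
have /andP[m1 m2] := truncn_itv d0.
have ye : y = x + s + m%:R by rewrite /s; ring.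
have s0 : 0 <= s by rewrite subr_ge0.
have s1 : s <= 1 by rewrite lerBlDr nat1r ltW.
rewrite ye bm_period // ?eqs // ltr_wpDr //.
Qed.

End BohrMollerup.

(** * The normalizing constants for real parameters *)

Section RieszReal.
Context {R : realType} {n : nat} {k : R} {lam : {measure set (RnB R n) -> \bar R}}.
Hypothesis (n1 : (1 <= n)%N) (k0 : 0 < k) (hlam : is_lebesgue_Rn lam).
Implicit Types (mu : R) (x : RnB R n).
Local Notation orth := (@Rplus_n R n).
Local Notation prs := (@pairs n predT).
Local Notation mu0 := (mu0 n k).

Definition dnr : R := \prod_(j < n) (Gammar (1 + j.+1%:R * k) / Gammar (1 + k)).
Definition Gnr mu : R := \prod_(j < n) Gammar (mu - k * j%:R).
Definition den mu : R := dnr * Gnr mu.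

Lemma mu_kj mu j : mu0 < mu -> (j < n)%N -> 0 < mu - k * j%:R.
Proof.
move=> h jn; rewrite subr_gt0; apply: le_lt_trans h; rewrite /mu0 ler_pM2l //.
by rewrite lerBrDr natr1 ler_nat.
Qed.

Lemma Gnr_gt0 mu : mu0 < mu -> 0 < Gnr mu.
Proof. by move=> h; apply: prodr_gt0 => j _; apply: Gammar_gt0; apply: mu_kj. Qed.

Lemma dnr_gt0 : 0 < dnr.
Proof.
apply: prodr_gt0 => j _; rewrite divr_gt0 // Gammar_gt0 // addr_gt0 // mulr_gt0 //.
Qed.

Lemma den_gt0 mu : mu0 < mu -> 0 < den mu.
Proof. by move=> h; rewrite mulr_gt0 ?dnr_gt0 ?Gnr_gt0. Qed.

Lemma cr_prod (I : Type) (r : seq I) (P : pred I) (F : I -> R) :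
  \prod_(i <- r | P i) cr (F i) = cr (\prod_(i <- r | P i) F i).
Proof.
elim: r => [|i r IH]; first by rewrite !big_nil.
by rewrite !big_cons; case: (P i); rewrite // IH crM.
Qed.

Lemma crV (a : R) : (cr a)^-1 = cr a^-1.
Proof.
have [->|a0] := eqVneq a 0; first by rewrite !invr0.
apply: (@mulIf _ (cr a)); first by apply: contra_neq a0 => -[].
rewrite mulVf; first by rewrite crM mulVf.
by apply: contra_neq a0 => -[].
Qed.

Lemma den_cr mu : d_n n k * Gamma_n n k (cr mu) = cr (den mu).
Proof.
rewrite /den -crM; congr (_ * _).
  by rewrite /d_n /dnr -cr_prod; apply: eq_bigr => j _; rewrite !cGamma_cr crV crM.
by rewrite /Gamma_n /Gnr -cr_prod; apply: eq_bigr => j _; rewrite crB cGamma_cr.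
Qed.

Lemma omega_vdm x : omega_k k x = vdm prs k 0 x.
Proof.
pose f (i j : 'I_n) : R := `|x ord0 i - x ord0 j| `^ k.
have fs i j : f i j = f j i by rewrite /f distrC.
have kk : (k + k == 0) = false by apply/negbTE; rewrite gt_eqF ?addr_gt0.
have ff i j : `|x ord0 i - x ord0 j| `^ (2 * k) = f i j * f j i.
  by rewrite (fs j i) /f -powRD ?kk // [in LHS](_ : 2 * k = k + k) //; ring.
have -> : vdm prs k 0 x = \prod_i \prod_(j | i != j) f i j.
  apply: eq_bigr => i _; apply: eq_bigr => j _; rewrite addr0 /f.
  rewrite -real_normK ?num_real // -powR_mulrn // -powRrM; congr (_ `^ _); by field.
have -> : \prod_i \prod_(j | i != j) f i j =
    (\prod_(i < n) \prod_(j < n | (i < j)%N) f i j) * (\prod_(i < n) \prod_(j < n | (j < i)%N) f i j).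
  rewrite -big_split; apply: eq_bigr => i _ /=.
  rewrite (bigID (fun j : 'I_n => (i < j)%N)) /=; congr (_ * _); apply: eq_bigl => j.
    by rewrite -val_eqE /=; case: ltngtP.
  by rewrite -val_eqE /=; case: ltngtP.
rewrite [X in _ * X](exchange_big_dep xpredT) //= -big_split; apply: eq_bigr => i _.
rewrite /= -big_split; apply: eq_bigr => j _; exact: ff.
Qed.

Definition al mu := mu - mu0 - 1.
Definition W0 mu := wt prs k (fun _ => al mu) (fun _ => 0) 0 : RnB R n -> R.

Lemma W0_E mu x : orth x -> Dx x `^ (al mu) * omega_k k x = W0 mu x.
Proof.
move=> xO; rewrite omega_vdm /W0 /wt -Dx_powR //; congr (_ * _); apply: eq_bigr => i _.
by rewrite mul0r oppr0 expR0 mulr1.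
Qed.

Lemma W0_exp mu (M : R) x : orth x -> expR (- (M * psum x)) * W0 mu x =
  wt prs k (fun _ => al mu) (fun _ => M) 0 x.
Proof.
move=> xO; rewrite /W0 /wt mulrA; congr (_ * _); rewrite /psum mulr_sumr -sumrN expR_sum /gam -big_split.
by apply: eq_bigr => i _ /=; rewrite mul0r oppr0 expR0 mulr1 mulrC.
Qed.

Lemma al_gt mu : mu0 < mu -> -1 < al mu.
Proof. by move=> h; rewrite ltrBrDr addNr subr_gt0. Qed.

Definition qn mu : R := \prod_(j < n) (mu - k * j%:R).

Lemma Zr_bm : bm mu0 qn (fun mu => Z lam k (al mu)).
Proof.
split=> [mu h|mu h|mu s h s0 s1].
- by apply: Z_gt0 => //; exact: al_gt.
- rewrite (_ : al (mu + 1) = al mu + 1); last by rewrite /al; ring.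
  rewrite Z_rec //; last exact: al_gt.
  by congr (_ * _); apply: eq_bigr => j _; rewrite /al /Defs.mu0; ring.
have q0 : 0 < qn mu by apply: prodr_gt0 => j _; exact: mu_kj.
have := Z_logconvex hlam k0 (al_gt h) s0 s1 q0.
rewrite Z_rec //; last exact: al_gt.
have -> : \prod_(j < n) (1 + al mu + k * (n%:R - 1 - j%:R)) = qn mu.
  by apply: eq_bigr => j _; rewrite /al /Defs.mu0; ring.
rewrite (_ : al (mu + s) = al mu + s); last by rewrite /al; ring.
rewrite (_ : s * _ * _ = s * (qn mu `^ (s - 1) * qn mu) * Z lam k (al mu)); last by ring.
have -> : qn mu `^ (s - 1) * qn mu = qn mu `^ s.
  by rewrite -{2}(powRr1 (ltW q0)) -powRD ?subrK // (gt_eqF q0) implybT.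
by rewrite -mulrDl -mulrDl subrK mul1r.
Qed.

Lemma Gnr_bm : bm mu0 qn Gnr.
Proof.
split=> [mu h|mu h|mu s h s0 s1]; first exact: Gnr_gt0.
  rewrite /Gnr /qn -big_split; apply: eq_bigr => j _ /=.
  by rewrite -Gammar_rec; [congr Gammar; ring|exact: mu_kj].
have -> : qn mu `^ s = \prod_(j < n) (mu - k * j%:R) `^ s.
  rewrite /qn; have : forall j : 'I_n, 0 < mu - k * j%:R by move=> j; exact: mu_kj.
  move=> p; elim: (index_enum _) => [|i r IH]; first by rewrite !big_nil powR1.
  rewrite !big_cons -IH powRM ?(ltW (p i)) //; apply: prodr_ge0 => j _; exact: ltW.
rewrite /Gnr -big_split; apply: ler_prod => j _; apply/andP; split.
  by apply/ltW/Gammar_gt0/mu_kj => //; rewrite ltr_wpDr.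
rewrite (_ : mu + s - _ = mu - k * j%:R + s); last by ring.
by apply: Gammar_logconvex => //; exact: mu_kj.
Qed.

Lemma Z_den_const : exists2 E0 : R, 0 < E0 & forall mu, mu0 < mu -> Z lam k (al mu) / den mu = E0.
Proof.
have m1 : mu0 < mu0 + 1 by rewrite ltrDl.
exists (Z lam k (al (mu0 + 1)) / den (mu0 + 1)) => [|mu h].
  by rewrite divr_gt0 ?den_gt0 // Z_gt0 // al_gt.
have red (x : R) : Z lam k (al x) / den x = dnr^-1 * (Z lam k (al x) / Gnr x) by rewrite /den invfM mulrCA.
have q0 : forall x : R, mu0 < x -> 0 < qn x by move=> x hx; apply: prodr_gt0 => j _; exact: mu_kj.
have qm : forall x y : R, mu0 < x -> x <= y -> qn x <= qn y.
  by move=> x y hx xy; apply: ler_prod => j _; rewrite (ltW (mu_kj hx (ltn_ord j))) /= lerD2r.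
suff qr : forall x : R, mu0 < x -> qn (x + m%:R + 1) / qn (x + m%:R) @[m --> \oo] --> (1 : R).
  apply: etrans (red mu) (etrans _ (esym (red (mu0 + 1)))).
  by rewrite (@bm_unique R mu0 qn q0 qm qr (fun mu => Z lam k (al mu)) Gnr mu (mu0 + 1) Zr_bm Gnr_bm h m1).
(* The quotient is the product over [j] of [1 + 1 / (x - k j + m)], and for [m >= 1] each inverse
   lies between 0 and [2 / (m + 1)]. *)
move=> x hx; pose r (m : nat) (j : 'I_n) : R := 1 + (x - k * j%:R + m%:R)^-1.
have re m : qn (x + m%:R + 1) / qn (x + m%:R) = \prod_j r m j.
  rewrite /qn -prodf_div; apply: eq_bigr => j _; rewrite /r.
  have : 0 < x - k * j%:R + m%:R by rewrite ltr_wpDr ?mu_kj.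
  move=> p; have e : x - k * j%:R + m%:R = x + m%:R - k * j%:R by ring.
  by rewrite e in p *; field; rewrite gt_eqF.
rewrite (funext re).
have cm : continuous (fun u : R * R => u.1 * u.2) by exact: mul_continuous.
have e1 : 1 = \prod_(j < n) (1 : R) by rewrite big1.
rewrite [X in _ --> X]e1.
apply: (cvg_big (U := R) cm) => j _; rewrite /r -[X in _ --> X]addr0; apply: cvgD; first exact: cvg_cst.
have p := mu_kj hx (ltn_ord j).
apply: (@squeeze_cvgr _ _ _ _ (fun _ => 0) (fun m => 2 * @harmonic R m)) => //; last 2 first.
- exact: cvg_cst.
- by rewrite -[X in _ --> X](mulr0 2); apply: cvgM; [exact: cvg_cst|exact: cvg_harmonic].
near=> m; have m1' : 1 <= m%:R :> R by rewrite ler1n; near: m; exact: nbhs_infty_gt.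
have pm : 0 < x - k * j%:R + m%:R by rewrite ltr_wpDr.
rewrite invr_ge0 (ltW pm) /= /harmonic ler_pdivlMr ?ltr0n // mulrC ler_pdivrMr // -natr1.
by lra.
Unshelve. all: by end_near.
Qed.

End RieszReal.

(** * Riesz distributions on exponentials times polynomials *)

Section Riesz.
Context {R : realType} {n : nat} {k : R} {lam : {measure set (RnB R n) -> \bar R}}.
Context {Rz : R[i] -> ('rV[R]_n -> R) -> R[i]}.
Hypothesis (n1 : (1 <= n)%N) (k0 : 0 < k) (hlam : is_lebesgue_Rn lam) (hRz : riesz_family k lam Rz).
Implicit Types (x : RnB R n) (phi psi : 'rV[R]_n -> R).
Local Notation orth := (@Rplus_n R n).
Local Notation prs := (@pairs n predT).
Local Notation mu0 := (mu0 n k).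

Lemma Rz_hol phi : schwartz phi -> holomorphic (fun mu => Rz mu phi).
Proof. by case: hRz => _ + _; exact. Qed.

Lemma Rz_lin mu (a b : R) f g : schwartz f -> schwartz g ->
  Rz mu (fun x => a * f x + b * g x) = cr a * Rz mu f + cr b * Rz mu g.
Proof. by case: hRz => /(_ mu) [+ _] _ _; exact. Qed.

Lemma Rz_real (mu : R) phi : mu0 < mu -> schwartz phi ->
  Rz (cr mu) phi = cr (Rintegral lam orth (fun x => phi x * @W0 R n k mu x) / @den R n k mu).
Proof.
move=> h sp; case: hRz => _ _ -> //; rewrite /riesz_integral den_cr crV -[RHS]crM; congr (_ * _).
have e x : orth x -> cpow (Dx x) (cr mu - cr mu0 - 1) * cr (phi x * omega_k k x) = cr (phi x * @W0 R n k mu x).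
  move=> xO; rewrite -cr1 !crB cpow_cr ?Dx_gt0 // crM; congr cr.
  by rewrite -W0_E // mulrCA.
congr Complex; first by apply: eq_Rintegral => x /set_mem xO; rewrite e.
rewrite (@eq_Rintegral _ _ _ _ _ (fun _ => 0)) ?/Rintegral ?integral0 // => x /set_mem xO.
by rewrite e.
Qed.

Lemma Rz_eq F G : holomorphic F -> holomorphic G ->
  (forall mu : R, mu0 < mu -> F (cr mu) = G (cr mu)) -> forall mu : R[i], F mu = G mu.
Proof. exact: entire_eq. Qed.

(** [R_mu] is supported in the closed orthant: for real [mu > mu0] only values on the open orthant
    enter the integral, and the equality continues to all [mu]. This frees the choice of an
    extension beyond the orthant. *)
Lemma Rz_local mu phi psi : schwartz phi -> schwartz psi ->
  (forall x, orth x -> phi x = psi x) -> Rz mu phi = Rz mu psi.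
Proof.
move=> sp ss e; move: mu; apply: (@Rz_eq (fun mu => Rz mu phi) (fun mu => Rz mu psi)) => [||mu h];
  [exact: Rz_hol..|].
by rewrite !Rz_real //; congr (cr (_ / _)); apply: eq_Rintegral => x /set_mem xO; rewrite e.
Qed.

Lemma Rz_mulD mu phi : schwartz phi -> Rz mu (fun x => phi x * Dx x) =
  \prod_(j < n) (mu - cr (k * j%:R)) * Rz (mu + 1) phi.
Proof.
move=> sp; have sD : schwartz (fun x => phi x * Dx x).
  by apply: schwartz_slow => //; apply: slow_prod => i _; exact: slow_coord.
move: mu; apply: (@Rz_eq (fun mu => Rz mu (fun x => phi x * Dx x))
  (fun mu => \prod_(j < n) (mu - cr (k * j%:R)) * Rz (mu + 1) phi)) => [||mu h].
- exact: Rz_hol.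
- apply: holomorphicM; last by apply: (holomorphic_shift (F := fun mu => Rz mu phi)); exact: Rz_hol.
  by apply: holomorphic_prod => j; apply: holomorphicB; [exact: holomorphic_id|exact: holomorphic_cst].
have h1 : mu0 < mu + 1 by rewrite ltr_wpDr.
rewrite -cr1 crD !Rz_real //.
rewrite (eq_bigr (fun j : 'I_n => cr (mu - k * j%:R))) => [|j _]; last by rewrite crB.
rewrite cr_prod crM; congr cr.
have [_ Gs _] := @Gnr_bm R n k k0.
rewrite /den Gs // -/(@qn R n k mu).
have q0 : @qn R n k mu != 0 by apply/lt0r_neq0/prodr_gt0 => j _; exact: (mu_kj k0 h (ltn_ord j)).
have G0 := lt0r_neq0 (@Gnr_gt0 R n k k0 mu h).
have d0 := lt0r_neq0 (@dnr_gt0 R n k k0).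
rewrite -[in RHS](@eq_Rintegral _ _ _ lam orth (fun x => phi x * @W0 R n k (mu + 1) x)
   (fun x => phi x * Dx x * @W0 R n k mu x)) => [|x /set_mem xO].
  by field; rewrite q0 G0 d0.
rewrite -mulrA; congr (_ * _); rewrite /W0 (_ : @al R n k (mu + 1) = @al R n k mu + 1); last by rewrite /al; ring.
by rewrite wt_Dx // powRr1 ?(ltW (Dx_gt0 xO)).
Qed.

(** A Schwartz extension of [expR (- (M * psum x)) * q x] from the orthant; by [Rz_local] the value
    of [R_mu] does not depend on [c]. *)
Definition exq (c M : R) (q : 'rV[R]_n -> R) (x : 'rV[R]_n) := Hcut c x * expR (- (M * psum x)) * q x.

Lemma exq_schwartz c M q : 0 < c -> 0 < M -> slow q -> schwartz (exq c M q).
Proof. by move=> c0 M0 sq; apply: schwartz_slow => //; exact: schwartz_expcut. Qed.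

Lemma exq_orth c M q x : 0 < c -> orth x -> exq c M q x = expR (- (M * psum x)) * q x.
Proof. by move=> c0 xO; rewrite /exq Hcut1 ?mul1r ?(ltW c0) // => i; exact: ltW. Qed.

Definition polyf (q : 'rV[R]_n -> R) := slow q /\ polyb (q : RnB R n -> R).

Lemma polyf_cst a : polyf (fun _ => a).
Proof. by split; [exact: slow_cst|exact: polyb_cst]. Qed.
Lemma polyf_coord i : polyf (fun x => x ord0 i).
Proof. by split; [exact: slow_coord|exact: polyb_coord]. Qed.
Lemma polyfD p q : polyf p -> polyf q -> polyf (fun x => p x + q x).
Proof. by move=> [s1 b1] [s2 b2]; split; [exact: slowD|exact: polybD]. Qed.
Lemma polyfM p q : polyf p -> polyf q -> polyf (fun x => p x * q x).
Proof. by move=> [s1 b1] [s2 b2]; split; [exact: slowM|exact: polybM]. Qed.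
Lemma polyfX p a : polyf p -> polyf (fun x => p x ^+ a).
Proof. by move=> [s1 b1]; split; [exact: slowX|exact: polybX]. Qed.
Lemma polyf_sum (I : Type) (r : seq I) (P : pred I) (f : I -> 'rV[R]_n -> R) :
  (forall i, P i -> polyf (f i)) -> polyf (fun x => \sum_(i <- r | P i) f i x).
Proof.
by move=> h; split; [apply: slow_sum => i /h []|apply: polyb_sum => i /h []].
Qed.
Lemma polyf_mon b : polyf (mon b).
Proof.
by split; [apply: slow_prod => i _; apply: slowX; exact: slow_coord|exact: mon_polyb].
Qed.

Lemma wt_al_int (mu M : R) q : mu0 < mu -> 0 < M -> polyf q ->
  lam.-integrable orth (EFin \o (fun x => q x * wt prs k (fun _ => @al R n k mu) (fun _ => M) 0 x)).
Proof.
move=> h M0 [_ pq]; apply: (@polyb_integrable _ _ _ hlam prs k k0) => // i; exact: al_gt.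
Qed.

Lemma Rz_exq (mu c M : R) q : mu0 < mu -> 0 < c -> 0 < M -> polyf q ->
  Rz (cr mu) (exq c M q) =
  cr (Rintegral lam orth (fun x => q x * wt prs k (fun _ => @al R n k mu) (fun _ => M) 0 x) / @den R n k mu).
Proof.
move=> h c0 M0 [sq _]; rewrite (Rz_real h (exq_schwartz c0 M0 sq)).
rewrite (@eq_Rintegral _ _ _ lam orth (fun x => q x * wt prs k (fun _ => @al R n k mu) (fun _ => M) 0 x)) //.
move=> x /set_mem xO; rewrite (exq_orth M q c0 xO).
by rewrite -(W0_exp mu M xO) mulrAC [LHS]mulrC.
Qed.

Lemma Rz_exq_lin mu c M (a b : R) p q : 0 < c -> 0 < M -> slow p -> slow q ->
  Rz mu (exq c M (fun x => a * p x + b * q x)) = cr a * Rz mu (exq c M p) + cr b * Rz mu (exq c M q).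
Proof.
move=> c0 M0 sp sq; rewrite -Rz_lin; [|exact: exq_schwartz..]; congr (Rz mu _).
by apply/funext => x; rewrite /exq; ring.
Qed.

(** A constant on the real ray continues as the same constant. In particular no [R_mu] is zero. *)
Lemma Rz_const : exists2 E0 : R, 0 < E0 & forall (mu : R[i]) c, 0 < c ->
  Rz mu (exq c 1 (fun _ => 1)) = cr E0.
Proof.
have [E0 E00 hE] := @Z_den_const R n k lam k0 hlam; exists E0 => // mu c c0; move: mu.
apply: (@Rz_eq (fun mu => Rz mu (exq c 1 (fun _ => 1))) (fun _ => cr E0)) => [||mu h].
- by apply: Rz_hol; apply: exq_schwartz => //; exact: slow_cst.
- exact: holomorphic_cst.
rewrite Rz_exq //; last exact: polyf_cst.
by rewrite -(hE mu h); congr (cr (_ / _)); apply: eq_Rintegral => x _; rewrite mul1r.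
Qed.

Lemma Rz_aomoto mu c (A : {set 'I_n}) i0 : 0 < c -> i0 \notin A ->
  Rz mu (exq c 1 (fun x => x ord0 i0 * mon (fun i => (i \in A) : nat) x)) =
  (mu - cr (k * #|A|%:R)) * Rz mu (exq c 1 (mon (fun i => (i \in A) : nat))).
Proof.
move=> c0 iA; pose b (i : 'I_n) := (i \in A) : nat; have pm := polyf_mon b; have pi := polyf_coord i0.
have pp := polyfM pi pm; move: mu.
apply: (@Rz_eq (fun mu => Rz mu (exq c 1 (fun x => x ord0 i0 * mon b x)))
  (fun mu => (mu - cr (k * #|A|%:R)) * Rz mu (exq c 1 (mon b)))) => [||mu h].
- by apply: Rz_hol; apply: exq_schwartz => //; case: pp.
- apply: holomorphicM; first by apply: holomorphicB; [exact: holomorphic_id|exact: holomorphic_cst].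
  by apply: Rz_hol; apply: exq_schwartz => //; case: pm.
rewrite !Rz_exq // crB crM; congr cr; rewrite mulrA; congr (_ / _).
have mO := @orthant_measurable R n.
rewrite -RintegralZl //; last exact: wt_al_int.
apply/eqP; rewrite eq_sym -subr_eq0; apply/eqP; rewrite -RintegralB //; last 2 first.
- exact: (integrableZl mO _ (wt_al_int h ltr01 pm)).
- exact: wt_al_int.
rewrite -[RHS](aomoto_identity hlam k0 (al_gt h) iA); apply: eq_Rintegral => x _ /=.
rewrite -/(wt _ _ _ _ _ _) /al /Defs.mu0 -/b.
by move: (wt prs k _ _ _ _) (mon b x) (#|A|%:R) => u v w; ring.
Qed.

Lemma Rz_perm mu c M b (sg : 'S_n) : 0 < c -> 0 < M ->
  Rz mu (exq c M (mon (fun i => b (sg i)))) = Rz mu (exq c M (mon b)).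
Proof.
move=> c0 M0; have p1 := polyf_mon b; have p2 := polyf_mon (fun i => b (sg i)); move: mu.
apply: (@Rz_eq (fun mu => Rz mu (exq c M (mon (fun i => b (sg i)))))
  (fun mu => Rz mu (exq c M (mon b)))) => [||mu h].
- by apply: Rz_hol; apply: exq_schwartz => //; case: p2.
- by apply: Rz_hol; apply: exq_schwartz => //; case: p1.
rewrite !Rz_exq //; congr (cr (_ / _)).
rewrite -(perm_Rintegral hlam sg (wt_al_int h M0 p2)); apply: eq_Rintegral => x _.
rewrite wt_perm //; last by move=> i j; rewrite /pairs /= (inj_eq (@perm_inj _ sg)).
congr (_ * _); rewrite /mon [RHS](reindex_inj (@perm_inj _ sg)) /=; apply: eq_bigr => i _.
by rewrite !mxE mul1r.
Qed.

(** [psA] is a power sum times a monomial; [psB] gathers the terms of the recursion whose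
    coefficients do not involve [mu]. *)
Definition psA (a : nat) (b : 'I_n -> nat) x : R := \sum_i x ord0 i ^+ a * mon b x.
Definition psB (a : nat) (b : 'I_n -> nat) x : R :=
  \sum_i (1 + a%:R + (b i)%:R) * (x ord0 i ^+ a * mon b x) +
  \sum_i \sum_(j | prs i j) k * ((\sum_(c < a.+1) x ord0 i ^+ (a - c) * x ord0 j ^+ c) * mon b x).

Lemma polyf_psA a b : polyf (psA a b).
Proof.
apply: polyf_sum => i _; apply: polyfM; last exact: polyf_mon.
by apply: polyfX; exact: polyf_coord.
Qed.

Lemma polyf_psB a b : polyf (psB a b).
Proof.
have pX i c : polyf (fun x => x ord0 i ^+ c) by apply: polyfX; exact: polyf_coord.
apply: polyfD; apply: polyf_sum => i _.
  apply: polyfM; first exact: polyf_cst.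
  by apply: polyfM => //; exact: polyf_mon.
apply: polyf_sum => j _; apply: polyfM; first exact: polyf_cst.
apply: polyfM; last exact: polyf_mon.
by apply: polyf_sum => l _; exact: polyfM.
Qed.

Lemma Rz_power_sum mu c M a b : 0 < c -> 0 < M ->
  cr M * Rz mu (exq c M (psA a.+1 b)) =
  (mu - cr mu0 - 1) * Rz mu (exq c M (psA a b)) + Rz mu (exq c M (psB a b)).
Proof.
move=> c0 M0; have pA := polyf_psA a b; have pB := polyf_psB a b; have pA' := polyf_psA a.+1 b.
move: mu; apply: (@Rz_eq (fun mu => cr M * Rz mu (exq c M (psA a.+1 b)))
  (fun mu => (mu - cr mu0 - 1) * Rz mu (exq c M (psA a b)) + Rz mu (exq c M (psB a b)))) => [||mu h].
- apply: holomorphicM; first exact: holomorphic_cst.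
  by apply: Rz_hol; apply: exq_schwartz => //; case: pA'.
- apply: holomorphicD; last by apply: Rz_hol; apply: exq_schwartz => //; case: pB.
  apply: holomorphicM; last by apply: Rz_hol; apply: exq_schwartz => //; case: pA.
  apply: holomorphicB; last exact: holomorphic_cst.
  by apply: holomorphicB; [exact: holomorphic_id|exact: holomorphic_cst].
rewrite !Rz_exq // -cr1 !crB !crM crD; congr cr; rewrite !mulrA -mulrDl; congr (_ / _).
have mO := @orthant_measurable R n.
have iA := wt_al_int h M0 pA; have iB := wt_al_int h M0 pB; have iA' := wt_al_int h M0 pA'.
rewrite -(RintegralZl _ mO iA') -(RintegralZl _ mO iA) -RintegralD //; last exact: (integrableZl mO _ iA).
apply/eqP; rewrite eq_sym -subr_eq0; apply/eqP; rewrite -RintegralB //; last 2 first.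
- exact: (integrableD mO (integrableZl mO _ iA) iB).
- exact: (integrableZl mO _ iA').
rewrite -[RHS](@power_sum_identity _ _ _ hlam predT k k0 (@al R n k mu) M (fun _ => M) a b (al_gt h) M0) //.
apply: eq_Rintegral => x _ /=; rewrite -/(wt _ _ _ _ _ _) /psA /psB.
have -> : \sum_(i < n) (1 + @al R n k mu + a%:R + (b i)%:R - M * x ord0 i) * (x ord0 i ^+ a * mon b x) =
    @al R n k mu * (\sum_i x ord0 i ^+ a * mon b x) +
    ((\sum_i (1 + a%:R + (b i)%:R) * (x ord0 i ^+ a * mon b x)) - M * (\sum_i x ord0 i ^+ a.+1 * mon b x)).
  rewrite !mulr_sumr -sumrN -!big_split; apply: eq_bigr => i _ /=.
  by rewrite exprS; ring.
by rewrite -/(@al R n k mu); ring.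
Qed.

End Riesz.

(** * Tempered distributions and measures *)

Section SeqMax.
Context {R : realType} {I : finType} {Y : Type}.

Lemma seq_max (F : seq I -> Y -> R) (N : nat) :
  (forall t, exists C : R, 0 <= C /\ forall y, F t y <= C) ->
  exists C : R, 0 <= C /\ forall t, (size t <= N)%N -> forall y, F t y <= C.
Proof.
move=> /choice[C HC]; exists (\sum_(l < N.+1) \sum_(t : l.-tuple I) C t); split=> [|t ts y].
  by apply: sumr_ge0 => l _; apply: sumr_ge0 => t _; case: (HC t).
apply: le_trans ((HC t).2 y) _.
rewrite (bigD1 (Ordinal (ts : (size t < N.+1)%N))) //= (bigD1 (in_tuple t)) //=.
rewrite -addrA lerDl addr_ge0 //; first by apply: sumr_ge0 => u _; case: (HC u).
by apply: sumr_ge0 => l _; apply: sumr_ge0 => u _; case: (HC u).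
Qed.

End SeqMax.

Section Cutoff.
Context {R : realType} {n : nat}.
Implicit Types (f g : 'rV[R]_n -> R) (x : 'rV[R]_n).

Lemma schwartz_max f (N m : nat) : schwartz f -> exists C : R, 0 <= C /\
  forall t, (size t <= N)%N -> forall x, `|x| ^+ m * `|pds t f x| <= C.
Proof.
move=> [_ h]; apply: seq_max => t; have [C HC] := h t m; exists C; split => //.
by apply: le_trans (HC 0); rewrite mulr_ge0 ?exprn_ge0.
Qed.

Definition ubd (F : nat -> 'rV[R]_n -> R) := (forall L, smooth (F L)) /\
  forall N, exists C : R, 0 <= C /\ forall L t, (size t <= N)%N -> forall x, `|pds t (F L) x| <= C.

Lemma ubdM F G : ubd F -> ubd G -> ubd (fun L x => F L x * G L x).
Proof.
move=> [sF hF] [sG hG]; split=> [L|N]; first exact: smoothM.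
have [C [C0 HC]] := hF N; have [D [D0 HD]] := hG N; exists (2 ^+ N * (C * D)).
split=> [|L t tN x]; first by rewrite !mulr_ge0 ?exprn_ge0.
apply: le_trans (pds_prod_bound (sF L) (sG L) C0 D0 _ _) _ => [u ut|u ut|].
- by apply: HC; exact: leq_trans tN.
- by apply: HD; exact: leq_trans tN.
by rewrite ler_wpM2r ?mulr_ge0 // ler_weXn2l // ler1n.
Qed.

Lemma ubd_cst c : ubd (fun _ _ => c).
Proof.
split=> [L|N]; first exact: smooth_cst.
exists `|c|; split=> // L t _ x; case: (posnP (size t)) => [/size0nil -> //|h].
by rewrite pds_cst0 // normr0.
Qed.

Lemma ubd_prod (I : Type) (r : seq I) (F : I -> nat -> 'rV[R]_n -> R) :
  (forall i, ubd (F i)) -> ubd (fun L x => \prod_(i <- r) F i L x).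
Proof.
move=> h; elim: r => [|a r IH].
  rewrite (_ : (fun L x => _) = fun _ _ => 1); first exact: ubd_cst.
  by apply/funext => L; apply/funext => x; rewrite big_nil.
rewrite (_ : (fun L x => _) = fun L x => F a L x * \prod_(i <- r) F i L x); first exact: ubdM.
by apply/funext => L; apply/funext => x; rewrite big_cons.
Qed.

Lemma ubd_step (c : nat -> R) (e : R) i : `|e| <= 1 -> ubd (fun L x => step (c L + e * x ord0 i)).
Proof.
move=> e1; split=> [L|N]; first by case: (slow_step (n := n) (c L) e i).
have /choice[C HC] : forall m, exists C : R, 0 <= C /\ forall t, `|(@step R)^`(m)%classic t| <= C.
  by move=> m; have [C C0 HC] := @step_bd R m; exists C.
exists (\sum_(m < N.+1) C m); split=> [|L t tN x]; first by apply: sumr_ge0 => m _; case: (HC m).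
apply: le_trans (pds_affine _ _ _ _ _ (@smooth1_step R)) _.
apply: le_trans (_ : C (size t) <= _).
  rewrite -[leRHS]mul1r; apply: ler_pM => //; first by rewrite exprn_ile1.
  by have [_] := HC (size t).
rewrite (bigD1 (Ordinal (tN : (size t < N.+1)%N))) //= lerDl.
by apply: sumr_ge0 => m _; case: (HC m).
Qed.

(** The transition layer has width 1 for every [L], so the derivatives are bounded uniformly in
    [L]. *)
Definition chi (L : nat) x : R := \prod_i (step (L.+1%:R + -1 * x ord0 i) * step (L.+1%:R + 1 * x ord0 i)).

Lemma ubd_chi : ubd chi.
Proof. by apply: ubd_prod => i; apply: ubdM; apply: ubd_step; rewrite ?normrN normr1. Qed.

Lemma chi_01 L x : 0 <= chi L x <= 1.
Proof.
apply/andP; split; first by apply: prodr_ge0 => i _; rewrite mulr_ge0 ?step_ge0.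
by apply: prodr_ile1 => i _; rewrite mulr_ge0 ?step_ge0 // mulr_ile1 ?step_ge0 ?step_le1.
Qed.

Lemma chi1 L x : `|x| <= L%:R -> chi L x = 1.
Proof.
move=> xL; rewrite /chi big1 // => i _; have := le_trans (coord_le_norm x i) xL.
rewrite ler_norml => /andP[h1 h2].
by rewrite !step1 ?mulr1 // -natr1; lra.
Qed.

Lemma chi0 L x : L.+1%:R < `|x| -> chi L x = 0.
Proof.
move=> xL; have [i hi] : exists i, L.+1%:R < `|x ord0 i|.
  apply: contrapT => /forallNP h; move: xL; apply/negP; rewrite -leNgt.
  by apply: norm_le_coord => // i; rewrite leNgt; apply/negP; exact: h.
rewrite /chi (bigD1 i) //=; have [x0|x0] := leP 0 (x ord0 i).
  rewrite (ger0_norm x0) in hi.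
  have e1 : step (L.+1%:R + -1 * x ord0 i) = 0 by apply: step0; lra.
  by rewrite e1 mul0r mul0r.
rewrite (ltr0_norm x0) in hi.
have e2 : step (L.+1%:R + 1 * x ord0 i) = 0 by apply: step0; lra.
by rewrite e2 mulr0 mul0r.
Qed.

Lemma chi_testfun f L : smooth f -> testfun (fun x => chi L x * f x).
Proof.
move=> sf; split; first by apply: smoothM => //; case: ubd_chi.
by exists L.+1%:R => x /chi0 ->; rewrite mul0r.
Qed.

(** The difference vanishes where [|x| < L]. Elsewhere, one more power of the norm than the seminorm
    involves, available for a Schwartz function, yields a factor [1 / L]. *)
Lemma tempered_cutoff (T : ('rV[R]_n -> R) -> R[i]) f (e : R) : tempered T -> schwartz f -> 0 < e ->
  exists L, normc (T f - T (fun x => chi L x * f x)) <= e.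
Proof.
move=> [lin [N [c hT]]] sf e0; have [fs _] := sf; have [sc hc] := ubd_chi.
have [D [D0 HD]] := hc N; have [A [A0 HA]] := @schwartz_max f N N.+1 sf.
have [B [B0 HB]] := @schwartz_max f N 1 sf.
pose D' := D + 1; pose K := 2 ^+ N * ((A + B) * D').
have K0 : 0 <= K by rewrite !mulr_ge0 ?exprn_ge0 ?addr_ge0.
pose L := (Num.truncn (`|c| * K / e)).+1.
have L0 : 0 < L%:R :> R by rewrite ltr0n.
exists L; have st := testfun_schwartz (chi_testfun L fs).
have -> : T f - T (fun x => chi L x * f x) = T (fun x => f x * (1 - chi L x)).
  have := lin 1 (-1) f _ sf st; rewrite (_ : cr 1 = 1) // mul1r (_ : cr (-1) = -1) ?mulN1r; last first.
    by apply/eqP; rewrite eq_complex /= oppr0 !eqxx.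
  by move=> <-; congr T; apply/funext => x; ring.
have s1 : smooth (fun x => 1 - chi L x).
  rewrite (_ : (fun x => _) = fun x => 1 + -1 * chi L x); last by apply/funext => x; ring.
  by apply: smoothD; [exact: smooth_cst|apply: smoothM; [exact: smooth_cst|exact: sc]].
have hs1 t : (size t <= N)%N -> forall x, `|pds t (fun x => 1 - chi L x) x| <= D'.
  move=> tN x; rewrite (_ : (fun x => _) = fun x => 1 + -1 * chi L x); last by apply/funext => y; ring.
  rewrite pdsD; [|exact: smooth_cst|by apply: smoothM; [exact: smooth_cst|exact: sc]].
  rewrite pdsZ // addrC; apply: le_trans (ler_normD _ _) _; apply: lerD.
    by rewrite normrM normrN normr1 mul1r; exact: HD.
  by case: (posnP (size t)) => [/size0nil -> /=|h]; rewrite ?normr1 // pds_cst0 // normr0.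
have ss : schwartz (fun x => f x * (1 - chi L x)).
  rewrite (_ : (fun x => _) = fun x => 1 * f x + -1 * (chi L x * f x)); last by apply/funext => x; ring.
  exact: schwartzD.
have key t m x : (size t <= N)%N -> (m <= N)%N ->
    `|x| ^+ m * `|pds t (fun x => f x * (1 - chi L x)) x| <= K / L%:R.
  move=> tN mN; have [xL|xL] := ltP `|x| L%:R.
    rewrite (@pds_zero _ _ [set x | `|x| < L%:R]) ?normr0 ?mulr0 ?divr_ge0 ?(ltW L0) //.
      apply: (@open_comp _ _ (fun x : 'rV[R]_n => `|x|) [set y | y < L%:R]); last exact: open_lt.
      by move=> y _; exact: norm_continuous.
    by move=> y /= /ltW yL; rewrite chi1 // subrr mulr0.
  have x0 : 0 < `|x| by exact: lt_le_trans xL.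
  have x1 : 1 <= `|x| by apply: le_trans xL; rewrite ler1n.
  have hf u : (size u <= size t)%N -> `|pds u f x| <= (A + B) / `|x| ^+ m.+1.
    move=> ut; rewrite ler_pdivlMr ?exprn_gt0 // mulrC.
    apply: le_trans (_ : `|x| ^+ N.+1 * `|pds u f x| <= _); first by rewrite ler_wpM2r // ler_weXn2l.
    by apply: le_trans (HA u (leq_trans ut tN) x) _; rewrite lerDl.
  have := @pds_prod_bound _ _ t f (fun x => 1 - chi L x) x ((A + B) / `|x| ^+ m.+1) D' fs s1.
  rewrite divr_ge0 ?addr_ge0 ?exprn_ge0 // => /(_ isT isT hf (fun u ut => hs1 u (leq_trans ut tN) x)) h.
  apply: le_trans (ler_wpM2l _ h) _; first by rewrite exprn_ge0.
  have -> : `|x| ^+ m * (2 ^+ size t * ((A + B) / `|x| ^+ m.+1 * D')) = 2 ^+ size t * ((A + B) * D') / `|x|.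
    by rewrite exprS; field; rewrite expf_eq0 negb_and !(lt0r_neq0 x0) orbT.
  apply: ler_pM; rewrite ?mulr_ge0 ?exprn_ge0 ?addr_ge0 ?invr_ge0 //.
    by rewrite ler_wpM2r ?mulr_ge0 ?addr_ge0 // ler_weXn2l // ler1n.
  by rewrite lef_pV2.
have := hT _ ss (K / L%:R) key; rewrite lecR => h; apply: le_trans h _.
apply: le_trans (_ : `|c| * (K / L%:R) <= _).
  by rewrite ler_wpM2r ?ler_norm // divr_ge0 // ltW.
rewrite mulrA ler_pdivrMr // (mulrC e) -ler_pdivrMr //; exact/ltW/truncnS_gt.
Qed.

End Cutoff.

Section Measures.
Context {R : realType} {n : nat}.
Implicit Types (f : 'rV[R]_n -> R) (nu : {measure set (RnB R n) -> \bar R}).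

Lemma ball_compact (r : R) : compact [set x : 'rV[R]_n | `|x| <= r].
Proof.
apply: bounded_closed_compact; first by exists r; split; [exact: num_real|move=> y ry x /= xr; exact: le_trans (ltW ry)].
rewrite (_ : [set x | _] = (fun x : 'rV[R]_n => `|x|) @^-1` [set y | y <= r]) //.
by apply: closed_comp => [x _|]; [exact: norm_continuous|exact: closed_le].
Qed.

Lemma ball_measurable (r : R) : measurable ([set x : 'rV[R]_n | `|x| <= r] : set (RnB R n)).
Proof.
rewrite -[X in measurable X]setCK; apply: measurableC.
apply: open_RnB_measurable; rewrite (_ : ~` _ = (fun x : 'rV[R]_n => `|x|) @^-1` [set y | r < y]).
  by apply: open_comp; [move=> x _; exact: norm_continuous|exact: open_gt].
by apply/seteqP; split=> x /=; rewrite ltNge => /negP.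
Qed.

Lemma testfun_measurable f : testfun f -> measurable_fun setT (f : RnB R n -> R).
Proof. by move=> [sf _]; apply: continuous_RnB_measurable; exact: smooth_continuous. Qed.

Lemma testfun_bounded f : testfun f -> exists B r : R, [/\ 0 <= B, 0 <= r,
  forall x, `|f x| <= B & forall x, r < `|x| -> f x = 0].
Proof.
move=> tf; have [_ h] := testfun_schwartz tf; have [B HB] := h [::] 0%N; have [_ [r hr]] := tf.
have hB x : `|f x| <= B by have := HB x; rewrite expr0 mul1r.
exists B, (Num.max 0 r); split; rewrite ?le_max ?lexx //; first exact: le_trans (hB 0).
by move=> x; rewrite gt_max => /andP[_]; exact: hr.
Qed.

Lemma compact_integral nu f (A : set (RnB R n)) (B : R) : locally_finite nu -> testfun f -> measurable A ->
  (exists r : R, A `<=` [set x | `|x| <= r]) -> 0 <= B -> (forall x, `|f x| <= B) -> (forall x, ~ A x -> f x = 0) ->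
  nu.-integrable setT (EFin \o f) /\ `|Rintegral nu setT f| <= B * fine (nu A).
Proof.
move=> lf tf mA [r Ar] B0 fB fA.
have nA : (nu A < +oo)%E.
  have h : (nu [set x : 'rV[R]_n | (`|x| <= r)%R] < +oo)%E := lf _ (@ball_compact r).
  have le : (nu A <= nu [set x : 'rV[R]_n | (`|x| <= r)%R])%E.
    by apply: le_measure => //; apply/mem_set => //; exact: ball_measurable.
  exact: le_lt_trans le h.
have nAf : nu A \is a fin_num by rewrite ge0_fin_numE.
have iI : nu.-integrable setT (EFin \o (\1_A : RnB R n -> R)).
  apply/integrableP; split; first exact/measurable_EFinP.
  rewrite (eq_integral (fun x => (\1_A x)%:E)) => [|t _]; last by rewrite gee0_abs // lee_fin.
  by rewrite integral_indic // setIT.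
have iA : nu.-integrable setT (EFin \o (fun x => B * \1_A x)).
  exact: (@integrableZl _ _ _ nu setT measurableT B (EFin \o \1_A)).
have le x : `|f x| <= B * \1_A x.
  rewrite indicE; case: (boolP (x \in A)) => [_|/negP xA]; first by rewrite mulr1.
  by rewrite fA ?normr0 ?mulr0 // => Ax; apply: xA; exact/mem_set.
have fi : nu.-integrable setT (EFin \o f).
  apply: le_integrable iA => //; first by apply/measurable_EFinP; exact: testfun_measurable.
  move=> x _; rewrite lee_fin /=; apply: le_trans (le x) _; exact: ler_norm.
split=> //; apply: le_trans (le_normr_Rintegral measurableT fi) _.
have -> : B * fine (nu A) = Rintegral nu setT (fun x => B * \1_A x).
  by rewrite (RintegralZl _ measurableT iI) /Rintegral integral_indic // setIT.
apply: le_Rintegral => //; first exact: (integrable_norm fi).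
Qed.

Definition nball (r : R) : set (RnB R n) := [set x : 'rV[R]_n | `|x| <= r].

(** [m] is the sum of the four measures and plays the part of the total variation: its sums over
    disjoint subsets of a ball are bounded, and it controls the functional on functions vanishing
    off a set. *)
Lemma complex_measure_bound (T : ('rV[R]_n -> R) -> R[i]) : is_complex_measure T ->
  exists m : set (RnB R n) -> R,
  (forall (r : R) (A : nat -> set (RnB R n)) L, (forall l, measurable (A l)) -> trivIset setT A ->
     (forall l, A l `<=` nball r) -> \sum_(l < L) m (A l) <= m (nball r)) /\
  (forall f A B, testfun f -> measurable A -> (exists r : R, A `<=` nball r) ->
     0 <= B -> (forall x, `|f x| <= B) -> (forall x, ~ A x -> f x = 0) -> normc (T f) <= B * m A).
Proof.
move=> [v1 [v2 [v3 [v4 [[l1 l2 l3 l4] hT]]]]].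
pose m A := fine (v1 A) + fine (v2 A) + (fine (v3 A) + fine (v4 A)); exists m; split.
  move=> r A L mA tA Ar.
  have h v : locally_finite v -> \sum_(l < L) fine (v (A l)) <= fine (v (nball r)).
    move=> lf; have fr : (v (nball r) < +oo)%E := lf _ (@ball_compact r).
    have fl l : v (A l) \is a fin_num.
      have le : (v (A l) <= v (nball r))%E.
        by apply: le_measure => //; apply/mem_set => //; exact: ball_measurable.
      by rewrite ge0_fin_numE //; exact: le_lt_trans le fr.
    rewrite -lee_fin fineK ?ge0_fin_numE // -sumEFin (eq_bigr (fun l : 'I_L => v (A l))) => [|l _]; last by rewrite fineK.
    rewrite -measure_semi_additive_ord_I //; last 2 first.
    - by apply: sub_trivIset tA.
    - exact: bigsetU_measurable.
    apply: le_measure; [by apply/mem_set; exact: bigsetU_measurable|by apply/mem_set; exact: ball_measurable|].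
    by rewrite -bigcup_mkord => x [l _]; exact: Ar.
  by rewrite /m !big_split /= !lerD ?h.
move=> f A B tf mA Ar B0 fB fA; rewrite hT //; apply: le_trans (normc_le _) _ => /=.
have h v (lv : locally_finite v) := (compact_integral lv tf mA Ar B0 fB fA).2.
rewrite /m !mulrDr; apply: lerD; apply: le_trans (ler_normB _ _) _; apply: lerD; exact: h.
Qed.

End Measures.

(** * Homogeneity and the case of complex measures *)

Section Scaling.
Context {R : realType} {n : nat} {k : R} {lam : {measure set (RnB R n) -> \bar R}}.
Context {Rz : R[i] -> ('rV[R]_n -> R) -> R[i]}.
Hypothesis (n1 : (1 <= n)%N) (k0 : 0 < k) (hlam : is_lebesgue_Rn lam) (hRz : riesz_family k lam Rz).
Implicit Types (x : RnB R n) (phi : 'rV[R]_n -> R).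
Local Notation orth := (@Rplus_n R n).
Local Notation prs := (@pairs n predT).
Local Notation mu0 := (mu0 n k).

Lemma psum_le_norm x : psum x <= n%:R * `|x : 'rV[R]_n|.
Proof.
rewrite /psum [leRHS](_ : _ = \sum_(i < n) `|x : 'rV[R]_n|); last by rewrite sumr_const card_ord mulr_natl.
by apply: ler_sum => i _; apply: le_trans (ler_norm _) (coord_le_norm x i).
Qed.

Lemma test_W0_int (mu : R) phi : mu0 < mu -> testfun phi ->
  lam.-integrable orth (EFin \o (fun x => phi x * @W0 R n k mu x)).
Proof.
move=> h tf; have [B [r [B0 r0 hB hr]]] := testfun_bounded tf.
have mO := @orthant_measurable R n.
have i1 := integrableZl mO (B * expR (n%:R * r)) (Z_integrable hlam k0 (al_gt h)).
apply: le_integrable i1 => //.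
  apply/measurable_EFinP; apply: measurable_funTS; apply: measurable_funM; last exact: wt_measurable.
  exact: testfun_measurable.
move=> x xO; rewrite lee_fin /= -/(@W0 R n k mu x) -/(wt _ _ _ _ _ _) normrM (ger0_norm (wt_ge0 _ _ _ _ _ _)).
have w0 := wt_ge0 prs k (fun _ => @al R n k mu) (fun _ => 1) 0 x.
rewrite [leRHS]ger0_norm; last by rewrite mulr_ge0 // mulr_ge0 ?expR_ge0.
rewrite -(W0_exp _ 1 xO) [leRHS]mulrA; apply: ler_wpM2r; first exact: wt_ge0.
have [xr|xr] := leP `|x : 'rV[R]_n| r; last by rewrite hr // normr0 !mulr_ge0 ?expR_ge0.
rewrite -[leLHS]mulr1 -mulrA; apply: ler_pM => //; rewrite -expRD -[leLHS]expR0 ler_expR mul1r subr_ge0.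
by apply: le_trans (psum_le_norm x) _; rewrite ler_wpM2l.
Qed.

(** The degree is [n (mu - mu0 - 1)] from the power of [D] plus [k n (n - 1) = n mu0] from the
    Vandermonde factor. *)
Lemma W0_scale (mu s : R) x : 0 < s -> orth x ->
  @W0 R n k mu (s *: (x : 'rV[R]_n)) = expR (ln s * (n%:R * (mu - 1))) * @W0 R n k mu x.
Proof.
move=> s0 xO; rewrite -!W0_E //; last by move=> i; rewrite mxE mulr_gt0.
have Ds : Dx (s *: (x : 'rV[R]_n)) = s ^+ n * Dx x.
  rewrite /Dx -[X in s ^+ X]card_ord -prodr_const -big_split; apply: eq_bigr => i _.
  by rewrite mxE.
have sn0 := exprn_ge0 n (ltW s0); have D0 := ltW (Dx_gt0 xO).
rewrite Ds !(omega_vdm k0) (powRM _ sn0 D0).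
have pm (c : R) m : (s `^ c) ^+ m = expR (ln s * (m%:R * c)).
  by rewrite -powR_mulrn ?powR_ge0 // -powRrM /powR (gt_eqF s0); congr expR; ring.
have -> : (s ^+ n) `^ (@al R n k mu) = (s `^ (@al R n k mu)) ^+ n.
  by rewrite pm -(powR_mulrn n (ltW s0)) -powRrM /powR (gt_eqF s0); congr expR; ring.
have -> : vdm prs k 0 (s *: (x : 'rV[R]_n)) = ((s `^ k) ^+ n.-1) ^+ n * vdm prs k 0 x.
  rewrite /vdm -[X in _ ^+ X * _](card_ord n) -prodr_const -big_split; apply: eq_bigr => i _ /=.
  have -> : (s `^ k) ^+ n.-1 = \prod_(j | prs i j) s `^ k.
    rewrite prodr_const; congr (_ ^+ _); rewrite -[in LHS](card_ord n) -(cardC1 i).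
    by apply: eq_card => j; rewrite !inE /pairs /= eq_sym.
  rewrite -big_split; apply: eq_bigr => j _ /=; rewrite !mxE -mulrBr exprMn addr0 addr0.
  rewrite powRM ?sqr_ge0 //; congr (_ * _); rewrite -powR_mulrn ?(ltW s0) // -powRrM.
  by congr (_ `^ _); field.
rewrite -exprM !pm [LHS](_ : _ = expR (ln s * (n%:R * @al R n k mu)) *
  expR (ln s * ((n.-1 * n)%:R * k)) * (Dx x `^ @al R n k mu * vdm prs k 0 x)); last by ring.
rewrite -expRD; congr (expR _ * _); rewrite /al /Defs.mu0 natrM -subn1 natrB //; ring.
Qed.

Lemma schwartz_scale (s : R) phi : 0 < s -> schwartz phi -> schwartz (fun x => phi (s *: x)).
Proof.
move=> s0 [sf hf]; split; first exact: smooth_scale.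
move=> t m; have [C HC] := hf t m; exists (s ^+ size t / s ^+ m * C) => x.
rewrite pds_scale // normrM (ger0_norm (exprn_ge0 _ (ltW s0))).
have -> : `|x| ^+ m * (s ^+ size t * `|pds t phi (s *: x)|) =
    s ^+ size t / s ^+ m * (`|s *: x| ^+ m * `|pds t phi (s *: x)|).
  rewrite normrZ (gtr0_norm s0) exprMn; have sm : s ^+ m != 0 by rewrite expf_neq0 ?gt_eqF.
  by move: (`|x| ^+ m) (`|pds t phi _|) => u v; field.
by rewrite ler_wpM2l // divr_ge0 ?exprn_ge0 ?(ltW s0).
Qed.

Lemma Rz_scale (mu : R[i]) (s : R) phi : 0 < s -> schwartz phi ->
  (forall mu : R, mu0 < mu -> lam.-integrable orth (EFin \o (fun x => phi x * @W0 R n k mu x))) ->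
  Rz mu (fun x => phi (s *: x)) = cexp (cr (- (n%:R * ln s)) * mu) * Rz mu phi.
Proof.
move=> s0 sp hi; have ss := schwartz_scale s0 sp; move: mu.
apply: (@Rz_eq R n k (fun mu => Rz mu (fun x => phi (s *: x)))
   (fun mu => cexp (cr (- (n%:R * ln s)) * mu) * Rz mu phi)) => [||mu h].
- exact: (Rz_hol hRz).
- by apply: holomorphicM; [exact: holomorphic_cexp|exact: (Rz_hol hRz)].
rewrite (Rz_real k0 hRz h ss) (Rz_real k0 hRz h sp) crM cexp_cr crM; congr cr; rewrite mulrA; congr (_ / _).
have sp0 i : 0 < (const_mx s : 'rV[R]_n) ord0 i by rewrite mxE.
have [_] := gmap_Rintegral hlam 1%g sp0 (@orthant_measurable R n) (hi mu h).
rewrite (_ : \prod_i _ = s ^+ n); last first.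
  by rewrite -[X in s ^+ X]card_ord -prodr_const; apply: eq_bigr => i _; rewrite mxE.
rewrite (_ : gmap _ _ @^-1` _ = orth); last first.
  apply/seteqP; split=> x h' i; have := h' i; rewrite /= !mxE perm1 ?pmulr_rgt0 //.
have gE x : gmap (const_mx s) 1%g x = s *: (x : 'rV[R]_n) by apply/rowP => i; rewrite !mxE perm1.
(* The exponent [- n mu] splits into minus the degree [n (mu - 1)] of the weight and the exponent
   [- n] of the Jacobian. *)
have -> : expR (- (n%:R * ln s) * mu) = expR (- (ln s * (n%:R * (mu - 1)))) * (s ^+ n)^-1.
  rewrite -[X in X ^+ n](lnK s0) -expRM_natl -expRN -expRD; congr expR; ring.
rewrite -mulrA => <-.
have ig : lam.-integrable orth (EFin \o (fun x => phi (gmap (const_mx s) 1%g x) * @W0 R n k mu (gmap (const_mx s) 1%g x))).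
  have [+ _] := gmap_Rintegral hlam 1%g sp0 (@orthant_measurable R n) (hi mu h).
  rewrite (_ : gmap _ _ @^-1` _ = orth) //.
  by apply/seteqP; split=> x h' i; have := h' i; rewrite /= !mxE perm1 ?pmulr_rgt0.
rewrite -(RintegralZl _ (@orthant_measurable R n) ig); apply: eq_Rintegral => x /set_mem xO.
rewrite gE W0_scale // expRN; move: (phi _) (@W0 R n k mu x) => u v.
by field; rewrite gt_eqF // expR_gt0.
Qed.

Lemma Rz_exp_scale : exists2 E0 : R, 0 < E0 & forall (mu : R[i]) c M, 0 < c -> 0 < M ->
  Rz mu (exq c M (fun _ => 1)) = cexp (cr (- (n%:R * ln M)) * mu) * cr E0.
Proof.
have [E0 E00 hE] := Rz_const k0 hlam hRz; exists E0 => // mu c M c0 M0.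
have s1 : schwartz (exq 1 1 (fun _ : 'rV[R]_n => 1)) by apply: exq_schwartz => //; exact: slow_cst.
rewrite -(hE mu 1 ltr01) -Rz_scale //; last first.
  move=> nu hnu; have := wt_al_int k0 hlam hnu ltr01 (polyf_cst 1).
  apply: eq_integrable; first exact: orthant_measurable.
  by move=> x /set_mem xO; rewrite /= exq_orth // mulr1 mul1r -(W0_exp _ 1 xO).
apply: (Rz_local k0 hRz); [by apply: exq_schwartz => //; exact: slow_cst|exact: schwartz_scale|].
move=> x xO; rewrite !exq_orth //; last by move=> i; rewrite mxE mulr_gt0.
by rewrite !mulr1 mul1r /psum mulr_sumr; congr (expR (- _)); apply: eq_bigr => i _; rewrite mxE.
Qed.

(** The exponential of [Rz_const] has a nonzero value, which the values at its truncations
    approximate. *)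
Lemma Rz_zero_contra mu : (forall f, testfun f -> Rz mu f = 0) -> False.
Proof.
move=> h; have [E0 E00 hE] := Rz_const k0 hlam hRz.
have s1 : schwartz (exq 1 1 (fun _ : 'rV[R]_n => 1)) by apply: exq_schwartz => //; exact: slow_cst.
have [sm _] := s1.
have e0 : 0 < E0 / 2 by rewrite divr_gt0.
have tT : tempered (Rz mu) by case: hRz.
have [L] := tempered_cutoff tT s1 e0; rewrite hE // h ?subr0; last exact: chi_testfun.
by rewrite normc_cr gtr0_norm //; lra.
Qed.

Lemma neg_not_measure (r : R) : r < 0 -> ~ is_complex_measure (Rz (cr r)).
Proof.
move=> r0 /complex_measure_bound[m [_ hm]]; apply: (@Rz_zero_contra (cr r)) => f tf.
have [B [r1 [B0 r10 hB hr]]] := testfun_bounded tf; have [sf _] := tf.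
apply/eqP; apply: contraT => z0; have N0 := normc_gt0 z0; set N := normc _ in N0.
have key (t : R) : 0 <= t -> N * expR (- (n%:R * r) * t) <= B * m (nball r1).
  move=> t0; have s1 : 1 <= expR t by rewrite -expR0 ler_expR.
  have s0 : 0 < expR t by exact: expR_gt0.
  have ts : testfun (fun x => f (expR t *: x)).
    split; first exact: smooth_scale.
    by exists r1 => x xr; apply: hr; rewrite normrZ (gtr0_norm s0) (lt_le_trans xr) // ler_peMl.
  have := hm _ (nball r1) B ts (ball_measurable _) (ex_intro _ r1 (@subset_refl _ _)) B0 (fun x => hB _).
  have z x : ~ nball r1 x -> f (expR t *: (x : 'rV[R]_n)) = 0.
    move=> /negP; rewrite -ltNge => xr; apply: hr.
    by rewrite normrZ (gtr0_norm s0) (lt_le_trans xr) // ler_peMl.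
  move=> /(_ z); rewrite (Rz_scale _ s0 (testfun_schwartz tf)); last by move=> mu h; exact: test_W0_int.
  rewrite crM cexp_cr normcM normc_cr (gtr0_norm (expR_gt0 _)) -/N mulrC expRK.
  by rewrite (_ : - (n%:R * t) * r = - (n%:R * r) * t) //; ring.
have nr : 0 < - (n%:R * r) by rewrite -mulrN mulr_gt0 ?oppr_gt0 // ltr0n.
have Bm0 : 0 <= B * m (nball r1).
  by apply: le_trans (key 0 (lexx _)); rewrite mulr_ge0 ?expR_ge0 // ltW.
(* By [expR u >= 1 + u], this [t] makes the left side of [key] at least [N + B * m (nball r1)]. *)
have t0 : 0 <= B * m (nball r1) / N / - (n%:R * r).
  by apply: divr_ge0; [apply: divr_ge0 => //; exact: ltW|exact: ltW].
have := key _ t0; rewrite leNgt => /negP; case.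
rewrite (mulrC (- _)) divfK ?gt_eqF //.
apply: lt_le_trans (ler_wpM2l (ltW N0) (expR_ge1Dx _)).
by rewrite mulrDr mulr1 mulrCA mulfV ?gt_eqF // mulr1 ltrDr.
Qed.

End Scaling.

(** * Complex measures: bumps accumulating at a wall of the orthant *)

Section Bumps.
Context {R : realType} {n : nat} {k : R} {lam : {measure set (RnB R n) -> \bar R}}.
Context {Rz : R[i] -> ('rV[R]_n -> R) -> R[i]}.
Hypothesis (n1 : (1 <= n)%N) (k0 : 0 < k) (hlam : is_lebesgue_Rn lam) (hRz : riesz_family k lam Rz).
Implicit Types (x : RnB R n) (phi : 'rV[R]_n -> R).
Local Notation orth := (@Rplus_n R n).
Local Notation prs := (@pairs n predT).
Local Notation mu0 := (mu0 n k).

Lemma Rint_box_ge (f : RnB R n -> R) (a b : 'rV[R]_n) (v : R) : lam.-integrable orth (EFin \o f) ->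
  (forall x, orth x -> 0 <= f x) -> (forall i, a ord0 i <= b ord0 i) -> cbox a b `<=` orth ->
  0 <= v -> (forall x, cbox a b x -> v <= f x) ->
  v * \prod_i (b ord0 i - a ord0 i) <= Rintegral lam orth f.
Proof.
move=> fi f0 ab sub v0 fv; have mO := @orthant_measurable R n; have mb := @cbox_measurable R n a b.
rewrite -lee_fin /Rintegral fineK; last exact: integrable_fin_num.
rewrite EFinM -(cbox_lam hlam ab) -(integral_cst _ mb).
apply: le_trans (_ : (\int[lam]_(x in cbox a b) (EFin \o f) x <= _)%E).
  by apply: ge0_le_integral => //; apply: measurable_funS (measurable_int lam fi).
by apply: ge0_subset_integral => //; exact: (measurable_int lam fi).
Qed.

(* The bumps sit around (2^-l, 2, ..., n): their supports are disjoint boxes inside one ball. *)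
Definition fac (l : nat) (i : 'I_n) : R := if (i : nat) == 0%N then 2 ^+ l else 1.

Lemma fac_ge1 l i : 1 <= fac l i.
Proof. by rewrite /fac; case: ifP => // _; rewrite exprn_ege1 // ler1n. Qed.

Lemma fac_gt0 l i : 0 < fac l i. Proof. exact: lt_le_trans ltr01 (fac_ge1 l i). Qed.

Lemma fac_prod l : \prod_i fac l i = 2 ^+ l.
Proof.
rewrite (bigD1 (Ordinal n1)) //= big1 ?mulr1 // => i /negPf i0.
by rewrite /fac; move: i0; rewrite -val_eqE /= => ->.
Qed.

Definition bump (d : R) (l : nat) (x : 'rV[R]_n) : R :=
  \prod_(i < n) (step ((2 - i.+1%:R / d) + (fac l i / d) * x ord0 i) *
           step ((2 + i.+1%:R / d) + - (fac l i / d) * x ord0 i)).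

(** The box of half-width [e * d] in the rescaled coordinates [fac l i * x_i]: the bump is 1 on the
    box with [e = 1] and vanishes off the one with [e = 2]. *)
Definition bbox (d e : R) l : set (RnB R n) :=
  cbox (\row_(i < n) ((i.+1%:R - e * d) / fac l i)) (\row_(i < n) ((i.+1%:R + e * d) / fac l i)).

Lemma bboxP (d e : R) l x : bbox d e l x <-> forall i : 'I_n, `|fac l i * x ord0 i - i.+1%:R| <= e * d.
Proof.
split=> h i; have := h i; rewrite ?mxE ?ler_distl ler_pdivrMr ?ler_pdivlMr ?fac_gt0 //.
  by rewrite (mulrC (x _ _)).
by rewrite (mulrC (fac l i)).
Qed.

Lemma bump01 d l x : 0 <= bump d l x <= 1.
Proof.
apply/andP; split; first by apply: prodr_ge0 => i _; rewrite mulr_ge0 ?step_ge0.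
by apply: prodr_ile1 => i _; rewrite mulr_ge0 ?step_ge0 // mulr_ile1 ?step_ge0 ?step_le1.
Qed.

Lemma bump1 d l x : 0 < d -> bbox d 1 l x -> bump d l x = 1.
Proof.
move=> d0 /bboxP h; rewrite /bump big1 // => i _; have := h i.
rewrite mul1r ler_distl => /andP[h1 h2]; rewrite !step1 ?mulr1 //.
  have -> : 2 + i.+1%:R / d + - (fac l i / d) * x ord0 i = 2 + (i.+1%:R - fac l i * x ord0 i) / d.
    by field; rewrite gt_eqF.
  have : -1 <= (i.+1%:R - fac l i * x ord0 i) / d by rewrite ler_pdivlMr //; lra.
  by lra.
have -> : 2 - i.+1%:R / d + (fac l i / d) * x ord0 i = 2 + (fac l i * x ord0 i - i.+1%:R) / d.
  by field; rewrite gt_eqF.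
have : -1 <= (fac l i * x ord0 i - i.+1%:R) / d by rewrite ler_pdivlMr //; lra.
by lra.
Qed.

Lemma bump0 d l x : 0 < d -> ~ bbox d 2 l x -> bump d l x = 0.
Proof.
move=> d0 hx; have [i hi] : exists i, 2 * d < `|fac l i * x ord0 i - i.+1%:R|.
  by apply: contrapT => /forallNP h; apply: hx; apply/bboxP => i; rewrite leNgt; apply/negP; exact: h.
rewrite /bump (bigD1 i) //=; have [z|z] := leP 0 (fac l i * x ord0 i - i.+1%:R).
  rewrite (ger0_norm z) in hi.
  have e : step ((2 + i.+1%:R / d) + - (fac l i / d) * x ord0 i) = 0.
    apply: step0; have -> : 2 + i.+1%:R / d + - (fac l i / d) * x ord0 i = 2 - (fac l i * x ord0 i - i.+1%:R) / d.
      by field; rewrite gt_eqF.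
    by rewrite subr_le0 ler_pdivlMr // ltW.
  by rewrite e mulr0 mul0r.
rewrite (ltr0_norm z) in hi.
have e : step ((2 - i.+1%:R / d) + (fac l i / d) * x ord0 i) = 0.
  apply: step0; have -> : 2 - i.+1%:R / d + (fac l i / d) * x ord0 i = 2 - (- (fac l i * x ord0 i - i.+1%:R)) / d.
    by field; rewrite gt_eqF.
  by rewrite subr_le0 ler_pdivlMr // ltW.
by rewrite e !mul0r.
Qed.

Lemma bbox_coord d e l x i : 0 < d -> 0 < e -> e * d <= 1 / 4 -> bbox d e l x ->
  3 / 4 <= fac l i * x ord0 i /\ fac l i * x ord0 i <= n%:R + 1 / 4.
Proof.
move=> d0 e0 ed /bboxP /(_ i); rewrite ler_distl => /andP[h1 h2].
have a1 : 1 <= i.+1%:R :> R by rewrite ler1n.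
have a2 : i.+1%:R <= n%:R :> R by rewrite ler_nat.
by split; lra.
Qed.

Lemma bbox_orth d e l x : 0 < d -> 0 < e -> e * d <= 1 / 4 -> bbox d e l x -> orth x.
Proof.
move=> d0 e0 ed h i; have [h1 _] := bbox_coord i d0 e0 ed h.
by rewrite -(pmulr_rgt0 _ (fac_gt0 l i)); apply: lt_le_trans h1; rewrite divr_gt0.
Qed.

Lemma bbox_ball d l : 0 < d -> 2 * d <= 1 / 4 -> bbox d 2 l `<=` nball (n%:R + 1 : R).
Proof.
move=> d0 dd x h; apply: norm_le_coord => [|i]; first by rewrite addr_ge0.
have xO : orth x := bbox_orth d0 (ltr0Sn _ 1) dd h.
have [_ h2] := bbox_coord i d0 (ltr0Sn _ 1) dd h.
rewrite (gtr0_norm (xO i)); apply: le_trans (_ : fac l i * x ord0 i <= _); last lra.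
by rewrite ler_peMl ?fac_ge1 // ltW.
Qed.

Lemma bump_smooth d l : smooth (bump d l).
Proof.
by apply: smooth_prod => i _; apply: smoothM; [case: (slow_step (n := n) (2 - i.+1%:R / d) (fac l i / d) i)|
  case: (slow_step (n := n) (2 + i.+1%:R / d) (- (fac l i / d)) i)].
Qed.

Lemma bump_testfun d l : 0 < d -> 2 * d <= 1 / 4 -> testfun (bump d l).
Proof.
move=> d0 dd; split; first exact: bump_smooth.
exists (n%:R + 1) => x xr; apply: bump0 => // h; have := bbox_ball d0 dd h.
by rewrite /nball /= leNgt xr.
Qed.

Lemma bbox_triv d : 0 < d -> 2 * d <= 1 / 4 -> trivIset setT (bbox d 2).
Proof.
move=> d0 dd; apply/trivIsetP => l l' _ _ ll; apply/seteqP; split=> // x [h h'].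
have /bboxP/(_ (Ordinal n1)) := h; have /bboxP/(_ (Ordinal n1)) := h'.
rewrite /fac /= !ler_distl => /andP[a1 a2] /andP[b1 b2].
have tw m m' : (m < m')%N -> 2 ^+ m' * x ord0 (Ordinal n1) <= 1 + 2 * d ->
    1 - 2 * d <= 2 ^+ m * x ord0 (Ordinal n1) -> False.
  move=> mm u1 u2; have x0 := bbox_orth d0 (ltr0Sn _ 1) dd h (Ordinal n1).
  have : 2 ^+ m.+1 * x ord0 (Ordinal n1) <= 2 ^+ m' * x ord0 (Ordinal n1).
    by rewrite ler_wpM2r ?(ltW x0) // ler_weXn2l // ler1n.
  rewrite exprS -mulrA; move: (2 ^+ m * _) u2 (2 ^+ m' * _) u1 => u u2 v u1; lra.
by case: (ltngtP l l') ll => // ll _; [exact: (tw l l')|exact: (tw l' l)].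
Qed.

Lemma ln_near (y c d : R) : 1 <= c -> `|y - c| <= d -> d <= 1 / 4 -> `|ln y - ln c| <= 2 * d.
Proof.
move=> c1 /[!ler_distl] /andP[h1 h2] d4; have c0 : 0 < c by lra.
have y0 : 0 < y by lra.
have L (u v : R) : 0 < u -> 0 < v -> ln u - ln v <= (u - v) / v.
  move=> u0 v0; rewrite -ln_div ?posrE //.
  have -> : (u - v) / v = u / v - 1 by field; rewrite gt_eqF.
  rewrite -{1}(subrKC 1 (u / v)); apply: le_ln1Dx.
  by rewrite ltrBrDr addNr divr_gt0.
have a1 := L y c y0 c0; have a2 := L c y c0 y0.
have b1 : (y - c) / c <= 2 * d by rewrite ler_pdivrMr //; nra.
have b2 : (c - y) / y <= 2 * d by rewrite ler_pdivrMr //; nra.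
by apply/andP; split; lra.
Qed.

Lemma cos_ge_half : exists2 eta : R, 0 < eta & forall u : R, `|u| <= eta -> 1 / 2 <= cos u.
Proof.
have /cvgrPdist_le /(_ (1 / 2)) := @continuous_cos R 0.
rewrite divr_gt0 // => /(_ isT) /nbhs_ballP[e /= e0 he]; exists (e / 2); first by rewrite divr_gt0.
move=> u ue; have := he u; rewrite /ball /= sub0r normrN cos0 => /(_ _)/[!ler_distl].
have -> : `|u| < e by apply: le_lt_trans ue _; rewrite ltr_pdivrMr // ltr_pMr // ltr1n.
by move=> /(_ isT) /andP[h1 h2]; lra.
Qed.

Lemma ln_Dx x : orth x -> ln (Dx x) = \sum_i ln (x ord0 i).
Proof.
move=> xO; rewrite /Dx; elim: (index_enum _) => [|i r IH]; first by rewrite !big_nil ln1.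
by rewrite !big_cons lnM ?posrE ?IH //; apply: prodr_gt0 => j _; exact: xO.
Qed.

Lemma Dx_measurable : measurable_fun setT (fun x : RnB R n => Dx x).
Proof. by apply: measurable_prod => i _; exact: coord_measurable. Qed.

(** For complex [nu] the density carries the oscillating phase [Im nu * ln (D x)]. On the support of
    a bump it stays within [eta] of its central value, uniformly in [l], so no cancellation occurs
    and the modulus is at least half of the integral with exponent [Re nu], up to normalization. *)
Lemma bump_lower (nu : R[i]) : mu0 < cRe nu -> exists d c : R, [/\ 0 < d, 2 * d <= 1 / 4, 0 < c &
  forall l, c * (((2 ^+ l)^-1) `^ (@al R n k (cRe nu)) * (2 ^+ l)^-1) <= normc (Rz nu (bump d l))].
Proof.
move=> h; pose a := @al R n k (cRe nu); pose t := cIm nu.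
have mO := @orthant_measurable R n.
have [eta e0 he] := cos_ge_half.
have nn : 0 < n%:R :> R by rewrite ltr0n.
have tp : 0 < 4 * n%:R * (`|t| + 1) by rewrite mulr_gt0 ?mulr_gt0 // ltr_wpDl.
(* [1 / 8] keeps the boxes in the orthant and disjoint. The second bound keeps the phase within
   [eta], as the logarithm of each coordinate deviates by at most [2 * (2 * d)] from its central
   value. *)
pose d := Num.min (1 / 8) (eta / (4 * n%:R * (`|t| + 1))).
have d0 : 0 < d by rewrite lt_min !divr_gt0.
have d8 : d <= 1 / 8 by rewrite ge_min lexx.
have dd : 2 * d <= 1 / 4 by lra.
have dt : `|t| * (n%:R * (2 * (2 * d))) <= eta.
  have : d <= eta / (4 * n%:R * (`|t| + 1)) by rewrite ge_min lexx orbT.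
  rewrite ler_pdivlMr // => u; apply: le_trans u.
  have : 0 <= d * (4 * n%:R) by rewrite !mulr_ge0 // ltW.
  by move: (d * _) => v v0; have := normr_ge0 t; nra.
pose D' := d_n n k * Gamma_n n k nu.
have [E0 E00 hE] := Rz_const k0 hlam hRz.
(* Division by 0 being 0, a vanishing normalizing factor would make [R_nu] zero, against
   [Rz_const]. *)
have D0 : D' != 0.
  have s1 : schwartz (exq 1 1 (fun _ : 'rV[R]_n => 1)) by apply: exq_schwartz => //; exact: slow_cst.
  have := hE nu 1 ltr01; case: hRz => _ _ -> //; rewrite /riesz_integral -/D'.
  apply: contra_eqN => /eqP ->; rewrite invr0 mulr0.
  by apply/eqP => -[/esym]; move: E00 => /[swap] ->; rewrite ltxx.
have DN := normc_gt0 D0.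
(* The exponent [a] may have either sign, so both ends of the range of the rescaled [D] are taken
   into account. *)
pose c1 := Num.min (((3 / 4 : R) ^+ n) `^ a) (((n%:R + 1 / 4 : R) ^+ n) `^ a).
have c10 : 0 < c1 by rewrite lt_min !powR_gt0 ?exprn_gt0 ?divr_gt0 ?addr_gt0 ?divr_gt0.
pose c2 : R := \prod_(i < n) \prod_(j < n | (i < j)%N) ((1 / 2) `^ (2 * k)).
have c20 : 0 < c2 by apply: prodr_gt0 => i _; apply: prodr_gt0 => j _; rewrite powR_gt0 // divr_gt0.
exists d, (1 / 2 * (c1 * c2) * (2 * d) ^+ n / normc D'); split=> // [|l].
  by rewrite divr_gt0 // !mulr_gt0 // exprn_gt0 // mulr_gt0.
pose w x := bump d l x * @W0 R n k (cRe nu) x.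
have tb := bump_testfun l d0 dd.
have wi : lam.-integrable orth (EFin \o w) by exact: test_W0_int.
have w0 x : 0 <= w x by rewrite mulr_ge0 ?wt_ge0 //; case/andP: (bump01 d l x).
pose N := Complex (Rintegral lam orth (fun x => w x * cos (t * ln (Dx x))))
                  (Rintegral lam orth (fun x => w x * sin (t * ln (Dx x)))).
have RzE : Rz nu (bump d l) = N / D'.
  case: hRz => _ _ -> //; last exact: testfun_schwartz.
  rewrite /riesz_integral -/D'; congr (_ / _).
  have e x : orth x -> cpow (Dx x) (nu - cr mu0 - 1) * cr (bump d l x * omega_k k x) =
      Complex (w x * cos (t * ln (Dx x))) (w x * sin (t * ln (Dx x))).
    move=> xO; have Dp := Dx_gt0 xO; rewrite /w -(W0_E k0 _ xO) /cpow.
    have -> : (nu - cr mu0 - 1) * cr (ln (Dx x)) = Complex (a * ln (Dx x)) (t * ln (Dx x)).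
      rewrite /a /t /al; case: (nu) => p q; apply/eqP; rewrite eq_complex /=.
      by apply/andP; split; apply/eqP; ring.
    have -> : Dx x `^ a = expR (a * ln (Dx x)) by rewrite /powR gt_eqF.
    by apply/eqP; rewrite /cexp eq_complex /=; apply/andP; split; apply/eqP; ring.
  by congr Complex; apply: eq_Rintegral => x /set_mem xO; rewrite e.
have mL : measurable_fun orth (fun x : RnB R n => t * ln (Dx x)).
  apply: measurable_funM => //; apply: measurableT_comp; first exact: measurable_ln.
  by apply: measurable_funTS; exact: Dx_measurable.
have mw := measurable_int lam wi.
have ci (F : R -> R) : continuous F -> (forall u, `|F u| <= 1) ->
    lam.-integrable orth (EFin \o (fun x => w x * F (t * ln (Dx x)))).
  move=> cF F1; apply: le_integrable wi => //.
    apply/measurable_EFinP; apply: measurable_funM; first exact/measurable_EFinP.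
    by apply: measurableT_comp mL; exact: continuous_measurable_fun.
  by move=> x xO; rewrite lee_fin /= normrM ler_piMr.
have ic := ci _ (@continuous_cos R) (@cos_max R).
have is_ := ci _ (@continuous_sin R) (@sin_max R).
(* The phase at the centre of the box. Projecting [N] on the direction of angle [th] gives an
   integrand that is at least [w / 2]. *)
pose th := t * \sum_(i < n) (ln i.+1%:R - ln (fac l i)).
have key : 1 / 2 * Rintegral lam orth w <= normc N.
  have e1 : cos th * cRe N + sin th * cIm N = Rintegral lam orth (fun x => w x * cos (t * ln (Dx x) - th)).
    rewrite /= -!RintegralZl // -RintegralD //; last 2 first.
    - exact: (integrableZl mO _ ic).
    - exact: (integrableZl mO _ is_).
    by apply: eq_Rintegral => x _ /=; rewrite cosB; ring.
  apply: le_trans (_ : cos th * cRe N + sin th * cIm N <= _).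
    rewrite e1 -RintegralZl //; apply: le_Rintegral => //.
    - exact: (integrableZl mO _ wi).
    - by apply: (ci (fun u => cos (u - th))) => [u|u]; [|exact: cos_max];
        apply: continuous_comp; [apply: cvgB; [exact: cvg_id|exact: cvg_cst]|exact: continuous_cos].
    move=> x xO; rewrite mulrC; have [bx|bx] := pselect (bbox d 2 l x); last first.
      by rewrite /w bump0 // !mul0r.
    rewrite -/(w x); apply: ler_wpM2l; first exact: w0.
    apply: he; rewrite ln_Dx // /th -mulrBr normrM.
    apply: le_trans dt; apply: ler_wpM2l => //; rewrite -sumrB; apply: le_trans (ler_norm_sum _ _ _) _.
    rewrite [leRHS](_ : _ = \sum_(i < n) (2 * (2 * d))); last by rewrite sumr_const card_ord mulr_natl.
    apply: ler_sum => i _; have /bboxP/(_ i) hb := bx.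
    have := ln_near (_ : 1 <= i.+1%:R) hb dd; rewrite ler1n lnM ?posrE ?fac_gt0 ?xO // => /(_ isT).
    by rewrite opprB addrA (addrC (ln (fac l i))).
  have := cos2Dsin2 th; case: (N) => p q /= cs.
  rewrite -[leRHS]ger0_norm ?sqrtr_ge0 //; apply: le_trans (ler_norm _) _.
  rewrite -[leLHS]sqrtr_sqr ger0_norm ?sqrtr_ge0 // ler_wsqrtr //.
  have : 0 <= (sin th * p - cos th * q) ^+ 2 by exact: sqr_ge0.
  have -> : p ^+ 2 + q ^+ 2 = (cos th ^+ 2 + sin th ^+ 2) * (p ^+ 2 + q ^+ 2) by rewrite cs mul1r.
  by move: (cos th) (sin th) => u v; nra.
have box : c1 * c2 * ((2 ^+ l)^-1) `^ a * ((2 * d) ^+ n / 2 ^+ l) <= Rintegral lam orth w.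
  have -> : (2 * d) ^+ n / 2 ^+ l = \prod_i ((\row_(i < n) ((i.+1%:R + 1 * d) / fac l i)) ord0 i -
      (\row_(i < n) ((i.+1%:R - 1 * d) / fac l i)) ord0 i).
    rewrite -fac_prod -[X in _ ^+ X]card_ord -prodr_const -prodf_div; apply: eq_bigr => i _.
    by rewrite !mxE -mulrBl; congr (_ / _); ring.
  have d14 : 1 * d <= 1 / 4 by lra.
  apply: Rint_box_ge => //.
  - move=> i; rewrite !mxE ler_pM2r ?invr_gt0 ?fac_gt0 //; lra.
  - by move=> x; exact: (bbox_orth d0 ltr01 d14).
  - by rewrite !mulr_ge0 ?powR_ge0 // ltW.
  move=> x hx; have xO : orth x := bbox_orth d0 ltr01 d14 hx.
  rewrite /w bump1 // mul1r -(W0_E k0 _ xO) mulrAC; apply: ler_pM; rewrite ?mulr_ge0 ?powR_ge0 ?(ltW c10) ?(ltW c20) //.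
    pose Y := \prod_i (fac l i * x ord0 i).
    have YD : Dx x = Y / 2 ^+ l.
      rewrite -fac_prod /Y -prodf_div; apply: eq_bigr => i _.
      by rewrite mulrC mulKf // gt_eqF // fac_gt0.
    have Y1 : (3 / 4 : R) ^+ n <= Y.
      rewrite -[X in _ ^+ X]card_ord -prodr_const; apply: ler_prod => i _; rewrite divr_ge0 //=.
      by have [] := bbox_coord i d0 ltr01 d14 hx.
    have Y2 : Y <= (n%:R + 1 / 4 : R) ^+ n.
      rewrite -[X in _ ^+ X]card_ord -prodr_const; apply: ler_prod => i _.
      have [h1 h2] := bbox_coord i d0 ltr01 d14 hx; rewrite h2 andbT.
      by apply: le_trans h1; rewrite divr_ge0.
    have Y0 : 0 < Y by apply: lt_le_trans Y1; rewrite exprn_gt0 // divr_gt0.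
    rewrite YD powRM ?invr_ge0 ?exprn_ge0 ?(ltW Y0) //; apply: ler_wpM2r; first exact: powR_ge0.
    rewrite -/a /c1 ge_min; apply/orP; have [a0|a0] := leP 0 a.
      by left; apply: ge0_ler_powR; rewrite ?nnegrE ?exprn_ge0 ?divr_ge0 // ltW.
    right; rewrite -[a]opprK !(powRN _ (- a)) lef_pV2 ?posrE ?powR_gt0 ?exprn_gt0 ?addr_gt0 ?divr_gt0 //.
    by apply: ge0_ler_powR; rewrite ?nnegrE ?exprn_ge0 ?addr_ge0 ?divr_ge0 ?oppr_ge0 // ltW.
  apply: ler_prod => i _; rewrite prodr_ge0 /= => [|j _]; last exact: powR_ge0.
  apply: ler_prod => j ij; rewrite powR_ge0 /=; apply: ge0_ler_powR; rewrite ?nnegrE ?divr_ge0 //.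
    by rewrite mulr_ge0 // ltW.
  have /bboxP hb := hx; have := hb i; have := hb j; rewrite !ler_distl => /andP[j1 j2] /andP[i1 i2].
  have fj : fac l j = 1 by rewrite /fac; case: eqP ij => // ->.
  have xi : x ord0 i <= fac l i * x ord0 i by rewrite ler_peMl ?fac_ge1 // ltW.
  have ji : i.+2%:R <= j.+1%:R :> R by rewrite ler_nat.
  move: ji j1; rewrite -natr1 fj mul1r => ji j1.
  by rewrite distrC; apply: le_trans (ler_norm _); lra.
have -> : normc (Rz nu (bump d l)) = normc N / normc D'.
  have DN0 := lt0r_neq0 DN; apply: (mulIf DN0); rewrite (divfK DN0) RzE -normcM.
  by rewrite (divfK D0).
rewrite ler_pdivlMr //; apply: le_trans key.
apply: le_trans (_ : 1 / 2 * (c1 * c2 * ((2 ^+ l)^-1) `^ a * ((2 * d) ^+ n / 2 ^+ l)) <= _).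
  rewrite -/a le_eqVlt; apply/orP; left; apply/eqP.
  by field; rewrite (lt0r_neq0 DN) expf_neq0.
by apply: ler_wpM2l => //; rewrite divr_ge0.
Qed.

Lemma complex_measure_dichotomy (mu : R[i]) : is_complex_measure (Rz mu) ->
  mu0 < cRe mu \/ exists j m : nat, [/\ (j < n)%N, 0 <= k * j%:R - m%:R & mu = cr (k * j%:R - m%:R)].
Proof.
move=> hmu; have [?|Re0] := ltP mu0 (cRe mu); first by left.
right; have [[j [m [jn e]]]|np] := pselect (exists j m : nat, (j < n)%N /\ mu = cr (k * j%:R - m%:R)).
  exists j, m; split=> //; rewrite leNgt; apply/negP => neg.
  by apply: (neg_not_measure n1 k0 hlam hRz neg); rewrite -e.
(* Raising [mu] by [m] reaches the region where [R] is given by the integral. *)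
exfalso; pose m := (Num.truncn (mu0 - cRe mu)).+1.
have nuE : cRe (mu + cr m%:R) = cRe mu + m%:R by case: (mu).
have hm : mu0 < cRe (mu + cr m%:R).
  by rewrite nuE -ltrBlDl; exact: truncnS_gt.
have [d [c [d0 dd c0 hc]]] := bump_lower hm.
(* The factor produced by [m] multiplications with [D]; a zero factor in it would put [mu] in the
   form [k j - i]. *)
pose P : R[i] := \prod_(i < m) \prod_(j < n) (mu + cr i%:R - cr (k * j%:R)).
have P0 : normc P != 0.
  apply/eqP => /eq0_normc /eqP; rewrite prodf_seq_eq0 => /hasP[i _ /=].
  rewrite prodf_seq_eq0 => /hasP[j _ /=]; rewrite subr_eq0 => /eqP e; apply: np; exists j, i.
  by split=> //; rewrite -crB -e addrK.
have Pg : 0 < normc P by rewrite lt_neqAle eq_sym P0 normc_ge0.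
have iter phi : schwartz phi -> forall p, Rz mu (fun x => phi x * Dx x ^+ p) =
    \prod_(i < p) \prod_(j < n) (mu + cr i%:R - cr (k * j%:R)) * Rz (mu + cr p%:R) phi.
  move=> sp p; elim: p phi sp => [|p IH] phi sp.
    rewrite big_ord0 mul1r (_ : cr 0%:R = 0) // addr0; congr (Rz mu _).
    by apply/funext => x; rewrite expr0 mulr1.
  rewrite (_ : (fun x => _) = fun x => (phi x * Dx x) * Dx x ^+ p); last first.
    by apply/funext => x; rewrite exprS mulrA.
  have sD : schwartz (fun x => phi x * Dx x).
    by apply: schwartz_slow => //; apply: slow_prod => i _; exact: slow_coord.
  rewrite IH // (Rz_mulD k0 hRz) // big_ord_recr /= mulrA; congr (_ * Rz _ _).
  by rewrite -addrA -cr1 crD natr1.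
(* On the support of the bump of index [l] the function [D] is of order [2 ^ (- l)]; the factor
   [(2 ^+ l) ^+ m] makes the bound on [f l] independent of [l] while keeping its size. *)
pose f l (x : 'rV[R]_n) : R := (2 ^+ l) ^+ m * (bump d l x * Dx x ^+ m).
pose B : R := ((n%:R + 1 / 4) ^+ n) ^+ m.
have B0 : 0 <= B by rewrite !exprn_ge0 // addr_ge0 // divr_ge0.
have sf l : smooth (fun x => bump d l x * Dx x ^+ m).
  apply: smoothM; first exact: bump_smooth.
  by have [] : slow (fun x : 'rV[R]_n => Dx x ^+ m) by apply: slowX; apply: slow_prod => i _; exact: slow_coord.
have tf0 l : testfun (fun x => bump d l x * Dx x ^+ m).
  by split; [exact: sf|have [_ [r hr]] := bump_testfun l d0 dd; exists r => x /hr ->; rewrite mul0r].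
have tf l : testfun (f l).
  split; first by apply: smoothM; [exact: smooth_cst|exact: sf].
  by have [_ [r hr]] := tf0 l; exists r => x /hr e; rewrite /f e mulr0.
have fz l x : ~ bbox d 2 l x -> f l x = 0 by move=> h; rewrite /f bump0 // mul0r mulr0.
have fB l x : `|f l x| <= B.
  have [hx|/fz ->] := pselect (bbox d 2 l x); last by rewrite normr0.
  have /andP[b0 b1] := bump01 d l x.
  have -> : f l x = bump d l x * (\prod_i (fac l i * x ord0 i)) ^+ m.
    by rewrite /f big_split /= fac_prod exprMn /Dx; ring.
  have hp : 0 <= \prod_i (fac l i * x ord0 i) <= (n%:R + 1 / 4) ^+ n.
    have hi i := bbox_coord i d0 (ltr0Sn _ 1) dd hx.
    have h34 : 0 <= 3 / 4 :> R by rewrite divr_ge0.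
    apply/andP; split; first by apply: prodr_ge0 => i _; apply: le_trans (hi i).1.
    rewrite -[X in _ ^+ X]card_ord -prodr_const; apply: ler_prod => i _.
    by rewrite (hi i).2 andbT; apply: le_trans (hi i).1.
  have /andP[p0 p1] := hp; rewrite ger0_norm ?mulr_ge0 ?exprn_ge0 // -[leRHS]mul1r.
  by apply: ler_pM; rewrite ?exprn_ge0 // /B lerXn2r ?nnegrE ?exprn_ge0 ?addr_ge0 ?divr_ge0.
have low l : normc P * c <= normc (Rz mu (f l)).
  have -> : Rz mu (f l) = cr ((2 ^+ l) ^+ m) * Rz mu (fun x => bump d l x * Dx x ^+ m).
    have st := testfun_schwartz (tf0 l).
    have := Rz_lin hRz mu ((2 ^+ l) ^+ m) 0 st st; rewrite (_ : cr (0 : R) = 0) // mul0r addr0 => <-.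
    by congr (Rz mu _); apply/funext => x; rewrite mul0r addr0.
  rewrite iter; last by apply: testfun_schwartz; exact: bump_testfun.
  rewrite !normcM normc_cr ger0_norm ?exprn_ge0 // mulrCA ler_pM2l //.
  apply: le_trans (ler_wpM2l _ (hc l)); last by rewrite !exprn_ge0.
  rewrite mulrCA ler_peMr ?(ltW c0) // nuE.
  have u0 : 0 < 2 ^+ l :> R by rewrite exprn_gt0.
  (* With [al] taken at [Re mu + m], the exponents add up to [m - al - 1 = mu0 - Re mu]. This is
     nonnegative by assumption, so the lower bound does not decay with [l]. *)
  have -> : (2 ^+ l) ^+ m * ((2 ^+ l)^-1 `^ @al R n k (cRe mu + m%:R) / 2 ^+ l) =
      (2 ^+ l) `^ (mu0 - cRe mu).
    have ui : (2 ^+ l)^-1 = (2 ^+ l) `^ (-1) :> R by rewrite powR_inv1 // ltW.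
    rewrite ui -powRrM -powR_mulrn ?(ltW u0) // -!powRD ?(gt_eqF u0) ?implybT //.
    by congr (_ `^ _); rewrite /al; ring.
  have e1 : 1 = 1 `^ (mu0 - cRe mu) :> R by rewrite powR1.
  by rewrite [leLHS]e1; apply: ge0_ler_powR; rewrite ?nnegrE ?subr_ge0 ?exprn_ge0 // exprn_ege1 // ler1n.
have [mm [hm1 hm2]] := complex_measure_bound hmu.
have tri L := hm1 (n%:R + 1) (bbox d 2) L (fun l => cbox_measurable _ _) (bbox_triv d0 dd) (fun l => bbox_ball d0 dd).
have Pc : 0 < normc P * c by rewrite mulr_gt0.
have all L : L%:R * (normc P * c) <= B * mm (nball (n%:R + 1)).
  apply: le_trans (ler_wpM2l B0 (tri L)); rewrite mulr_sumr mulr_natl -[L in _ *+ L]card_ord -sumr_const.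
  apply: ler_sum => l _; apply: le_trans (low l) _; apply: (hm2 _ (bbox d 2 l) B (tf l)) => //.
  - exact: cbox_measurable.
  - by exists (n%:R + 1); exact: bbox_ball.
  by move=> x; exact: fz.
have := all (Num.truncn (B * mm (nball (n%:R + 1)) / (normc P * c))).+1.
by rewrite -ler_pdivlMr // leNgt truncnS_gt.
Qed.

End Bumps.

(** * Necessity of the Wallach set *)

Section Positive.
Context {R : realType} {n : nat} {k : R} {lam : {measure set (RnB R n) -> \bar R}}.
Context {Rz : R[i] -> ('rV[R]_n -> R) -> R[i]}.
Hypothesis (n1 : (1 <= n)%N) (k0 : 0 < k) (hlam : is_lebesgue_Rn lam) (hRz : riesz_family k lam Rz).
Implicit Types (x : RnB R n) (f q : 'rV[R]_n -> R).
Local Notation mu0 := (mu0 n k).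

Lemma positive_complex (T : ('rV[R]_n -> R) -> R[i]) : is_positive_measure T -> is_complex_measure T.
Proof.
move=> [nu [lf hT]]; exists nu, mzero, mzero, mzero; split.
  have z : locally_finite (@mzero _ (RnB R n) R : {measure set (RnB R n) -> \bar R}) by move=> K _; exact: ltry.
  by split.
move=> f tf; rewrite hT // /cr; congr Complex; rewrite /Rintegral integral_measure_zero /= ?subr0 //.
Qed.

(** The cut-offs take values in [[0, 1]], so truncation preserves the sign of [f], and the measure
    gives real values at the truncated functions. *)
Lemma positive_schwartz (T : ('rV[R]_n -> R) -> R[i]) f : tempered T -> is_positive_measure T ->
  schwartz f -> cIm (T f) = 0 /\ ((forall x, 0 <= f x) -> 0 <= cRe (T f)).
Proof.
move=> tT [nu [lf hT]] sf; have [fs _] := sf.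
have app e : 0 < e -> exists2 z : R, normc (T f - cr z) <= e & (forall x, 0 <= f x) -> 0 <= z.
  move=> e0; have [L hL] := tempered_cutoff tT sf e0.
  move: hL; rewrite (hT _ (chi_testfun L fs)).
  set z := Rintegral _ _ _ => hz; exists z => // f0; apply: Rintegral_ge0 => x _.
  by rewrite mulr_ge0 //; case/andP: (chi_01 L x).
split.
  apply/eqP; apply: contraT => i0; have ip : 0 < `|cIm (T f)| / 2 by rewrite divr_gt0 ?normr_gt0.
  have [z hz _] := app _ ip; have := le_trans (cIm_le_normc _) hz.
  have -> : cIm (T f - cr z) = cIm (T f) by case: (T f) => a b /=; rewrite subr0.
  by have := normr_ge0 (cIm (T f)); move: ip; move: (`|cIm _|) => u; lra.
move=> f0; rewrite leNgt; apply/negP => r0; have ip : 0 < - cRe (T f) / 2 by rewrite divr_gt0 ?oppr_gt0.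
have [z hz z0] := app _ ip; have := le_trans (cRe_le_normc _) hz; have {}z0 := z0 f0.
have -> : cRe (T f - cr z) = cRe (T f) - z by case: (T f).
by rewrite ler_norml => /andP[+ _]; lra.
Qed.

Definition Lq (mu : R[i]) q : R := cRe (Rz mu (exq 1 1 q)).

Lemma Lq_lin mu (a b : R) p q : slow p -> slow q ->
  Lq mu (fun x => a * p x + b * q x) = a * Lq mu p + b * Lq mu q.
Proof.
move=> sp sq; rewrite /Lq (Rz_exq_lin hRz) //; case: (Rz _ _) (Rz _ _) => a1 b1 [a2 b2] /=.
by rewrite !mul0r !subr0.
Qed.

(** The shifted product is a polynomial in [e] with coefficients on which the functional is linear;
    the induction peels off one factor at a time. *)
Lemma shift_continuity mu (s : seq 'I_n) q : slow q -> exists2 C : R, 0 <= C &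
  forall e, 0 <= e -> e <= 1 ->
  `|Lq mu (fun x => (\prod_(i <- s) (x ord0 i + e)) * q x) - Lq mu (fun x => (\prod_(i <- s) x ord0 i) * q x)| <= C * e.
Proof.
have sl (e : R) (t : seq 'I_n) : slow (fun x : 'rV[R]_n => \prod_(i <- t) (x ord0 i + e)).
  by apply: slow_prod => i _; apply: slowD; [exact: slow_coord|exact: slow_cst].
elim: s q => [|i s IH] q sq.
  exists 0 => // e _ _; rewrite mul0r [X in Lq mu X - _](_ : _ = fun x => (\prod_(i <- [::]) x ord0 i) * q x).
    by rewrite subrr normr0.
  by apply/funext => x; rewrite !big_nil.
have sxq : slow (fun x => x ord0 i * q x) by apply: slowM => //; exact: slow_coord.
have [C1 C10 h1] := IH _ sxq; have [C2 C20 h2] := IH _ sq.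
pose A := `|Lq mu (fun x => (\prod_(i <- s) x ord0 i) * q x)|.
exists (C1 + (A + C2)) => [|e e0 e1]; first by rewrite !addr_ge0 // normr_ge0.
have -> : Lq mu (fun x => (\prod_(j <- i :: s) (x ord0 j + e)) * q x) =
    Lq mu (fun x => (\prod_(j <- s) (x ord0 j + e)) * (x ord0 i * q x)) +
    e * Lq mu (fun x => (\prod_(j <- s) (x ord0 j + e)) * q x).
  rewrite -[X in X + _]mul1r -Lq_lin; [|by apply: slowM..].
  by congr (Lq mu _); apply/funext => x; rewrite big_cons; ring.
have -> : Lq mu (fun x => (\prod_(j <- i :: s) x ord0 j) * q x) =
    Lq mu (fun x => (\prod_(j <- s) x ord0 j) * (x ord0 i * q x)).
  by congr (Lq mu _); apply/funext => x; rewrite big_cons; ring.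
rewrite addrAC; apply: le_trans (ler_normD _ _) _; rewrite mulrDl; apply: lerD; first exact: h1.
rewrite normrM (ger0_norm e0) mulrC; apply: ler_wpM2r => //.
have := h2 e e0 e1; rewrite -/A; set u := Lq _ _; set v := Lq _ _ => h.
have : `|u| <= `|u - v| + `|v| by rewrite -{1}(subrK v u) ler_normD.
have : C2 * e <= C2 by rewrite ler_piMr.
rewrite -/v in h *; rewrite /A -/v; lra.
Qed.

(** The extension of a monomial takes negative values beyond the orthant. The factors [x_i + e] are
    nonnegative where the cut-off with [c = 2 / e] does not vanish, and changing [c] is harmless by
    [Rz_local]; then [e] becomes small. *)
Lemma positive_mon mu (A : {set 'I_n}) : is_positive_measure (Rz mu) ->
  0 <= Lq mu (mon (fun i => (i \in A) : nat)).
Proof.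
move=> pos; have tT : tempered (Rz mu) by case: hRz.
have [C C0 hC] := @shift_continuity mu (enum A) (fun _ => 1) (slow_cst 1).
have mE : Lq mu (mon (fun i => (i \in A) : nat)) = Lq mu (fun x => (\prod_(i <- enum A) x ord0 i) * 1).
  congr (Lq mu _); apply/funext => x; rewrite mulr1 big_enum /= /mon [RHS]big_mkcond /=; apply: eq_bigr => i _.
  by case: (i \in A); rewrite ?expr1 ?expr0.
rewrite mE; set v := Lq mu _ in hC *.
rewrite leNgt; apply/negP => v0.
(* This makes the error [C * e] at most half of [- v], where [v] is the supposed negative value. *)
pose e := Num.min 1 (- v / (2 * (C + 1))).
have Cp : 0 < 2 * (C + 1) by rewrite mulr_gt0 // ltr_wpDl.
have e0 : 0 < e by rewrite lt_min ltr01 divr_gt0 // oppr_gt0.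
have e1 : e <= 1 by rewrite ge_min lexx.
have eC : C * e <= - v / 2.
  have : e <= - v / (2 * (C + 1)) by rewrite ge_min lexx orbT.
  rewrite ler_pdivlMr // => h; nra.
have := hC e (ltW e0) e1; rewrite ler_distl => /andP[_].
have : 0 <= Lq mu (fun x => (\prod_(i <- enum A) (x ord0 i + e)) * 1).
  have sq : slow (fun x : 'rV[R]_n => (\prod_(i <- enum A) (x ord0 i + e)) * 1).
    apply: slowM; last exact: slow_cst.
    by apply: slow_prod => i _; apply: slowD; [exact: slow_coord|exact: slow_cst].
  have ce : 0 < 2 / e by rewrite divr_gt0.
  have loc : Rz mu (exq 1 1 (fun x => (\prod_(i <- enum A) (x ord0 i + e)) * 1)) =
      Rz mu (exq (2 / e) 1 (fun x => (\prod_(i <- enum A) (x ord0 i + e)) * 1)).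
    by apply: (Rz_local k0 hRz); [exact: exq_schwartz..|move=> x xO; rewrite !exq_orth].
  rewrite /Lq loc; apply: (positive_schwartz tT pos _).2; first exact: exq_schwartz.
  move=> x; rewrite /exq mulr1.
  have [[i xi]|/forallNP h] := pselect (exists i, x ord0 i <= - (2 / (2 / e))).
    by rewrite (Hcut0 ce xi) !mul0r.
  rewrite !mulr_ge0 ?Hcut_ge0 ?expR_ge0 //; apply: prodr_ge0 => i _.
  have := h i; have -> : 2 / (2 / e) = e by field; rewrite gt_eqF.
  by move=> /negP; rewrite -ltNge => /ltW; lra.
by move: v0 eC; lra.
Qed.

Lemma positive_wallach mu : is_positive_measure (Rz mu) ->
  (exists j : nat, (j < n)%N /\ mu = cr (k * j%:R)) \/ (cIm mu = 0 /\ mu0 < cRe mu).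
Proof.
move=> pos; have tT : tempered (Rz mu) by case: hRz.
have [E0 E00 hE] := Rz_const k0 hlam hRz.
pose A s : {set 'I_n} := finset (fun i : 'I_n => (i < s)%N).
have cs s : (s <= n)%N -> Rz mu (exq 1 1 (mon (fun i => (i \in A s) : nat))) =
    \prod_(j < s) (mu - cr (k * j%:R)) * cr E0.
  elim: s => [|s IH] sn.
    rewrite big_ord0 mul1r -(hE mu 1 ltr01); congr (Rz mu (exq 1 1 _)).
    by apply/funext => x; rewrite /mon big1 // => i _; rewrite inE expr0.
  pose i0 := Ordinal sn; have iA : i0 \notin A s by rewrite inE ltnn.
  have cA : #|A s| = s.
    rewrite -sum1_card (eq_bigl (fun i : 'I_n => (i < s)%N)) => [|i]; last by rewrite inE.
    by rewrite -(big_ord_widen n (fun _ => 1%N) (ltnW sn)) sum1_card card_ord.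
  have := Rz_aomoto k0 hlam hRz mu ltr01 iA; rewrite cA IH ?(ltnW sn) //.
  move=> hh; rewrite big_ord_recr /= (mulrC (\prod_(j < s) _)) -mulrA -hh; congr (Rz mu (exq 1 1 _)).
  apply/funext => x; rewrite -monS; apply: eq_bigr => i _; congr (_ ^+ _); rewrite !inE ltnS leq_eqVlt -val_eqE /=.
  by case: ltngtP.
have [h|[j [m [jn r0 e]]]] := complex_measure_dichotomy n1 k0 hlam hRz (positive_complex pos).
  (* The moment of one coordinate is [mu * E0]; positivity makes it real, hence [mu] is real. *)
  right; split=> //.
  have sm : schwartz (exq 1 1 (mon (fun i : 'I_n => (i \in A 1%N) : nat) : 'rV[R]_n -> R)).
    by apply: exq_schwartz => //; case: (polyf_mon (R := R) (fun i : 'I_n => (i \in A 1%N) : nat)).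
  have := (positive_schwartz tT pos sm).1; rewrite cs // big_ord1 mulr0 (_ : cr (0 : R) = 0) // subr0.
  by case: (mu) => p q /=; rewrite mulr0 add0r => /eqP; rewrite mulf_eq0 (gt_eqF E00) orbF => /eqP.
left; set r := k * j%:R - m%:R in r0 e; apply: contrapT => hn.
have ne i : (i < n)%N -> r - k * i%:R != 0.
  by move=> lt_in; apply/eqP => /eqP; rewrite subr_eq0 => /eqP er; apply: hn; exists i; rewrite e er.
have pr s : (s <= n)%N -> 0 <= \prod_(i < s) (r - k * i%:R).
  move=> sn; have := positive_mon (A s) pos; rewrite /Lq cs // e.
  rewrite (eq_bigr (fun i : 'I_s => cr (r - k * i%:R))) => [|i _]; last by rewrite crB.
  by rewrite cr_prod crM /= pmulr_lge0.
(* The partial products are nonnegative and no factor vanishes, so all factors are positive; yet the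
   factor of index [j] is [- m]. *)
have all s : (s <= n)%N -> forall i, (i < s)%N -> 0 < r - k * i%:R.
  elim: s => [//|s IH] sn i; rewrite ltnS leq_eqVlt => /orP[/eqP ->|]; last exact: IH (ltnW sn) i.
  have := pr _ sn; rewrite big_ord_recr /= pmulr_rge0.
    by rewrite le_eqVlt eq_sym (negPf (ne s sn)).
  by apply: prodr_gt0 => l _; exact: IH (ltnW sn) l (ltn_ord l).
have := all n (leqnn n) j jn; rewrite /r; have : 0 <= m%:R :> R by [].
by lra.
Qed.

End Positive.

(** * Measures with density on the orthant *)

Section Density.
Context d (T : measurableType d) {R : realType} (mu : {measure set T -> \bar R}).
Variable w : T -> R.
Hypotheses (w0 : forall x, 0 <= w x) (mw : measurable_fun setT w).
Local Open Scope ereal_scope.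

(** The hypotheses on [w] are arguments of [densm], so that the measure structure attached to it can
    be inferred. *)
Definition densm of (forall x, (0 <= w x)%R) & measurable_fun setT w : set T -> \bar R :=
  fun A => \int[mu]_(x in A) (w x)%:E.

Let nu := densm w0 mw.

Let nu0 : nu set0 = 0. Proof. by rewrite /nu /densm integral_set0. Qed.
Let nu_ge0 A : 0 <= nu A. Proof. by apply: integral_ge0 => x _; rewrite lee_fin. Qed.
Let nu_add : semi_sigma_additive nu.
Proof.
apply: semi_sigma_additive_nng_induced; first exact/measurable_EFinP.
by move=> x; rewrite lee_fin.
Qed.

HB.instance Definition _ := isMeasure.Build _ _ _ (densm w0 mw) nu0 nu_ge0 nu_add.

Import HBNNSimple.

Lemma densm_indic (A : set T) : measurable A -> \int[mu]_x ((\1_A x)%:E * (w x)%:E) = nu A.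
Proof.
move=> mA; rewrite /nu /densm [RHS]integral_mkcond; apply: eq_integral => x _.
rewrite /patch indicE; case: (x \in A); first by rewrite mul1e.
by rewrite mul0e.
Qed.

Lemma densm_nnsfun (g : {nnsfun T >-> R}) :
  \int[densm w0 mw]_x (g x)%:E = \int[mu]_x ((g x)%:E * (w x)%:E).
Proof.
rewrite integralT_nnsfun sintegralE fsbig_finite //=.
set s : seq R := finmap.enum_fset _.
transitivity (\int[mu]_x \sum_(k <- s) (k%:E * (\1_(g @^-1` [set k]) x)%:E * (w x)%:E)); last first.
  apply: eq_integral => x _; rewrite [in RHS](fimfunE g x) fsbig_finite //= -/s -sumEFin.
  rewrite -ge0_sume_distrl => [|k _]; first by congr (_ * _); apply: eq_bigr => k _; rewrite EFinM.
  exact: nnfun_muleindic_ge0.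
rewrite ge0_integral_sum //; last 2 first.
- move=> k; apply: emeasurable_funM; last exact/measurable_EFinP.
  by apply: emeasurable_funM => //; exact/measurable_EFinP.
- by move=> k x _; rewrite mule_ge0 ?lee_fin //; exact: nnfun_muleindic_ge0.
apply: eq_bigr => k _; transitivity (k%:E * nu (g @^-1` [set k])); first by [].
have [k0|k0] := leP 0%R k.
  under eq_integral do rewrite -muleA; rewrite ge0_integralZl ?lee_fin ?densm_indic //.
    by apply: emeasurable_funM; exact/measurable_EFinP.
  by move=> x _; rewrite mule_ge0 ?lee_fin.
have -> : g @^-1` [set k] = set0.
  by rewrite preimage10 // => -[x _ gx]; move: k0; rewrite -gx ltNge fun_ge0.
rewrite nu0 mule0 (eq_integral (fun=> 0)) ?integral0 // => x _.
by rewrite indic0 mule0 mul0e.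
Qed.

Lemma densm_integral (h : T -> R) : (forall x, 0 <= h x)%R -> measurable_fun setT h ->
  \int[densm w0 mw]_x (h x)%:E = \int[mu]_x (h x * w x)%:E.
Proof.
move=> h0 mh; have mE : measurable_fun setT (EFin \o h) by exact/measurable_EFinP.
pose f_ := nnsfun_approx measurableT mE.
have cf x : (f_ n x)%:E @[n --> \oo] --> (h x)%:E.
  by apply: (@cvg_nnsfun_approx _ _ _ _ measurableT _ mE) => // y _; rewrite lee_fin.
have nd x : {homo (fun n => (f_ n x)%:E) : a b / (a <= b)%N >-> a <= b}.
  by move=> a b ab; rewrite lee_fin; exact/lefP/nd_nnsfun_approx.
transitivity (limn (fun n => \int[densm w0 mw]_x (f_ n x)%:E)).
  rewrite -monotone_convergence //.
  - by apply: eq_integral => x _; apply/esym/cvg_lim => //; exact: cf.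
  - by move=> n; exact/measurable_EFinP.
  - by move=> n x _; rewrite lee_fin.
rewrite (_ : (fun n => _) = fun n => \int[mu]_x ((f_ n x)%:E * (w x)%:E)); last first.
  by apply/funext => n; rewrite densm_nnsfun.
rewrite -monotone_convergence //.
- apply: eq_integral => x _; apply/cvg_lim => //; rewrite EFinM.
  by apply: cvgeZr => //; exact: cf.
- by move=> n; apply: emeasurable_funM; exact/measurable_EFinP.
- by move=> n x _; rewrite mule_ge0 ?lee_fin.
- by move=> x _ a b ab; apply: lee_wpmul2r; [rewrite lee_fin|exact: nd].
Qed.

End Density.

Section PositiveMeasures.
Context {R : realType} {n : nat}.
Variable lam : {measure set (RnB R n) -> \bar R}.
Implicit Types (f : 'rV[R]_n -> R) (x : RnB R n).
Local Notation orth := (@Rplus_n R n).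

(** The measure is the image under [g] of the density [w] on the orthant, so a measure on a face is
    also obtained from [lam]. Integrability over preimages of balls is local finiteness. *)
Lemma density_positive (w : RnB R n -> R) (g : RnB R n -> RnB R n) :
  (forall x, 0 <= w x) -> measurable_fun setT w -> measurable_fun setT g ->
  (forall r, lam.-integrable orth (EFin \o (fun x => \1_(nball r) (g x) * w x))) ->
  is_positive_measure (fun f : 'rV[R]_n -> R => cr (Rintegral lam orth (fun x => f (g x) * w x))).
Proof.
move=> w0 mw mg hi; have mO := @orthant_measurable R n.
pose w1 x : R := w x * \1_orth x.
have w10 x : 0 <= w1 x by rewrite mulr_ge0.
have mw1 : measurable_fun setT w1 by apply: measurable_funM.
pose nu0 := densm lam w10 mw1 : {measure set (RnB R n) -> \bar R}.
pose nu1 := (pushforward nu0 g : {measure set (RnB R n) -> \bar R}); pose nu := nu1 mg.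
have key (h : RnB R n -> R) : (forall x, 0 <= h x) -> measurable_fun setT h ->
    (\int[nu]_x (h x)%:E = \int[lam]_(x in orth) (h (g x) * w x)%:E)%E.
  move=> h0 mh; have mE : measurable_fun setT (EFin \o h) by exact/measurable_EFinP.
  have hE0 : {in [set: RnB R n], forall y, (0 <= (EFin \o h) y)%E} by move=> y _; rewrite lee_fin.
  rewrite [LHS](ge0_integral_pushforward mg nu0 measurableT mE hE0) preimage_setT.
  have hg0 x : 0 <= (h \o g) x by exact: h0.
  have mhg : measurable_fun setT (h \o g) := measurableT_comp mh mg.
  rewrite [LHS](@densm_integral _ _ _ lam w1 w10 mw1 (h \o g) hg0 mhg).
  rewrite [RHS]integral_mkcond; apply: eq_integral => x _.
  by rewrite /patch /w1 indicE; case: (x \in orth); rewrite ?mulr1 // !mulr0.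
have lf : locally_finite nu.
  move=> K cK; have [r [_ hr]] := compact_bounded cK.
  have sub : K `<=` nball (r + 1).
    by move=> x Kx; apply: (hr (r + 1) _ x Kx); rewrite ltrDl.
  have mK : measurable (K : set (RnB R n)).
    rewrite -[X in measurable X]setCK; apply: measurableC; apply: open_RnB_measurable.
    by apply: closed_openC; apply: compact_closed => //; exact: norm_hausdorff.
  have le : (nu K <= nu (nball (r + 1)))%E.
    by apply: le_measure => //; apply/mem_set => //; exact: ball_measurable.
  apply: le_lt_trans le _; rewrite -[X in nu X]setIT -integral_indic //; last exact: ball_measurable.
  rewrite key //; last by apply: measurable_indic; exact: ball_measurable.
  have /integrableP[_] := hi (r + 1); apply: le_lt_trans; apply: ge0_le_integral => //.
  - by move=> x _; rewrite lee_fin mulr_ge0.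
  - exact: measurable_int (hi (r + 1)).
  - by apply: measurableT_comp => //; exact: measurable_int (hi (r + 1)).
  - by move=> x _; rewrite lee_abs.
exists nu; split=> // f tf; congr cr.
have mf := testfun_measurable tf.
have mpos (h : RnB R n -> R) : measurable_fun setT h -> measurable_fun setT (fun x => Num.max (h x) 0).
  by move=> mh; exact: measurable_maxr.
have pe (h : RnB R n -> R) x : ((EFin \o h)^\+ x = (Num.max (h x) 0)%:E)%E by rewrite funeposE -EFin_max.
have ne (h : RnB R n -> R) x : ((EFin \o h)^\- x = (Num.max (- h x) 0)%:E)%E by rewrite funenegE -EFin_max.
have mw0 (a b : R) : 0 <= b -> Num.max (a * b) 0 = Num.max a 0 * b by move=> b0; rewrite maxr_pMl // mul0r.
rewrite /Rintegral -[in RHS]/(EFin \o f) [in RHS]integralE [in LHS]integralE; congr fine; congr (_ - _)%E.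
  rewrite [RHS](eq_integral (fun x => (Num.max (f x) 0)%:E)) => [|x _]; last by rewrite pe.
  rewrite key; [|by move=> x; rewrite le_max lexx orbT|exact: mpos].
  by apply: eq_integral => x _; rewrite (pe (fun x => f (g x) * w x)) mw0.
rewrite [RHS](eq_integral (fun x => (Num.max (- f x) 0)%:E)) => [|x _]; last by rewrite ne.
rewrite (key (fun x => Num.max (- f x) 0)); [|by move=> x; rewrite le_max lexx orbT|].
  by apply: eq_integral => x _; rewrite (ne (fun x => f (g x) * w x)) -mulNr mw0.
by apply: (mpos (fun x => - f x)); exact: measurableT_comp.
Qed.

Lemma positive_add (T1 T2 : ('rV[R]_n -> R) -> R[i]) : is_positive_measure T1 -> is_positive_measure T2 ->
  is_positive_measure (fun f => T1 f + T2 f).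
Proof.
move=> [v1 [l1 h1]] [v2 [l2 h2]].
exists (measure_add v1 v2); split=> [K cK|f tf].
  have e : (measure_add v1 v2 K = v1 K + v2 K)%E := measure_addE v1 v2 K.
  by rewrite [X in (X < _)%E]e lte_add_pinfty //; [exact: l1|exact: l2].
rewrite h1 // h2 // crD; congr cr.
have [B [r [B0 r0 hB hr]]] := testfun_bounded tf.
have i v (lv : locally_finite v) : v.-integrable setT (EFin \o f).
  apply: (compact_integral (A := nball r) (B := B) lv tf _ _ B0 hB _).1; first exact: ball_measurable.
    by exists r.
  by move=> x /negP; rewrite -ltNge; exact: hr.
rewrite /Rintegral integral_measure_add //; [|exact: i..].
have f1 := integrable_fin_num measurableT (i _ l1); have f2 := integrable_fin_num measurableT (i _ l2).
have h := fineD f1 f2; exact: esym h.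
Qed.

Lemma positive_zero : is_positive_measure (fun _ : 'rV[R]_n -> R => cr 0 : R[i]).
Proof.
exists mzero; split=> [K _|f _]; first exact: ltry.
by rewrite /Rintegral integral_measure_zero.
Qed.

Lemma positive_sum (I : Type) (r : seq I) (F : I -> ('rV[R]_n -> R) -> R) :
  (forall i, is_positive_measure (fun f => cr (F i f))) ->
  is_positive_measure (fun f => cr (\sum_(i <- r) F i f)).
Proof.
move=> h; elim: r => [|i r IH].
  rewrite (_ : (fun f => _) = fun _ => cr 0); first exact: positive_zero.
  by apply/funext => f; rewrite big_nil.
rewrite (_ : (fun f => _) = fun f => cr (F i f) + cr (\sum_(i <- r) F i f)); first exact: positive_add.
by apply/funext => f; rewrite big_cons crD.
Qed.

End PositiveMeasures.

(** * The weight carried by a face of the orthant *)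

Section MomentInduction.
Context {R : realType} {n : nat} (k M : R) (c : R[i]) (L : ('rV[R]_n -> R) -> R[i]).
Hypothesis M0 : 0 < M.
Implicit Types (x : 'rV[R]_n).
Hypothesis L_lin : forall (a b : R) p q, polyf p -> polyf q ->
  L (fun x => a * p x + b * q x) = cr a * L p + cr b * L q.
Hypothesis L_perm : forall b (sg : 'S_n), L (mon (fun i => b (sg i))) = L (mon b).
Hypothesis L_rec : forall a b, cr M * L (psA a.+1 b) = c * L (psA a b) + L (@psB R n k a b).
Hypothesis L_1 : L (fun _ => 1) = 0.

Lemma moment_sum (I : Type) (r : seq I) (P : pred I) (f : I -> 'rV[R]_n -> R) : (forall i, polyf (f i)) ->
  L (fun x => \sum_(i <- r | P i) f i x) = \sum_(i <- r | P i) L (f i).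
Proof.
move=> pf; elim: r => [|i r IH].
  rewrite big_nil (_ : (fun x => _) = fun x => 0 * 1 + 0 * 1); last first.
    by apply/funext => x; rewrite big_nil !mul0r addr0.
  rewrite (@L_lin 0 0 (fun _ => 1) (fun _ => 1)); [|exact: polyf_cst..].
  by rewrite L_1 !mulr0 addr0.
rewrite big_cons; case: (boolP (P i)) => Pi; last first.
  by rewrite -IH; congr L; apply/funext => x; rewrite big_cons (negPf Pi).
rewrite -IH -[L (f i)]mul1r -[X in _ + X]mul1r -cr1 -L_lin //; last by apply: polyf_sum.
by congr L; apply/funext => x; rewrite big_cons Pi !mul1r.
Qed.

Let Z p := polyf p /\ L p = 0.

Let Z_scale (a : R) p : Z p -> Z (fun x => a * p x).
Proof.
move=> [pp p0]; split; first by apply: polyfM => //; exact: polyf_cst.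
rewrite (_ : (fun x => _) = fun x => a * p x + 0 * p x); last by apply/funext => x; rewrite mul0r addr0.
by rewrite L_lin // p0 !mulr0 addr0.
Qed.

Let Z_add p q : Z p -> Z q -> Z (fun x => p x + q x).
Proof.
move=> [pp p0] [pq q0]; split; first exact: polyfD.
rewrite (_ : (fun x => _) = fun x => 1 * p x + 1 * q x); last by apply/funext => x; rewrite !mul1r.
by rewrite L_lin // p0 q0 !mulr0 addr0.
Qed.

Let Z_sum (I : Type) (r : seq I) (P : pred I) (f : I -> 'rV[R]_n -> R) : (forall i, Z (f i)) ->
  Z (fun x => \sum_(i <- r | P i) f i x).
Proof.
move=> h; split; first by apply: polyf_sum => i _; case: (h i).
by rewrite moment_sum => [|i]; [rewrite big1 // => i _|]; case: (h i).
Qed.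

(* Induction on the degree, then on the size of the support: the recursion expresses the sum over i of
   mon (b' + (a+1) e_i) through lower degrees; the terms with i in the support of b' have smaller support and
   the others are permutations of each other. *)
Lemma moment_zero b : L (mon b) = 0.
Proof.
suff H d : forall s b, (\sum_i b i = d)%N -> (#|[pred i | b i != 0%N]| < s)%N -> L (mon b) = 0.
  exact: (H _ _ b erefl (ltnSn _)).
elim/ltn_ind: d => d IHd; elim=> // s IHs {}b bd bs.
have [i0 bi0|b0] := pickP (fun i => b i != 0%N); last first.
  rewrite -L_1; congr L; apply/funext => x; rewrite /mon big1 // => i _.
  by have /negbFE/eqP -> := b0 i; rewrite expr0.
pose a := (b i0).-1; pose b' j := if j == i0 then 0%N else b j.
have ba : b i0 = a.+1 by rewrite prednK // lt0n.
have sD f e (i : 'I_n) : (\sum_j (f j + e * (j == i)) = \sum_j f j + e)%N.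
  rewrite big_split /=; congr (_ + _)%N; rewrite (bigD1 i) //= eqxx muln1 big1 ?addn0 // => j /negPf ->.
  by rewrite muln0.
have b'd : (\sum_j b' j + a.+1 = d)%N.
  rewrite -(sD _ _ i0) -bd; apply: eq_bigr => j _; rewrite /b'.
  by case: eqP => [->|_]; rewrite ?muln1 ?muln0 ?addn0 ?add0n.
have small f : (\sum_j f j < d)%N -> Z (mon f).
  by move=> fd; split; [exact: polyf_mon|exact: (IHd _ fd _ f erefl (ltnSn _))].
have Zm2 i j e1 e2 : (e1 + e2 = a)%N -> Z (fun x => x ord0 i ^+ e1 * x ord0 j ^+ e2 * mon b' x).
  move=> ea; rewrite (_ : (fun x => _) = mon (fun l => (b' l + e2 * (l == j)) + e1 * (l == i))%N).
    by apply: small; rewrite !sD; move: b'd ea; lia.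
  by apply/funext => x; rewrite !monD mulrA.
have Zm1 i : Z (fun x => x ord0 i ^+ a * mon b' x).
  rewrite (_ : (fun x => _) = fun x => x ord0 i ^+ a * x ord0 i ^+ 0 * mon b' x).
    by apply: Zm2; rewrite addn0.
  by apply/funext => x; rewrite expr0 mulr1.
have [_ A0] : Z (psA a b') by exact: Z_sum.
have [_ B0] : Z (@psB R n k a b').
  apply: Z_add; apply: Z_sum => i; first exact: Z_scale.
  apply: Z_sum => j; apply: Z_scale.
  rewrite (_ : (fun x => _) = fun x => \sum_(c < a.+1) x ord0 i ^+ (a - c) * x ord0 j ^+ c * mon b' x).
    by apply: Z_sum => e; apply: Zm2; rewrite subnK // -ltnS.
  by apply/funext => x; rewrite mulr_suml.
have A1 : L (psA a.+1 b') = 0.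
  have := L_rec a b'; rewrite A0 B0 mulr0 addr0 => /eqP; rewrite mulf_eq0 => /orP[/eqP|/eqP//].
  by move=> /(congr1 (@cRe R)) /= M00; move: M0; rewrite M00 ltxx.
have pm i : polyf (fun x => x ord0 i ^+ a.+1 * mon b' x).
  by apply: polyfM; [apply: polyfX; exact: polyf_coord|exact: polyf_mon].
have e1 i : (fun x => x ord0 i ^+ a.+1 * mon b' x) = mon (fun j => b' j + a.+1 * (j == i))%N.
  by apply/funext => x; rewrite monD.
move: A1; rewrite /psA (@moment_sum _ _ predT (fun i x => x ord0 i ^+ a.+1 * mon b' x)) //.
rewrite (bigID (fun i => b' i != 0%N)) /= big1 ?add0r => [|i bi]; last first.
  rewrite e1; apply: IHs; first by rewrite sD.
  apply: leq_trans (proper_card _) bs; apply/properP; split.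
    apply/fintype.subsetP => j; rewrite !inE; move: bi; rewrite /b'.
    case: (eqVneq j i0) => [->|ji0]; first by [].
    by case: (eqVneq j i) => [e|ji]; [rewrite -e (negPf ji0)|rewrite muln0 addn0].
  exists i0; rewrite !inE //; move: bi; rewrite /b' eqxx; case: (eqVneq i i0) => // ii0 _.
  by rewrite muln0.
rewrite (eq_bigr (fun _ => L (mon b))) => [|i]; last first.
  rewrite negbK => /eqP bi; rewrite e1 -(L_perm b (tperm i0 i)); congr L; congr mon; apply/funext => j.
  case: tpermP => [->|->|/eqP ji0 /eqP ji]; last first.
  - by rewrite /b' (negPf ji0) (negPf ji) muln0 addn0.
  - by rewrite bi eqxx muln1 ba.
  - rewrite {1}/b' eqxx add0n; case: (eqVneq i0 i) => [e|ii0]; first by rewrite muln1 -ba -e.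
    by move: bi; rewrite /b' eq_sym (negPf ii0) muln0.
rewrite sumr_const => /eqP; rewrite mulrn_eq0 => /orP[|/eqP//].
by move=> /eqP/card0_eq/(_ i0); rewrite /in_mem /= /b' eqxx.
Qed.

End MomentInduction.

Section WallachWeight.
Context {R : realType} {n : nat} (k : R) (lam : {measure set (RnB R n) -> \bar R}).
Context (Rz : R[i] -> ('rV[R]_n -> R) -> R[i]).
Hypothesis (n1 : (1 <= n)%N) (k0 : 0 < k) (hlam : is_lebesgue_Rn lam) (hRz : riesz_family k lam Rz).
Variable r : nat.
Hypothesis rn : (r < n)%N.
Implicit Types (x : RnB R n) (q : 'rV[R]_n -> R).
Local Notation orth := (@Rplus_n R n).
Local Notation mu0 := (mu0 n k).
Local Notation permv sg := (gmap (const_mx 1) sg).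

Let I : pred 'I_n := fun i => (i < r)%N.
(** The exponent forced by the recursion at [mu = k r]: a coordinate of the face meets the [n - r]
    zero coordinates in both orders, which adds [2 k (n - r)] to [mu - mu0 - 1]. *)
Definition walpha : R := k * (n%:R - r%:R + 1) - 1.
Let dl i : R := if I i then walpha else 0.
Let ms (M : R) i : R := if I i then M else 1.
(* The coordinates outside the face carry the exponential density of mass 1: they are integrated out. *)
Definition wweight (M : R) x : R := wt (pairs I) k dl (ms M) 0 x.
Definition face x : RnB R n := \row_i (if I i then x ord0 i else 0).

Lemma wweight_ge0 M x : 0 <= wweight M x. Proof. exact: wt_ge0. Qed.

Lemma face_measurable : measurable_fun setT face.
Proof.
apply: RnB_measurable => i.
rewrite (_ : (fun t => _) = if I i then fun x => x ord0 i else fun _ => 0).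
  by case: (I i) => //; exact: coord_measurable.
by apply/funext => x; rewrite mxE; case: (I i).
Qed.

Lemma walpha_gt : -1 < walpha.
Proof.
rewrite /walpha ltrBrDl subrr mulr_gt0 //; have : (r%:R : R) <= n%:R by rewrite ler_nat ltnW.
by move: (r%:R) (n%:R) => u v; lra.
Qed.

Let dl_gt i : -1 < dl i.
Proof. by rewrite /dl; case: (I i); [exact: walpha_gt|lra]. Qed.

Let ms_gt M i : 0 < M -> 0 < ms M i.
Proof. by rewrite /ms; case: (I i). Qed.

Lemma face_norm x : orth x -> `|face x : 'rV[R]_n| <= p1 x.
Proof.
move=> xO; apply: norm_le_coord => [|i]; first exact: p1_ge0.
rewrite mxE; case: (I i); last by rewrite normr0 p1_ge0.
by rewrite gtr0_norm //; exact: coord_le_p1.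
Qed.

Lemma wweight_integrable M q (C : R) N : 0 < M -> measurable_fun setT (q : RnB R n -> R) ->
  (forall x, orth x -> `|q x| <= C * (1 + p1 x) ^+ N) ->
  lam.-integrable orth (EFin \o (fun x => q x * wweight M x)).
Proof.
move=> Mp mq hq; apply: (@wt_integrable _ _ _ hlam (pairs I) k k0 N dl (ms M) 0 q C) => // i; exact: ms_gt.
Qed.

Definition tame q := measurable_fun setT (q : RnB R n -> R) /\
  exists (C : R) (N : nat), 0 <= C /\ forall x, `|q x| <= C * (1 + `|x : 'rV[R]_n|) ^+ N.

Lemma slow_tame q : slow q -> tame q.
Proof.
move=> [sq /(_ [::])[C [N [C0 hC]]]]; split; last by exists C, N.
by apply: continuous_RnB_measurable; exact: smooth_continuous.
Qed.

Lemma tame_perm q (sg : 'S_n) : tame q -> tame (fun x => q (permv sg x)).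
Proof.
move=> [mq [C [N [C0 hC]]]]; split.
  by apply: (measurableT_comp mq); apply: gmap_measurable => i; rewrite mxE.
exists C, N; split=> // x; apply: le_trans (hC _) _; apply: ler_wpM2l => //.
apply: lerXn2r; rewrite ?nnegrE ?addr_ge0 // lerD2l; apply: norm_le_coord => // i.
by rewrite !mxE mul1r; exact: coord_le_norm.
Qed.

Lemma wint_int M q : 0 < M -> tame q ->
  lam.-integrable orth (EFin \o (fun x => q (face x) * wweight M x)).
Proof.
move=> Mp [mq [C [N [C0 hC]]]]; apply: (@wweight_integrable M (q \o face) C N) => //.
  exact: (measurableT_comp mq face_measurable).
move=> x xO; apply: le_trans (hC _) _; apply: ler_wpM2l => //.
have h0 := face_norm xO; have g0 := normr_ge0 (face x : 'rV[R]_n); have P0 := p1_ge0 xO.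
by apply: lerXn2r; rewrite ?nnegrE ?addr_ge0 // lerD2l.
Qed.

Definition wint (M : R) q : R := Rintegral lam orth (fun x => q (face x) * wweight M x).

Lemma wint_lin M (a b : R) p q : 0 < M -> tame p -> tame q ->
  wint M (fun x => a * p x + b * q x) = a * wint M p + b * wint M q.
Proof.
move=> Mp sp sq; have ip := wint_int Mp sp; have iq := wint_int Mp sq; have mO := @orthant_measurable R n.
rewrite /wint -(RintegralZl _ mO ip) -(RintegralZl _ mO iq) -RintegralD //; last 2 first.
- exact: (integrableZl mO _ ip).
- exact: (integrableZl mO _ iq).
by apply: eq_Rintegral => x _ /=; ring.
Qed.

(** If the monomial involves a coordinate off the face, everything vanishes. Otherwise pairs inside
    the face give the recursion of the face weight, mixed pairs account for its exponent [walpha],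
    and pairs off the face matter for [a = 0] only. *)
Lemma wint_power_sum M a b : 0 < M ->
  M * wint M (psA a.+1 b) = (k * r%:R - mu0 - 1) * wint M (psA a b) + wint M (@psB R n k a b).
Proof.
move=> Mp; have sA := slow_tame (@polyf_psA R n a b).1; have sB := slow_tame (@polyf_psB R n k a b).1.
have sA' := slow_tame (@polyf_psA R n a.+1 b).1; have mO := @orthant_measurable R n.
have [i0 /andP[iI bi]|supp] := pickP (fun i => ~~ I i && (b i != 0%N)).
  have m0 x : mon b (face x) = 0.
    by rewrite /mon (bigD1 i0) //= mxE (negPf iI) expr0n (negPf bi) mul0r.
  have A0 e x : psA e b (face x) = 0 by rewrite /psA big1 // => i _; rewrite m0 mulr0.
  have B0 x : @psB R n k a b (face x) = 0.
    rewrite /psB m0 !big1 ?addr0 // => i _; first by rewrite big1 // => j _; rewrite !mulr0.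
    by rewrite !mulr0.
  have z q : (forall x, q (face x) = 0) -> wint M q = 0.
    move=> h; rewrite /wint (@eq_Rintegral _ _ _ lam orth (fun _ => 0)) ?/Rintegral ?integral0 // => x _.
    by rewrite h mul0r.
  by rewrite !z // !mulr0 addr0.
have key x : (k * r%:R - mu0 - 1) * psA a b (face x) + @psB R n k a b (face x) - M * psA a.+1 b (face x) =
  \sum_(i | I i) (1 + walpha + a%:R + (b i)%:R - M * x ord0 i) * (x ord0 i ^+ a * mon b x) +
  \sum_i \sum_(j | pairs I i j) k * ((\sum_(c < a.+1) x ord0 i ^+ (a - c) * x ord0 j ^+ c) * mon b x).
  have mB : mon b (face x) = mon b x.
    apply: eq_bigr => i _; rewrite mxE; have := supp i; case: (I i) => //= /negbFE/eqP ->.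
    by rewrite !expr0.
  have yI i : I i -> face x ord0 i = x ord0 i by rewrite mxE => ->.
  have yN i : ~~ I i -> face x ord0 i = 0 by rewrite mxE => /negPf ->.
  have Sr (u : R) : \sum_(c < a.+1) u ^+ (a - c) * 0 ^+ c = u ^+ a.
    rewrite big_ord_recl expr0 mulr1 subn0 big1 ?addr0 // => c _.
    by rewrite expr0n mulr0.
  have Sl (u : R) : \sum_(c < a.+1) 0 ^+ (a - c) * u ^+ c = u ^+ a.
    rewrite big_ord_recr /= subnn expr0 mul1r big1 ?add0r // => c _.
    by rewrite expr0n subn_eq0 leqNgt ltn_ord mul0r.
  have cI (t : R) : \sum_(j | I j) t = r%:R * t.
    by rewrite -(big_ord_widen n (fun _ => t) (ltnW rn)) sumr_const card_ord mulr_natl.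
  have cN (t : R) : \sum_(j | ~~ I j) t = (n%:R - r%:R) * t.
    have : \sum_(j < n) t = n%:R * t by rewrite sumr_const card_ord mulr_natl.
    by rewrite (bigID I) /= cI mulrBl => <-; ring.
  rewrite /psB /psA mB; set B := mon b x; set y := face x.
  (* [B0] is [n - r] for [a = 0], as [0 ^ 0 = 1], and 0 otherwise. It stays symbolic: its total
     coefficient [k r - mu0 + k (n - r) - k] is zero, which is where the value [mu = k r] enters. *)
  pose A := \sum_(i | I i) y ord0 i ^+ a; pose B0 := \sum_(i | ~~ I i) y ord0 i ^+ a.
  have tot : \sum_i y ord0 i ^+ a = A + B0 by rewrite (bigID I).
  set P := \sum_i \sum_(j | pairs I i j) _.
  have -> : \sum_i y ord0 i ^+ a * B = (A + B0) * B by rewrite -mulr_suml tot.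
  pose T := \sum_(i | I i) (1 + a%:R + (b i)%:R) * (y ord0 i ^+ a * B).
  have -> : \sum_i (1 + a%:R + (b i)%:R) * (y ord0 i ^+ a * B) = T + B0 * B.
    rewrite (bigID I) /=; congr (_ + _); rewrite mulr_suml; apply: eq_bigr => i iI.
    have := supp i; rewrite iI /= => /negbFE/eqP ->; rewrite yN // expr0n.
    by case: (a) => [|a']; rewrite ?mulr0n ?mulr1n ?mul0r ?mulr0 ?addr0 ?mul1r.
  pose A' := \sum_(i | I i) y ord0 i ^+ a.+1 * B.
  have -> : \sum_i y ord0 i ^+ a.+1 * B = A'.
    rewrite (bigID I) /= [X in _ + X]big1 ?addr0 // => i iI; by rewrite yN // expr0n mul0r.
  have -> : \sum_(i < n | I i) (1 + walpha + a%:R + (b i)%:R - M * x ord0 i) * (x ord0 i ^+ a * B) =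
      walpha * (A * B) + T - M * A'.
    rewrite /A /T /A' mulr_suml !mulr_sumr -sumrN -!big_split /=; apply: eq_bigr => i iI.
    by rewrite /y !(yI _ iI) exprS; ring.
  have -> : \sum_i \sum_(j | @pairs n predT i j)
      k * ((\sum_(c < a.+1) y ord0 i ^+ (a - c) * y ord0 j ^+ c) * B) =
      P + (n%:R - r%:R) * (k * (A * B)) + ((n%:R - r%:R) * (k * ((A + B0) * B)) - k * (B0 * B)).
    rewrite (bigID I) /=; congr (_ + _).
      rewrite /P [in RHS](bigID I) /= [X in _ + X + _]big1 ?addr0 => [|i iI]; last first.
        by rewrite big_pred0 // => j; rewrite /pairs (negPf iI).
      rewrite /A mulr_suml !mulr_sumr -big_split /=; apply: eq_bigr => i iI.
      rewrite (bigID I) /=; congr (_ + _).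
        rewrite (eq_bigl (pairs I i)) => [|j]; last by rewrite /pairs iI /= andbC.
        by apply: eq_bigr => j /and3P[_ jI _]; rewrite /y !yI.
      rewrite (eq_bigl (fun j => ~~ I j)) => [|j]; last first.
        rewrite /pairs /=; case: (eqVneq i j) => [<-|//]; by rewrite iI.
      rewrite (eq_bigr (fun _ => k * (y ord0 i ^+ a * B))) => [|j jI]; first by rewrite cN.
      by rewrite (yN j jI) Sr.
    rewrite /B0 mulr_suml mulr_sumr -[in RHS](cN (k * ((A + _) * B))) -sumrB; apply: eq_bigr => i iI.
    rewrite -tot mulr_suml mulr_sumr [in RHS](bigD1 i) //= [RHS]addrAC subrr add0r.
    rewrite (eq_bigl (fun j => j != i)) => [|j]; last by rewrite /pairs /= eq_sym.
    by apply: eq_bigr => j _; rewrite (yN i iI) Sl.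
  rewrite /walpha /Defs.mu0; ring.
have iA := wint_int Mp sA; have iB := wint_int Mp sB; have iA' := wint_int Mp sA'.
rewrite /wint -(RintegralZl _ mO iA') -(RintegralZl _ mO iA) -RintegralD //; last exact: (integrableZl mO _ iA).
apply/eqP; rewrite eq_sym -subr_eq0; apply/eqP; rewrite -RintegralB //; last 2 first.
- exact: (integrableD mO (integrableZl mO _ iA) iB).
- exact: (integrableZl mO _ iA').
rewrite -[RHS](@power_sum_identity _ _ _ hlam I k k0 walpha M (ms M) a b walpha_gt Mp) //; last 2 first.
- by move=> i; exact: ms_gt.
- by move=> i Ii; rewrite /ms Ii.
apply: eq_Rintegral => x _ /=; rewrite -/(wt _ _ _ _ _ _) -key -/(wweight M x); ring.
Qed.

Lemma wint1_gt0 M : 0 < M -> 0 < wint M (fun _ => 1).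
Proof.
move=> Mp; rewrite /wint; apply: (Rint_gt0 hlam (wint_int Mp (slow_tame (slow_cst 1))) _ stair_lt stair_orth) => [x _|x xb].
  by rewrite mul1r wweight_ge0.
by rewrite mul1r mulr_gt0 ?vdm_gt0 ?gam_gt0 //; exact: stair_orth.
Qed.

(** The degrees add up to [r * walpha + k r (r - 1) + r = n k r], the homogeneity of [R_mu] at
    [mu = k r]. *)
Lemma wint1_scale M : 0 < M ->
  wint M (fun _ => 1) = expR (- (n%:R * ln M) * (k * r%:R)) * wint 1 (fun _ => 1).
Proof.
move=> Mp; pose s : 'rV[R]_n := \row_i ms M i; pose E := (r%:R * walpha + k * (r%:R * (r%:R - 1))) * ln M.
have s0 i : 0 < s ord0 i by rewrite mxE ms_gt.
have cI (t : R) : \sum_(j | I j) t = r%:R * t.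
  by rewrite -(big_ord_widen n (fun _ => t) (ltnW rn)) sumr_const card_ord mulr_natl.
have mO := @orthant_measurable R n.
have pO : gmap s 1%g @^-1` orth = orth.
  apply/seteqP; split => x /= h i; have := h i; rewrite !mxE perm1 => hi.
    by rewrite -(pmulr_rgt0 _ (s0 i)) mxE.
  by rewrite mulr_gt0 // ms_gt.
have i1 := wint_int ltr01 (slow_tame (slow_cst 1)).
have sc x : orth x -> wweight 1 (gmap s 1%g x) = expR E * wweight M x.
  move=> xO; rewrite /wweight /wt /E mulrDl expRD.
  have -> : gam dl (ms 1) (gmap s 1%g x) = expR (r%:R * walpha * ln M) * gam dl (ms M) x.
    have -> : r%:R * walpha * ln M = \sum_i (if I i then walpha * ln M else 0).
      by rewrite -big_mkcond /= cI mulrA.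
    rewrite expR_sum -big_split /=; apply: eq_bigr => i _; rewrite !mxE perm1 /ms /dl.
    case: (I i); rewrite ?expR0 ?mul1r // powRM ?(ltW Mp) ?(ltW (xO i)) // mulrA; congr (_ * _ * _).
    by rewrite /powR gt_eqF.
  have -> : vdm (pairs I) k 0 (gmap s 1%g x) = expR (k * (r%:R * (r%:R - 1)) * ln M) * vdm (pairs I) k 0 x.
    have -> : k * (r%:R * (r%:R - 1)) * ln M = \sum_i \sum_(j | pairs I i j) k * ln M.
      rewrite (bigID I) /= [X in _ = _ + X]big1 ?addr0 => [|i iI]; last first.
        by rewrite big_pred0 // => j; rewrite /pairs (negPf iI).
      rewrite (eq_bigr (fun _ => (r%:R - 1) * (k * ln M))) => [|i iI]; first by rewrite cI; ring.
      rewrite mulrBl -(cI (k * ln M)) [in RHS](bigD1 i) //= mul1r [RHS]addrAC subrr add0r; apply: eq_bigl => j.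
      by rewrite /pairs iI /= eq_sym.
    rewrite expR_sum -big_split /=; apply: eq_bigr => i _; rewrite expR_sum -big_split /=.
    apply: eq_bigr => j /and3P[iI jI _]; rewrite !mxE !perm1 /ms iI jI !addr0 -mulrBr exprMn powRM ?sqr_ge0 //.
    by congr (_ * _); rewrite /powR gt_eqF ?exprn_gt0 // lnXn // -mulr_natr; congr expR; field.
  by ring.
have [_] := gmap_Rintegral hlam 1%g s0 mO i1; rewrite pO.
rewrite (@eq_Rintegral _ _ _ lam orth (fun x => expR E * (1 * wweight M x))) => [|x /set_mem xO]; last first.
  by rewrite !mul1r sc.
rewrite (RintegralZl _ mO (wint_int Mp (slow_tame (slow_cst 1)))) -/(wint M (fun _ => 1)) -/(wint 1 (fun _ => 1)) => h.
have ps : (\prod_i s ord0 i)^-1 = expR (- (r%:R * ln M)).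
  rewrite expRN; congr (_^-1); rewrite -cI [in RHS]big_mkcond expR_sum; apply: eq_bigr => i _.
  by rewrite mxE /ms; case: (I i); rewrite ?expR0 // lnK.
apply: (mulfI (lt0r_neq0 (expR_gt0 E))); rewrite h ps mulrA -expRD; congr (expR _ * _).
by rewrite /E /walpha; ring.
Qed.

Definition swint (M : R) q : R := \sum_(sg : 'S_n) wint M (fun x => q (permv sg x)).

Let perm1E (sg : 'S_n) x i : permv sg x ord0 i = x ord0 (sg i).
Proof. by rewrite !mxE mul1r. Qed.

Lemma mon_perm1 b (sg : 'S_n) x : mon b (permv sg x) = mon (fun i => b (sg^-1 i)%g) x.
Proof.
rewrite /mon [RHS](reindex_inj (@perm_inj _ sg)) /=; apply: eq_bigr => i _.
by rewrite permK perm1E.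
Qed.

Lemma psA_perm1 a b (sg : 'S_n) x : psA a b (permv sg x) = psA a (fun i => b (sg^-1 i)%g) x.
Proof.
rewrite /psA mon_perm1 [RHS](reindex_inj (@perm_inj _ sg)) /=.
by apply: eq_bigr => i _; rewrite perm1E.
Qed.

Lemma psB_perm1 a b (sg : 'S_n) x : @psB R n k a b (permv sg x) = @psB R n k a (fun i => b (sg^-1 i)%g) x.
Proof.
rewrite /psB mon_perm1; congr (_ + _).
  rewrite [RHS](reindex_inj (@perm_inj _ sg)) /=; apply: eq_bigr => i _.
  by rewrite perm1E permK.
rewrite [RHS](reindex_inj (@perm_inj _ sg)) /=; apply: eq_bigr => i _.
rewrite [RHS](reindex_inj (@perm_inj _ sg)) /=; apply: eq_big => [j|j _].
  by rewrite /pairs /= (inj_eq (@perm_inj _ sg)).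
by rewrite !perm1E.
Qed.

Lemma swint_lin M (a b : R) p q : 0 < M -> slow p -> slow q ->
  swint M (fun x => a * p x + b * q x) = a * swint M p + b * swint M q.
Proof.
move=> Mp sp sq; rewrite /swint !mulr_sumr -big_split; apply: eq_bigr => sg _ /=.
by rewrite wint_lin //; apply: tame_perm; apply: slow_tame.
Qed.

(** Matches the symmetrized weight with [R_mu] on the exponential of rate 1; by homogeneity the
    values then agree at every rate. *)
Definition skappa : R := projT1 (cid2 (Rz_exp_scale n1 k0 hlam hRz)) / (#|'S_n|%:R * wint 1 (fun _ => 1)).

Lemma skappa_ge0 : 0 <= skappa.
Proof.
rewrite /skappa; case: cid2 => E0 E00 _ /=.
by rewrite divr_ge0 ?mulr_ge0 ?ler0n // ltW // wint1_gt0.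
Qed.

(** At each rate [M] the two functionals obey the same recursion and symmetry and agree on 1, so
    [moment_zero] applies to their difference. *)
Lemma face_moments c M b : 0 < c -> 0 < M ->
  Rz (cr (k * r%:R)) (exq c M (mon b)) = cr (skappa * swint M (mon b)).
Proof.
move=> c0 Mp; apply/eqP; rewrite -subr_eq0; apply/eqP; move: b.
pose L q := Rz (cr (k * r%:R)) (exq c M q) - cr (skappa * swint M q).
have sl q : polyf q -> slow q by case.
apply: (@moment_zero R n k M (cr (k * r%:R - mu0 - 1)) L Mp) => [a b p q pp pq|b sg|a b|].
- rewrite /L (Rz_exq_lin hRz) //; [|exact: sl..]; rewrite swint_lin //; [|exact: sl..].
  have -> : skappa * (a * swint M p + b * swint M q) = a * (skappa * swint M p) + b * (skappa * swint M q) by ring.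
  by rewrite -crD -!(crM _ (skappa * _)); ring.
- rewrite /L (Rz_perm k0 hlam hRz) //; congr (_ - cr (_ * _)); rewrite /swint.
  rewrite [RHS](reindex_inj (mulgI sg^-1%g)) /=; apply: eq_bigr => tau _; congr wint; apply/funext => x.
  by rewrite !mon_perm1; congr (mon _ x); apply/funext => i; rewrite invMg invgK permM.
- have h := Rz_power_sum k0 hlam hRz (cr (k * r%:R)) a b c0 Mp; rewrite -cr1 !crB in h.
  rewrite /L !mulrBr h; suff e : M * (skappa * swint M (psA a.+1 b)) =
      (k * r%:R - mu0 - 1) * (skappa * swint M (psA a b)) + skappa * swint M (@psB R n k a b).
    by rewrite !crM e -[cr (_ + skappa * _)]crD; ring.
  rewrite mulrCA [X in _ = X + _]mulrCA -mulrDr; congr (_ * _).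
  rewrite /swint !mulr_sumr -big_split; apply: eq_bigr => sg _ /=.
  have eA e : (fun x => psA e b (permv sg x)) = psA e (fun i => b (sg^-1 i)%g).
    by apply/funext => x; rewrite psA_perm1.
  rewrite !eA wint_power_sum //; congr (_ + wint M _); apply/funext => x.
  by rewrite psB_perm1.
- rewrite /L /skappa; case: cid2 => E0 E00 hE /=; rewrite hE // crM cexp_cr crM.
  have e : swint M (fun _ => 1) = #|'S_n|%:R * wint M (fun _ => 1).
    by rewrite /swint sumr_const mulr_natl.
  rewrite e (wint1_scale Mp); apply/eqP; rewrite subr_eq0; apply/eqP; congr cr.
  have w0 := lt0r_neq0 (wint1_gt0 ltr01).
  have S0 : #|'S_n|%:R != 0 :> R by rewrite pnatr_eq0 -lt0n; apply/card_gt0P; exists 1%g.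
  by field; rewrite w0 S0.
Qed.

End WallachWeight.

(** * Szasz operators *)

Section Poisson.
Context {R : realType}.
Implicit Types (y Y : R) (j J : nat).

(** The Poisson probabilities of mean [y]. *)
Definition po j y : R := expR (- y) * (y ^+ j / j`!%:R).

Lemma po_ge0 j y : 0 <= y -> 0 <= po j y.
Proof. by move=> y0; rewrite mulr_ge0 ?expR_ge0 // divr_ge0 ?exprn_ge0. Qed.

Let ps J y : R := \sum_(j < J) y ^+ j / j`!%:R.

Let po_sum J y : \sum_(j < J) po j y = expR (- y) * ps J y.
Proof. by rewrite mulr_sumr. Qed.

Let ps_diff J J' y : (J <= J')%N -> ps J' y - ps J y = \sum_(J <= j < J') y ^+ j / j`!%:R.
Proof.
move=> h; rewrite /ps -!(big_mkord xpredT (fun j => y ^+ j / j`!%:R)) (big_cat_nat (n := J)) //=.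
by rewrite addrAC subrr add0r.
Qed.

Let ps_mono J J' y : 0 <= y -> (J <= J')%N -> ps J y <= ps J' y.
Proof.
move=> y0 h; rewrite -subr_ge0 ps_diff //; apply: sumr_ge0 => j _.
by rewrite divr_ge0 ?exprn_ge0.
Qed.

Let ps_ub y a N : (forall J, (N <= J)%N -> ps J y <= a) -> expR y <= a.
Proof.
move=> h; rewrite /expR; apply: limr_le; first exact: is_cvg_series_exp_coeff.
near=> J; have := h J; rewrite /ps /series /= big_mkord; apply; near: J; exact: nbhs_infty_ge.
Unshelve. all: by end_near.
Qed.

Let ps_lb y a N : (forall J, (N <= J)%N -> a <= ps J y) -> a <= expR y.
Proof.
move=> h; rewrite /expR; apply: limr_ge; first exact: is_cvg_series_exp_coeff.
near=> J; have := h J; rewrite /ps /series /= big_mkord; apply; near: J; exact: nbhs_infty_ge.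
Unshelve. all: by end_near.
Qed.

Let ps_le J y : 0 <= y -> ps J y <= expR y.
Proof. by move=> y0; apply: (@ps_lb _ _ J) => J' h; exact: ps_mono. Qed.

Lemma po_sum_le1 J y : 0 <= y -> \sum_(j < J) po j y <= 1.
Proof.
move=> y0; rewrite po_sum; apply: le_trans (_ : expR (- y) * expR y <= _).
  by apply: ler_wpM2l; [exact: expR_ge0|exact: ps_le].
by rewrite -expRD addNr expR0.
Qed.

(** Every term of the exponential series increases with [y], so the tail at [Y] dominates the
    others; the factor [expR (- y)] is at most 1. *)
Lemma po_tail Y (e : R) : 0 <= Y -> 0 < e -> exists J0, forall J y, (J0 <= J)%N -> 0 <= y -> y <= Y ->
  1 - \sum_(j < J) po j y <= e.
Proof.
move=> Y0 e0; have [J0 hJ] : exists J0, expR Y - e <= ps J0 Y.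
  apply: contrapT => h; have : expR Y <= expR Y - e; last by move: (expR Y) e0 => u; lra.
  apply: (@ps_ub _ _ 0%N) => J _; rewrite leNgt; apply/negP => /ltW hJ; apply: h; by exists J.
exists J0 => J y JJ y0 yY.
have : expR y <= ps J y + e.
  apply: (@ps_ub _ _ J) => J' h.
  have : ps J' y - ps J y <= ps J' Y - ps J Y.
    rewrite !ps_diff //; apply: ler_sum => j _; apply: ler_wpM2r; first by rewrite invr_ge0.
    by apply: lerXn2r => //; rewrite nnegrE.
  have := ps_le J' Y0; have := ps_mono Y0 JJ.
  by move: hJ; move: (ps J' y) (ps J y) (ps J' Y) (ps J Y) (ps J0 Y) (expR Y) => *; lra.
move=> h; rewrite po_sum; have E0 := expR_ge0 (- y); have EE : expR (- y) * expR y = 1 by rewrite -expRD addNr expR0.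
have E1 : expR (- y) <= 1 by rewrite -expR0 ler_expR oppr_le0.
have := ler_wpM2l E0 h; rewrite EE mulrDr.
have : expR (- y) * e <= e by rewrite ger_pMl.
by move: (expR (- y) * e) (expR (- y) * ps J y) => *; lra.
Qed.

Lemma po_moment2 J y : 0 <= y -> \sum_(j < J) (j%:R - y) ^+ 2 * po j y <= y.
Proof.
move=> y0; pose w j := y ^+ j / j`!%:R; pose M J := \sum_(j < J) (j%:R - y) ^+ 2 * w j.
have w0 j : 0 <= w j by rewrite divr_ge0 ?exprn_ge0.
have wS j : y * w j = j.+1%:R * w j.+1.
  have f1 : (j`!%:R : R) != 0 by rewrite pnatr_eq0 -lt0n fact_gt0.
  have f2 : (j.+1%:R : R) != 0 by rewrite pnatr_eq0.
  rewrite /w factS natrM exprS; move: (j.+1%:R) (j`!%:R) f1 f2 => S F F0 S0.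
  by field; rewrite ?F0 ?S0.
(* The partial sums of the variance have a closed form. Its last term is nonpositive once [j >= y],
   and monotonicity in [j] extends the bound to all partial sums. *)
have ME j : M j.+1 = y * ps j y + y * w j * (y - j%:R).
  elim: j => [|j IH].
    by rewrite /M /ps big_ord_recr !big_ord0 /w /=; rewrite expr0 fact0; field.
  rewrite /M big_ord_recr /= -/(M j.+1) IH /ps big_ord_recr /= -/(ps j y) -/(w j) -/(w j.+1).
  have hS : (j.+1%:R : R) = j%:R + 1 by rewrite natr1.
  have := wS j; rewrite hS; move: (w j.+1) (w j) (ps j y) (j%:R : R) => u v t m h.
  by rewrite [y * (t + v)]mulrDr h; ring.
have Mmono j j' : (j <= j')%N -> M j <= M j'.
  move=> h; rewrite /M -!(big_mkord xpredT (fun j => (j%:R - y) ^+ 2 * w j)) [leRHS](big_cat_nat (n := j)) //=.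
  by rewrite lerDl; apply: sumr_ge0 => i _; rewrite mulr_ge0 ?sqr_ge0.
have Mle : M J <= y * expR y.
  have [m hm] : exists m : nat, y <= m%:R by exists (Num.truncn y).+1; exact/ltW/truncnS_gt.
  apply: le_trans (Mmono J (maxn J m).+1 _) _; first by rewrite ltnW // ltnS leq_maxl.
  rewrite ME -[leRHS]addr0; apply: lerD; first by apply: ler_wpM2l => //; exact: ps_le.
  apply: mulr_ge0_le0; first exact: mulr_ge0.
  rewrite subr_le0; apply: le_trans hm _; by rewrite ler_nat leq_maxr.
have -> : \sum_(j < J) (j%:R - y) ^+ 2 * po j y = expR (- y) * M J.
  by rewrite /M mulr_sumr; apply: eq_bigr => j _; rewrite /po mulrCA.
apply: le_trans (_ : expR (- y) * (y * expR y) <= _); first by apply: ler_wpM2l => //; exact: expR_ge0.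
by rewrite mulrCA -expRD addNr expR0 mulr1.
Qed.

(** From [|t| <= d + t ^ 2 / d] and the variance bound; the mean [Q (x + 1)] matches the nodes
    [j / Q - 1]. *)
Lemma po_moment1 J (Q d x : R) : 0 < Q -> 0 < d -> -1 < x ->
  \sum_(j < J) `|j%:R / Q - 1 - x| * po j (Q * (x + 1)) <= d + (x + 1) / (d * Q).
Proof.
move=> Q0 d0 x1; set y := Q * (x + 1); have y0 : 0 <= y by rewrite mulr_ge0 ?ltW //; move: x1; lra.
have s1 := po_sum_le1 J y0; have s2 := po_moment2 J y0.
apply: le_trans (_ : \sum_(j < J) (d * po j y + (d * Q ^+ 2)^-1 * ((j%:R - y) ^+ 2 * po j y)) <= _).
  apply: ler_sum => j _; rewrite [X in _ <= _ + X]mulrA -mulrDl; apply: ler_wpM2r; first exact: po_ge0.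
  have -> : j%:R / Q - 1 - x = (j%:R - y) / Q by rewrite /y; field; rewrite gt_eqF.
  set t := (_ - y) / Q; have -> : (d * Q ^+ 2)^-1 * (j%:R - y) ^+ 2 = d^-1 * t ^+ 2.
    by rewrite /t; field; rewrite !gt_eqF.
  have h : 0 <= (`|t| - d) ^+ 2 / d by rewrite divr_ge0 ?sqr_ge0 ?ltW.
  have e : (`|t| - d) ^+ 2 / d = d^-1 * t ^+ 2 + d - 2 * `|t|.
    by rewrite -[t ^+ 2]real_normK ?num_real //; field; rewrite gt_eqF.
  by rewrite e in h; have := normr_ge0 t; move: (`|t|) (d^-1 * _) h => *; lra.
rewrite big_split /= -[X in X + _]mulr_sumr -[X in _ + X]mulr_sumr; apply: lerD.
  by have h := ler_wpM2l (ltW d0) s1; rewrite mulr1 in h.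
apply: le_trans (_ : (d * Q ^+ 2)^-1 * y <= _).
  by apply: ler_wpM2l => //; rewrite invr_ge0 mulr_ge0 ?exprn_ge0 ?ltW.
by rewrite le_eqVlt; apply/orP; left; apply/eqP; rewrite /y; field; rewrite !gt_eqF.
Qed.

End Poisson.

(** * Difference quotients and derivatives of Szasz operators *)

Section Differences.
Context {R : realType} {n : nat}.
Implicit Types (x z v : 'rV[R]_n) (f g a : 'rV[R]_n -> R) (s : seq 'I_n).
Local Notation ev i := (delta_mx (ord0 : 'I_1) (i : 'I_n) : 'rV[R]_n).

Lemma pd_shift i f z : pd i (fun x => f (x + z)) = fun x => pd i f (x + z).
Proof.
apply/funext => x; have e : (fun h : R => h^-1 *: (((fun x => f (x + z)) \o shift x) (h *: ev i) - f (x + z))) =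
   (fun h : R => h^-1 *: ((f \o shift (x + z)) (h *: ev i) - f (x + z))).
  by apply/funext => h /=; rewrite addrA.
by rewrite /pd /derive e.
Qed.

Lemma pdZ i (c : R) f x : smooth f -> pd i (fun x => c * f x) x = c * pd i f x.
Proof. exact: (pdsZ [:: i]). Qed.

Lemma smooth_shift f z : smooth f -> smooth (fun x => f (x + z)).
Proof.
move=> sf s; have -> : pds s (fun x => f (x + z)) = fun x => pds s f (x + z).
  by elim: s => //= i s ->; exact: (pd_shift i (pds s f) z).
move=> x; apply: (@differentiable_comp _ _ _ _ (fun x => x + z) (pds s f)); last exact: sf.
by apply: (differentiableD (f := id) (g := cst z)); [exact: ex_diff|exact: differentiable_cst].
Qed.

Lemma is_derive_line g x v (t : R) : smooth g ->
  is_derive t 1 (fun t : R => g (x + t *: v)) ('D_v g (x + t *: v)).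
Proof.
move=> sg; have e : (fun h : R => h^-1 *: (((fun t : R => g (x + t *: v)) \o shift t) (h *: 1) - g (x + t *: v))) =
   (fun h : R => h^-1 *: ((g \o shift (x + t *: v)) (h *: v) - g (x + t *: v))).
  apply/funext => h /=; congr (_ *: (g _ - _)).
  by rewrite [h *: 1]mulr1 scalerDl addrCA.
split; first by rewrite /derivable e; exact: smooth_derivable.
by rewrite /derive e.
Qed.

Lemma derive_coord g x v : smooth g -> 'D_v g x = \sum_i v ord0 i * pd i g x.
Proof.
move=> sg; have dg := smooth_diff x sg; rewrite deriveE // {1}(row_sum_delta v) linear_sum /=.
by apply: eq_bigr => i _; rewrite linearZ /= /pd deriveE.
Qed.

Lemma smooth_MVT g x v (c : R) : smooth g -> 0 < c ->
  exists t : R, [/\ 0 <= t, t <= c & g (x + c *: v) - g x = c * 'D_v g (x + t *: v)].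
Proof.
move=> sg c0; have hd (t : R) := is_derive_line x v t sg.
have hc : {within `[0, c], continuous (fun t : R => g (x + t *: v))}.
  apply: continuous_subspaceT => t; apply: differentiable_continuous; apply/derivable1_diffP.
  exact: (@ex_derive _ _ _ _ _ _ _ (hd t)).
have [t] := @MVT R (fun t : R => g (x + t *: v)) (fun t => 'D_v g (x + t *: v)) 0 c c0 (fun t _ => hd t) hc.
rewrite in_itv /= => /andP[t0 tc]; rewrite scale0r addr0 subr0 mulrC => h.
by exists t; split=> //; exact: ltW.
Qed.

Lemma smooth_lipschitz g (B : R) x z : smooth g -> (forall i y, `|pd i g y| <= B) ->
  `|g z - g x| <= B * \sum_i `|z ord0 i - x ord0 i|.
Proof.
move=> sg hB; have [t [_ _]] := smooth_MVT x (z - x) sg ltr01.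
rewrite scale1r [x + _]addrC subrK mul1r => ->; rewrite derive_coord //.
apply: le_trans (ler_norm_sum _ _ _) _; rewrite mulr_sumr; apply: ler_sum => i _.
by rewrite normrM !mxE mulrC; apply: ler_wpM2r.
Qed.

Variable Q : R.
Hypothesis Q0 : 0 < Q.

Definition dq i a x := Q * (a (x + Q^-1 *: ev i) - a x).
Definition dqs s a := foldr dq a s.

Lemma smooth_dq i a : smooth a -> smooth (dq i a).
Proof.
move=> sa; have sM (c : R) f : smooth f -> smooth (fun x => c * f x).
  by move=> sf; apply: smoothM => //; exact: smooth_cst.
apply: (sM Q (fun x => a (x + Q^-1 *: ev i) - a x)).
rewrite (_ : (fun x => _) = fun x => a (x + Q^-1 *: ev i) + -1 * a x); last by apply/funext => x; rewrite mulN1r.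
by apply: smoothD; [exact: smooth_shift|exact: sM].
Qed.

Lemma smooth_dqs s a : smooth a -> smooth (dqs s a).
Proof. by move=> sa; elim: s => //= i s IH; exact: smooth_dq. Qed.

Lemma pd_dq i j a : smooth a -> pd i (dq j a) = dq j (pd i a).
Proof.
move=> sa; apply/funext => x; have s1 := smooth_shift (Q^-1 *: ev j) sa.
have s2 : smooth (fun x => -1 * a x) by apply: smoothM => //; exact: smooth_cst.
have e : dq j a = fun x => Q * (a (x + Q^-1 *: ev j) + -1 * a x) by apply/funext => z; rewrite mulN1r.
rewrite e (pdZ i Q x (smoothD s1 s2)) pdD; [|exact: smooth_diff..]; rewrite pd_shift.
by rewrite (pdZ i (-1) x sa) mulN1r.
Qed.

Lemma pd_dqs i s a : smooth a -> pd i (dqs s a) = dqs s (pd i a).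
Proof. by move=> sa; elim: s => //= j s <-; rewrite pd_dq //; exact: smooth_dqs. Qed.

Lemma dq_comm i j a : dq i (dq j a) = dq j (dq i a).
Proof. by apply/funext => x; rewrite /dq (addrAC x); ring. Qed.

Lemma dqs_dq s i a : dqs s (dq i a) = dq i (dqs s a).
Proof. by elim: s => //= j s ->; rewrite dq_comm. Qed.

(** Difference quotients commute with each other and with derivatives, so the mean value theorem is
    applied in one direction at a time. *)
Lemma dqs_MVT s a x : smooth a -> exists z, (forall i, `|z ord0 i| <= (size s)%:R / Q) /\
  dqs s a x = pds s a (x + z).
Proof.
elim/last_ind: s a x => [|s i IH] a x sa.
  by exists 0; split=> [i|]; rewrite ?mxE ?normr0 ?mul0r // addr0.
have Qi : 0 < Q^-1 by rewrite invr_gt0.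
have [t [t0 tQ]] := smooth_MVT x (ev i) (smooth_dqs s sa) Qi.
have -> : dqs (rcons s i) a = dq i (dqs s a) by rewrite /dqs foldr_rcons -/(dqs s _) dqs_dq.
rewrite {1}/dq => ->; rewrite mulrA mulfV ?gt_eqF // mul1r -/(pd i _ _) pd_dqs //.
have [z [hz ->]] := IH (pd i a) (x + t *: ev i) (smooth_pd i sa).
exists (t *: ev i + z); split=> [j|]; last by rewrite pds_rcons addrA.
rewrite !mxE eqxx /= size_rcons -natr1 mulrDl mul1r addrC; apply: le_trans (ler_normD _ _) _.
apply: lerD => //; rewrite ger0_norm ?mulr_ge0 // -[leRHS]mulr1.
by apply: ler_pM => //; case: (_ == _).
Qed.

Definition vanish_above (c : R) a := forall x i, c <= x ord0 i -> a x = 0.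

Lemma vanish_dq c i a : vanish_above c a -> vanish_above c (dq i a).
Proof.
move=> h x j xj; rewrite /dq !(h _ j) ?subrr ?mulr0 // !mxE; apply: le_trans xj _.
by rewrite lerDl mulr_ge0 ?invr_ge0 ?(ltW Q0).
Qed.

Lemma vanish_dqs c s a : vanish_above c a -> vanish_above c (dqs s a).
Proof. by move=> h; elim: s => //= i s IH; exact: vanish_dq. Qed.

Variable J : nat.

(** The nodes start at -1 rather than 0: a distribution supported in the closed orthant sees
    derivatives at its walls, so approximation is needed on a neighbourhood. *)
Definition node (j : {ffun 'I_n -> 'I_J}) : 'rV[R]_n := \row_l ((j l : nat)%:R / Q - 1).
Definition pw (j : 'I_n -> nat) x : R := \prod_l po (j l) (Q * (x ord0 l + 1)).
Definition szasz a x : R := \sum_(j : {ffun 'I_n -> 'I_J}) a (node j) * pw (fun l => j l) x.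

Let aff l x := Q * (x ord0 l + 1).

Let smooth_aff l : smooth (aff l).
Proof.
apply: smoothM; first exact: smooth_cst.
by apply: smoothD; [exact: smooth_coord|exact: smooth_cst].
Qed.

Let pd_aff i l x : pd i (aff l) x = Q * (l == i)%:R.
Proof.
have sc : smooth (fun x => x ord0 l + 1) by apply: smoothD; [exact: smooth_coord|exact: smooth_cst].
rewrite /aff (pdZ i Q x sc) pdD; [|exact: smooth_diff (smooth_coord _)|exact: smooth_diff (smooth_cst _)].
by rewrite pd_coord pd_cst addr0.
Qed.

Let smooth_po j l : smooth (fun x => po j (aff l x)).
Proof.
apply: smoothM; last first.
  apply: smoothM; last exact: smooth_cst.
  rewrite (_ : (fun x => _) = fun x => \prod_(c < j) aff l x); first by apply: smooth_prod.
  by apply/funext => x; rewrite prodr_const card_ord.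
apply: smooth_comp; first exact: smooth1_expR.
rewrite (_ : (fun x => _) = fun x => -1 * aff l x); last by apply/funext => x; rewrite mulN1r.
by apply: smoothM => //; exact: smooth_cst.
Qed.

Lemma smooth_pw j : smooth (pw j).
Proof. by apply: smooth_prod => l _; exact: smooth_po. Qed.

Lemma smooth_szasz a : smooth (szasz a).
Proof. by apply: smooth_sum => j _; apply: smoothM; [exact: smooth_cst|exact: smooth_pw]. Qed.

Definition popred j (y : R) : R := if j is j'.+1 then po j' y else 0.

Let pd_po i l j x :
  pd i (fun x => po j (aff l x)) x = Q * (l == i)%:R * (popred j (aff l x) - po j (aff l x)).
Proof.
have sN : smooth (fun x => -1 * aff l x) by apply: smoothM => //; exact: smooth_cst.
have sE : smooth (fun x => expR (-1 * aff l x)) by apply: smooth_comp => //; exact: smooth1_expR.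
have sX m : smooth (fun x => aff l x ^+ m).
  rewrite (_ : (fun x => _) = fun x => \prod_(c < m) aff l x); first by apply: smooth_prod.
  by apply/funext => z; rewrite prodr_const card_ord.
have pX m : pd i (fun x => aff l x ^+ m) x = m%:R * aff l x ^+ m.-1 * (Q * (l == i)%:R).
  elim: m => [|m IH]; first by rewrite (_ : (fun x => _) = fun _ => 1) ?pd_cst ?mul0r.
  rewrite (_ : (fun x => _) = fun x => aff l x * aff l x ^+ m); last by apply/funext => z; rewrite exprS.
  rewrite pdM; [|exact: smooth_diff..]; rewrite IH pd_aff -natr1 /=.
  by case: (m) => [|m']; rewrite /= ?exprS; ring.
have pE : pd i (fun x => expR (-1 * aff l x)) x = expR (- aff l x) * (- (Q * (l == i)%:R)).
  rewrite (pd_comp (F := expR) (f := fun x => -1 * aff l x)) //; last exact: smooth_diff.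
  rewrite derive1E (@derive_val _ _ _ _ _ _ _ (is_derive_expR _)) mulN1r; congr (_ * _).
  by rewrite (pdZ i (-1) x (smooth_aff l)) pd_aff mulN1r.
rewrite (_ : (fun x => _) = fun x => (j`!%:R)^-1 * (expR (-1 * aff l x) * aff l x ^+ j)); last first.
  by apply/funext => z; rewrite /po mulN1r; ring.
rewrite (pdZ i (j`!%:R)^-1 x (smoothM sE (sX j))) pdM; [|exact: smooth_diff..]; rewrite pE pX mulN1r /po /popred.
case: j => [|j]; first by rewrite /= fact0 mul0r; ring.
have f1 : (j`!%:R : R) != 0 by rewrite pnatr_eq0 -lt0n fact_gt0.
have f2 : (j.+1%:R : R) != 0 by rewrite pnatr_eq0.
rewrite /= factS natrM /po exprS; move: (j.+1%:R) (j`!%:R) f1 f2 => S F F0 S0.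
by field; rewrite ?F0 ?S0.
Qed.

Let pd_pw i j x : pd i (pw j) x =
  Q * (popred (j i) (aff i x) * (\prod_(l | l != i) po (j l) (aff l x)) - pw j x).
Proof.
have -> : pw j = fun x => po (j i) (aff i x) * \prod_(l | l != i) po (j l) (aff l x).
  by apply/funext => z; rewrite /pw (bigD1 i).
have sr : smooth (fun x => \prod_(l | l != i) po (j l) (aff l x)) by apply: smooth_prod.
rewrite pdM; [|exact: smooth_diff..]; rewrite pd_po eqxx /= mulr1.
have -> : pd i (fun x => \prod_(l | l != i) po (j l) (aff l x)) x = 0.
  elim: (index_enum _) => [|l r IH]; first by under eq_fun do rewrite big_nil; rewrite pd_cst.
  under eq_fun do rewrite big_cons; case: (boolP (l != i)) => // /negPf li.
  rewrite pdM; [|exact: smooth_diff|by apply: smooth_diff; apply: smooth_prod].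
  by rewrite IH pd_po li !(mulr0n, mulr0, mul0r, addr0).
by ring.
Qed.

Let pd_lsum (I : Type) (r : seq I) (c : I -> R) (f : I -> 'rV[R]_n -> R) i x : (forall t, smooth (f t)) ->
  pd i (fun x => \sum_(t <- r) c t * f t x) x = \sum_(t <- r) c t * pd i (f t) x.
Proof.
move=> sf; elim: r => [|t r IH]; first by under eq_fun do rewrite big_nil; rewrite pd_cst big_nil.
have sc u : smooth (fun x => c u * f u x) by apply: smoothM => //; exact: smooth_cst.
under eq_fun do rewrite big_cons; rewrite pdD; last 2 first.
- exact: smooth_diff.
- by apply: smooth_diff; apply: smooth_sum.
by rewrite IH big_cons (pdZ i (c t) x (sf t)).
Qed.

(** Summation by parts: the derivative of a Poisson weight is a multiple of the difference of two
    neighbouring weights, and the shift is moved to the values of [a]. *)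
Lemma pd_szasz i a : vanish_above (J%:R / Q - 1) a -> pd i (szasz a) = szasz (dq i a).
Proof.
move=> va; apply/funext => x; rewrite /szasz pd_lsum => [|j]; last exact: smooth_pw.
pose B (j : {ffun 'I_n -> 'I_J}) := popred (j i) (aff i x) * (\prod_(l | l != i) po (j l) (aff l x)).
rewrite (eq_bigr (fun j => Q * (a (node j) * B j) - Q * (a (node j) * pw (fun l => j l) x))) => [|j _]; last first.
  by rewrite pd_pw /B; ring.
rewrite [RHS](eq_bigr (fun j => Q * (a (node j + Q^-1 *: ev i) * pw (fun l => j l) x) -
   Q * (a (node j) * pw (fun l => j l) x))) => [|j _]; last by rewrite /dq; ring.
rewrite !sumrB; congr (_ - _); rewrite -!mulr_sumr; congr (_ * _).
(* Cyclic shift of the index in position [i]. At the wrap-around one side contains [popred 0 = 0],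
   and on the other [a] vanishes at the node of index [J]. *)
pose h (j : {ffun 'I_n -> 'I_J}) : {ffun 'I_n -> 'I_J} := [ffun l => if l == i then ordS (j l) else j l].
pose h' (j : {ffun 'I_n -> 'I_J}) : {ffun 'I_n -> 'I_J} := [ffun l => if l == i then ord_pred (j l) else j l].
have hb : bijective h.
  exists h' => j; apply/ffunP => l; rewrite !ffunE; case: eqP => // _; [exact: ordSK|exact: ord_predK].
rewrite (reindex h); last exact: onW_bij; apply: eq_bigr => j _.
have eB : \prod_(l | l != i) po (h j l) (aff l x) = \prod_(l | l != i) po (j l) (aff l x).
  by apply: eq_bigr => l /negPf li; rewrite ffunE li.
have hi : h j i = ((j i).+1 %% J)%N :> nat by rewrite ffunE eqxx.
have [lt|ge] := ltnP (j i).+1 J.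
  rewrite /B eB hi modn_small //= /pw [in RHS](bigD1 i) //=; congr (a _ * _).
  apply/rowP => l; rewrite !mxE eqxx /=; case: (eqVneq l i) => [->|li].
    by rewrite hi modn_small // -natr1 (_ : true%:R = 1 :> R) // mulr1; field; rewrite gt_eqF.
  by rewrite ffunE (negPf li) mulr0 addr0.
have eJ : (j i).+1 = J by apply/eqP; rewrite eqn_leq ge ltn_ord.
rewrite /B hi eJ modnn /= mul0r mulr0 (va _ i) ?mul0r // !mxE !eqxx /= -{1}eJ -natr1.
by rewrite le_eqVlt; apply/orP; left; apply/eqP; field; rewrite gt_eqF.
Qed.

Lemma pds_szasz s a : vanish_above (J%:R / Q - 1) a -> pds s (szasz a) = szasz (dqs s a).
Proof.
move=> va; elim: s => //= i s ->; rewrite -/(pd i _) pd_szasz //; exact: vanish_dqs.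
Qed.

Lemma pw_sum (F : 'I_n -> nat -> R) x :
  \sum_(j : {ffun 'I_n -> 'I_J}) \prod_l (F l (j l) * po (j l) (aff l x)) =
  \prod_l \sum_(c < J) F l c * po c (aff l x).
Proof. by rewrite bigA_distr_bigA. Qed.

End Differences.

Section SzaszConvergence.
Context {R : realType} {n : nat}.
Implicit Types (x z : 'rV[R]_n) (f g phi : 'rV[R]_n -> R) (s : seq 'I_n) (q : nat).

(* A square, so that the optimal scale of the Chebyshev bound, 1 / sqrt mesh, is rational. *)
Definition mesh q : R := (q.+1%:R) ^+ 2.

Lemma mesh_gt0 q : 0 < mesh q. Proof. by rewrite exprn_gt0 // ltr0n. Qed.

Lemma one_sub_prod (I : Type) (r : seq I) (P : I -> R) : (forall i, 0 <= P i) -> (forall i, P i <= 1) ->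
  0 <= 1 - \prod_(i <- r) P i /\ 1 - \prod_(i <- r) P i <= \sum_(i <- r) (1 - P i).
Proof.
move=> P0 P1; elim: r => [|i r [IH0 IH1]]; first by rewrite !big_nil subrr lexx.
rewrite !big_cons; have p0 : 0 <= \prod_(i <- r) P i by exact: prodr_ge0.
have := P0 i; have := P1 i; move: (P i) (\prod_(_ <- _) _) IH0 IH1 p0 => a b h0 h1 h2 h3 h4.
by split; nra.
Qed.

(** By [pds_szasz] a derivative of the operator is a Szasz sum of difference quotients. Its error
    has three sources: the mean displacement of the nodes, of order [d q * (1 + |x|)]; the step of
    the difference quotients, at most [size s / Q] in each coordinate; and the truncated mass, which
    counts only where [|x| <= r]. The growth in [x] is absorbed by an exponential later. *)
Lemma szasz_conv phi : testfun phi -> exists J : nat -> nat, forall s, exists C : R, 0 <= C /\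
  forall q x, (forall i, -1 < x ord0 i) ->
  `|pds s (szasz (mesh q) (J q) phi) x - pds s phi x| <= C / q.+1%:R * (1 + `|x|).
Proof.
move=> tf; have [B [r [B0 r0 hB hr]]] := testfun_bounded tf; have [sm _] := tf.
have sch := testfun_schwartz tf.
pose d q : R := (q.+1%:R)^-1; have d0 q : 0 < d q by rewrite invr_gt0 ltr0n.
have d1 q : d q <= 1 by rewrite invf_le1 ?ltr0n // ler1n.
have md q : mesh q * d q ^+ 2 = 1 by rewrite /mesh /d -exprMn mulfV ?expr1n // pnatr_eq0.
have hJ q : exists J : nat, r < J%:R / mesh q - 1 /\
    forall y, 0 <= y -> y <= mesh q * (r + 1) -> 1 - \sum_(j < J) po j y <= d q.
  have Y0 : 0 <= mesh q * (r + 1) by rewrite mulr_ge0 ?(ltW (mesh_gt0 q)) ?addr_ge0.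
  have [J0 hJ0] := po_tail Y0 (d0 q).
  (* [J1] puts the last node beyond the support of [phi]; [J0] makes the truncated mass small. *)
  pose J1 := (Num.truncn (mesh q * (r + 2))).+1; exists (maxn J0 J1); split.
    have h1 : mesh q * (r + 2) < J1%:R by exact: truncnS_gt.
    have h2 : mesh q * (r + 2) < (maxn J0 J1)%:R by apply: lt_le_trans h1 _; rewrite ler_nat leq_maxr.
    rewrite ltrBrDr ltr_pdivlMr ?mesh_gt0 //; apply: le_lt_trans h2; rewrite mulrC.
    by apply: ler_wpM2l; [exact/ltW/mesh_gt0|rewrite lerD2l ler1n].
  by move=> y y0 yY; apply: hJ0 => //; rewrite leq_maxl.
have [J HJ] := choice hJ; exists J => s.
have va q : vanish_above ((J q)%:R / mesh q - 1) phi.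
  move=> x i xi; apply: hr; apply: lt_le_trans (coord_le_norm x i).
  have [h _] := HJ q; apply: lt_le_trans h _; apply: le_trans xi _; exact: ler_norm.
have bd t : exists C : R, forall x, `|pds t phi x| <= C.
  by have [_ /(_ t 0%N)[C hC]] := sch; exists C => x; have := hC x; rewrite expr0 mul1r.
have [G hG] := bd s; have G0 : 0 <= G by apply: le_trans (hG 0).
have [CL hCL] := choice (fun i => bd (i :: s)).
pose L := \sum_i `|CL i|; have L0 : 0 <= L by exact: sumr_ge0.
have hL i x : `|pd i (pds s phi) x| <= L.
  apply: le_trans (hCL i x) _; apply: le_trans (ler_norm _) _.
  by rewrite /L (bigD1 i) //= lerDl sumr_ge0.
have sg := smooth_pds s sm; set g := pds s phi in sg hL hG *.
have g0 x : r < `|x| -> g x = 0.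
  have oU : open [set x : 'rV[R]_n | r < `|x|].
    apply: (@open_comp _ _ (fun x : 'rV[R]_n => `|x|) [set y | r < y]); last exact: open_gt.
    by move=> z _; exact: norm_continuous.
  by move=> rx; exact: (pds_zero s oU hr).
pose N : R := n%:R; have N0 : 0 <= N by [].
pose S : R := (size s)%:R; have S0 : 0 <= S by [].
exists (L * (N * (2 + S)) + G * N); split; first by rewrite addr_ge0 ?mulr_ge0 // addr_ge0.
move=> q x xi; have Q0 := mesh_gt0 q; rewrite (pds_szasz Q0 s (va q)).
set Q := mesh q in Q0 *; set b := dqs Q s phi; pose y l := Q * (x ord0 l + 1).
have y0 l : 0 <= y l by rewrite mulr_ge0 ?(ltW Q0) //; have := xi l; move: (x ord0 l) => u; lra.
pose P l := \sum_(c < J q) po c (y l).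
have P0 l : 0 <= P l by apply: sumr_ge0 => c _; exact: po_ge0.
have P1 l : P l <= 1 by exact: po_sum_le1.
pose W (j : {ffun 'I_n -> 'I_(J q)}) := pw Q (fun l => j l) x.
have W0 j : 0 <= W j by apply: prodr_ge0 => l _; exact: (po_ge0 _ (y0 l)).
have sumW : \sum_j W j = \prod_l P l.
  by rewrite /P (bigA_distr_bigA (fun l (c : 'I_(J q)) => po c (y l))).
have [pp0 pp1] := one_sub_prod (index_enum 'I_n) P0 P1.
have -> : szasz Q (J q) b x - g x =
    \sum_j (b (node Q j) - g x) * W j - g x * (1 - \prod_l P l).
  rewrite -sumW mulrBr mulr1 mulr_sumr /szasz -/(W _).
  rewrite [X in _ = X - _](eq_bigr (fun j => b (node Q j) * W j - g x * W j)) => [|j _]; last by rewrite mulrBl.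
  by rewrite sumrB opprB addrA subrK.
have nx := normr_ge0 x.
have tail : `|g x * (1 - \prod_l P l)| <= G * N * d q.
  have [xr|xr] := ltP r `|x|; first by rewrite g0 // mul0r normr0 !mulr_ge0 // ltW.
  rewrite normrM -mulrA; apply: ler_pM => //; rewrite (ger0_norm pp0); apply: le_trans pp1 _.
  apply: le_trans (_ : \sum_(l < n) d q <= _); last by rewrite sumr_const card_ord mulr_natl.
  apply: ler_sum => l _; have [_ h] := HJ q; apply: h => //.
  rewrite /y; apply: ler_wpM2l; first exact: ltW.
  rewrite lerD2r; apply: le_trans xr; apply: le_trans (coord_le_norm x l); exact: ler_norm.
have diff z : `|b z - g x| <= L * \sum_l (`|z ord0 l - x ord0 l| + S / Q).
  have [v [hv e]] := dqs_MVT Q0 s z sm; rewrite /b e.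
  apply: le_trans (smooth_lipschitz x (z + v) sg hL) _; apply: ler_wpM2l => //; apply: ler_sum => l _.
  rewrite !mxE addrAC; apply: le_trans (ler_normD _ _) _; rewrite lerD2l; exact: hv.
have X l : \sum_j `|node Q j ord0 l - x ord0 l| * W j <= 2 * d q * (1 + `|x|).
  pose F (m : 'I_n) (c : nat) : R := if m == l then `|c%:R / Q - 1 - x ord0 m| else 1.
  have -> : \sum_j `|node Q j ord0 l - x ord0 l| * W j = \prod_m \sum_(c < J q) F m c * po c (y m).
    rewrite -(pw_sum Q (J q) F x); apply: eq_bigr => j _; rewrite big_split /=; congr (_ * _).
    by rewrite /F -big_mkcond big_pred1_eq mxE.
  rewrite (bigD1 l) //=; have Fl : \sum_(c < J q) F l c * po c (y l) <= 2 * d q * (1 + `|x|).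
    rewrite /F eqxx; apply: le_trans (po_moment1 (J q) Q0 (d0 q) (xi l)) _.
    have -> : (d q * Q)^-1 = d q.
      by apply: (mulfI (x := d q * Q)); rewrite ?mulfV ?mulf_neq0 ?gt_eqF //; rewrite -(md q) -/Q; ring.
    have := le_trans (ler_norm _) (coord_le_norm x l); move: (x ord0 l) (d0 q) => u dq0 ux.
    by move: (d q) (`|x|) dq0 ux nx => e m e0 um m0; nra.
  have Fp m : 0 <= \sum_(c < J q) F m c * po c (y m).
    by apply: sumr_ge0 => c _; rewrite mulr_ge0 ?po_ge0 // /F; case: (m == l).
  rewrite -[leRHS]mulr1; apply: ler_pM => //; first by apply: prodr_ge0.
  apply: prodr_ile1 => m ml; rewrite Fp /= /F (negPf ml).
  by under eq_bigr do rewrite mul1r; exact: P1.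
have main : `|\sum_j (b (node Q j) - g x) * W j| <= L * (N * (2 + S)) * (d q * (1 + `|x|)).
  apply: le_trans (ler_norm_sum _ _ _) _.
  apply: le_trans (_ : \sum_j L * (\sum_l (`|node Q j ord0 l - x ord0 l| * W j + S / Q * W j)) <= _).
    apply: ler_sum => j _; rewrite normrM (ger0_norm (W0 j)).
    rewrite [X in _ <= _ * X](eq_bigr (fun l => (`|node Q j ord0 l - x ord0 l| + S / Q) * W j)) => [|l _].
      by rewrite -mulr_suml mulrA; apply: ler_wpM2r.
    by rewrite mulrDl.
  rewrite -mulr_sumr -!mulrA; apply: ler_wpM2l => //; rewrite exchange_big /=.
  apply: le_trans (_ : \sum_(l < n) ((2 + S) * (d q * (1 + `|x|))) <= _); last first.
    by rewrite sumr_const card_ord mulr_natl.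
  apply: ler_sum => l _; rewrite big_split /= mulrDl; apply: lerD.
    by rewrite mulrA; exact: X.
  rewrite -mulr_sumr sumW.
  have QV : Q^-1 <= d q.
    have -> : Q^-1 = d q ^+ 2 by apply: (mulfI (lt0r_neq0 Q0)); rewrite md mulfV // gt_eqF.
    by rewrite expr2 ger_pMl.
  have p1 : \prod_l P l <= 1 by rewrite -subr_ge0.
  have p0 : 0 <= \prod_l P l by exact: prodr_ge0.
  rewrite -mulrA; apply: ler_wpM2l => //; rewrite -[leLHS]mulrC; apply: le_trans (_ : Q^-1 <= _).
    by rewrite ger_pMl // invr_gt0.
  by apply: le_trans QV _; rewrite ler_peMr ?(ltW (d0 q)) // lerDl.
apply: le_trans (ler_normB _ _) _; apply: le_trans (lerD main tail) _.
rewrite -/(d q) -[leRHS]mulrA [leRHS]mulrDl lerD2l; apply: ler_wpM2l; first exact: mulr_ge0.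
by rewrite ler_peMr ?(ltW (d0 q)) // lerDl.
Qed.

End SzaszConvergence.

(** * Sufficiency of the Wallach set *)

Section FaceMeasure.
Context {R : realType} {n : nat} {k : R} {lam : {measure set (RnB R n) -> \bar R}}.
Context {Rz : R[i] -> ('rV[R]_n -> R) -> R[i]}.
Hypothesis (n1 : (1 <= n)%N) (k0 : 0 < k) (hlam : is_lebesgue_Rn lam) (hRz : riesz_family k lam Rz).
Context {r : nat}.
Hypothesis rn : (r < n)%N.
Implicit Types (x : RnB R n) (p q phi : 'rV[R]_n -> R).
Local Notation orth := (@Rplus_n R n).
Local Notation permv sg := (gmap (const_mx 1) sg).
Local Notation kap := (skappa n1 k0 hlam hRz r).
Local Notation SW := (swint k lam r).
Local Notation T := (Rz (cr (k * r%:R))).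
Local Notation faceR := (@face R n r).
Local Notation ww := (@wweight R n k r).

(** Agreement of [R_mu] with the candidate measure at rate [M]. The cut-off parameter 4 confines
    supports to [x_i >= - 1 / 2], inside the region [x_i > -1] where the Szasz operators
    converge. *)
Definition agree M q := slow q /\ T (exq 4 M q) = cr (kap * SW M q).

Lemma agree_lin M (a b : R) p q : 0 < M -> agree M p -> agree M q -> agree M (fun x => a * p x + b * q x).
Proof.
move=> Mp [sp hp] [sq hq]; split.
  by apply: slowD; apply: slowM => //; exact: slow_cst.
rewrite (Rz_exq_lin hRz) // swint_lin // hp hq.
have -> : kap * (a * SW M p + b * SW M q) = a * (kap * SW M p) + b * (kap * SW M q) by ring.
by rewrite -crD -!(crM _ (kap * _)).
Qed.

Lemma agree_mon M b : 0 < M -> agree M (mon b).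
Proof.
move=> Mp; have s4 : 0 < 4 :> R by [].
split; first exact: (polyf_mon b).1.
have h := face_moments n1 k0 hlam hRz rn b s4 Mp.
exact: h.
Qed.

Lemma agree_prod M (t : seq 'I_n) (e : 'I_n -> nat) : 0 < M ->
  forall b, agree M (fun x => (\prod_(l <- t) (x ord0 l + 1) ^+ e l) * mon b x).
Proof.
move=> Mp; elim: t => [|l t IH] b.
  rewrite (_ : (fun x => _) = mon b); first exact: agree_mon.
  by apply/funext => x; rewrite big_nil mul1r.
pose P (x : 'rV[R]_n) : R := \prod_(l <- t) (x ord0 l + 1) ^+ e l.
have H m : forall b, agree M (fun x => (x ord0 l + 1) ^+ m * P x * mon b x).
  elim: m => [|m IHm] {}b.
    rewrite (_ : (fun x => _) = fun x => P x * mon b x); first exact: IH.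
    by apply/funext => x; rewrite expr0 mul1r.
  have := @agree_lin M 1 1 _ _ Mp (IHm (fun j => b j + (j == l))%N) (IHm b).
  congr agree; apply/funext => x; rewrite monS exprS; ring.
have := H (e l) b; congr agree; apply/funext => x; by rewrite big_cons.
Qed.

Lemma agree_sum M (I : Type) (t : seq I) (c : I -> R) (f : I -> 'rV[R]_n -> R) : 0 < M ->
  (forall i, agree M (f i)) -> agree M (fun x => \sum_(i <- t) c i * f i x).
Proof.
move=> Mp h; elim: t => [|i t IH].
  have := @agree_lin M 0 0 _ _ Mp (agree_mon (fun _ => 0%N) Mp) (agree_mon (fun _ => 0%N) Mp).
  by congr agree; apply/funext => x; rewrite big_nil !mul0r addr0.
have := @agree_lin M (c i) 1 _ _ Mp (h i) IH.
by congr agree; apply/funext => x; rewrite big_cons mul1r.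
Qed.

Let coef (Q : R) (j : 'I_n -> nat) : R := expR (- (Q * n%:R)) * \prod_l (Q ^+ j l / (j l)`!%:R).
Let spoly (Q : R) J (a : 'rV[R]_n -> R) (x : 'rV[R]_n) : R :=
  \sum_(j : {ffun 'I_n -> 'I_J}) (a (node Q j) * coef Q (fun l => j l)) * \prod_l (x ord0 l + 1) ^+ j l.

(** A product of Poisson weights of means [Q (x_l + 1)] is the exponential of rate [Q] times a
    polynomial. A Szasz sum at rate 1 is therefore a polynomial at rate [1 + Q], where the moments
    agree. *)
Lemma szaszE Q J a x : szasz Q J a x = expR (- (Q * psum x)) * spoly Q J a x.
Proof.
rewrite /szasz /spoly mulr_sumr; apply: eq_bigr => j _.
suff -> : pw Q (fun l => j l) x = expR (- (Q * psum x)) * (coef Q (fun l => j l) * \prod_l (x ord0 l + 1) ^+ j l).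
  by ring.
rewrite /pw /po big_split /= -expR_sum /coef mulrA mulrA -expRD -mulrA -big_split; congr (expR _ * _).
  rewrite sumrN -mulr_sumr big_split /= sumr_const card_ord /psum mulrDr opprD.
  by rewrite -[1 *+ n]/(n%:R).
by apply: eq_bigr => l _; rewrite exprMn /=; ring.
Qed.

Lemma spoly_agree Q J a M : 0 < M -> agree M (spoly Q J a).
Proof.
move=> Mp; apply: agree_sum => // j.
have := agree_prod (index_enum 'I_n) (fun l => j l) Mp (fun _ => 0%N).
by congr agree; apply/funext => x; rewrite (_ : mon _ x = 1) ?mulr1 // /mon big1.
Qed.

Lemma psum_perm (sg : 'S_n) x : psum (permv sg x) = psum x.
Proof.
rewrite /psum [RHS](reindex_inj (@perm_inj _ sg)) /=; apply: eq_bigr => l _.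
by rewrite !mxE mul1r.
Qed.

Lemma wweight_exp Q x : ww (1 + Q) x = expR (- (Q * psum (faceR x))) * ww 1 x.
Proof.
rewrite /wweight /wt mulrA; congr (_ * _); rewrite /psum mulr_sumr -sumrN expR_sum /gam -big_split.
apply: eq_bigr => i _ /=; rewrite !mxE; case: ((i < r)%N).
  by rewrite mulrCA -expRD; congr (_ * expR _); ring.
by rewrite mulr0 oppr0 expR0 [RHS]mul1r.
Qed.

Lemma exq_szasz Q J a : exq 4 1 (szasz Q J a) = exq 4 (1 + Q) (spoly Q J a).
Proof.
apply/funext => x; rewrite /exq szaszE mulrA -[_ * expR _ * expR _]mulrA -expRD; congr (_ * expR _ * _); ring.
Qed.

Lemma wint_szasz Q J a (sg : 'S_n) x :
  szasz Q J a (permv sg (faceR x)) * ww 1 x = spoly Q J a (permv sg (faceR x)) * ww (1 + Q) x.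
Proof. by rewrite szaszE psum_perm wweight_exp; ring. Qed.

Lemma szasz_agree Q J a : 0 < Q -> T (exq 4 1 (szasz Q J a)) = cr (kap * SW 1 (szasz Q J a)).
Proof.
move=> Q0; have Mp : 0 < 1 + Q by rewrite addr_gt0.
have [_ h] := spoly_agree Q J a Mp; rewrite exq_szasz h; congr (cr (_ * _)).
by apply: eq_bigr => sg _; rewrite /wint; apply: eq_Rintegral => x _; rewrite wint_szasz.
Qed.

Lemma schwartz_is_slow f : schwartz f -> slow (f : 'rV[R]_n -> R).
Proof.
move=> [sf h]; split=> // s; have [C hC] := h s 0%N; exists `|C|, 0%N; split=> // x.
by rewrite expr0 mulr1; have := hC x; rewrite expr0 mul1r => /le_trans; apply; exact: ler_norm.
Qed.

(** Where some coordinate is at most -1, the cut-off vanishes nearby. Elsewhere the Leibniz rule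
    combines convergence at the rate [(1 + |x|) / (q + 1)] with the rapid decay of the cut-off
    exponential. *)
Lemma exq_szasz_seminorm phi (J : nat -> nat) N : smooth phi ->
  (forall s, exists C : R, 0 <= C /\ forall (q : nat) (x : 'rV[R]_n), (forall i, -1 < x ord0 i) ->
    `|pds s (szasz (mesh q) (J q) phi) x - pds s phi x| <= C / q.+1%:R * (1 + `|x|)) ->
  exists K : R, forall (q : nat) s m (x : 'rV[R]_n), (size s <= N)%N -> (m <= N)%N ->
    `|x| ^+ m * `|pds s (fun x => Hcut 4 x * expR (- (1 * psum x)) * (szasz (mesh q) (J q) phi x - phi x)) x|
      <= K / q.+1%:R.
Proof.
move=> sphi hc; pose E (x : 'rV[R]_n) : R := Hcut 4 x * expR (- (1 * psum x)).
have sE : schwartz E by exact: schwartz_expcut.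
have [A1 [A10 hA1]] := @schwartz_max R n E N 0 sE; have [A2 [A20 hA2]] := @schwartz_max R n E N N.+1 sE.
(* The extension by 0 off the region lets [seq_max] provide one constant for all orders up to [N],
   all [q] and all [x]. *)
pose F (s : seq 'I_n) (qx : nat * 'rV[R]_n) : R := if [forall i, -1 < qx.2 ord0 i]
  then `|pds s (szasz (mesh qx.1) (J qx.1) phi) qx.2 - pds s phi qx.2| * qx.1.+1%:R / (1 + `|qx.2|) else 0.
have [C [C0 hC]] : exists C : R, 0 <= C /\ forall s, (size s <= N)%N -> forall y, F s y <= C.
  apply: seq_max => s; have [C [C0 hC]] := hc s; exists C; split=> // -[q x]; rewrite /F /=.
  case: forallP => // h; rewrite ler_pdivrMr; last by rewrite ltr_pwDl.
  have q0 : 0 < q.+1%:R :> R by rewrite ltr0n.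
  by have := hC q x h; rewrite mulrAC ler_pdivlMr.
exists (2 ^+ N * (2 * (A1 + A2) * C)) => q s m x sN mN.
have q0 : 0 < q.+1%:R :> R by rewrite ltr0n.
pose D (x : 'rV[R]_n) : R := szasz (mesh q) (J q) phi x - phi x.
have sS := smooth_szasz (mesh q) (J q) phi.
have DE : D = fun x => szasz (mesh q) (J q) phi x + -1 * phi x by apply/funext => z; rewrite mulN1r.
have sm : smooth (fun x => -1 * phi x) by apply: smoothM => //; exact: smooth_cst.
have sD : smooth D by rewrite DE; exact: smoothD.
rewrite -/(D _) -/(E _).
have K0 : 0 <= 2 ^+ N * (2 * (A1 + A2) * C) / q.+1%:R.
  by rewrite divr_ge0 ?(ltW q0) // !mulr_ge0 ?addr_ge0 ?exprn_ge0.
have [[i xi]|hx] := pselect (exists i, x ord0 i <= -1).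
  rewrite (@pds_zero _ _ [set x | x ord0 i < - (1 / 2)]) ?normr0 ?mulr0 //.
  - apply: (@open_comp _ _ (fun x : 'rV[R]_n => x ord0 i) [set y | y < - (1 / 2)]); last exact: open_lt.
    by move=> z _; exact: coord_continuous.
  - move=> z /= zi; rewrite (@Hcut0 _ _ 4 z i) ?mul0r //; apply: le_trans (ltW zi) _; lra.
  - by apply: le_lt_trans xi _; lra.
have xi i : -1 < x ord0 i by rewrite ltNge; apply/negP => h; apply: hx; exists i.
have hD t : (size t <= size s)%N -> `|pds t D x| <= C / q.+1%:R * (1 + `|x|).
  move=> ts; have := hC t (leq_trans ts sN) (q, x); rewrite /F /=; case: forallP => [_|/(_ xi)//].
  rewrite DE pdsD // pdsZ // mulN1r ler_pdivrMr; last by rewrite ltr_pwDl.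
  by rewrite mulrAC ler_pdivlMr.
have nx := normr_ge0 x; have Cq : 0 <= C / q.+1%:R by rewrite divr_ge0 // ltW.
have B0 : 0 <= C / q.+1%:R * (1 + `|x|) by rewrite mulr_ge0 // addr_ge0.
have sEs : smooth E by case: sE.
have p2 : 2 ^+ size s <= 2 ^+ N :> R by rewrite ler_eXn2l // ltr1n.
have fin (A : R) : 0 <= A -> (forall t, (size t <= size s)%N -> `|pds t E x| <= A) ->
    `|x| ^+ m * (A * (1 + `|x|)) <= 2 * (A1 + A2) ->
    `|x| ^+ m * `|pds s (fun x => E x * D x) x| <= 2 ^+ N * (2 * (A1 + A2) * C) / q.+1%:R.
  move=> A0 hA fA; have h := pds_prod_bound sEs sD A0 B0 hA hD.
  apply: le_trans (ler_wpM2l (exprn_ge0 m nx) h) _.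
  have -> : `|x| ^+ m * (2 ^+ size s * (A * (C / q.+1%:R * (1 + `|x|)))) =
    2 ^+ size s * (`|x| ^+ m * (A * (1 + `|x|)) * (C / q.+1%:R)) by ring.
  have -> : 2 ^+ N * (2 * (A1 + A2) * C) / q.+1%:R = 2 ^+ N * (2 * (A1 + A2) * (C / q.+1%:R)) by ring.
  have Y0 : 0 <= `|x| ^+ m * (A * (1 + `|x|)) by rewrite !mulr_ge0 ?exprn_ge0 // addr_ge0.
  by apply: ler_pM; [exact: exprn_ge0|exact: mulr_ge0|exact: p2|exact: ler_wpM2r].
have [x1|x1] := leP `|x| 1.
  apply: (fin A1) => // [t ts|].
    by have := hA1 t (leq_trans ts sN) x; rewrite expr0 mul1r.
  apply: le_trans (_ : 1 * (A1 * 2) <= _); last by lra.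
  by apply: ler_pM => //; rewrite ?exprn_ge0 ?mulr_ge0 ?addr_ge0 ?exprn_ile1 //; apply: ler_wpM2l => //; lra.
have x0 : 0 < `|x| by exact: lt_trans x1.
apply: (fin (A2 / `|x| ^+ N.+1)); first by rewrite divr_ge0 ?exprn_ge0.
  move=> t ts; rewrite ler_pdivlMr ?exprn_gt0 // mulrC; exact: hA2 (leq_trans ts sN) x.
have h1 : `|x| ^+ m <= `|x| ^+ N by rewrite ler_weXn2l // ltW.
apply: le_trans (_ : `|x| ^+ N * (A2 / `|x| ^+ N.+1 * (2 * `|x|)) <= _).
  apply: ler_pM => //; rewrite ?exprn_ge0 ?mulr_ge0 ?divr_ge0 ?addr_ge0 ?exprn_ge0 //.
  by apply: ler_wpM2l; [rewrite divr_ge0 ?exprn_ge0|lra].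
have -> : `|x| ^+ N * (A2 / `|x| ^+ N.+1 * (2 * `|x|)) = 2 * A2.
  by rewrite exprS; field; rewrite ?expf_neq0 gt_eqF.
by apply: ler_wpM2l => //; rewrite lerDr.
Qed.

(** The approximation error grows linearly in [x], which the exponential weight integrates. *)
Lemma swint_szasz_bound phi (J : nat -> nat) (C : R) : 0 <= C -> slow phi ->
  (forall (q : nat) (x : 'rV[R]_n), (forall i, -1 < x ord0 i) ->
    `|szasz (mesh q) (J q) phi x - phi x| <= C / q.+1%:R * (1 + `|x|)) ->
  exists K : R, forall q : nat, `|SW 1 (szasz (mesh q) (J q) phi) - SW 1 phi| <= K / q.+1%:R.
Proof.
move=> C0 sphi hC; have mO := @orthant_measurable R n.
have i1 : lam.-integrable orth (EFin \o (fun x => (1 + p1 x) * ww 1 x)).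
  apply: (@wweight_integrable R n k lam k0 hlam r rn 1 (fun x => 1 + p1 x) 1 1) => //.
    by apply: measurable_funD => //; exact: p1_measurable.
  by move=> x xO; rewrite mul1r expr1 ger0_norm // addr_ge0 // p1_ge0.
pose K2 := Rintegral lam orth (fun x => (1 + p1 x) * ww 1 x).
exists (\sum_(sg : 'S_n) C * K2) => q; have q0 : 0 < q.+1%:R :> R by rewrite ltr0n.
have M0 : 0 < 1 + mesh q :> R by rewrite addr_gt0 // mesh_gt0.
rewrite /swint -sumrB mulr_suml; apply: le_trans (ler_norm_sum _ _ _) _; apply: ler_sum => sg _.
have iS : lam.-integrable orth (EFin \o (fun x => szasz (mesh q) (J q) phi (permv sg (faceR x)) * ww 1 x)).
  have [sp _] := spoly_agree (mesh q) (J q) phi M0.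
  have := @wint_int R n k lam k0 hlam r rn (1 + mesh q) (fun x => spoly (mesh q) (J q) phi (permv sg x)) M0
    (tame_perm sg (slow_tame sp)).
  by apply: eq_integrable => // x _; rewrite /= -wint_szasz.
have iP : lam.-integrable orth (EFin \o (fun x => phi (permv sg (faceR x)) * ww 1 x)).
  exact: (@wint_int R n k lam k0 hlam r rn 1 (fun x => phi (permv sg x)) ltr01 (tame_perm sg (slow_tame sphi))).
rewrite /wint -RintegralB //; apply: le_trans (le_normr_Rintegral mO (integrableB mO iS iP)) _.
have -> : C * K2 / q.+1%:R = C / q.+1%:R * K2 by ring.
rewrite /K2 -(RintegralZl _ mO i1); apply: le_Rintegral => //.
- exact: (integrable_norm (integrableB mO iS iP)).
- exact: (integrableZl mO _ i1).
move=> x xO /=; rewrite -mulrBl normrM mulrA (ger0_norm (wweight_ge0 k r 1 x)); apply: ler_wpM2r.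
  exact: wweight_ge0.
have ge i : 0 <= permv sg (faceR x) ord0 i.
  by rewrite !mxE mul1r; case: ((sg i < r)%N) => //; exact/ltW/xO.
apply: le_trans (hC q _ _) _ => [i|]; first by apply: lt_le_trans (ge i); rewrite oppr_lt0.
apply: ler_wpM2l; first by rewrite divr_ge0 // ltW.
rewrite lerD2l; apply: le_trans (face_norm r xO); apply: norm_le_coord => // i.
rewrite mxE [const_mx _ _ _]mxE mul1r; exact: coord_le_norm.
Qed.

(** On the orthant [phi] is [expR (- psum x)] times [phi'], and [phi'] is replaced by its Szasz
    sums, where both sides agree. Temperedness controls the left side and integrability of the face
    weight the right one, so the modulus of the fixed difference is at most [K / (q + 1)] for every
    [q]. *)
Lemma face_test phi : testfun phi -> T phi = cr (kap * SW 1 (fun x => expR (psum x) * phi x)).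
Proof.
move=> tf; have [sm [rr hr]] := tf; pose phi' (x : 'rV[R]_n) : R := expR (psum x) * phi x.
have tf' : testfun phi'.
  split; last by exists rr => x /hr h; rewrite /phi' h mulr0.
  apply: smoothM => //; apply: smooth_comp; first exact: smooth1_expR.
  by apply: smooth_sum => i _; exact: smooth_coord.
have [sm' _] := tf'; have sl' := schwartz_is_slow (testfun_schwartz tf').
have s4 : 0 < 4 :> R by [].
have sx' := exq_schwartz s4 (@ltr01 R) sl'.
have -> : T phi = T (exq 4 1 phi').
  apply: (Rz_local k0 hRz) => //; first exact: testfun_schwartz.
  by move=> x xO; rewrite exq_orth // /phi' mulrA -expRD mul1r addNr expR0 mul1r.
have [J hJ] := szasz_conv tf'.
have tT : tempered T by case: hRz.
have [lin [N [c hT]]] := tT.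
have [K1 hK1] := exq_szasz_seminorm N sm' hJ.
have [C [C0 hC]] := hJ [::]; have [K2 hK2] := swint_szasz_bound C0 sl' hC.
rewrite -/phi'; apply/eqP; rewrite -subr_eq0; apply: contraT => z0; have N0 := normc_gt0 z0.
set z := _ - _ in z0 N0; pose K := `|c * K1| + `|kap * K2|.
have bound (q : nat) : normc z <= K / q.+1%:R.
  pose S := szasz (mesh q) (J q) phi'; have q0 : 0 < q.+1%:R :> R by rewrite ltr0n.
  have M0 : 0 < 1 + mesh q :> R by rewrite addr_gt0 // mesh_gt0.
  have sxS : schwartz (exq 4 1 S).
    by rewrite exq_szasz; apply: exq_schwartz => //; case: (spoly_agree (mesh q) (J q) phi' M0).
  pose f (x : 'rV[R]_n) : R := Hcut 4 x * expR (- (1 * psum x)) * (S x - phi' x).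
  have fE : f = fun x => 1 * exq 4 1 S x + -1 * exq 4 1 phi' x by apply/funext => x; rewrite /f /exq; ring.
  have sf : schwartz f by rewrite fE; exact: schwartzD.
  have Tf : T f = T (exq 4 1 S) - T (exq 4 1 phi').
    by rewrite fE (Rz_lin hRz) // -crN cr1 mulN1r mul1r.
  have -> : z = cr (kap * (SW 1 S - SW 1 phi')) - T f.
    by rewrite Tf /z szasz_agree ?mesh_gt0 // mulrBr -crB; ring.
  apply: le_trans (le_normcD _ _) _; rewrite normcN normc_cr addrC /K mulrDl; apply: lerD.
    have := hT f sf (K1 / q.+1%:R) (fun s m x sN mN => hK1 q s m x sN mN); rewrite lecR => h.
    apply: le_trans h _; rewrite mulrA; apply: ler_wpM2r; [by rewrite invr_ge0 ltW|exact: ler_norm].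
  rewrite normrM; apply: le_trans (ler_wpM2l (normr_ge0 _) (hK2 q)) _.
  by rewrite mulrA; apply: ler_wpM2r; [rewrite invr_ge0 ltW|rewrite (normrM kap K2); exact: (ler_wpM2l (normr_ge0 kap) (ler_norm K2))].
pose m := Num.truncn (K / normc z).
have := bound m; rewrite ler_pdivlMr ?ltr0n // mulrC -ler_pdivlMr // leNgt.
by rewrite truncnS_gt.
Qed.

Lemma positive_ext (T1 T2 : ('rV[R]_n -> R) -> R[i]) : (forall f, testfun f -> T1 f = T2 f) ->
  is_positive_measure T2 -> is_positive_measure T1.
Proof. by move=> e [nu [lf h]]; exists nu; split=> // f tf; rewrite e // h. Qed.

Lemma psum_measurable : measurable_fun setT (psum : RnB R n -> R).
Proof. exact: p1_measurable. Qed.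

Lemma face_positive : is_positive_measure T.
Proof.
have mO := @orthant_measurable R n.
(* The factor [expR (psum (faceR x))] cancels the exponential of rate 1 on the face; the exponential
   densities of the other coordinates remain. *)
pose w x : R := kap * expR (psum (faceR x)) * ww 1 x.
pose g (sg : 'S_n) x : RnB R n := permv sg (faceR x).
have kap0 : 0 <= kap by exact: skappa_ge0.
have mg sg : measurable_fun setT (g sg).
  by apply: measurableT_comp; [apply: gmap_measurable => i; rewrite mxE|exact: face_measurable].
have mE : measurable_fun setT (fun x => kap * expR (psum (faceR x))).
  apply: measurable_funM => //; apply: measurableT_comp => //.
  exact: (measurableT_comp psum_measurable (@face_measurable R n r)).
apply: (@positive_ext _ (fun f => cr (\sum_(sg : 'S_n) Rintegral lam orth (fun x => f (g sg x) * w x)))).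
  move=> phi tf; rewrite (face_test tf); congr cr; rewrite /swint mulr_sumr; apply: eq_bigr => sg _.
  pose phi' (x : 'rV[R]_n) : R := expR (psum x) * phi x.
  have tf' : testfun phi'.
    have [sm [rr hr]] := tf; split; last by exists rr => x /hr h; rewrite /phi' h mulr0.
    apply: smoothM => //; apply: smooth_comp; first exact: smooth1_expR.
    by apply: smooth_sum => i _; exact: smooth_coord.
  have sl' := schwartz_is_slow (testfun_schwartz tf').
  have iP := @wint_int R n k lam k0 hlam r rn 1 (fun x => phi' (permv sg x)) ltr01 (tame_perm sg (slow_tame sl')).
  rewrite /wint -(RintegralZl _ mO iP); apply: eq_Rintegral => x _ /=.
  by rewrite /w /g /phi' psum_perm; ring.
apply: (positive_sum (index_enum _) (F := fun (sg : 'S_n) f => Rintegral lam orth (fun x => f (g sg x) * w x))) => sg.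
apply: density_positive => //.
- by move=> x; rewrite mulr_ge0 ?wweight_ge0 // mulr_ge0 ?expR_ge0.
- by apply: measurable_funM => //; exact: wt_measurable.
move=> rho; pose q x : R := \1_(nball rho) (g sg x) * (kap * expR (psum (faceR x))).
have mq : measurable_fun setT q.
  apply: measurable_funM => //; apply: measurableT_comp (mg sg).
  by apply: measurable_indic; exact: ball_measurable.
have := @wweight_integrable R n k lam k0 hlam r rn 1 q (kap * expR (n%:R * rho)) 0 ltr01 mq.
rewrite (_ : (fun x => q x * _) = fun x => \1_(nball rho) (g sg x) * w x); last first.
  by apply/funext => x; rewrite /q /w; ring.
apply=> x xO; rewrite expr0 mulr1 /q indicE; case: (boolP (_ \in _)) => [/set_mem gx|_]; last first.
  by rewrite mul0r normr0 mulr_ge0 ?expR_ge0.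
have e1 : 0 <= kap * expR (psum (faceR x)) by rewrite mulr_ge0 ?expR_ge0.
rewrite (_ : true%:R = 1 :> R) // mul1r (ger0_norm e1).
have e2 : expR (psum (faceR x)) <= expR (n%:R * rho).
  rewrite ler_expR -(psum_perm sg); apply: le_trans (psum_le_norm _) _.
  by apply: ler_wpM2l.
exact: (ler_wpM2l kap0 e2).
Qed.

End FaceMeasure.

Section Density.
Context {R : realType} {n : nat} {k : R} {lam : {measure set (RnB R n) -> \bar R}}.
Context {Rz : R[i] -> ('rV[R]_n -> R) -> R[i]}.
Hypothesis (n1 : (1 <= n)%N) (k0 : 0 < k) (hlam : is_lebesgue_Rn lam) (hRz : riesz_family k lam Rz).
Local Notation orth := (@Rplus_n R n).

Lemma regular_positive (mu : R) : mu0 n k < mu -> is_positive_measure (Rz (cr mu)).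
Proof.
move=> h; have mO := @orthant_measurable R n; have d0 := den_gt0 k0 h.
pose w (x : RnB R n) : R := (@den R n k mu)^-1 * @W0 R n k mu x.
apply: (@positive_ext R n _ (fun f => cr (Rintegral lam orth (fun x => f (id x) * w x)))).
  move=> f tf; rewrite (Rz_real k0 hRz h (testfun_schwartz tf)); congr cr.
  rewrite mulrC -(RintegralZl _ mO (test_W0_int k0 hlam h tf)); apply: eq_Rintegral => x _ /=.
  by rewrite /w mulrCA.
apply: density_positive => //.
- by move=> x; rewrite mulr_ge0 ?invr_ge0 ?(ltW d0) //; exact: wt_ge0.
- by apply: measurable_funM => //; exact: wt_measurable.
(* Integrability is known for exponentially decaying weights; on a ball the factor [expR (psum x)]
   that removes the decay is bounded. *)
move=> rho; pose q (x : RnB R n) : R := \1_(nball rho) x * ((@den R n k mu)^-1 * expR (psum x)).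
have pq : polyb q.
  split.
    apply: measurable_funM; first by apply: measurable_indic; exact: ball_measurable.
    by apply: measurable_funM => //; apply: measurableT_comp => //; exact: psum_measurable.
  exists ((@den R n k mu)^-1 * expR (n%:R * rho)), 0%N; split; first by rewrite mulr_ge0 ?invr_ge0 ?expR_ge0 ?(ltW d0).
  move=> x xO; rewrite expr0 mulr1 /q indicE; case: (boolP (_ \in _)) => [/set_mem gx|_]; last first.
    by rewrite mul0r normr0 mulr_ge0 ?expR_ge0 ?invr_ge0 ?(ltW d0).
  rewrite (_ : true%:R = 1 :> R) // mul1r ger0_norm ?mulr_ge0 ?expR_ge0 ?invr_ge0 ?(ltW d0) //.
  apply: ler_wpM2l; first by rewrite invr_ge0 ltW.
  by rewrite ler_expR; apply: le_trans (psum_le_norm _) _; exact: ler_wpM2l.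
have := @polyb_integrable _ _ _ hlam (pairs predT) k k0 (fun _ => @al R n k mu) (fun _ => 1) 0 q
  (fun _ => al_gt h) (fun _ => ltr01) (lexx 0) ler01 pq.
apply: eq_integrable => // x /set_mem xO; rewrite /= -/(wt _ _ _ _ _ _) -(W0_exp mu 1 xO) /q /w.
rewrite mul1r; have := expRxMexpNx_1 (psum x); move: (expR (psum x)) (expR (- psum x)) (W0 mu x) (den mu)^-1 (\1_(nball rho) x) => a b c d e ab.
by congr EFin; transitivity ((e * (d * c)) * (a * b)); [ring|rewrite ab mulr1].
Qed.

End Density.

Theorem theorem5p15 (R : realType) (n : nat) (k : R)
    (lam : {measure set (RnB R n) -> \bar R})
    (Rz : R[i] -> ('rV[R]_n -> R) -> R[i]) :
  (1 <= n)%N -> 0 < k -> is_lebesgue_Rn lam -> riesz_family k lam Rz ->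
  (forall mu : R[i], is_complex_measure (Rz mu) ->
     mu0 n k < cRe mu \/
     exists j m : nat, [/\ (j < n)%N, 0 <= k * j%:R - m%:R
                         & mu = cr (k * j%:R - m%:R)]) /\
  (forall mu : R[i], is_positive_measure (Rz mu) <->
     (exists j : nat, (j < n)%N /\ mu = cr (k * j%:R)) \/
     (cIm mu = 0 /\ mu0 n k < cRe mu)).
Proof.
move=> n1 k0 hlam hRz; split; first by move=> mu; exact: (complex_measure_dichotomy n1 k0 hlam hRz).
move=> mu; split; first exact: (positive_wallach n1 k0 hlam hRz).
case=> [[j [jn ->]]|[i0 h]]; first exact: (face_positive n1 k0 hlam hRz jn).
have -> : mu = cr (cRe mu) by case: mu i0 h => a b /= ->.
exact: (regular_positive k0 hlam hRz h).
Qed.
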